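(* Fix $\rho\in\mathbb R$ and $v_0\in(0,2\pi)$, and let $(K^R_t)_{t\in[0,T]}$, $T<\infty$, be a family of disk hulls, parametrized by conformal radius and driven by $e^{iw_t}$ with $w$ continuous, $w_0=0$, such that $e^{iv_0}\notin K^R_T$. Let $\varphi_0:\mathbb H\to\mathbb D$ be a conformal map with $\varphi_0^{-1}(e^{iv_0})=\infty$ and $\varphi_0^{-1}(1)=0$. Then $(K^C_{t(s)})_s:=(\varphi_0^{-1}(K^R_{t(s)}))_s$, where $s\mapsto t(s)$ is the appropriate re-parametrization, is a family of half-plane hulls, parametrized by half-plane capacity and driven by a continuous function $W^C$ with $W_0^C=0$, such that $z_0^C:=\varphi_0^{-1}(0)\in\mathbb H$ does not belong to the final hull. The reverse also holds, i.e. every such family of half-plane hulls induces (via $\varphi_0$ and re-parametrization) such a family of disk hulls. Moreover, under this change of coordinates, $$I^R_{\rho,e^{iv_0}}((K^R_t)_t)=I^C_{-6-\rho,z_0^C}((K^C_s)_s).$$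
   Context: $\mathbb H$ is the upper half-plane, $\mathbb D$ the unit disk. A half-plane hull is a compact $K\subset\overline{\mathbb H}$ with $\mathbb H\setminus K$ simply connected and $K=\overline{K\cap\mathbb H}$; its mapping-out function $g_K:\mathbb H\setminus K\to\mathbb H$ is the conformal map with $g_K(z)=z+a_Kz^{-1}+o(z^{-1})$ at $\infty$. A family $(K_t)$ is parametrized by half-plane capacity if $a_{K_t}=2t$, and driven by $W$ if $g_t=g_{K_t}$ solves $\partial_tg_t(z)=\frac{2}{g_t(z)-W_t}$, $g_0(z)=z$. A disk hull is a compact $K\subset\overline{\mathbb D}$ with $0\notin K$, $\mathbb D\setminus K$ simply connected, $K=\overline{K\cap\mathbb D}$; its mapping-out function $g_K:\mathbb D\setminus K\to\mathbb D$ is the conformal map with $g_K(0)=0$, $g_K'(0)>0$. A family is parametrized by conformal radius if $g_{K_t}'(0)=e^t$, and driven by $W_t=e^{iw_t}$ if $g_t=g_{K_t}$ solves $\partial_tg_t(z)=g_t(z)\frac{W_t+g_t(z)}{W_t-g_t(z)}$, $g_0(z)=z$. For a family of half-plane hulls on $[0,S]$ driven by $W$ and $z_0\in\mathbb H\setminus K_S$, $\rho'\in\mathbb R$: $I^C_{\rho',z_0}((K_s))=\frac12\int_0^S\big(\dot W_s-\rho'\,\mathrm{Re}\frac1{W_s-g_s(z_0)}\big)^2ds$ if $W$ is absolutely continuous, and $\infty$ otherwise. For a family of disk hulls as in the claim: $I^R_{\rho,e^{iv_0}}((K_t))=\frac12\int_0^T\big(\dot w_t-\frac\rho2\cot\frac{w_t-v_t}2\big)^2dt$,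 where $v$ is the continuous function equal to $v_0$ at time $0$ with $e^{iv_t}=g_t(e^{iv_0})$, if $w$ is absolutely continuous, and $\infty$ otherwise. *)

(* Defs.v *)
From HB Require Import structures.
From mathcomp Require Import all_boot all_order all_algebra.
From mathcomp Require Import complex.
From mathcomp Require Import all_classical all_reals all_analysis.

Set Implicit Arguments.
Unset Strict Implicit.
Unset Printing Implicit Defensive.

Import Order.TTheory GRing.Theory Num.Theory.
Import numFieldNormedType.Exports.

Local Open Scope classical_set_scope.
Local Open Scope ring_scope.
Local Open Scope complex_scope.

(* The topology and the normed-module structure of MathComp-Analysis are
   attached to [numFieldType], not to the type [R[i]] itself; [derivable] and
   [derive1] for functions [Cplx R -> Cplx R] are complex differentiation. *)
Definition Cplx (R : realType) : numFieldType := R[i].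

Section Defs.
Variable R : realType.
Local Notation C := (Cplx R).
Implicit Types (A B K : set C) (f g : C -> C) (z : C) (t T S : R).

Definition real_cplx (x : R) : C := x%:C.

Definition expi (x : R) : C := cos x +i* sin x.

Definition upper : set C := [set z | 0 < complex.Im z].
Definition closed_upper : set C := [set z | 0 <= complex.Im z].
Definition disk : set C := [set z | `|z| < 1].
Definition closed_disk : set C := [set z | `|z| <= 1].

Definition cplx_infty : set_system C :=
  filter_from [set: R] (fun M => [set z | real_cplx M < `|z|]).

(* Used for open [A] only. *)
Definition conformal A B f :=
  (forall z, A z -> derivable f z 1) /\ set_bij A B f.

(* The continuous extension of [f : A -> C] at a point [z] of the closure of
   [A].  When the limit does not exist, [lim] returns the default point. *)
Definition extension A f z : C := lim (f @ within A (nbhs z)).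

Definition simply_connected A :=
  [/\ A !=set0,
      forall x y, A x -> A y -> exists c : R -> C,
        [/\ {within `[0, 1], continuous c},
            (forall t, t \in `[0, 1] -> A (c t)), c 0 = x & c 1 = y]
    & forall c : R -> C, {within `[0, 1], continuous c} ->
        (forall t, t \in `[0, 1] -> A (c t)) -> c 0 = c 1 ->
        exists h : R * R -> C,
          [/\ {within `[0, 1]%classic `*` `[0, 1]%classic, continuous h},
              (forall s t, s \in `[0, 1] -> t \in `[0, 1] -> A (h (s, t))),
              (forall t, t \in `[0, 1] -> h (0, t) = c t /\ h (1, t) = c 0)
            & forall s, s \in `[0, 1] -> h (s, 0) = c 0 /\ h (s, 1) = c 0]].

Definition half_hull K :=
  [/\ compact K, K `<=` closed_upper, simply_connected (upper `\` K)
    & K = closure (K `&` upper)].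

Definition disk_hull K :=
  [/\ compact K, K `<=` closed_disk, ~ K 0, simply_connected (disk `\` K)
    & K = closure (K `&` disk)].

(* [g z = z + a / z + o(1 / z)] as [z] tends to infinity in [upper `\` K]. *)
Definition half_expansion K g (a : R) :=
  z * (g z - (z + real_cplx a / z)) @[z --> within (upper `\` K) cplx_infty]
    --> (0 : C).

Definition is_half_mapout K g :=
  conformal (upper `\` K) upper g /\ exists a : R, half_expansion K g a.

Definition is_disk_mapout K g :=
  [/\ conformal (disk `\` K) disk g, g 0 = 0 & 0 < derive1 g 0].

(* Mapping-out functions are unique on the complement of the hull; the values
   elsewhere are arbitrary and never used.  The default [cst 0] satisfies
   neither normalization of capacity below, so that the latter include the
   existence of the mapping-out function. *)
Definition half_mapout K : C -> C := xget (cst 0) [set g | is_half_mapout K g].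
Definition disk_mapout K : C -> C := xget (cst 0) [set g | is_disk_mapout K g].

(* [l] is the derivative at [t] of the restriction of [f] to [D]; it is
   one-sided at the endpoints of an interval [D]. *)
Definition has_deriv_within (D : set R) (f : R -> C) t (l : C) :=
  real_cplx (s - t)^-1 * (f s - f t) @[s --> within D t^'] --> l.

Definition increasing_family T (K : R -> set C) :=
  forall s t, 0 <= s -> s <= t -> t <= T -> K s `<=` K t.

(* At fixed [z] the Loewner equation is required on the set of times at which
   [z] is not yet swallowed, an initial segment of [0, S]. *)
Definition half_driven S (K : R -> set C) (W : R -> R) :=
  (forall z, (upper `\` K 0) z -> half_mapout (K 0) z = z) /\
  forall t z, t \in `[0, S] -> (upper `\` K t) z ->
    has_deriv_within [set s | s \in `[0, S] /\ ~ K s z]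
      (fun s => half_mapout (K s) z) t
      (2 / (half_mapout (K t) z - real_cplx (W t))).

Definition disk_driven T (K : R -> set C) (W : R -> C) :=
  (forall z, (disk `\` K 0) z -> disk_mapout (K 0) z = z) /\
  forall t z, t \in `[0, T] -> (disk `\` K t) z ->
    has_deriv_within [set s | s \in `[0, T] /\ ~ K s z]
      (fun s => disk_mapout (K s) z) t
      (disk_mapout (K t) z *
        ((W t + disk_mapout (K t) z) / (W t - disk_mapout (K t) z))).

Definition half_family S (K : R -> set C) (W : R -> R) :=
  [/\ increasing_family S K,
      forall t, t \in `[0, S] -> half_hull (K t),
      forall t, t \in `[0, S] ->
        half_expansion (K t) (half_mapout (K t)) (2 * t),
      {within `[0, S], continuous W} /\ W 0 = 0
    & half_driven S K W].

Definition disk_family T (K : R -> set C) (w : R -> R) :=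
  [/\ increasing_family T K,
      forall t, t \in `[0, T] -> disk_hull (K t),
      forall t, t \in `[0, T] ->
        derive1 (disk_mapout (K t)) 0 = real_cplx (expR t),
      {within `[0, T], continuous w} /\ w 0 = 0
    & disk_driven T K (fun t => expi (w t))].

Definition abs_continuous (a b : R) (f : R -> R) :=
  forall e : R, 0 < e -> exists2 d : R, 0 < d &
    forall (n : nat) (x y : 'I_n -> R),
      (forall i, a <= x i /\ x i <= y i /\ y i <= b) ->
      trivIset [set: 'I_n] (fun i => `]x i, y i[%classic) ->
      \sum_(i < n) (y i - x i) < d ->
      \sum_(i < n) `|f (y i) - f (x i)| < e.

Definition half_energy (rho : R) (z0 : C) S (K : R -> set C) (W : R -> R)
    : \bar R :=
  if `[< abs_continuous 0 S W >] then
    ((2^-1)%:E * \int[lebesgue_measure]_(s in `[0%R, S])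
      ((derive1 W s - rho * complex.Re
         (real_cplx (W s) - half_mapout (K s) z0)^-1) ^+ 2)%:E)%E
  else +oo%E.

(* The continuous lift [v] of the image of the boundary point [expi v0], to
   which [disk_mapout (K t)] extends continuously. *)
Definition force_angle (v0 : R) T (K : R -> set C) : R -> R :=
  xget (cst 0) [set v : R -> R |
    [/\ {within `[0, T], continuous v}, v 0 = v0
      & forall t, t \in `[0, T] ->
          expi (v t) = extension (disk `\` K t) (disk_mapout (K t)) (expi v0)]].

Definition cot (x : R) : R := cos x / sin x.

Definition disk_energy (rho v0 : R) T (K : R -> set C) (w : R -> R)
    : \bar R :=
  let v := force_angle v0 T K in
  if `[< abs_continuous 0 T w >] then
    ((2^-1)%:E * \int[lebesgue_measure]_(t in `[0%R, T])
      ((derive1 w t - rho / 2 * cot ((w t - v t) / 2)) ^+ 2)%:E)%E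
  else +oo%E.

(* Hulls contain boundary points, so images and preimages of hulls are taken
   under the continuous extension of [phi] to the closed half-plane. *)
Definition hull_image (phi : C -> C) K : set C := extension upper phi @` K.
Definition hull_preimage (phi : C -> C) K : set C :=
  [set z | closed_upper z /\ K (extension upper phi z)].

Definition reparametrization S T (tau : R -> R) :=
  [/\ tau 0 = 0, tau S = T, {within `[0, S], continuous tau}
    & {in `[0, S] &, {homo tau : s t / s < t}}].

End Defs.

(* Main.v *)
Require Import Defs.
From HB Require Import structures.
From mathcomp Require Import all_boot all_order all_algebra.
From mathcomp Require Import complex ring lra.
From mathcomp Require Import all_classical all_reals all_analysis.
From mathcomp Require Import measurable_realfun.

Set Implicit Arguments.
Unset Strict Implicit.
Unset Printing Implicit Defensive.

Import Order.TTheory GRing.Theory Num.Theory.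
Import numFieldNormedType.Exports.

Local Open Scope classical_set_scope.
Local Open Scope ring_scope.

(* By Schwarz's lemma [phi0] is the Cayley transform of [upper] that maps [z0] to
   [0] and infinity to [expi v0].  Let [expi (v t)] be the image of [expi v0]
   under the disk mapping-out function [g_t], [al = (v - w) / 2], and let
   [Z = x + i y] solve
     x' = - y cos al / (2 sin al ^ 3),   y' = - y / (2 sin al ^ 2),
   with [Z = z0] at time [0].  If [psi_t] is the Cayley transform that maps [Z t]
   to [0] and infinity to [expi (v t)], then [psi_t^-1 \o g_t \o phi0] solves the
   chordal Loewner equation with driving function [W = x + y cot al] in the time
   [s] with [ds/dt = (y / (2 sin al ^ 2)) ^ 2], and integrating this equation at
   points near infinity shows that it is hydrodynamically normalized with half-plane
   capacity [2 s].  By uniqueness it is the half-plane mapping-out function, and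
   [Z] is the image of [z0].  The chain rule gives
     dW/ds + (6 + rho) Re (1 / (W - Z))
       = (2 sin al ^ 2 / y) (dw/dt - rho / 2 cot ((w - v) / 2)),
   whose square integrates to the equality of energies.  The converse runs the
   same computation backwards from [Z s], the image of [z0].

   That [expi v0] is never swallowed only means that it is outside the final
   hull, so [v] is first constructed: if the flow of points near [expi v0] came
   close to the driving function, [1 - |g|^2] would decay faster for many such
   points than is allowed by a Hopf type lower bound for [1 - |g_T|^2]. *)

(** * Complex numbers in real coordinates *)

(** The rate [(y / (2 sin al ^ 2)) ^ 2] is the squared modulus of the derivative of [psi_t^-1] at
    [expi (w t)], which is how half-plane capacity scales; the system for [x], [y] is
    [dZ/ds = 2 / (Z - W)] multiplied by this rate. In terms of [al] it is triangular and linear in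
    [y], so integrals and one exponential solve it. The driving functions are merely continuous and
    are not differentiated in the Loewner part: the transformed equation is a rational identity in
    [expi v], [expi w], [Z] and its conjugate. Both energies may be infinite, so absolute continuity
    has to be carried across the time change in both directions. Moreover [derive1] takes
    unspecified values where there is no derivative, hence the integrands are not known to be
    measurable, and the energies are compared through a measurable function that agrees with them
    off null sets. The function theory rests on a mean value property that tolerates a point of mere
    continuity. It gives the maximum principle, and from it come the comparison of conformal maps
    onto the disk, the uniqueness of mapping-out functions and the Hopf bound. *)

Section ComplexBasics.
Variable R : realType.
Local Notation C := (Cplx R).
Implicit Types (z w : C) (x y : R).

Local Notation cRe := (@complex.Re R : C -> R).
Local Notation cIm := (@complex.Im R : C -> R).
(** The norm of [Cplx R] takes its values in [Cplx R]; with this real-valued modulus all estimates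
    take place in the ordered field [R]. *)
Definition cabs (z : C) : R := Num.sqrt (cRe z ^+ 2 + cIm z ^+ 2).
Definition cconj (z : C) : C := Complex (cRe z) (- cIm z).
Definition Ci : C := Complex 0 1.

Lemma normC_cabs z : `|z| = real_cplx (cabs z).
Proof. by case: z. Qed.

Lemma C_eqP z w : cRe z = cRe w -> cIm z = cIm w -> z = w.
Proof. by case: z w => [a b] [c d] /= -> ->. Qed.

Lemma cReD z w : cRe (z + w) = cRe z + cRe w. Proof. by case: z w => [? ?] [? ?]. Qed.
Lemma cImD z w : cIm (z + w) = cIm z + cIm w. Proof. by case: z w => [? ?] [? ?]. Qed.
Lemma cReN z : cRe (- z) = - cRe z. Proof. by case: z. Qed.
Lemma cImN z : cIm (- z) = - cIm z. Proof. by case: z. Qed.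
Lemma cReM z w : cRe (z * w) = cRe z * cRe w - cIm z * cIm w.
Proof. by case: z w => [? ?] [? ?]. Qed.
Lemma cImM z w : cIm (z * w) = cRe z * cIm w + cIm z * cRe w.
Proof. by case: z w => [? ?] [? ?] /=; rewrite addrC. Qed.
Lemma cRe1 : cRe (1 : C) = 1. Proof. by []. Qed.
Lemma cIm1 : cIm (1 : C) = 0. Proof. by []. Qed.
Lemma cRe0 : cRe (0 : C) = 0. Proof. by []. Qed.
Lemma cIm0 : cIm (0 : C) = 0. Proof. by []. Qed.
Lemma cRe_real x : cRe (real_cplx x) = x. Proof. by []. Qed.
Lemma cIm_real x : cIm (real_cplx x) = 0. Proof. by []. Qed.
Lemma cRe_conj z : cRe (cconj z) = cRe z. Proof. by []. Qed.
Lemma cIm_conj z : cIm (cconj z) = - cIm z. Proof. by []. Qed.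
Lemma cRe_nat n : cRe (n%:R : C) = n%:R.
Proof. by elim: n => // n IH; rewrite !mulrS cReD IH. Qed.
Lemma cIm_nat n : cIm (n%:R : C) = 0.
Proof. by elim: n => // n IH; rewrite !mulrS cImD IH addr0. Qed.
Lemma cRe_Ci : cRe Ci = 0. Proof. by []. Qed.
Lemma cIm_Ci : cIm Ci = 1. Proof. by []. Qed.
Lemma cRe_expi x : cRe (expi x) = cos x. Proof. by []. Qed.
Lemma cIm_expi x : cIm (expi x) = sin x. Proof. by []. Qed.
Definition ReIm := (cReD, cImD, cReN, cImN, cReM, cImM, cRe1, cIm1, cRe0, cIm0, cRe_real,
  cIm_real, cRe_conj, cIm_conj, cRe_nat, cIm_nat, cRe_Ci, cIm_Ci, cRe_expi, cIm_expi).

Lemma cReV z : cRe z^-1 = cRe z / (cRe z ^+ 2 + cIm z ^+ 2). Proof. by case: z. Qed.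
Lemma cImV z : cIm z^-1 = - cIm z / (cRe z ^+ 2 + cIm z ^+ 2).
Proof. by case: z => a b /=; rewrite mulNr. Qed.

Lemma rcD x y : real_cplx (x + y) = real_cplx x + real_cplx y.
Proof. by apply: C_eqP; rewrite !ReIm ?addr0. Qed.
Lemma rcN x : real_cplx (- x) = - real_cplx x.
Proof. by apply: C_eqP; rewrite !ReIm ?oppr0. Qed.
Lemma rcB x y : real_cplx (x - y) = real_cplx x - real_cplx y.
Proof. by rewrite rcD rcN. Qed.
Lemma rcM x y : real_cplx (x * y) = real_cplx x * real_cplx y.
Proof. by apply: C_eqP; rewrite !ReIm; ring. Qed.
Lemma rc0 : real_cplx 0 = 0 :> C. Proof. by []. Qed.
Lemma rc1 : real_cplx 1 = 1 :> C. Proof. by []. Qed.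
Lemma rc_nat n : real_cplx n%:R = n%:R :> C.
Proof. by apply: C_eqP; rewrite !ReIm. Qed.
Lemma rc_inj : injective (@real_cplx R). Proof. by move=> x y []. Qed.
Lemma rc_eq0 x : (real_cplx x == 0) = (x == 0).
Proof. by apply/eqP/eqP => [[]|->]. Qed.
Lemma rcV x : real_cplx x^-1 = (real_cplx x)^-1.
Proof.
have [->|x0] := eqVneq x 0; first by rewrite invr0 rc0 invr0.
by apply: (mulIf (_ : real_cplx x != 0)); rewrite ?rc_eq0// -rcM !mulVf ?rc_eq0.
Qed.
Lemma rcX x n : real_cplx (x ^+ n) = real_cplx x ^+ n.
Proof. by elim: n => [|n IH]; rewrite ?expr0// !exprS rcM IH. Qed.
Lemma rc_lt x y : (real_cplx x < real_cplx y) = (x < y).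
Proof. by rewrite /real_cplx ltcR. Qed.
Lemma rc_le x y : (real_cplx x <= real_cplx y) = (x <= y).
Proof. by rewrite /real_cplx lecR. Qed.
Lemma C_ReIm z : z = real_cplx (cRe z) + Ci * real_cplx (cIm z).
Proof. by apply: C_eqP; rewrite !ReIm; ring. Qed.
Lemma Ci2 : Ci * Ci = -1.
Proof. by apply: C_eqP; rewrite !ReIm; ring. Qed.

Lemma cabs_ge0 z : 0 <= cabs z. Proof. exact: sqrtr_ge0. Qed.
Lemma cabs2 z : cabs z ^+ 2 = cRe z ^+ 2 + cIm z ^+ 2.
Proof. by rewrite sqr_sqrtr// addr_ge0// sqr_ge0. Qed.
Lemma cabsM z w : cabs (z * w) = cabs z * cabs w.
Proof. by apply: rc_inj; rewrite rcM -!normC_cabs normrM. Qed.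
Lemma cabsN z : cabs (- z) = cabs z.
Proof. by apply: rc_inj; rewrite -!normC_cabs normrN. Qed.
Lemma cabsC z w : cabs (z - w) = cabs (w - z).
Proof. by rewrite -cabsN opprB. Qed.
Lemma cabsV z : cabs z^-1 = (cabs z)^-1.
Proof. by apply: rc_inj; rewrite rcV -!normC_cabs normfV. Qed.
Lemma cabsX z n : cabs (z ^+ n) = cabs z ^+ n.
Proof. by apply: rc_inj; rewrite rcX -!normC_cabs normrX. Qed.
Lemma cabs0 : cabs 0 = 0. Proof. by apply: rc_inj; rewrite -normC_cabs normr0. Qed.
Lemma cabs1 : cabs 1 = 1. Proof. by apply: rc_inj; rewrite -normC_cabs normr1. Qed.
Lemma cabs_eq0 z : (cabs z == 0) = (z == 0).
Proof. by rewrite -rc_eq0 -normC_cabs normr_eq0. Qed.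
Lemma cabs_gt0 z : (0 < cabs z) = (z != 0).
Proof. by rewrite lt_neqAle cabs_ge0 andbT eq_sym cabs_eq0. Qed.
Lemma ler_cabsD z w : cabs (z + w) <= cabs z + cabs w.
Proof. by rewrite -rc_le rcD -!normC_cabs ler_normD. Qed.
Lemma ler_cabsB z w : cabs (z - w) <= cabs z + cabs w.
Proof. by rewrite -(cabsN w) ler_cabsD. Qed.
Lemma lerB_cabs z w : cabs z - cabs w <= cabs (z - w).
Proof. by rewrite -rc_le rcB -!normC_cabs lerB_dist. Qed.
Lemma lerB_cabsD z w : cabs z - cabs w <= cabs (z + w).
Proof. by rewrite -(cabsN w) -{2}(opprK w) lerB_cabs. Qed.
Lemma cabs_real x : cabs (real_cplx x) = `|x|.
Proof. by rewrite /cabs !ReIm expr0n addr0 sqrtr_sqr. Qed.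
Lemma cabs_conj z : cabs (cconj z) = cabs z.
Proof. by rewrite /cabs !ReIm sqrrN. Qed.
Lemma cabs_Ci : cabs Ci = 1.
Proof. by rewrite /cabs !ReIm expr0n expr1n add0r sqrtr1. Qed.
Lemma cabs_expi x : cabs (expi x) = 1.
Proof. by rewrite /cabs !ReIm cos2Dsin2 sqrtr1. Qed.
Lemma cabs_nat n : cabs n%:R = n%:R.
Proof. by rewrite -rc_nat cabs_real normr_nat. Qed.
Lemma ler_Re_cabs z : `|cRe z| <= cabs z.
Proof. by rewrite -[X in X <= _]sqrtr_sqr ler_wsqrtr// lerDl sqr_ge0. Qed.
Lemma ler_Im_cabs z : `|cIm z| <= cabs z.
Proof. by rewrite -[X in X <= _]sqrtr_sqr ler_wsqrtr// lerDr sqr_ge0. Qed.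
Lemma cabs_le_ReIm z : cabs z <= `|cRe z| + `|cIm z|.
Proof.
rewrite [in cabs _](C_ReIm z); apply: (le_trans (ler_cabsD _ _)).
by rewrite cabsM cabs_Ci mul1r !cabs_real.
Qed.
Lemma cabs_sqr_conj z : real_cplx (cabs z ^+ 2) = z * cconj z.
Proof. by rewrite cabs2; apply: C_eqP; rewrite !ReIm; ring. Qed.
Lemma conjD z w : cconj (z + w) = cconj z + cconj w.
Proof. by apply: C_eqP; rewrite !ReIm; ring. Qed.
Lemma conjN z : cconj (- z) = - cconj z.
Proof. by apply: C_eqP; rewrite !ReIm. Qed.
Lemma conjM z w : cconj (z * w) = cconj z * cconj w.
Proof. by apply: C_eqP; rewrite !ReIm; ring. Qed.
Lemma conjV z : cconj z^-1 = (cconj z)^-1.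
Proof.
by apply: C_eqP; rewrite ?(cReV, cImV, cRe_conj, cIm_conj) ?sqrrN ?mulNr ?opprK.
Qed.
Lemma conj_unit z : cabs z = 1 -> cconj z = z^-1.
Proof.
move=> z1; have z0 : z != 0 by rewrite -cabs_gt0 z1.
by apply: (mulfI z0); rewrite -cabs_sqr_conj z1 expr1n mulfV.
Qed.

Lemma cabs_conj_sub z : 0 < cIm z -> cabs (cconj z - z) = 2 * cIm z.
Proof.
move=> z0; have -> : cconj z - z = - (Ci * real_cplx (2 * cIm z)).
  by apply: C_eqP; rewrite !ReIm; ring.
by rewrite cabsN cabsM cabs_Ci mul1r cabs_real ger0_norm// mulr_ge0// ltW.
Qed.

Lemma conj_real x : cconj (real_cplx x) = real_cplx x.
Proof. by apply: C_eqP; rewrite !ReIm ?oppr0. Qed.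
Lemma conjK z : cconj (cconj z) = z.
Proof. by apply: C_eqP; rewrite !ReIm ?opprK. Qed.

Lemma expiD x y : expi (x + y) = expi x * expi y.
Proof. by apply: C_eqP; rewrite !ReIm ?cosD ?sinD; ring. Qed.
Lemma expi0 : expi 0 = 1 :> C.
Proof. by apply: C_eqP; rewrite !ReIm ?cos0 ?sin0. Qed.
Lemma expi_neq0 x : expi x != 0.
Proof. by rewrite -cabs_gt0 cabs_expi. Qed.
Lemma expiN x : expi (- x) = (expi x)^-1.
Proof.
by apply: (mulIf (expi_neq0 x)); rewrite -expiD addNr expi0 mulVf// expi_neq0.
Qed.

(** The radii of balls in [Cplx R] are themselves elements of [Cplx R]. A positive radius is real,
    because the order of the complex numbers only compares numbers with equal imaginary parts. *)
Lemma nbhsCP z (A : set C) :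
  nbhs z A <-> exists2 e : R, 0 < e & forall w, cabs (w - z) < e -> A w.
Proof.
split.
- move=> /nbhs_ballP[e /= e0 zA].
  have er : e = real_cplx (cRe e).
    by move: e0; rewrite ltcE /= => /andP[/eqP i0 _]; apply: C_eqP.
  exists (cRe e); first by rewrite -rc_lt -er.
  move=> w wz; apply: zA; rewrite /ball/= /ball_ /=.
  by rewrite er distrC normC_cabs rc_lt.
- case=> e e0 zA; apply/nbhs_ballP; exists (real_cplx e) => /=.
    by rewrite rc_lt.
  move=> w; rewrite /ball/= /ball_ /= => wz; apply: zA.
  by move: wz; rewrite distrC normC_cabs rc_lt.
Qed.

Lemma cvgCP (T : Type) (F : set_system T) {FF : Filter F} (f : T -> C) (l : C) :
  f @ F --> l <->
  forall e : R, 0 < e -> \forall x \near F, cabs (f x - l) < e.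
Proof.
split.
- move=> fl e e0; have : nbhs l [set w | cabs (w - l) < e].
    by apply/nbhsCP; exists e.
  exact: fl.
- move=> fl A /nbhsCP[e e0 eA]; apply: filterS (fl _ e0) => x; exact: eA.
Qed.

Lemma cvgC_Re (T : Type) (F : set_system T) {FF : Filter F} (f : T -> C) (l : C) :
  f @ F --> l -> cRe (f x) @[x --> F] --> cRe l.
Proof.
move=> /cvgCP fl; apply/cvgrPdist_lt => e e0; apply: filterS (fl _ e0) => x.
by apply: le_lt_trans; rewrite distrC -cReN -cReD ler_Re_cabs.
Qed.

Lemma cvgC_Im (T : Type) (F : set_system T) {FF : Filter F} (f : T -> C) (l : C) :
  f @ F --> l -> cIm (f x) @[x --> F] --> cIm l.
Proof.
move=> /cvgCP fl; apply/cvgrPdist_lt => e e0; apply: filterS (fl _ e0) => x.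
by apply: le_lt_trans; rewrite distrC -cImN -cImD ler_Im_cabs.
Qed.

Lemma cvgC_ReIm (T : Type) (F : set_system T) {FF : Filter F} (f : T -> C) (l : C) :
  cRe (f x) @[x --> F] --> cRe l -> cIm (f x) @[x --> F] --> cIm l ->
  f @ F --> l.
Proof.
move=> /cvgrPdist_lt fr /cvgrPdist_lt fi; apply/cvgCP => e e0.
have e20 : 0 < e / 2 by rewrite divr_gt0.
apply: filterS2 (fr _ e20) (fi _ e20) => x hr hi.
apply: (le_lt_trans (cabs_le_ReIm _)); rewrite !ReIm !(distrC (_ (f x))).
by rewrite [e]splitr ltrD.
Qed.

Lemma cvgC_conj (T : Type) (F : set_system T) {FF : Filter F} (f : T -> C) (l : C) :
  f @ F --> l -> cconj (f x) @[x --> F] --> cconj l.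
Proof.
move=> /cvgCP fl; apply/cvgCP => e e0; apply: filterS (fl _ e0) => x.
by rewrite -conjN -conjD cabs_conj.
Qed.

Lemma cvgC_abs (T : Type) (F : set_system T) {FF : Filter F} (f : T -> C) (l : C) :
  f @ F --> l -> cabs (f x) @[x --> F] --> cabs l.
Proof.
move=> /cvgCP fl; apply/cvgrPdist_lt => e e0; apply: filterS (fl _ e0) => x.
apply: le_lt_trans; rewrite ler_norml lerNl opprB lerB_cabs cabsC; exact: lerB_cabs.
Qed.

Lemma cvgC_real (T : Type) (F : set_system T) {FF : Filter F} (f : T -> R) (l : R) :
  f @ F --> l -> real_cplx (f x) @[x --> F] --> real_cplx l.
Proof. by move=> fl; apply: cvgC_ReIm => //=; exact: cvg_cst. Qed.

Lemma cvgC_expi (T : Type) (F : set_system T) {FF : Filter F} (f : T -> R) (l : R) :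
  f @ F --> l -> expi (f x) @[x --> F] --> expi l.
Proof.
move=> fl; apply: cvgC_ReIm => //=.
  exact: (cvg_comp _ _ fl (@continuous_cos R l)).
exact: (cvg_comp _ _ fl (@continuous_sin R l)).
Qed.

Lemma continuous_Re : continuous (cRe : C -> R).
Proof. by move=> z; apply: (@cvgC_Re _ (nbhs z) _ id); exact: cvg_id. Qed.
Lemma continuous_cabs : continuous (cabs : C -> R).
Proof. by move=> z; apply: (@cvgC_abs _ (nbhs z) _ id); exact: cvg_id. Qed.

Lemma continuousCP (f : C -> C) z :
  {for z, continuous f} <->
  forall e : R, 0 < e -> exists2 d : R, 0 < d &
    forall w, cabs (w - z) < d -> cabs (f w - f z) < e.
Proof.
split.
- move=> /cvgCP fz e /fz; rewrite -[X in X -> _]/(nbhs z _) => /nbhsCP[d d0 H].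
  by exists d.
- move=> H; apply/(@cvgCP _ (nbhs z) _ f (f z)) => e /H[d d0 Hd]; apply/nbhsCP; by exists d.
Qed.

Lemma bounded_closed_compactC (A : set C) (M : R) :
  closed A -> (forall z, A z -> cabs z <= M) -> compact A.
Proof.
move=> cA bA.
pose f (p : R * R) : C := Complex p.1 p.2.
have cf : continuous f.
  move=> p; apply: (@cvgC_ReIm _ (nbhs p) _ f) => /=; [exact: cvg_fst|exact: cvg_snd].
have K : compact (f @` (`[-M, M]%classic `*` `[-M, M]%classic)).
  apply: continuous_compact; first exact: continuous_subspaceT.
  by apply: compact_setX; exact: segment_compact.
apply: subclosed_compact K _ => // z Az; exists (cRe z, cIm z); last by case: z {Az}.
have := bA _ Az; move=> zM; split => /=; rewrite in_itv /= -ler_norml;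
  apply: le_trans zM; [exact: ler_Re_cabs|exact: ler_Im_cabs].
Qed.

Lemma compactC_bounded (A : set C) : compact A ->
  exists M : R, forall z, A z -> cabs z <= M.
Proof.
move=> cA; have [->|/set0P A0] := eqVneq A set0; first by exists 0.
have [c _ cmax] := compact_EVT_max A0 cA
  (continuous_subspaceT continuous_cabs).
by exists (cabs c) => z Az; exact: cmax (mem_set Az).
Qed.

Lemma hausdorffC : hausdorff_space C. Proof. exact: norm_hausdorff. Qed.

Lemma compactC_closed (A : set C) : compact A -> closed A.
Proof. exact: compact_closed hausdorffC. Qed.

End ComplexBasics.
Arguments Ci {R}.
Arguments cconj {R} z.
Arguments cabs {R} z.

(** * Complex derivatives and the exponential *)

Section ComplexDerivative.
Variable R : realType.
Local Notation C := (Cplx R).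
Implicit Types (f g : C -> C) (z w l : C).
Local Notation cRe := (@complex.Re R : C -> R).
Local Notation cIm := (@complex.Im R : C -> R).

Lemma div2_gt0 (e : R) : 0 < e -> 0 < e / 2. Proof. by move=> ?; rewrite divr_gt0. Qed.

Lemma div3_gt0 (e : R) : 0 < e -> 0 < e / 3. Proof. by move=> ?; rewrite divr_gt0. Qed.

Lemma cvgCD (T : Type) (F : set_system T) {FF : Filter F} (u v : T -> C) (a b : C) :
  u @ F --> a -> v @ F --> b -> (fun x => u x + v x) @ F --> a + b.
Proof. by move=> ua vb; exact: (cvgD ua vb). Qed.
Lemma cvgCM (T : Type) (F : set_system T) {FF : Filter F} (u v : T -> C) (a b : C) :
  u @ F --> a -> v @ F --> b -> (fun x => u x * v x) @ F --> a * b.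
Proof. by move=> ua vb; exact: (cvgM ua vb). Qed.
Lemma cvgCN (T : Type) (F : set_system T) {FF : Filter F} (u : T -> C) (a : C) :
  u @ F --> a -> (fun x => - u x) @ F --> - a.
Proof. by move=> ua; exact: (cvgN ua). Qed.
Lemma cvgCB (T : Type) (F : set_system T) {FF : Filter F} (u v : T -> C) (a b : C) :
  u @ F --> a -> v @ F --> b -> (fun x => u x - v x) @ F --> a - b.
Proof. by move=> ua vb; exact: cvgCD ua (cvgCN vb). Qed.
Lemma cvgCV (T : Type) (F : set_system T) {FF : Filter F} (u : T -> C) (a : C) :
  a != 0 -> u @ F --> a -> (fun x => (u x)^-1) @ F --> a^-1.
Proof. by move=> a0 ua; exact: (cvgV a0 ua). Qed.
Lemma cvgC_cst (T : Type) (F : set_system T) {FF : Filter F} (a : C) :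
  (fun _ : T => a) @ F --> a.
Proof. exact: (@cvg_cst C a T F). Qed.
Lemma cvgC_div (T : Type) (F : set_system T) {FF : Filter F} (u v : T -> C) (a b : C) :
  b != 0 -> u @ F --> a -> v @ F --> b -> (fun x => u x / v x) @ F --> a / b.
Proof. by move=> b0 ua vb; exact: cvgCM ua (cvgCV b0 vb). Qed.

Lemma cont_cst (c : C) z : {for z, continuous (fun=> c : C)}.
Proof. exact: (@cvgC_cst _ (nbhs z)). Qed.

Lemma cont_id z : {for z, continuous (fun w : C => w)}.
Proof. exact: (@cvg_id C (nbhs z)). Qed.

Lemma contD f g z : {for z, continuous f} -> {for z, continuous g} ->
  {for z, continuous (fun w => f w + g w)}.
Proof. exact: (@cvgCD _ (nbhs z)). Qed.

Lemma contN f z : {for z, continuous f} -> {for z, continuous (fun w => - f w)}.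
Proof. exact: (@cvgCN _ (nbhs z)). Qed.

Lemma contB f g z : {for z, continuous f} -> {for z, continuous g} ->
  {for z, continuous (fun w => f w - g w)}.
Proof. exact: (@cvgCB _ (nbhs z)). Qed.

Lemma contM f g z : {for z, continuous f} -> {for z, continuous g} ->
  {for z, continuous (fun w => f w * g w)}.
Proof. exact: (@cvgCM _ (nbhs z)). Qed.

Lemma contV f z : f z != 0 -> {for z, continuous f} ->
  {for z, continuous (fun w => (f w)^-1)}.
Proof. exact: (@cvgCV _ (nbhs z)). Qed.

Lemma cont_comp f g z : {for z, continuous f} -> {for f z, continuous g} ->
  {for z, continuous (fun w => g (f w))}.
Proof. by move=> cf cg; exact: (cvg_comp _ _ cf cg). Qed.

Arguments cont_cst c z : clear implicits.
Arguments cont_id z : clear implicits.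
Arguments contD {f g z} _ _.
Arguments contN {f z} _.
Arguments contB {f g z} _ _.
Arguments contM {f g z} _ _.
Arguments contV {f z} _ _.
Arguments cont_comp {f g z} _ _.

(* Caratheodory's form of complex differentiability: it turns the rules of
   differentiation into ring identities. *)
Definition cderiv f z l := exists q : C -> C,
  [/\ {for z, continuous q}, q z = l & forall w, f w - f z = q w * (w - z)].

Lemma cderiv_continuous f z l : cderiv f z l -> {for z, continuous f}.
Proof.
case=> q [cq _ fq].
have -> : f = (fun w => f z + q w * (w - z)).
  by apply/funext => w; rewrite -fq addrC subrK.
apply: contD; first exact: cont_cst.
by exact: contM cq (contB (cont_id z) (cont_cst z z)).
Qed.

Lemma cderivP f z l : cderiv f z l <-> 
  forall e : R, 0 < e -> exists2 d : R, 0 < d & forall w, cabs (w - z) < d ->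
    cabs (f w - f z - l * (w - z)) <= e * cabs (w - z).
Proof.
split.
- case=> q [/continuousCP cq qz fq] e /cq[d d0 Hd]; exists d => // w /Hd.
  by rewrite fq -mulrBl cabsM -qz => /ltW H; apply: ler_wpM2r => //; exact: cabs_ge0.
- move=> H; exists (fun w => if w == z then l else (f w - f z) / (w - z)).
  rewrite eqxx; split=> //; last first.
    move=> w; case: eqVneq => [->|wz]; first by rewrite !subrr mulr0.
    by rewrite divfK// subr_eq0.
  apply/continuousCP => e e0.
  have [d d0 Hd] := H (e / 2) (div2_gt0 e0); exists d => // w wd.
  rewrite eqxx; case: (boolP (w == z)) => [_|wz]; first by rewrite subrr cabs0.
  have wz0 : w - z != 0 by rewrite subr_eq0.
  rewrite -{1}(mulfK wz0 l) -mulrBl cabsM cabsV ltr_pdivrMr ?cabs_gt0//.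
  apply: (le_lt_trans (Hd _ wd)); rewrite ltr_pM2r ?cabs_gt0// ltr_pdivrMr//.
  by rewrite ltr_pMr// ltr1n.
Qed.

Lemma cderiv_uniq f z l l' : cderiv f z l -> cderiv f z l' -> l = l'.
Proof.
move=> /cderivP Hl /cderivP Hl'; apply/eqP; rewrite -subr_eq0 -cabs_eq0.
apply/negPn/negP => n0.
have e0 : 0 < cabs (l - l') by rewrite lt_neqAle eq_sym n0 cabs_ge0.
have [d d0 Hd] := Hl (cabs (l - l') / 3) (div3_gt0 e0).
have [d' d'0 Hd'] := Hl' (cabs (l - l') / 3) (div3_gt0 e0).
pose h := Num.min d d' / 2; have h0 : 0 < h by rewrite divr_gt0// lt_min d0.
have hh : h < Num.min d d' by rewrite ltr_pdivrMr// ltr_pMr ?lt_min ?d0// ltr1n.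
move: hh; rewrite lt_min => /andP[hd hd'].
have ab : cabs (z + real_cplx h - z) = h.
  by rewrite addrC addKr cabs_real ger0_norm// ltW.
have := Hd (z + real_cplx h); have := Hd' (z + real_cplx h).
rewrite ab => /(_ hd') A /(_ hd) B.
set F := f _ - f z in A B; set k := z + _ - z in A B ab.
have : cabs ((l - l') * k) <= 2 / 3 * cabs (l - l') * h.
  have -> : (l - l') * k = (F - l' * k) - (F - l * k) by ring.
  apply: (le_trans (ler_cabsB _ _)).
  by apply: (le_trans (lerD A B)); rewrite -mulrDl; apply: ler_wpM2r; [exact: ltW|lra].
rewrite cabsM ab ler_pM2r//; lra.
Qed.

Lemma derivable_cderiv f z : derivable f z 1 <-> exists l, cderiv f z l.
Proof.
split.
- move=> df; exists ('D_1 f z); apply/cderivP => e e0.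
  have : h^-1 *: (f (h *: 1 + z) - f z) @[h --> 0^'] --> 'D_1 f z by [].
  move=> /cvgCP/(_ _ e0); rewrite -[X in X -> _]/(nbhs _ _).
  rewrite /dnbhs /within /= => /nbhsCP[d d0 Hd].
  exists d => // w wd; have [->|wz] := eqVneq w z.
    by rewrite !subrr mulr0 subr0 cabs0 mulr0.
  have wz0 : w - z != 0 by rewrite subr_eq0.
  have := Hd (w - z); rewrite subr0 => /(_ wd wz0) /ltW.
  rewrite -[(w - z) *: 1]/((w - z) * 1) mulr1 subrK.
  rewrite -[(w - z)^-1 *: _]/((w - z)^-1 * _) => H.
  have -> : f w - f z - 'D_1 f z * (w - z)
      = ((w - z)^-1 * (f w - f z) - 'D_1 f z) * (w - z).
    by rewrite mulrBl mulrAC mulVf// mul1r.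
  by rewrite cabsM; apply: ler_wpM2r => //; exact: cabs_ge0.
- case=> l /cderivP H; apply/cvg_ex; exists l; apply/cvgCP => e e0.
  have [d d0 Hd] := H (e / 2) (div2_gt0 e0).
  rewrite nearE /dnbhs /within /=; apply/nbhsCP; exists d => // h.
  rewrite subr0 => hd h0; have := Hd (h + z); rewrite addrK => /(_ hd) K.
  rewrite -[h *: 1]/(h * 1) mulr1 -[h^-1 *: _]/(h^-1 * _).
  have -> : h^-1 * (f (h + z) - f z) - l = (f (h + z) - f z - l * h) / h.
    by rewrite mulrBl mulfK// mulrC.
  rewrite cabsM cabsV ltr_pdivrMr ?cabs_gt0//; apply: (le_lt_trans K).
  by rewrite ltr_pM2r ?cabs_gt0// ltr_pdivrMr// ltr_pMr// ltr1n.
Qed.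

Lemma cderiv_derive1 f z l : cderiv f z l -> derive1 f z = l.
Proof.
move=> fl; have /derivable_cderiv df : exists l, cderiv f z l by exists l.
apply: cderiv_uniq fl; apply/cderivP => e e0.
have : h^-1 *: (f (h + z) - f z) @[h --> 0^'] --> derive1 f z.
  rewrite derive1E; have : h^-1 *: (f (h *: 1 + z) - f z) @[h --> 0^'] --> 'D_1 f z by [].
  apply: cvg_trans; apply: near_eq_cvg; near=> h.
  by rewrite -[h *: 1]/(h * 1) mulr1.
move=> /cvgCP/(_ _ e0); rewrite -[X in X -> _]/(nbhs _ _).
rewrite /dnbhs /within /= => /nbhsCP[d d0 Hd].
exists d => // w wd; have [->|wz] := eqVneq w z.
  by rewrite !subrr mulr0 subr0 cabs0 mulr0.
have wz0 : w - z != 0 by rewrite subr_eq0.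
have := Hd (w - z); rewrite subr0 => /(_ wd wz0) /ltW.
rewrite subrK -[(w - z)^-1 *: _]/((w - z)^-1 * _) => H.
have -> : f w - f z - derive1 f z * (w - z)
    = ((w - z)^-1 * (f w - f z) - derive1 f z) * (w - z).
  by rewrite mulrBl mulrAC mulVf// mul1r.
by rewrite cabsM; apply: ler_wpM2r => //; exact: cabs_ge0.
Unshelve. all: by end_near. Qed.

Lemma cderiv_cst (c : C) z : cderiv (fun=> c) z 0.
Proof.
by exists (fun=> 0); split => //; [exact: cont_cst|move=> w; rewrite subrr mul0r].
Qed.

Lemma cderiv_id z : cderiv id z 1.
Proof.
by exists (fun=> 1); split => //; [exact: cont_cst|move=> w; rewrite mul1r].
Qed.

Lemma cderivD f g z l k : cderiv f z l -> cderiv g z k ->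
  cderiv (fun w => f w + g w) z (l + k).
Proof.
move=> [p [cp pz fp]] [q [cq qz fq]]; exists (fun w => p w + q w); split.
- exact: contD.
- by rewrite pz qz.
- by move=> w; rewrite mulrDl -fp -fq; ring.
Qed.

Lemma cderivN f z l : cderiv f z l -> cderiv (fun w => - f w) z (- l).
Proof.
move=> [p [cp pz fp]]; exists (fun w => - p w); split.
- exact: contN.
- by rewrite pz.
- by move=> w; rewrite mulNr -fp; ring.
Qed.

Lemma cderivB f g z l k : cderiv f z l -> cderiv g z k ->
  cderiv (fun w => f w - g w) z (l - k).
Proof. by move=> fl gk; apply: cderivD => //; exact: cderivN. Qed.

Lemma cderivM f g z l k : cderiv f z l -> cderiv g z k ->
  cderiv (fun w => f w * g w) z (l * g z + f z * k).
Proof.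
move=> fl gk; have cg := cderiv_continuous gk.
case: fl gk => [p [cp pz fp]] [q [cq qz fq]].
exists (fun w => p w * g w + f z * q w); split.
- exact: contD (contM cp cg) (contM (cont_cst (f z) z) cq).
- by rewrite pz qz.
- move=> w; have -> : f w * g w - f z * g z = (f w - f z) * g w + f z * (g w - g z) by ring.
  by rewrite fp fq; ring.
Qed.

(** The candidate quotient [- p w / (f w * f z)] represents the increment only where [f w] is
    nonzero, that is near [z]; hence the detour through the local criterion [cderivP]. *)
Lemma cderivV f z l : f z != 0 -> cderiv f z l ->
  cderiv (fun w => (f w)^-1) z (- l / (f z) ^+ 2).
Proof.
move=> fz0 fl; have cf := cderiv_continuous fl.
apply/cderivP => e e0.
have cg : {for z, continuous (fun w => (f w)^-1)} by exact: contV.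
case: fl => [p [cp pz fp]].
have : {for z, continuous (fun w => - p w / (f w * f z))}.
  have cm : {for z, continuous (fun w => f w * f z)} := contM cf (cont_cst (f z) z).
  have ci := @contV (fun w => f w * f z) z (mulf_neq0 fz0 fz0) cm.
  exact: contM (contN cp) ci.
move=> /continuousCP/(_ _ e0)[d d0 Hd].
have f0 : 0 < cabs (f z) by rewrite cabs_gt0.
have /continuousCP/(_ _ f0)[d' d'0 Hd'] := cf.
exists (Num.min d d'); first by rewrite lt_min d0.
move=> w; rewrite lt_min => /andP[/Hd H1 /Hd' H2].
have fw0 : f w != 0.
  by apply: contraTneq H2 => ->; rewrite sub0r cabsN ltxx.
have -> : (f w)^-1 - (f z)^-1 - - l / f z ^+ 2 * (w - z) =
   (- p w / (f w * f z) - - p z / (f z * f z)) * (w - z).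
  have -> : (f w)^-1 - (f z)^-1 = - (p w * (w - z)) / (f w * f z).
    by rewrite -fp; field; rewrite fz0 fw0.
  by rewrite pz; field; rewrite fz0 fw0.
by rewrite cabsM; apply: ler_wpM2r; [exact: cabs_ge0|exact: ltW].
Qed.

Lemma cderiv_comp f g z l k : cderiv f z l -> cderiv g (f z) k ->
  cderiv (fun w => g (f w)) z (k * l).
Proof.
move=> fl; have cf := cderiv_continuous fl.
case: fl => [p [cp pz fp]] [q [cq qz fq]].
exists (fun w => q (f w) * p w); split.
- exact: contM (cont_comp cf cq) cp.
- by rewrite pz qz.
- by move=> w; rewrite fq fp mulrA.
Qed.

Lemma cderiv_div f g z l k : g z != 0 -> cderiv f z l -> cderiv g z k ->
  cderiv (fun w => f w / g w) z (l / g z - f z * k / g z ^+ 2).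
Proof.
move=> g0 fl gk.
have -> : l / g z - f z * k / g z ^+ 2 = l * (g z)^-1 + f z * (- k / g z ^+ 2) by ring.
by apply: cderivM => //; exact: cderivV.
Qed.

Lemma cderiv_near f g z l : (\forall w \near z, f w = g w) ->
  cderiv f z l -> cderiv g z l.
Proof.
move=> fg /cderivP H; apply/cderivP => e /H[d d0 Hd].
have gz := nbhs_singleton fg.
move: fg => /nbhsCP[d' d'0 Hd'].
exists (Num.min d d'); first by rewrite lt_min d0.
by move=> w; rewrite lt_min => /andP[/Hd H1 /Hd' <-]; rewrite -gz.
Qed.

(** Serves to unroll a punctured disc into a half-plane, so that Cauchy's theorem on rectangles
    gives information about circles, and to differentiate [expi]. *)
Definition cexp z : C := real_cplx (expR (cRe z)) * expi (cIm z).

Lemma cexpD z w : cexp (z + w) = cexp z * cexp w.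
Proof. by rewrite /cexp cReD cImD expRD rcM expiD; ring. Qed.

Lemma cabs_cexp z : cabs (cexp z) = expR (cRe z).
Proof. by rewrite cabsM cabs_expi mulr1 cabs_real ger0_norm// expR_ge0. Qed.

Lemma cexp_neq0 z : cexp z != 0.
Proof. by rewrite -cabs_gt0 cabs_cexp expR_gt0. Qed.

Lemma is_derive_small (u : R -> R) (x a : R) : is_derive x 1 u a ->
  forall e : R, 0 < e -> exists2 d : R, 0 < d & forall y, `|y| < d ->
    `|u (y + x) - u x - a * y| <= e * `|y|.
Proof.
move=> [du <-] e e0.
have : h^-1 *: (u (h *: 1 + x) - u x) @[h --> 0^'] --> 'D_1 u x by [].
move=> /cvgrPdist_lt/(_ _ e0); rewrite -[X in X -> _]/(nbhs _ _).
rewrite /dnbhs /within /= => /nbhs_ballP[d /= d0 Hd].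
exists d => // y yd; have [->|y0] := eqVneq y 0.
  by rewrite add0r subrr mulr0 subr0 normr0 mulr0.
have := Hd y; rewrite /ball /= sub0r normrN => /(_ yd y0) /ltW.
rewrite -[y *: 1]/(y * 1) mulr1 -[y^-1 *: _]/(y^-1 * _) distrC => H.
have -> : u (y + x) - u x - 'D_1 u x * y = (y^-1 * (u (y + x) - u x) - 'D_1 u x) * y.
  by rewrite mulrBl mulrAC mulVf// mul1r.
by rewrite normrM; apply: ler_wpM2r.
Qed.

Lemma cexp_small (e : R) : 0 < e -> exists2 d : R, 0 < d &
  forall h, cabs h < d -> cabs (cexp h - 1 - h) <= e * cabs h.
Proof.
(* The three error terms below cost [k], [6 * k] and [2 * k] times [cabs h], whence the 9. *)
move=> e0; pose k := Num.min (e / 9) 1.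
have k0 : 0 < k by rewrite lt_min ltr01 divr_gt0.
have [k9 k1] : k <= e / 9 /\ k <= 1 by split; rewrite ge_min lexx ?orbT.
have [d1 d10 H1] := is_derive_small (@is_derive_expR R 0) k0.
have [d2 d20 H2] := is_derive_small (@is_derive_cos R 0) k0.
have [d3 d30 H3] := is_derive_small (@is_derive_sin R 0) k0.
exists (Num.min (Num.min d1 k) (Num.min d2 d3)); first by rewrite lt_min [in X in X && _]lt_min [in X in _ && X]lt_min d10 d20 d30 k0.
move=> h; rewrite lt_min [in X in X && _]lt_min [in X in _ && X]lt_min => /andP[/andP[hd1 hk] /andP[hd2 hd3]].
set a := cRe h; set b := cIm h.
have ah : `|a| <= cabs h by exact: ler_Re_cabs.
have bh : `|b| <= cabs h by exact: ler_Im_cabs.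
have := H1 a (le_lt_trans ah hd1); have := H2 b (le_lt_trans bh hd2).
have := H3 b (le_lt_trans bh hd3).
rewrite !addr0 expR0 sin0 cos0 subr0 oppr0 mul0r subr0 !mul1r.
set E := expR a - 1 - a; set G := cos b - 1; set S := sin b - b => HS HG HE.
have ka : k * `|a| <= k * cabs h by rewrite ler_pM2l.
have kb : k * `|b| <= k * cabs h by rewrite ler_pM2l.
have -> : cexp h - 1 - h = real_cplx E + real_cplx (expR a) * (real_cplx G + Ci * real_cplx S)
   + real_cplx (expR a - 1) * (Ci * real_cplx b).
  apply: C_eqP; rewrite /cexp /E /G /S !ReIm -/a -/b; ring.
have nG : cabs ((real_cplx G + Ci * real_cplx S)) <= `|G| + `|S| 
  by apply: (le_trans (cabs_le_ReIm _)); rewrite !ReIm !mul0r !mul1r !subr0 !add0r addr0 lexx.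
have h0 := cabs_ge0 h.
have Ea1 : `|expR a - 1| <= 2 * cabs h.
  have -> : expR a - 1 = E + a by rewrite /E; ring.
  apply: (le_trans (ler_normD _ _)).
  have : k * cabs h <= cabs h by rewrite ler_piMl.
  lra.
have Ea : `|expR a| <= 3.
  have -> : expR a = (expR a - 1) + 1 by ring.
  by apply: (le_trans (ler_normD _ _)); rewrite normr1; lra.
apply: (le_trans (ler_cabsD _ _)); apply: (le_trans (lerD (ler_cabsD _ _) (lexx _))).
rewrite !cabsM !cabs_real cabs_Ci mul1r.
have B1 : `|expR a| * cabs ((real_cplx G + Ci * real_cplx S)) <= 3 * (2 * (k * cabs h)).
  by apply: ler_pM => //; [exact: cabs_ge0|lra].
have B2 : `|expR a - 1| * `|b| <= 2 * cabs h * k.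
  apply: ler_pM => //; apply: (le_trans bh); exact: ltW.
have : 9 * (k * cabs h) <= e * cabs h.
  by rewrite mulrA; apply: ler_wpM2r => //; lra.
lra.
Qed.

Lemma cderiv_cexp z : cderiv cexp z (cexp z).
Proof.
apply/cderivP => e e0.
have z0 : 0 < cabs (cexp z) by rewrite cabs_cexp expR_gt0.
have [d d0 Hd] := cexp_small (divr_gt0 e0 z0); exists d => // w /Hd H.
have -> : cexp w - cexp z - cexp z * (w - z) = cexp z * (cexp (w - z) - 1 - (w - z)).
  have -> : cexp w = cexp z * cexp (w - z) by rewrite -cexpD addrC subrK.
  by rewrite !mulrBr mulr1; ring.
rewrite cabsM -ler_pdivlMl//; apply: (le_trans H).
by rewrite -mulrA mulrCA lexx.
Qed.

End ComplexDerivative.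

Arguments cont_cst {R} c z.
Arguments cont_id {R} z.
Arguments contD {R f g z} _ _.
Arguments contN {R f z} _.
Arguments contB {R f g z} _ _.
Arguments contM {R f g z} _ _.
Arguments contV {R f z} _ _.
Arguments cont_comp {R f g z} _ _.

(** * Cauchy's theorem and the maximum principle *)

Section IntervalIntegrals.
Variable R : realType.
Local Notation C := (Cplx R).
Local Notation mu := (@lebesgue_measure R).
Implicit Types (u v : R -> R) (a b m M x y : R).

Definition cont_on a b u := forall x, a <= x <= b -> {for x, continuous u}.

Lemma cont_on_sub a b a' b' u : a <= a' -> b' <= b -> cont_on a b u -> cont_on a' b' u.
Proof.
by move=> aa bb cu x /andP[ax xb]; apply: cu; rewrite (le_trans aa ax) (le_trans xb bb).
Qed.

Lemma cont_on_integrable a b u : cont_on a b u -> mu.-integrable `[a, b] (EFin \o u).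
Proof.
move=> cu; apply: continuous_compact_integrable; first exact: segment_compact.
apply: continuous_in_subspaceT => x; rewrite inE /= in_itv /=; exact: cu.
Qed.

Definition rint u a b : R := (\int[mu]_(x in `[a, b]) u x)%R.

Lemma rint_split u a m b : a <= m -> m <= b -> cont_on a b u ->
  rint u a b = rint u a m + rint u m b.
Proof.
move=> am mb cu; apply/eqP; rewrite addrC -subr_eq; apply/eqP.
rewrite /rint Rintegral_itvB ?bnd_simp//; last exact: cont_on_integrable.
apply: Rintegral_itv_obnd_cbnd.
apply: integrableS (cont_on_integrable (cont_on_sub am (lexx b) cu)) => //.
exact: subset_itv_oc_cc.
Qed.

Lemma rintB u v a b : cont_on a b u -> cont_on a b v ->
  rint (fun x => u x - v x) a b = rint u a b - rint v a b.
Proof. by move=> cu cv; apply: RintegralB => //; exact: cont_on_integrable. Qed.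

Lemma rintZ u k a b : cont_on a b u ->
  rint (fun x => k * u x) a b = k * rint u a b.
Proof. by move=> cu; apply: RintegralZl => //; exact: cont_on_integrable. Qed.

Lemma rint_cst k a b : a <= b -> rint (fun=> k) a b = k * (b - a).
Proof.
move=> ab; rewrite /rint Rintegral_cst//= lebesgue_measure_itv /= lte_fin.
by move: ab; rewrite le_eqVlt => /predU1P[->|->]; rewrite ?ltxx//= subrr.
Qed.

Lemma cont_on_cst k a b : cont_on a b (fun=> k).
Proof. by move=> x _; exact: cvg_cst. Qed.

Lemma eq_rint u v a b : (forall x, a <= x <= b -> u x = v x) -> rint u a b = rint v a b.
Proof. by move=> uv; apply: eq_Rintegral => x; rewrite inE /= in_itv /=; exact: uv. Qed.

Lemma rint_le u v a b : cont_on a b u -> cont_on a b v ->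
  (forall x, a <= x <= b -> u x <= v x) -> rint u a b <= rint v a b.
Proof.
move=> cu cv uv; apply: le_Rintegral => //; try exact: cont_on_integrable.
Qed.

Lemma rint_bound u M a b : a <= b -> cont_on a b u ->
  (forall x, a <= x <= b -> `|u x| <= M) -> `|rint u a b| <= M * (b - a).
Proof.
move=> ab cu uM; rewrite ler_norml -mulNr -!(rint_cst _ ab); apply/andP; split;
  apply: rint_le => //; try exact: cont_on_cst; move=> x /uM.
- by rewrite ler_norml => /andP[].
- by rewrite ler_norml => /andP[].
Qed.

(** A deficit of [u] at [a] would persist on an interval of positive length and push the integral
    strictly below its bound. Only the endpoint is recorded, since circles are parametrized from
    angle 0. *)
Lemma rint_eq_max u M a b : a < b -> cont_on a b u ->
  (forall x, a <= x <= b -> u x <= M) -> rint u a b = M * (b - a) -> u a = M.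
Proof.
move=> ab cu uM E; apply/eqP; rewrite eq_le uM ?lexx ?(ltW ab)//=.
rewrite leNgt; apply/negP => uaM.
have e0 : 0 < (M - u a) / 2 by rewrite divr_gt0// subr_gt0.
have : {for a, continuous u} by apply: cu; rewrite lexx ltW.
move=> /cvgrPdist_lt/(_ _ e0)/nbhs_ballP[d /= d0 Hd].
pose m := a + Num.min (d / 2) (b - a).
have mm0 : 0 < Num.min (d / 2) (b - a) by rewrite lt_min divr_gt0//= subr_gt0.
have am : a < m by rewrite ltrDl.
have mb : m <= b by rewrite -lerBrDl ge_min lexx orbT.
have md : m - a <= d / 2 by rewrite addrC addKr ge_min lexx.
have cu1 : cont_on a m u by exact: cont_on_sub cu.
have cu2 : cont_on m b u by exact: cont_on_sub (ltW am) (lexx _) cu.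
have H1 : rint u a m <= (M - (M - u a) / 2) * (m - a).
  rewrite -(rint_cst _ (ltW am)); apply: rint_le => //; first exact: cont_on_cst.
  move=> x /andP[ax xm].
  have : `|u a - u x| < (M - u a) / 2.
    apply: Hd; rewrite /ball /= distrC ger0_norm ?subr_ge0//.
    by apply: (@le_lt_trans _ _ (m - a)); [rewrite lerD2r|lra].
  rewrite ltr_norml; lra.
have H2 : rint u m b <= M * (b - m).
  rewrite -(rint_cst _ mb); apply: rint_le => //; first exact: cont_on_cst.
  by move=> x /andP[mx xb]; apply: uM; rewrite (le_trans (ltW am) mx).
have := rint_split (ltW am) mb cu; rewrite E.
have : 0 < (M - u a) / 2 * (m - a) by rewrite mulr_gt0// subr_gt0.
lra.
Qed.

Local Notation cRe := (@complex.Re R : C -> R).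
Local Notation cIm := (@complex.Im R : C -> R).
Implicit Types (f g : R -> C).

Definition ccont_on a b f := forall x, a <= x <= b -> f @ nbhs x --> f x.

Definition cint f a b : C :=
  real_cplx (rint (fun x => cRe (f x)) a b) + Ci * real_cplx (rint (fun x => cIm (f x)) a b).

Lemma ccont_on_Re a b f : ccont_on a b f -> cont_on a b (fun x => cRe (f x)).
Proof. by move=> cf x /cf fx; exact: cvgC_Re fx. Qed.

Lemma ccont_on_Im a b f : ccont_on a b f -> cont_on a b (fun x => cIm (f x)).
Proof. by move=> cf x /cf fx; exact: cvgC_Im fx. Qed.

Lemma ccont_on_sub a b a' b' f : a <= a' -> b' <= b -> ccont_on a b f -> ccont_on a' b' f.
Proof.
by move=> aa bb cu x /andP[ax xb]; apply: cu; rewrite (le_trans aa ax) (le_trans xb bb).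
Qed.

Lemma ccont_onB a b f g : ccont_on a b f -> ccont_on a b g ->
  ccont_on a b (fun x => f x - g x).
Proof. by move=> cf cg x xab; exact: cvgCB (cf _ xab) (cg _ xab). Qed.

Lemma cint_split f a m b : a <= m -> m <= b -> ccont_on a b f ->
  cint f a b = cint f a m + cint f m b.
Proof.
move=> am mb cf; rewrite /cint (rint_split am mb (ccont_on_Re cf)).
by rewrite (rint_split am mb (ccont_on_Im cf)) !rcD; ring.
Qed.

Lemma cintB f g a b : ccont_on a b f -> ccont_on a b g ->
  cint (fun x => f x - g x) a b = cint f a b - cint g a b.
Proof.
move=> cf cg; rewrite /cint.
have := rintB (ccont_on_Re cf) (ccont_on_Re cg).
have := rintB (ccont_on_Im cf) (ccont_on_Im cg).
under eq_rint do rewrite -cImN -cImD; move=> ->.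
under eq_rint do rewrite -cReN -cReD; move=> ->.
by rewrite !rcB; ring.
Qed.

Lemma cint_cst (k : C) a b : a <= b -> cint (fun=> k) a b = k * real_cplx (b - a).
Proof. by move=> ab; rewrite /cint !rint_cst// !rcM {3}(C_ReIm k); ring. Qed.

Lemma eq_cint f g a b : (forall x, a <= x <= b -> f x = g x) -> cint f a b = cint g a b.
Proof.
by move=> fg; congr (real_cplx _ + Ci * real_cplx _); apply: eq_rint => x /fg ->.
Qed.

(** The factor 2 comes from bounding the real and the imaginary part separately. *)
Lemma cint_bound f M a b : a <= b -> ccont_on a b f ->
  (forall x, a <= x <= b -> cabs (f x) <= M) -> cabs (cint f a b) <= 2 * M * (b - a).
Proof.
move=> ab cf fM; apply: (le_trans (ler_cabsD _ _)).
rewrite cabsM cabs_Ci mul1r !cabs_real.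
have -> : 2 * M * (b - a) = M * (b - a) + M * (b - a) by ring.
by apply: lerD; apply: rint_bound => //; [exact: ccont_on_Re| |exact: ccont_on_Im|];
  move=> x /fM; apply: le_trans; [exact: ler_Re_cabs|exact: ler_Im_cabs].
Qed.

Lemma cint_mull (k : C) f a b : ccont_on a b f ->
  cRe (k * cint f a b) = rint (fun x => cRe (k * f x)) a b.
Proof.
move=> cf; have cr := ccont_on_Re cf; have ci := ccont_on_Im cf.
rewrite (@eq_rint _ (fun x => cRe k * cRe (f x) - cIm k * cIm (f x))); last first.
  by move=> x _; exact: cReM.
rewrite rintB; last 2 first.
- by move=> x xab; apply: cvgM; [exact: cvg_cst|exact: cr].
- by move=> x xab; apply: cvgM; [exact: cvg_cst|exact: ci].
by rewrite !rintZ// /cint !ReIm; ring.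
Qed.

End IntervalIntegrals.

(** * Goursat's theorem on rectangles *)

Section Goursat.
Variable R : realType.
Local Notation C := (Cplx R).
Local Notation cRe := (@complex.Re R : C -> R).
Local Notation cIm := (@complex.Im R : C -> R).
Implicit Types (F f : C -> C) (a b c d x y : R).

Lemma cvgC_comp (T : Type) (G : set_system T) {FG : Filter G} (u : T -> C) f (l : C) :
  u @ G --> l -> {for l, continuous f} -> (fun t => f (u t)) @ G --> f l.
Proof. by move=> ul fl; exact: (@cvg_comp _ _ _ u f G (nbhs l) (nbhs (f l)) ul fl). Qed.

Definition cpt x y : C := Complex x y.

Lemma cvg_cptl x y : (fun t => cpt t y) @ nbhs x --> cpt x y.
Proof. by apply: cvgC_ReIm => /=; [exact: cvg_id|exact: cvg_cst]. Qed.

Lemma cvg_cptr x y : (fun t => cpt x t) @ nbhs y --> cpt x y.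
Proof. by apply: cvgC_ReIm => /=; [exact: cvg_cst|exact: cvg_id]. Qed.

(** The contour integral along the boundary of the rectangle, taken counterclockwise, with opposite
    sides paired in one integrand. *)
Definition rect_int F a b c d : C :=
  cint (fun x => F (cpt x c) - F (cpt x d)) a b +
  Ci * cint (fun y => F (cpt b y) - F (cpt a y)) c d.

Definition cont_rect F a b c d := forall x y, a <= x <= b -> c <= y <= d ->
  {for cpt x y, continuous F}.

Lemma cont_rectl F a b c d y : cont_rect F a b c d -> c <= y <= d ->
  ccont_on a b (fun x => F (cpt x y)).
Proof.
by move=> cF ycd x xab; have cFx := cF _ _ xab ycd; exact: (@cvgC_comp _ (nbhs x) _ (fun t => cpt t y) F (cpt x y) (@cvg_cptl x y) cFx).
Qed.

Lemma cont_rectr F a b c d x : cont_rect F a b c d -> a <= x <= b ->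
  ccont_on c d (fun y => F (cpt x y)).
Proof.
by move=> cF xab y ycd; have cFx := cF _ _ xab ycd; exact: (@cvgC_comp _ (nbhs y) _ (fun t => cpt x t) F (cpt x y) (@cvg_cptr x y) cFx).
Qed.

Lemma cont_rect_sub F a b c d a' b' c' d' : a <= a' -> b' <= b -> c <= c' -> d' <= d ->
  cont_rect F a b c d -> cont_rect F a' b' c' d'.
Proof.
move=> aa bb cc dd cF x y /andP[ax xb] /andP[cy yd]; apply: cF.
  by rewrite (le_trans aa ax) (le_trans xb bb).
by rewrite (le_trans cc cy) (le_trans yd dd).
Qed.

Lemma rect_int_splitl F a m b c d : a <= m -> m <= b -> c <= d -> cont_rect F a b c d ->
  rect_int F a b c d = rect_int F a m c d + rect_int F m b c d.
Proof.
move=> am mb cd cF; rewrite /rect_int.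
have ab := le_trans am mb.
have Hx x : a <= x <= b -> ccont_on c d (fun y => F (cpt x y)) by exact: cont_rectr.
have [Ha Hm Hb] : [/\ a <= a <= b, a <= m <= b & a <= b <= b].
  by split; rewrite ?lexx ?ab ?am ?mb.
have Hc : ccont_on a b (fun x => F (cpt x c)) by apply: cont_rectl cF _; rewrite lexx.
have Hd : ccont_on a b (fun x => F (cpt x d)) by apply: cont_rectl cF _; rewrite lexx cd.
rewrite (cint_split am mb (ccont_onB Hc Hd)) !cintB //; try exact: Hx; first ring.
- exact: ccont_on_sub am (lexx _) Hc.
- exact: ccont_on_sub am (lexx _) Hd.
- exact: ccont_on_sub (lexx _) mb Hc.
- exact: ccont_on_sub (lexx _) mb Hd.
Qed.

Lemma rect_int_splitr F a b c m d : a <= b -> c <= m -> m <= d -> cont_rect F a b c d ->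
  rect_int F a b c d = rect_int F a b c m + rect_int F a b m d.
Proof.
move=> ab cm md cF; rewrite /rect_int.
have cd := le_trans cm md.
have Hx y : c <= y <= d -> ccont_on a b (fun x => F (cpt x y)) by exact: cont_rectl.
have [Ha Hm Hb] : [/\ c <= c <= d, c <= m <= d & c <= d <= d].
  by split; rewrite ?lexx ?cd ?cm ?md.
have Hc : ccont_on c d (fun x => F (cpt a x)) by apply: cont_rectr cF _; rewrite lexx.
have Hd : ccont_on c d (fun x => F (cpt b x)) by apply: cont_rectr cF _; rewrite lexx ab.
rewrite (cint_split cm md (ccont_onB Hd Hc)) !cintB //; try exact: Hx; first ring.
- exact: ccont_on_sub cm (lexx _) Hd.
- exact: ccont_on_sub cm (lexx _) Hc.
- exact: ccont_on_sub (lexx _) md Hd.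
- exact: ccont_on_sub (lexx _) md Hc.
Qed.

(** Affine functions have contour integral zero, so [F] may be replaced by the error of its linear
    approximation at [p]. *)
Lemma rect_int_small F a b c d p l (M : R) : a <= b -> c <= d -> cont_rect F a b c d ->
  (forall x y, a <= x <= b -> c <= y <= d ->
     cabs (F (cpt x y) - F p - l * (cpt x y - p)) <= M) ->
  cabs (rect_int F a b c d) <= 4 * M * ((b - a) + (d - c)).
Proof.
move=> ab cd cF FM.
pose e (z : C) := F z - F p - l * (z - p).
have Hx y : c <= y <= d -> ccont_on a b (fun x => F (cpt x y)) by exact: cont_rectl.
have Hy x : a <= x <= b -> ccont_on c d (fun y => F (cpt x y)) by exact: cont_rectr.
have [Ia Ib] : a <= a <= b /\ a <= b <= b by rewrite !lexx ab.
have [Ic Id] : c <= c <= d /\ c <= d <= d by rewrite !lexx cd.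
have kx (k : C) : ccont_on a b (fun=> k) by move=> ? _; exact: cvgC_cst.
have ky (k : C) : ccont_on c d (fun=> k) by move=> ? _; exact: cvgC_cst.
have E1 x : e (cpt x c) - e (cpt x d)
    = F (cpt x c) - F (cpt x d) - l * (Ci * real_cplx (c - d)).
  rewrite /e; have -> : cpt x c = cpt x d + Ci * real_cplx (c - d).
    by apply: C_eqP; rewrite !ReIm /=; ring.
  ring.
have E2 y : e (cpt b y) - e (cpt a y)
    = F (cpt b y) - F (cpt a y) - l * real_cplx (b - a).
  rewrite /e; have -> : cpt b y = cpt a y + real_cplx (b - a).
    by apply: C_eqP; rewrite !ReIm /=; ring.
  ring.
have -> : rect_int F a b c d = rect_int e a b c d.
  rewrite /rect_int (eq_cint (fun x _ => E1 x)) (eq_cint (fun x _ => E2 x)).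
  rewrite [X in _ = X + _]cintB//; last by apply: ccont_onB; exact: Hx.
  rewrite [X in _ = _ + _ * X]cintB//; last by apply: ccont_onB; exact: Hy.
  rewrite !cint_cst// !rcB; ring.
apply: (le_trans (ler_cabsD _ _)); rewrite cabsM cabs_Ci mul1r.
have -> : 4 * M * (b - a + (d - c)) = 2 * (M + M) * (b - a) + 2 * (M + M) * (d - c) by ring.
apply: lerD; apply: cint_bound => //.
- have -> : (fun x => e (cpt x c) - e (cpt x d)) =
    (fun x => F (cpt x c) - F (cpt x d) - l * (Ci * real_cplx (c - d))).
    by apply/funext => t; exact: E1.
  exact: ccont_onB (ccont_onB (Hx _ Ic) (Hx _ Id)) (kx _).
- by move=> x xab; apply: (le_trans (ler_cabsB _ _)); apply: lerD; exact: FM.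
- have -> : (fun y => e (cpt b y) - e (cpt a y)) =
    (fun y => F (cpt b y) - F (cpt a y) - l * real_cplx (b - a)).
    by apply/funext => t; exact: E2.
  exact: ccont_onB (ccont_onB (Hy _ Ib) (Hy _ Ia)) (ky _).
- by move=> x xab; apply: (le_trans (ler_cabsB _ _)); apply: lerD; exact: FM.
Qed.

Lemma nested_intervals (X L : nat -> R) :
  (forall n, X n <= X n.+1) -> (forall n, X n.+1 + L n.+1 <= X n + L n) ->
  (forall n, 0 <= L n) -> exists x, forall n, X n <= x <= X n + L n.
Proof.
move=> X1 X2 L0.
have Xm n k : X n <= X (n + k)%N.
  by elim: k => [|k IH]; rewrite ?addn0// addnS (le_trans IH).
have XLm n k : X (n + k)%N + L (n + k)%N <= X n + L n.
  by elim: k => [|k IH]; rewrite ?addn0// addnS (le_trans (X2 _)).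
have XL n m : X n <= X m + L m.
  apply: (le_trans (Xm n m)); rewrite addnC; apply: le_trans (XLm m n).
  by rewrite lerDl.
have hs : has_sup (range X).
  by split; [exists (X 0%N), 0%N|exists (X 0%N + L 0%N) => _ [n _ <-]].
exists (sup (range X)) => n; apply/andP; split.
  by apply: sup_upper_bound => //; exists n.
by apply: ge_sup; [exists (X 0%N), 0%N|move=> _ [m _ <-]].
Qed.

Lemma half_pow_small (A e : R) : 0 < e -> exists n, A / 2 ^+ n < e.
Proof.
move=> e0; exists (Num.bound `|A / e|).
rewrite ltr_pdivrMr ?exprn_gt0// mulrC -ltr_pdivrMr//.
apply: (le_lt_trans (ler_norm _)); apply: (lt_trans (archi_boundP (normr_ge0 _))).
by rewrite -natrX ltr_nat ltn_expl.
Qed.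

Lemma quarter_choice (z1 z2 z3 z4 : C) (k : R) : k <= cabs (z1 + z2 + (z3 + z4)) ->
  [\/ k / 4 <= cabs z1, k / 4 <= cabs z2, k / 4 <= cabs z3 | k / 4 <= cabs z4].
Proof.
move=> H; have : k <= cabs z1 + cabs z2 + (cabs z3 + cabs z4).
  apply: (le_trans H); apply: (le_trans (ler_cabsD _ _)).
  by apply: lerD; exact: ler_cabsD.
have [?|?] := leP (k / 4) (cabs z1); first by constructor 1.
have [?|?] := leP (k / 4) (cabs z2); first by constructor 2.
have [?|?] := leP (k / 4) (cabs z3); first by constructor 3.
have [?|?] := leP (k / 4) (cabs z4); first by constructor 4.
lra.
Qed.

(** Repeated bisection: some quarter always carries a fourth of the modulus of the integral, while
    near the common point of the nested rectangles the linear approximation makes the integral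
    smaller than any multiple of the squared size. Both scale like [4 ^- n]. *)
Lemma goursat F a b c d : a <= b -> c <= d ->
  (forall x y, a <= x <= b -> c <= y <= d -> exists l, cderiv F (cpt x y) l) ->
  rect_int F a b c d = 0.
Proof.
move=> ab cd dF.
have cF : cont_rect F a b c d.
  by move=> x y xab ycd; have [l] := dF _ _ xab ycd; exact: cderiv_continuous.
apply/eqP; rewrite -cabs_eq0; apply/negPn/negP => J0.
pose k := cabs (rect_int F a b c d).
have k0 : 0 < k by rewrite lt_neqAle eq_sym J0 cabs_ge0.
pose L n := (b - a) / 2 ^+ n; pose H n := (d - c) / 2 ^+ n.
have L0 n : 0 <= L n by rewrite divr_ge0 ?subr_ge0// exprn_ge0.
have H0 n : 0 <= H n by rewrite divr_ge0 ?subr_ge0// exprn_ge0.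
have LS n : L n = L n.+1 + L n.+1.
  by rewrite /L exprS invfM mulrCA; field; rewrite expf_neq0// pnatr_eq0.
have HS n : H n = H n.+1 + H n.+1.
  by rewrite /H exprS invfM mulrCA; field; rewrite expf_neq0// pnatr_eq0.
pose P n (p : R * R) := [/\ a <= p.1, p.1 + L n <= b, c <= p.2, p.2 + H n <= d &
  k / 4 ^+ n <= cabs (rect_int F p.1 (p.1 + L n) p.2 (p.2 + H n))].
pose Q n (p q : R * R) := [/\ P n.+1 q, p.1 <= q.1, q.1 + L n.+1 <= p.1 + L n,
  p.2 <= q.2 & q.2 + H n.+1 <= p.2 + H n].
(* The hypothesis stands under the existential so that a successor can be chosen for every pair [p],
   invariant or not. *)
have step n p : exists q, P n p -> Q n p q.
  have [[p1 p2 p3 p4 p5]|nP] := pselect (P n p); last by exists p.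
  set x := p.1 in p1 p2 p5 *; set y := p.2 in p3 p4 p5 *.
  have lS := LS n; have hS := HS n; have l0 := L0 n.+1; have h0 := H0 n.+1.
  have E : rect_int F x (x + L n) y (y + H n) =
    rect_int F x (x + L n.+1) y (y + H n.+1) +
    rect_int F x (x + L n.+1) (y + H n.+1) (y + H n) +
    (rect_int F (x + L n.+1) (x + L n) y (y + H n.+1) +
    rect_int F (x + L n.+1) (x + L n) (y + H n.+1) (y + H n)).
    have cF1 : cont_rect F x (x + L n) y (y + H n) by exact: cont_rect_sub cF.
    have [e1 e2 e3] : [/\ x <= x + L n.+1, x + L n.+1 <= x + L n & y <= y + H n] by split; lra.
    have [e4 e5] : y <= y + H n.+1 /\ y + H n.+1 <= y + H n by split; lra.
    rewrite (@rect_int_splitl _ x (x + L n.+1))//.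
    rewrite (@rect_int_splitr _ x _ _ (y + H n.+1))//; last exact: cont_rect_sub cF1.
    rewrite (@rect_int_splitr _ (x + L n.+1) _ _ (y + H n.+1))//.
    exact: cont_rect_sub cF1.
  have xx : x + L n = x + L n.+1 + L n.+1 by lra.
  have yy : y + H n = y + H n.+1 + H n.+1 by lra.
  move: p5; rewrite E => /quarter_choice.
  have -> : k / 4 ^+ n / 4 = k / 4 ^+ n.+1 by rewrite exprSr invfM mulrA.
  rewrite xx yy => -[] K; clear - K lS hS l0 h0 p1 p2 p3 p4.
  - by exists (x, y) => _; split; [split| | | |] => //=; lra.
  - by exists (x, y + H n.+1) => _; split; [split| | | |] => //=; lra.
  - by exists (x + L n.+1, y) => _; split; [split| | | |] => //=; lra.
  - by exists (x + L n.+1, y + H n.+1) => _; split; [split| | | |] => //=; lra.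
have /choice[s sP] : forall n, exists s : R * R -> R * R, forall p, P n p -> Q n p (s p).
  by move=> n; have [s sP] := choice (step n); exists s.
pose fix u n := if n is m.+1 then s m (u m) else (a, c).
have uP n : P n (u n).
  elim: n => [|n IH]; last by have [] := sP n _ IH.
  by rewrite /P /= /L /H expr0 !divr1 !(addrC _ (_ - _)) !subrK !lexx.
have uQ n : Q n (u n) (u n.+1) by exact: sP.
have [x xP] : exists x, forall n, (u n).1 <= x <= (u n).1 + L n.
  by apply: nested_intervals => // n; have [] := uQ n.
have [y yP] : exists y, forall n, (u n).2 <= y <= (u n).2 + H n.
  by apply: nested_intervals => // n; have [] := uQ n.
have xab : a <= x <= b.
  have [A B _ _ _] := uP 0%N; have /andP[A' B'] := xP 0%N.
  by rewrite (le_trans A A') (le_trans B' B).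
have ycd : c <= y <= d.
  have [_ _ A B _] := uP 0%N; have /andP[A' B'] := yP 0%N.
  by rewrite (le_trans A A') (le_trans B' B).
have [l /cderivP dl] := dF _ _ xab ycd.
pose S := (b - a) + (d - c).
have S0 : 0 <= S by rewrite /S; lra.
(* The local estimate will read [4 * eps * S ^+ 2 / 4 ^+ n] and must fall below [k / 4 ^+ n]; the
   summand 1 covers degenerate rectangles with [S = 0]. *)
pose eps := k / (8 * (S ^+ 2 + 1)).
have S1 : 0 < S ^+ 2 + 1 by rewrite ltr_wpDl// sqr_ge0.
have eps0 : 0 < eps by rewrite divr_gt0// mulr_gt0.
have [dl' dl0 Hdl] := dl _ eps0.
have [n nS] := half_pow_small S dl0.
have [A1 A2 A3 A4 A5] := uP n.
have SE : S / 2 ^+ n = L n + H n by rewrite /S /L /H mulrDl.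
have := A5; rewrite leNgt => /negP; apply.
have {A5} : cabs (rect_int F (u n).1 ((u n).1 + L n) (u n).2 ((u n).2 + H n)) <=
   4 * (eps * (L n + H n)) * (((u n).1 + L n - (u n).1) + ((u n).2 + H n - (u n).2)).
  apply: (@rect_int_small _ _ _ _ _ (cpt x y) l); rewrite ?lerDl//.
    exact: cont_rect_sub cF.
  move=> x' y' /andP[x1 x2] /andP[y1 y2].
  have /andP[xx1 xx2] := xP n; have /andP[yy1 yy2] := yP n.
  have dist : cabs (cpt x' y' - cpt x y) <= L n + H n.
    apply: (le_trans (cabs_le_ReIm _)); rewrite !ReIm /=.
    by apply: lerD; rewrite ler_norml; apply/andP; split; lra.
  apply: le_trans (Hdl _ _) _; first by rewrite -SE in dist; exact: le_lt_trans nS.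
  by apply: ler_wpM2l => //; exact: ltW.
have -> : (u n).1 + L n - (u n).1 + ((u n).2 + H n - (u n).2) = L n + H n by ring.
move=> /le_lt_trans; apply; rewrite -SE.
have -> : 4 * (eps * (S / 2 ^+ n)) * (S / 2 ^+ n) = 4 * eps * S ^+ 2 / 4 ^+ n.
  have -> : (4 : R) = 2 ^+ 2 by rewrite -natrX.
  by rewrite -exprM mulnC exprM; field; rewrite expf_neq0// pnatr_eq0.
rewrite ltr_pM2r ?invr_gt0 ?exprn_gt0//.
have -> : 4 * eps * S ^+ 2 = k * (S ^+ 2 / (2 * (S ^+ 2 + 1))).
  by rewrite /eps; field; rewrite gt_eqF.
rewrite gtr_pMr// ltr_pdivrMr ?mulr_gt0// mul1r.
have := sqr_ge0 S; lra.
Qed.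

End Goursat.

(** * Mean values over circles and the maximum principle *)

Section MaximumPrinciple.
Variable R : realType.
Local Notation C := (Cplx R).
Local Notation cRe := (@complex.Re R : C -> R).
Local Notation cIm := (@complex.Im R : C -> R).
Local Notation tau := (pi *+ 2 : R).
Implicit Types (F f : C -> C) (U : set C) (z w : C).

Definition circle z (r t : R) : C := z + real_cplx r * expi t.

Lemma Ci_neq0 : Ci != 0 :> C.
Proof. by rewrite -cabs_gt0 cabs_Ci ltr01. Qed.

Lemma expi_tau : expi tau = 1 :> C.
Proof. by apply: C_eqP; rewrite !ReIm ?cos2pi ?sin2pi. Qed.

Lemma tau_gt0 : 0 < tau. Proof. by rewrite pmulrn_lgt0// pi_gt0. Qed.

Lemma cvg_circle z (r t : R) : circle z r @ nbhs t --> circle z r t.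
Proof.
have h : expi s @[s --> t] --> expi t.
  by apply: (@cvgC_expi _ _ (nbhs t)); exact: cvg_id.
apply: (@cvgCD _ _ (nbhs t)); first exact: (@cvgC_cst _ _ (nbhs t)).
apply: (@cvgCM _ _ (nbhs t)); [exact: (@cvgC_cst _ _ (nbhs t))|exact: h].
Qed.

Lemma cabs_circle z (r t : R) : 0 <= r -> cabs (circle z r t - z) = r.
Proof.
move=> r0; rewrite /circle addrC addKr cabsM cabs_expi mulr1 cabs_real.
exact: ger0_norm.
Qed.

Lemma cvg_on_circle f z (r t : R) : {for circle z r t, continuous f} ->
  (fun s => f (circle z r s)) @ nbhs t --> f (circle z r t).
Proof.
move=> cf; exact: (@cvgC_comp _ _ (nbhs t) _ (circle z r) f _ (@cvg_circle z r t) cf).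
Qed.

Definition circle_mean f z (r : R) := cint (fun t => f (circle z r t)) 0 tau.

(** In the coordinate [u] with [w = z + cexp u] circles become vertical segments of length [2 pi],
    and the horizontal sides of a rectangle cancel by periodicity. So the mean does not depend on
    the radius, and continuity at [z] identifies it as the radius shrinks. Asking only for
    continuity at the centre is what admits the quotients of [ratio_bound]. *)
Lemma circle_mean_value f z (r : R) : 0 < r -> {for z, continuous f} ->
  (forall w, cabs (w - z) <= r -> w != z -> exists l, cderiv f w l) ->
  circle_mean f z r = f z * real_cplx tau.
Proof.
move=> r0 cz df.
pose F u := f (z + cexp u).
have dF x y : x <= ln r -> exists l, cderiv F (cpt x y) l.
  move=> xr; have [|//|l fl] := df (z + cexp (cpt x y)).
  - by rewrite addrC addKr cabs_cexp /= -[leRHS]lnK ?posrE// ler_expR.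
  - by rewrite -subr_eq0 addrC addKr cexp_neq0.
  exists (l * (0 + cexp (cpt x y))).
  have dz := cderivD (cderiv_cst z (cpt x y)) (cderiv_cexp (cpt x y)).
  exact: (@cderiv_comp _ (fun u => z + cexp u) f _ _ _ dz fl).
have t0 : 0 <= tau := ltW tau_gt0.
have KE x : x <= ln r -> cint (fun y => F (cpt x y)) 0 tau = cint (fun y => F (cpt (ln r) y)) 0 tau.
  move=> xr; have : rect_int F x (ln r) 0 tau = 0.
    by apply: goursat => // a b /andP[_ ?] _; exact: dF.
  rewrite /rect_int (_ : cint _ _ _ = 0) ?add0r; last first.
    rewrite (@eq_cint _ _ (fun=> 0)) ?cint_cst ?mul0r// => s _.
    rewrite /F /cexp /= (_ : expi 0 = expi tau); first by rewrite subrr.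
    by rewrite expi_tau expi0.
  move=> /eqP; rewrite mulf_eq0 (negbTE Ci_neq0) => /eqP.
  rewrite cintB; last 2 first.
  - apply: (@cont_rectr _ F x (ln r) 0 tau); last by rewrite xr lexx.
    by move=> a b /andP[_ br] _; have [l fl] := dF a b br; exact: cderiv_continuous fl.
  - apply: (@cont_rectr _ F x (ln r) 0 tau); last by rewrite xr lexx.
    by move=> a b /andP[_ br] _; have [l fl] := dF a b br; exact: cderiv_continuous fl.
  by move=> /eqP; rewrite subr_eq0 => /eqP ->.
have <- : cint (fun y => F (cpt (ln r) y)) 0 tau = circle_mean f z r.
  by apply: eq_cint => t _; rewrite /F /cexp /= lnK ?posrE.
apply/eqP; rewrite -subr_eq0 -cabs_eq0; apply/negPn/negP => n0.
set D := cabs _ in n0.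
have D0 : 0 < D by rewrite lt_neqAle eq_sym n0 cabs_ge0.
(* With this tolerance [cint_bound] yields [D <= D / 2]. *)
have e0 : 0 < D / (4 * tau) by rewrite divr_gt0// mulr_gt0// tau_gt0.
have /continuousCP/(_ _ e0)[d d0 Hd] := cz.
pose x := Num.min (ln r) (ln (d / 2)).
have xr : x <= ln r by rewrite ge_min lexx.
have ex : expR x < d.
  apply: (@le_lt_trans _ _ (d / 2)); last by lra.
  by rewrite -[leRHS]lnK ?posrE ?divr_gt0// ler_expR ge_min lexx orbT.
have cFx : ccont_on 0 tau (fun y => F (cpt x y)).
  apply: (@cont_rectr _ F x (ln r) 0 tau); last by rewrite xr lexx.
  by move=> a b /andP[_ br] _; have [l fl] := dF a b br; exact: cderiv_continuous fl.
have ck : ccont_on 0 tau (fun=> f z) by move=> ? _; exact: cvgC_cst.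
have : D <= 2 * (D / (4 * tau)) * (tau - 0).
  have DE : D = cabs (cint (fun y => F (cpt x y) - f z) 0 tau).
    by rewrite /D -(KE x xr) (cintB cFx ck) cint_cst// subr0.
  rewrite [leLHS]DE.
  apply: cint_bound; [exact: t0|exact: (ccont_onB cFx ck)|].
  move=> t _; apply: ltW; apply: Hd.
  by rewrite addrC addKr cabs_cexp /=.
have -> : 2 * (D / (4 * tau)) * (tau - 0) = D / 2.
  by rewrite subr0; have := tau_gt0; move: (tau) => T T0; field; rewrite gt_eqF.
lra.
Qed.

(** This property is all that the maximum principle uses; unlike holomorphy it survives at a point
    where [f] is only known to be continuous. *)
Definition mean_value_on U f := forall z, U z -> {for z, continuous f} /\
  exists2 r : R, 0 < r & (forall w, cabs (w - z) <= r -> U w) /\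
    forall r', 0 < r' <= r -> circle_mean f z r' = f z * real_cplx tau.

Lemma open_disc U z : open U -> U z -> exists2 r : R, 0 < r & forall w, cabs (w - z) <= r -> U w.
Proof.
move=> oU Uz; have /nbhsCP[e e0 He] : nbhs z U by exact: open_nbhs_nbhs.
exists (e / 2); first by rewrite divr_gt0.
by move=> w wz; apply: He; apply: (le_lt_trans wz); lra.
Qed.

Lemma mean_value_onP U f (a : C) : open U -> (U a -> {for a, continuous f}) ->
  (forall z, U z -> z != a -> exists l, cderiv f z l) -> mean_value_on U f.
Proof.
move=> oU ca df z Uz; have cz : {for z, continuous f}.
  have [za|za] := eqVneq z a; first by rewrite za; apply: ca; rewrite -za.
  by have [l] := df z Uz za; exact: cderiv_continuous.
split => //; have [r r0 Hr] := open_disc oU Uz.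
have [za|za] := eqVneq z a.
  exists r => //; split => // r' /andP[r'0 r'r]; apply: circle_mean_value => // w wz wn.
  by apply: df; [apply: Hr; exact: le_trans r'r|rewrite -za].
have d0 : 0 < cabs (a - z) by rewrite cabs_gt0 subr_eq0 eq_sym.
exists (Num.min r (cabs (a - z) / 2)); first by rewrite lt_min r0 divr_gt0.
split; first by move=> w; rewrite le_min => /andP[/Hr].
move=> r'; rewrite le_min => /andP[r'0 /andP[r'r r'a]]; apply: circle_mean_value => // w wz wn.
apply: df; first by apply: Hr; exact: le_trans r'r.
by apply/eqP => wa; move: wz; rewrite wa; lra.
Qed.

Lemma cabs2_Re z : cabs z ^+ 2 = cRe (cconj z * z).
Proof. by rewrite cabs2 !ReIm; ring. Qed.

(** The function [cRe (cconj (f z) * f w)] is bounded by [cabs (f z) ^+ 2] on the circle and has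
    exactly this mean, so the bound is attained at angle 0. *)
Lemma mean_value_max f z (r : R) : 0 < r ->
  (forall t, {for circle z r t, continuous f}) ->
  circle_mean f z r = f z * real_cplx tau ->
  (forall t, cabs (f (circle z r t)) <= cabs (f z)) ->
  cRe (cconj (f z) * f (z + real_cplx r)) = cabs (f z) ^+ 2.
Proof.
move=> r0 cf mf fz.
have cc : ccont_on 0 tau (fun t => f (circle z r t)).
  by move=> t _; exact: cvg_on_circle.
have <- : circle z r 0 = z + real_cplx r by rewrite /circle expi0 mulr1.
apply: (@rint_eq_max _ (fun t => cRe (cconj (f z) * f (circle z r t))) _ 0 tau).
- exact: tau_gt0.
- move=> t _; apply: cvgC_Re; apply: (@cvgCM _ _ (nbhs t)).
    exact: (@cvgC_cst _ _ (nbhs t)).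
  exact: cvg_on_circle.
- move=> t _; apply: (le_trans (ler_norm _)); apply: (le_trans (ler_Re_cabs _)).
  rewrite cabsM cabs_conj expr2; apply: ler_wpM2l => //; exact: cabs_ge0.
- rewrite -cint_mull// -/(circle_mean f z r) mf subr0 mulrA cabs2_Re.
  by rewrite !ReIm mulr0 subr0.
Qed.

(** The boundary condition is expressed by compact subsets of [U], which suits unbounded domains
    without a described boundary. If the bound failed, the maximum of [cabs f] would be attained on
    a compact set; by [mean_value_max] a point to the right of a maximum point is again one, which
    is impossible for the rightmost. Choosing the rightmost maximum replaces any connectedness
    argument. *)
Lemma maximum_principle U f (M : R) : 0 <= M -> mean_value_on U f ->
  (forall e : R, 0 < e -> exists K : set C, [/\ compact K, K `<=` U &
     forall z, U z -> ~ K z -> cabs (f z) <= M + e]) ->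
  forall z, U z -> cabs (f z) <= M.
Proof.
move=> M0 mU bd z1 Uz1; rewrite leNgt; apply/negP => Mf.
pose e := (cabs (f z1) - M) / 2; have e0 : 0 < e by rewrite /e; lra.
have [K [cK KU Kb]] := bd _ e0.
have K1 : K z1.
  by apply: contrapT => nK; have := Kb _ Uz1 nK; rewrite /e; lra.
have cabsf : {within K, continuous (fun z => cabs (f z))}.
  apply: continuous_in_subspaceT => z; rewrite inE => /KU /mU[cz _].
  exact: (@cvgC_abs _ _ (nbhs z) _ f (f z) cz).
have [p0] := @compact_EVT_max _ _ _ K (ex_intro _ z1 K1) cK cabsf.
rewrite inE => Kp0 p0max.
have fmax z : U z -> cabs (f z) <= cabs (f p0).
  move=> Uz; have [Kz|nKz] := pselect (K z); first by apply: p0max; rewrite inE.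
  have := p0max z1; rewrite inE => /(_ K1) m1.
  by apply: (le_trans (Kb _ Uz nKz)); move: m1; rewrite /e; lra.
have inK z : U z -> cabs (f z) = cabs (f p0) -> K z.
  move=> Uz E; apply: contrapT => nK; have := Kb _ Uz nK; rewrite E.
  have := p0max z1; rewrite inE => /(_ K1); rewrite /e; lra.
pose A := [set z | K z /\ cabs (f z) = cabs (f p0)].
have cA : compact A.
  have -> : A = K `&` [set z | K z -> cabs (f z) = cabs (f p0)].
    by apply/seteqP; split => z [] //= Kz E; split => //; exact: E.
  have [B BP] := compactC_bounded cK.
  apply: (@bounded_closed_compactC _ _ B); last by move=> z [/BP].
  move=> z clz; have Kz : K z.
    apply: (compactC_closed cK) => V nB; have [w [[Kw _] Bw]] := clz _ nB.
    by exists w.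
  split => // _; apply/eqP; rewrite -subr_eq0 -normr_eq0; apply/negPn/negP => n0.
  have n00 : 0 < `|cabs (f z) - cabs (f p0)| by rewrite lt_neqAle eq_sym n0/=.
  have [cz _] := mU z (KU _ Kz).
  have /continuousCP/(_ _ n00)[d d0 Hd] := cz.
  have nz : nbhs z [set w | cabs (w - z) < d] by apply/nbhsCP; exists d.
  have [w [[Kw Ew] wz]] := clz _ nz.
  have := Hd w wz; rewrite -(Ew Kw) ltNge => /negP; apply.
  by rewrite ler_norml lerNl opprB lerB_cabs cabsC lerB_cabs.
have [p] := @compact_EVT_max _ _ _ A (ex_intro _ p0 (conj Kp0 erefl)) cA
   (continuous_subspaceT (@continuous_Re R)).
rewrite inE => -[Kp Ep] pmax.
have [cp [r r0 [Ur mr]]] := mU p (KU _ Kp).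
have rr : 0 < r <= r by rewrite r0 lexx.
have Uc t : U (circle p r t) by apply: Ur; rewrite cabs_circle// ltW.
have E := mean_value_max r0 (fun t => (mU _ (Uc t)).1) (mr _ rr)
  (fun t => le_trans (fmax _ (Uc t)) (eq_ind_r (fun x => x <= _) (lexx _) (esym Ep))).
set q := p + real_cplx r in E.
have Uq : U q by apply: Ur; rewrite /q addrC addKr cabs_real ger0_norm// ltW.
have fp0 : 0 < cabs (f p).
  by rewrite Ep; apply: le_lt_trans M0 (lt_le_trans Mf (fmax _ Uz1)).
have fq : cabs (f q) = cabs (f p0).
  apply/eqP; rewrite eq_le fmax//= -Ep -(ler_pM2l fp0) -expr2 -E.
  by apply: (le_trans (ler_norm _)); apply: (le_trans (ler_Re_cabs _)); rewrite cabsM cabs_conj.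
have := pmax q; rewrite inE => /(_ (conj (inK _ Uq fq) fq)).
by rewrite /q !ReIm; lra.
Qed.

End MaximumPrinciple.

(** * Derivatives in the time variable *)

Section TimeDerivative.
Variable R : realType.
Local Notation C := (Cplx R).
Local Notation cRe := (@complex.Re R : C -> R).
Local Notation cIm := (@complex.Im R : C -> R).
Implicit Types (D : set R) (f g : R -> C) (u v : R -> R) (s t m k : R) (l : C).

(* Caratheodory's form of [has_deriv_within]. *)
Definition tderiv D f t l := exists q : R -> C,
  [/\ q @ within D (nbhs t) --> l, q t = l &
      forall s, D s -> f s - f t = real_cplx (s - t) * q s].

Lemma within_nbhsP D t (A : set R) :
  within D (nbhs t) A <-> exists2 e : R, 0 < e & forall s, `|s - t| < e -> D s -> A s.
Proof.
rewrite /within /=; split.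
- move=> /nbhs_ballP[e /= e0 H]; exists e => // s st; apply: H.
  by rewrite /ball /= distrC.
- by case=> e e0 H; apply/nbhs_ballP; exists e => //= s; rewrite /ball /= distrC; exact: H.
Qed.

Lemma tderivP D f t l : tderiv D f t l <-> has_deriv_within D f t l.
Proof.
split.
- case=> q [/cvgCP cq qt fq]; apply/cvgCP => e /cq.
  move=> /within_nbhsP[d d0 H].
  rewrite nearE /within /= /dnbhs /within /=; apply/nbhs_ballP; exists d => //= s.
  rewrite /ball /= distrC => st st0 Ds; rewrite fq// mulrA -rcM mulVf ?subr_eq0// mul1r.
  exact: H.
- move=> H; exists (fun s => if s == t then l else real_cplx (s - t)^-1 * (f s - f t)).
  rewrite eqxx; split=> //.
    apply/cvgCP => e e0.
    have /cvgCP/(_ _ e0) := H.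
    rewrite nearE /within /= /dnbhs /within /= => /nbhs_ballP[d /= d0 Hd].
    apply/within_nbhsP; exists d => // s st Ds.
    case: (boolP (s == t)) => [_|sn]; first by rewrite subrr cabs0.
    by apply: Hd => //; rewrite /ball /= distrC.
  move=> s _; have [/eqP ->|sn] := boolP (s == t); first by rewrite !subrr mul0r.
  by rewrite mulrA -rcM mulfV ?subr_eq0// mul1r.
Qed.

Lemma tderiv_cont D f t l : tderiv D f t l -> f @ within D (nbhs t) --> f t.
Proof.
case=> q [cq _ fq].
have h : (fun s => f t + real_cplx (s - t) * q s) @ within D (nbhs t) --> f t + 0 * l.
  apply: (@cvgCD _ _ (within D (nbhs t))); first exact: (@cvgC_cst _ _ (within D (nbhs t))).
  apply: (@cvgCM _ _ (within D (nbhs t))); last exact: cq.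
  rewrite -[0]/(real_cplx 0 : C); apply: (@cvgC_real _ _ (within D (nbhs t))).
  rewrite -(subrr t); apply: (@cvgB _ _ _ (within D (nbhs t))); last exact: cvg_cst.
  by apply: cvg_within_filter; exact: cvg_id.
rewrite mul0r addr0 in h; apply: cvg_trans h; apply: near_eq_cvg.
by apply/within_nbhsP; exists 1 => // s _ Ds; rewrite -fq// addrC subrK.
Qed.

Lemma tderiv_sub D D' f t l : D' `<=` D -> tderiv D f t l -> tderiv D' f t l.
Proof.
move=> DD [q [cq qt fq]]; exists q; split=> //; last by move=> s /DD; exact: fq.
apply: cvg_trans cq => A /within_nbhsP[e e0 H]; apply/within_nbhsP.
by exists e => // s se /DD; exact: H.
Qed.

Lemma tderiv_eq D f g t l : D t -> (forall s, D s -> f s = g s) -> tderiv D f t l -> tderiv D g t l.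
Proof. by move=> Dt fg [q [cq qt fq]]; exists q; split=> // s Ds; rewrite -!fg//; exact: fq. Qed.

Lemma tderiv_eqd D f t l l' : l = l' -> tderiv D f t l -> tderiv D f t l'.
Proof. by move=> ->. Qed.

Lemma tderiv_cst D l t : tderiv D (fun=> l) t 0.
Proof.
exists (fun=> 0); split=> //; last by move=> s _; rewrite subrr mulr0.
exact: (@cvgC_cst _ _ (within D (nbhs t))).
Qed.

Lemma tderiv_id D t : tderiv D (@real_cplx R) t 1.
Proof.
exists (fun=> 1); split=> //; last by move=> s _; rewrite mulr1 rcB.
exact: (@cvgC_cst _ _ (within D (nbhs t))).
Qed.

Lemma tderivD D f g t l l' : tderiv D f t l -> tderiv D g t l' ->
  tderiv D (fun s => f s + g s) t (l + l').
Proof.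
move=> [p [cp pt fp]] [q [cq qt gq]]; exists (fun s => p s + q s); split.
- exact: (@cvgCD _ _ (within D (nbhs t)) _ _ _ _ _ cp cq).
- by rewrite pt qt.
- by move=> s Ds; rewrite mulrDr -fp// -gq//; ring.
Qed.

Lemma tderivN D f t l : tderiv D f t l -> tderiv D (fun s => - f s) t (- l).
Proof.
move=> [p [cp pt fp]]; exists (fun s => - p s); split.
- exact: (@cvgCN _ _ (within D (nbhs t)) _ _ _ cp).
- by rewrite pt.
- by move=> s Ds; rewrite mulrN -fp//; ring.
Qed.

Lemma tderivB D f g t l l' : tderiv D f t l -> tderiv D g t l' ->
  tderiv D (fun s => f s - g s) t (l - l').
Proof. by move=> fl gl; exact: tderivD fl (tderivN gl). Qed.

Lemma tderivM D f g t l l' : tderiv D f t l -> tderiv D g t l' ->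
  tderiv D (fun s => f s * g s) t (l * g t + f t * l').
Proof.
move=> fl gl; have cg := tderiv_cont gl.
move: fl gl => [p [cp pt fp]] [q [cq qt gq]]; exists (fun s => p s * g s + f t * q s); split.
- apply: (@cvgCD _ _ (within D (nbhs t))).
    exact: (@cvgCM _ _ (within D (nbhs t)) _ _ _ _ _ cp cg).
  apply: (@cvgCM _ _ (within D (nbhs t))); last exact: cq.
  exact: (@cvgC_cst _ _ (within D (nbhs t))).
- by rewrite pt qt.
- move=> s Ds; have -> : f s * g s - f t * g t = (f s - f t) * g s + f t * (g s - g t) by ring.
  by rewrite fp// gq//; ring.
Qed.

Lemma tderiv_comp D f (h : C -> C) t l (k : C) : cderiv h (f t) k -> tderiv D f t l ->
  tderiv D (fun s => h (f s)) t (k * l).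
Proof.
move=> [q [cq qt hq]] fl; have cf := tderiv_cont fl.
case: fl => p [cp pt fp]; exists (fun s => q (f s) * p s); split.
- apply: (@cvgCM _ _ (within D (nbhs t))); last exact: cp.
  rewrite -qt; exact: (cvg_comp _ _ cf cq).
- by rewrite pt qt.
- by move=> s Ds; rewrite hq fp//; ring.
Qed.

Lemma tderivV D f t l : f t != 0 -> tderiv D f t l ->
  tderiv D (fun s => (f s)^-1) t (- l / f t ^+ 2).
Proof.
move=> f0 fl; have := tderiv_comp (cderivV f0 (cderiv_id (f t))) fl.
by apply: tderiv_eqd; ring.
Qed.

Lemma tderiv_div D f g t l l' : g t != 0 -> tderiv D f t l -> tderiv D g t l' ->
  tderiv D (fun s => f s / g s) t ((l * g t - f t * l') / g t ^+ 2).
Proof.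
move=> g0 fl gl; have := tderivM fl (tderivV g0 gl).
by apply: tderiv_eqd; field.
Qed.

Lemma tderiv_conj D f t l : tderiv D f t l -> tderiv D (fun s => cconj (f s)) t (cconj l).
Proof.
case=> p [cp pt fp]; exists (fun s => cconj (p s)); split.
- exact: (@cvgC_conj _ _ (within D (nbhs t)) _ _ _ cp).
- by rewrite pt.
- by move=> s Ds; rewrite -conjN -conjD fp// conjM conj_real.
Qed.

(** Coded through [real_cplx] so that the calculus of [tderiv] serves real and complex functions
    alike. *)
Definition rderiv D u t m := tderiv D (fun s => real_cplx (u s)) t (real_cplx m).

Lemma rderiv_Re D f t l : tderiv D f t l -> rderiv D (fun s => cRe (f s)) t (cRe l).
Proof.
case=> p [cp pt fp]; exists (fun s => real_cplx (cRe (p s))); split.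
- apply: (@cvgC_real _ _ (within D (nbhs t))).
  exact: (@cvgC_Re _ _ (within D (nbhs t)) _ _ _ cp).
- by rewrite pt.
- by move=> s Ds; rewrite -rcB -cReN -cReD fp// cReM cRe_real cIm_real mul0r subr0 rcM.
Qed.

Lemma rderiv_Im D f t l : tderiv D f t l -> rderiv D (fun s => cIm (f s)) t (cIm l).
Proof.
case=> p [cp pt fp]; exists (fun s => real_cplx (cIm (p s))); split.
- apply: (@cvgC_real _ _ (within D (nbhs t))).
  exact: (@cvgC_Im _ _ (within D (nbhs t)) _ _ _ cp).
- by rewrite pt.
- by move=> s Ds; rewrite -rcB -cImN -cImD fp// cImM cRe_real cIm_real mul0r addr0 rcM.
Qed.

Lemma rderivP D u t m : rderiv D u t m <-> exists q : R -> R,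
  [/\ q @ within D (nbhs t) --> m, q t = m & forall s, D s -> u s - u t = (s - t) * q s].
Proof.
split.
- case=> p [cp pt up]; exists (fun s => cRe (p s)); split.
  + exact: (@cvgC_Re _ _ (within D (nbhs t)) _ _ _ cp).
  + by rewrite pt.
  + move=> s Ds; have := up s Ds; rewrite -rcB => /(congr1 cRe).
    by rewrite cReM !cRe_real cIm_real mul0r subr0.
- case=> q [cq qt uq]; exists (fun s => real_cplx (q s)); split.
  + exact: (@cvgC_real _ _ (within D (nbhs t)) _ _ _ cq).
  + by rewrite qt.
  + by move=> s Ds; rewrite -rcB uq// rcM.
Qed.

Lemma rderiv_cont D u t m : rderiv D u t m -> u @ within D (nbhs t) --> u t.
Proof. by move=> /tderiv_cont h; exact: (@cvgC_Re _ _ (within D (nbhs t)) _ _ _ h). Qed.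

Lemma rderiv_eqd D u t m k : m = k -> rderiv D u t m -> rderiv D u t k.
Proof. by move=> ->. Qed.

Lemma rderiv_cst D m t : rderiv D (fun=> m) t 0.
Proof. exact: tderiv_cst. Qed.

Lemma rderiv_id D t : rderiv D id t 1.
Proof. exact: tderiv_id. Qed.

Lemma rderivD D u v t m k : rderiv D u t m -> rderiv D v t k ->
  rderiv D (fun s => u s + v s) t (m + k).
Proof.
move=> um vk; have := rderiv_Re (tderivD um vk).
by rewrite cReD !cRe_real.
Qed.

Lemma rderivN D u t m : rderiv D u t m -> rderiv D (fun s => - u s) t (- m).
Proof. by move=> um; have := rderiv_Re (tderivN um); rewrite cReN !cRe_real. Qed.

Lemma rderivB D u v t m k : rderiv D u t m -> rderiv D v t k ->
  rderiv D (fun s => u s - v s) t (m - k).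
Proof. by move=> um vk; exact: rderivD um (rderivN vk). Qed.

Lemma rderivM D u v t m k : rderiv D u t m -> rderiv D v t k ->
  rderiv D (fun s => u s * v s) t (m * v t + u t * k).
Proof.
move=> um vk; have := rderiv_Re (tderivM um vk).
rewrite -!rcM -rcD cRe_real; congr (rderiv D _ t _).
by apply/funext => s; rewrite -rcM.
Qed.

Lemma rderivZ D u t m k : rderiv D u t m -> rderiv D (fun s => k * u s) t (k * m).
Proof.
by move=> um; have := rderivM (rderiv_cst D k t) um; rewrite mul0r add0r.
Qed.

Lemma is_derive_quot (h : R -> R) (x k : R) : is_derive x 1 h k -> exists q : R -> R,
  [/\ {for x, continuous q}, q x = k & forall y, h y - h x = q y * (y - x)].
Proof.
move=> hk; exists (fun y => if y == x then k else (h y - h x) / (y - x)).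
rewrite eqxx; split=> //; last first.
  move=> y; case: eqVneq => [->|yx]; first by rewrite !subrr mulr0.
  by rewrite divfK// subr_eq0.
apply/cvgrPdist_lt => e e0; have [d d0 Hd] := is_derive_small hk (div2_gt0 e0).
apply/nbhs_ballP; exists d => //= y; rewrite /ball /= distrC eqxx => yd.
case: (boolP (y == x)) => [_|yx]; first by rewrite subrr normr0.
have yx0 : y - x != 0 by rewrite subr_eq0.
have := Hd _ yd; rewrite subrK => H.
have -> : k - (h y - h x) / (y - x) = - ((h y - h x - k * (y - x)) / (y - x)) by field.
rewrite normrN normrM normfV ltr_pdivrMr ?normr_gt0//; apply: (le_lt_trans H).
by rewrite ltr_pM2r ?normr_gt0//; lra.
Qed.

Lemma rderiv_comp D u (h : R -> R) t m k : is_derive (u t) 1 h k -> rderiv D u t m ->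
  rderiv D (fun s => h (u s)) t (k * m).
Proof.
move=> hk um; have cu := rderiv_cont um.
have [q [cq qx hq]] := is_derive_quot hk.
move/rderivP: um => [p [cp pt up]]; apply/rderivP.
exists (fun s => q (u s) * p s); split.
- by rewrite -qx; apply: cvgM => //; exact: (cvg_comp _ _ cu cq).
- by rewrite pt qx.
- by move=> s Ds; rewrite hq up//; ring.
Qed.

Lemma tderiv_time D D' f (r : R -> R) t l m : (forall s, D' s -> D (r s)) ->
  rderiv D' r t m -> tderiv D f (r t) l -> tderiv D' (fun s => f (r s)) t (l * real_cplx m).
Proof.
move=> DD rm [q [cq qt fq]]; have cr := rderiv_cont rm.
move/rderivP: rm => [p [cp pt rp]].
exists (fun s => q (r s) * real_cplx (p s)); split.
- apply: (@cvgCM _ _ (within D' (nbhs t))).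
    apply: cvg_comp cq => A /within_nbhsP[e e0 H].
    move/cvgrPdist_lt: cr => /(_ _ e0) /within_nbhsP[d d0 Hd].
    by apply/within_nbhsP; exists d => // s sd Ds; apply: H; [rewrite distrC; exact: Hd|exact: DD].
  exact: (@cvgC_real _ _ (within D' (nbhs t)) _ _ _ cp).
- by rewrite pt qt.
- by move=> s Ds; rewrite fq ?rp ?rcM//; [ring|exact: DD].
Qed.

Lemma rderiv_time D D' u (r : R -> R) t k m : (forall s, D' s -> D (r s)) ->
  rderiv D' r t m -> rderiv D u (r t) k -> rderiv D' (fun s => u (r s)) t (k * m).
Proof.
move=> DD rm uk; have := rderiv_Re (tderiv_time DD rm uk).
by rewrite -rcM cRe_real.
Qed.

Lemma rderiv_interior D u t m e : 0 < e -> (forall s, `|s - t| < e -> D s) ->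
  rderiv D u t m -> is_derive t 1 u m.
Proof.
move=> e0 De /rderivP[q [cq qt uq]].
suff h : h^-1 *: (u (h *: 1 + t) - u t) @[h --> 0^'] --> m.
  by apply: DeriveDef; [apply/cvg_ex; exists m|exact/cvg_lim].
apply/cvgrPdist_lt => d d0; move/cvgrPdist_lt: cq => /(_ _ d0) /within_nbhsP[r r0 Hr].
apply/nbhs_ballP; exists (Num.min e r); first by rewrite /= lt_min e0.
move=> h; rewrite /ball /= sub0r normrN lt_min => /andP[he hr] h0.
rewrite -[h *: 1]/(h * 1) mulr1 -[h^-1 *: _]/(h^-1 * _).
have Dh : D (h + t) by apply: De; rewrite addrK.
by rewrite uq// addrK mulKf//; apply: Hr => //; rewrite addrK.
Qed.

Lemma is_derive_rderiv D u t m : is_derive t 1 u m -> rderiv D u t m.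
Proof.
move=> /is_derive_quot[q [cq qt uq]]; apply/rderivP; exists q; split=> //.
  by rewrite -qt; apply: cvg_within_filter; exact: cq.
by move=> s _; rewrite uq mulrC.
Qed.

Lemma rderiv_within_cont D u (u' : R -> R) (a b : R) : (forall s, a <= s <= b -> D s) ->
  (forall s, a <= s <= b -> rderiv D u s (u' s)) -> {within `[a, b], continuous u}.
Proof.
move=> Dab du; apply/subspace_continuousP => x /=; rewrite in_itv /= => xab.
have := rderiv_cont (du _ xab); apply: cvg_trans => A /within_nbhsP[e e0 H].
by apply/within_nbhsP; exists e => // s se; rewrite /= in_itv /= => /Dab; exact: H.
Qed.

Lemma rderiv_le D u (u' : R -> R) (a b : R) : a <= b -> (forall s, a <= s <= b -> D s) ->
  (forall s, a <= s <= b -> rderiv D u s (u' s)) ->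
  (forall s, a <= s <= b -> 0 <= u' s) -> u a <= u b.
Proof.
move=> ab Dab du u0.
have [x|c cab E] := @MVT_segment R u u' a b ab _ (rderiv_within_cont Dab du).
  rewrite in_itv /= => /andP[ax xb].
  apply: (@rderiv_interior D _ _ _ (Num.min (x - a) (b - x))).
  - by rewrite lt_min !subr_gt0 ax.
  - move=> s; rewrite lt_min !ltr_norml => /andP[/andP[s1 s2] /andP[s3 s4]].
    by apply: Dab; apply/andP; split; lra.
  - by apply: du; rewrite !ltW.
rewrite -subr_ge0 E mulr_ge0 ?subr_ge0//; apply: u0; by rewrite in_itv /= in cab.
Qed.

Lemma rderiv_ge D u (u' : R -> R) (a b : R) : a <= b -> (forall s, a <= s <= b -> D s) ->
  (forall s, a <= s <= b -> rderiv D u s (u' s)) ->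
  (forall s, a <= s <= b -> u' s <= 0) -> u b <= u a.
Proof.
move=> ab Dab du u0; rewrite -lerN2.
apply: (@rderiv_le D (fun s => - u s) (fun s => - u' s)) => // s sab.
  exact: rderivN (du _ sab).
by rewrite oppr_ge0; exact: u0.
Qed.

(* Projecting on the direction of the increment reduces to the real case. *)
Lemma tderiv_bound D f (f' : R -> C) u (u' : R -> R) (a b : R) : a <= b ->
  (forall s, a <= s <= b -> D s) ->
  (forall s, a <= s <= b -> tderiv D f s (f' s)) ->
  (forall s, a <= s <= b -> rderiv D u s (u' s)) ->
  (forall s, a <= s <= b -> cabs (f' s) <= u' s) -> cabs (f b - f a) <= u b - u a.
Proof.
move=> ab Dab df du fu.
have u0 : 0 <= u b - u a.
  rewrite subr_ge0; apply: (@rderiv_le D u u') => // s sab.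
  by apply: le_trans (fu _ sab); exact: cabs_ge0.
have [->|d0] := eqVneq (f b - f a) 0; first by rewrite cabs0.
pose k := cconj (f b - f a).
have k0 : 0 < cabs (f b - f a) by rewrite cabs_gt0.
have : cabs (f b - f a) * u a - cRe (k * f a) <= cabs (f b - f a) * u b - cRe (k * f b).
  apply: (@rderiv_le D (fun s => cabs (f b - f a) * u s - cRe (k * f s))
     (fun s => cabs (f b - f a) * u' s - cRe (k * f' s))) => // s sab.
    apply: rderivB; first exact: rderivZ (du _ sab).
    have := rderiv_Re (tderivM (tderiv_cst D k s) (df _ sab)).
    by rewrite mul0r add0r.
  rewrite subr_ge0; apply: (le_trans (ler_norm _)); apply: (le_trans (ler_Re_cabs _)).
  by rewrite cabsM cabs_conj; apply: ler_wpM2l; [exact: ltW|exact: fu].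
have E : cRe (k * f b) - cRe (k * f a) = cabs (f b - f a) ^+ 2.
  by rewrite cabs2 -cReN -cReD -mulrBr /k !ReIm; ring.
move=> H; rewrite -(ler_pM2l k0) -expr2 -E; move: H; lra.
Qed.

Lemma tderiv0_const D f (a b : R) : a <= b -> (forall s, a <= s <= b -> D s) ->
  (forall s, a <= s <= b -> tderiv D f s 0) -> f b = f a.
Proof.
move=> ab Dab df; apply/eqP; rewrite -subr_eq0 -cabs_eq0 eq_le cabs_ge0 andbT.
have := @tderiv_bound D f (fun=> 0) (fun=> 0) (fun=> 0) a b ab Dab df.
rewrite subrr; apply => s _; [exact: rderiv_cst|by rewrite cabs0].
Qed.

Lemma locally_const_const f (a b : R) : a <= b ->
  (forall t, a <= t <= b -> exists2 e : R, 0 < e &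
     forall s, a <= s <= b -> `|s - t| < e -> f s = f t) -> f b = f a.
Proof.
move=> ab lf; apply: (@tderiv0_const [set s | a <= s <= b] f) => // t tab.
have [e e0 He] := lf _ tab.
exists (fun s => if `|s - t| < e then 0 else real_cplx (s - t)^-1 * (f s - f t)).
rewrite subrr normr0 e0; split=> //.
  apply/cvgCP => d d0; apply/within_nbhsP; exists e => // s se sab.
  by rewrite se subrr cabs0.
move=> s sab; case: ifP => se; first by rewrite mulr0 He// subrr.
rewrite mulrA -rcM mulfV ?mul1r//; apply/eqP => st; move: se.
by rewrite st normr0 e0.
Qed.

End TimeDerivative.

(** * Conformal maps and mapping-out functions *)

Section ConformalMaps.
Variable R : realType.
Local Notation C := (Cplx R).
Local Notation cRe := (@complex.Re R : C -> R).
Local Notation cIm := (@complex.Im R : C -> R).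
Implicit Types (f g h : C -> C) (A B K U : set C) (a c z w l k Z : C).

Definition holo U f := forall z, U z -> exists l, cderiv f z l.

Lemma conformalP A B f : conformal A B f <-> holo A f /\ set_bij A B f.
Proof.
split=> -[df bf]; split=> // z Az; first by apply/derivable_cderiv; exact: df.
by apply/derivable_cderiv; exact: df.
Qed.

Lemma set_bijP_C A B f : set_bij A B f <->
  [/\ forall z, A z -> B (f z), forall z w, A z -> A w -> f z = f w -> z = w
    & forall w, B w -> exists2 z, A z & f z = w].
Proof.
split=> [[fAB fi fs]|[fAB fi fs]]; split.
- by move=> z Az; exact: fAB.
- by move=> z w Az Aw; apply: fi; rewrite inE.
- by move=> w /fs[z Az <-]; exists z.
- by move=> z Az; exact: fAB.
- by move=> z w; rewrite !inE; exact: fi.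
- by move=> w /fs[z Az <-]; exists z.
Qed.

Lemma holo_comp A B f g : holo A f -> (forall z, A z -> B (f z)) -> holo B g ->
  holo A (fun z => g (f z)).
Proof.
move=> hf fAB hg z Az; have [l fl] := hf _ Az; have [k gk] := hg _ (fAB _ Az).
by exists (k * l); exact: cderiv_comp fl gk.
Qed.

Lemma conformal_comp A B D f g : conformal A B f -> conformal B D g ->
  conformal A D (fun z => g (f z)).
Proof.
move=> /conformalP[hf /set_bijP_C[f1 f2 f3]] /conformalP[hg /set_bijP_C[g1 g2 g3]].
apply/conformalP; split; first exact: holo_comp hf f1 hg.
apply/set_bijP_C; split.
- by move=> z /f1 /g1.
- by move=> z w Az Aw E; apply: f2 => //; apply: g2 => //; exact: f1.
- by move=> w /g3[y /f3[z Az <-] <-]; exists z.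
Qed.

Lemma openCP A : open A <-> forall z, A z -> exists2 e : R, 0 < e &
  forall w, cabs (w - z) < e -> A w.
Proof.
split=> [oA z Az|H]; first by apply/nbhsCP; exact: open_nbhs_nbhs.
by rewrite openE => z /H ?; apply/nbhsCP.
Qed.

Lemma diskE z : disk z <-> cabs z < 1.
Proof. by rewrite /disk /= normC_cabs -rc1 rc_lt. Qed.

Lemma closed_diskE z : closed_disk z <-> cabs z <= 1.
Proof. by rewrite /closed_disk /= normC_cabs -rc1 rc_le. Qed.

Lemma open_disk : open (@disk R).
Proof.
apply/openCP => z /diskE z1; exists (1 - cabs z); first by rewrite subr_gt0.
move=> w wz; apply/diskE; rewrite -(subrK z w).
by apply: (le_lt_trans (ler_cabsD _ _)); lra.
Qed.

Lemma open_upper : open (@upper R).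
Proof.
apply/openCP => z z1; exists (cIm z) => // w wz.
have := le_lt_trans (ler_Im_cabs _) wz; rewrite /upper /= in z1 *.
by rewrite !ReIm ltr_norml => /andP[]; lra.
Qed.

Lemma openD_compact A K : open A -> compact K -> open (A `\` K).
Proof.
by move=> oA cK; apply: openI => //; apply: closed_openC; exact: compactC_closed.
Qed.

Lemma compact_sublevel B (u : C -> R) (m : R) : compact B ->
  (forall z, B z -> {for z, continuous u}) -> compact [set z | B z /\ u z <= m].
Proof.
move=> cB cu; have [M MP] := compactC_bounded cB.
apply: (@bounded_closed_compactC _ _ M); last by move=> z [/MP].
move=> z clz; have Bz : B z.
  by apply: (compactC_closed cB) => V nV; have [w [[Bw _] Vw]] := clz _ nV; exists w.
split=> //; rewrite leNgt; apply/negP => mu.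
have nz : nbhs z [set w | m < u w].
  have cz : u @ nbhs z --> u z := cu _ Bz.
  have uz : 0 < u z - m by rewrite subr_gt0.
  move/cvgrPdist_lt: cz => /(_ _ uz); apply: filterS => w /=.
  by rewrite ltr_norml => /andP[_]; lra.
by have [w [[_ wm] /= mw]] := clz _ nz; move: wm; rewrite leNgt mw.
Qed.

Lemma cont_cabsB f z c : {for z, continuous f} -> {for z, continuous (fun w => cabs (f w - c))}.
Proof.
move=> cf; have h : {for z, continuous (fun w => f w - c)} := contB cf (cont_cst c z).
exact: (@cvgC_abs _ _ (nbhs z) _ (fun w => f w - c) (f z - c) h).
Qed.

Arguments cont_cabsB {f z} c _.

Lemma compact_closed_disc z (r : R) : compact [set w | cabs (w - z) <= r].
Proof.
have cB : compact [set w | cabs w <= cabs z + r].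
  apply: (@bounded_closed_compactC _ _ (cabs z + r)) => //.
  apply: (@preimage_closed _ _ cabs [set x : R | x <= cabs z + r]); last exact: closed_le.
  by move=> w _; exact: continuous_cabs.
rewrite (_ : [set _ | _] = [set w | [set w | cabs w <= cabs z + r] w /\ cabs (w - z) <= r]).
  by apply: compact_sublevel => // w _; exact: (@cont_cabsB (fun w => w) w z (cont_id w)).
apply/seteqP; split=> w /=; last by case.
move=> wz; split=> //; rewrite -(subrK z w) addrC.
by apply: (le_trans (ler_cabsD _ _)); rewrite lerD2l.
Qed.

(** If [f] omitted [c] on the disc, the maximum principle would apply to the inverse of [f - c].
    Injectivity keeps [f] away from [f z0] on the circle, by some [m] by compactness; for [c] within
    [m / 2] of [f z0] the inverse would then be larger at the centre than on the circle. *)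
Lemma inj_open_mapping U f z0 (r : R) : open U -> holo U f ->
  (forall z w, U z -> U w -> f z = f w -> z = w) -> U z0 -> 0 < r ->
  exists2 d : R, 0 < d & forall c, cabs (c - f z0) < d ->
    exists z, [/\ U z, cabs (z - z0) < r & f z = c].
Proof.
move=> oU hf fi Uz0 r0.
have [r1 r10 Ur1] := open_disc oU Uz0.
pose r' := Num.min r1 r.
have r'0 : 0 < r' by rewrite lt_min r10.
have [r'r1 r'r] : r' <= r1 /\ r' <= r by split; rewrite ge_min lexx ?orbT.
have Ur' w : cabs (w - z0) <= r' -> U w by move=> H; apply: Ur1; exact: le_trans r'r1.
have cf z : U z -> {for z, continuous f} by move=> /hf[l]; exact: cderiv_continuous.
pose S := [set w | [set w | cabs (w - z0) <= r'] w /\ - cabs (w - z0) <= - r'].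
have cS : compact S.
  apply: compact_sublevel; first exact: compact_closed_disc.
  move=> z _; have h : {for z, continuous (fun w => cabs (w - z0))} := cont_cabsB z0 (cont_id z).
  exact: (@cvgN _ _ _ (nbhs z) _ _ _ h).
have SE w : S w -> cabs (w - z0) = r'.
  by move=> [/= H1]; rewrite lerN2 => H2; apply/eqP; rewrite eq_le H1.
have S0 : S !=set0.
  exists (z0 + real_cplx r'); rewrite /S /= addrC addKr cabs_real.
  by rewrite ger0_norm ?lexx// ltW.
have cu : {within S, continuous (fun z => - cabs (f z - f z0))}.
  apply: continuous_in_subspaceT => z; rewrite inE => /SE Sz.
  have Uz : U z by apply: Ur'; rewrite Sz.
  have h : {for z, continuous (fun w => cabs (f w - f z0))} := cont_cabsB (f z0) (cf _ Uz).
  exact: (@cvgN _ _ _ (nbhs z) _ _ _ h).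
have [p] := compact_EVT_max S0 cS cu; rewrite inE => Sp pmax.
pose m := cabs (f p - f z0).
have m0 : 0 < m.
  rewrite cabs_gt0 subr_eq0; apply/eqP => E.
  have pz : p = z0 by apply: fi => //; apply: Ur'; rewrite SE.
  by have := SE _ Sp; rewrite pz subrr cabs0 => r'E; rewrite -r'E ltxx in r'0.
have mmin w : S w -> m <= cabs (f w - f z0).
  by move=> Sw; rewrite -lerN2; apply: pmax; rewrite inE.
pose d := m / 2; have d0 : 0 < d by rewrite divr_gt0.
exists d => // c cd; apply: contrapT => nz.
pose V := [set w | cabs (w - z0) < r'].
have VU w : V w -> U w by move=> /ltW; exact: Ur'.
have nc w : V w -> f w - c != 0.
  move=> Vw; apply/eqP => /eqP; rewrite subr_eq0 => /eqP fwc; apply: nz; exists w; split=> //.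
    exact: VU.
  exact: lt_le_trans r'r.
have oV : open V.
  apply/openCP => z zV; exists (r' - cabs (z - z0)); first by rewrite subr_gt0.
  move=> w wz; rewrite /V /=; have -> : w - z0 = (w - z) + (z - z0) by rewrite addrA subrK.
  by apply: (le_lt_trans (ler_cabsD _ _)); rewrite -ltrBrDr.
have hV z : V z -> exists l, cderiv (fun w => (f w - c)^-1) z l.
  move=> Vz; have [l fl] := hf _ (VU _ Vz); exists (- (l - 0) / (f z - c) ^+ 2).
  exact: (@cderivV _ (fun w => f w - c) z _ (nc _ Vz) (cderivB fl (cderiv_cst c z))).
have mv : mean_value_on V (fun w => (f w - c)^-1).
  apply: (@mean_value_onP _ V _ z0) => //; last by move=> z Vz _; exact: hV.
  by move=> /hV[l]; exact: cderiv_continuous.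
have Vz0 : V z0 by rewrite /V /= subrr cabs0.
have B0 : 0 <= d^-1 by rewrite invr_ge0 ltW.
have := @maximum_principle _ V _ d^-1 B0 mv _ z0 Vz0.
rewrite cabsV lef_pV2 ?posrE ?cabs_gt0 ?nc//.
move=> H; have {H} : d <= cabs (f z0 - c).
  (* On the circle [cabs (f w - c)] exceeds [d], hence [d'], so this sublevel set stays inside the
     open disc [V] and is a legitimate compact subset of it. *)
  apply: H => e e0; pose d' := (d^-1 + e)^-1.
  have d'0 : 0 < d' by rewrite invr_gt0 addr_gt0 ?invr_gt0.
  have d'd : d' < d.
    by rewrite -[ltRHS]invrK ltf_pV2 ?posrE ?invr_gt0// ?addr_gt0 ?invr_gt0// ltrDl.
  exists [set w | [set w | cabs (w - z0) <= r'] w /\ cabs (f w - c) <= d']; split.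
  - apply: compact_sublevel; first exact: compact_closed_disc.
    by move=> w /Ur' /cf; exact: cont_cabsB.
  - move=> w [/= wr wd]; rewrite /V /= lt_neqAle wr andbT; apply/eqP => wE.
    have := mmin w; rewrite /S /= wE !lexx => /(_ (conj isT isT)).
    have := ler_cabsD (f w - c) (c - f z0); rewrite addrA subrK.
    by rewrite /d in d'd cd; lra.
  - move=> w Vw nK; rewrite cabsV -[leRHS]invrK lef_pV2 ?posrE ?cabs_gt0 ?nc//.
    rewrite leNgt; apply/negP => H; apply: nK; split; [exact: ltW|exact: ltW].
by rewrite cabsC => /le_lt_trans/(_ cd); rewrite ltxx.
Qed.

(** The preimage is the image of [K] under the inverse map, which is continuous by the open mapping
    property. *)
Lemma conformal_preimage_compact A B f K : open A -> conformal A B f -> compact K ->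
  K `<=` B -> compact [set z | A z /\ K (f z)].
Proof.
move=> oA /conformalP[hf /set_bijP_C[f1 f2 f3]] cK KB.
pose inv w := xget 0 [set z | A z /\ f z = w].
have invP w : B w -> A (inv w) /\ f (inv w) = w.
  by move=> /f3[z Az fz]; apply: (@xgetPex _ 0 [set z | A z /\ f z = w]); exists z.
have -> : [set z | A z /\ K (f z)] = inv @` K.
  apply/seteqP; split=> [z [Az Kz]|_ [w Kw <-]].
    have [A1 E] := invP _ (KB _ Kz); exists (f z) => //; exact: f2.
  by have [A1 E] := invP _ (KB _ Kw); split=> //; rewrite E.
apply: continuous_compact => //; apply: continuous_in_subspaceT => w; rewrite inE => /KB Bw.
apply/continuousCP => e e0; have [A1 E] := invP _ Bw.
have [d d0 Hd] := inj_open_mapping oA hf f2 A1 e0.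
exists d => // c cd; rewrite -E in cd; have [z [Az zr fz]] := Hd _ cd.
have Bc : B c by rewrite -fz; exact: f1.
have [A2 E2] := invP _ Bc.
have -> : inv c = z by apply: f2 => //; rewrite E2.
exact: zr.
Qed.

(* Division by the Caratheodory quotients removes the common zero at [a]. *)
Lemma ratio_bound U f g a l k : open U -> holo U f -> holo U g -> U a ->
  f a = 0 -> g a = 0 -> cderiv f a l -> cderiv g a k -> k != 0 ->
  (forall z, U z -> cabs (f z) <= 1) -> (forall z, U z -> z != a -> g z != 0) ->
  (forall r : R, 0 < r < 1 -> exists K, [/\ compact K, K `<=` U &
      forall z, U z -> ~ K z -> r < cabs (g z)]) ->
  exists q, [/\ {for a, continuous q}, q a = l / k, 
     forall z, U z -> z != a -> exists l, cderiv q z l,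
     forall z, U z -> f z = q z * g z & forall z, U z -> cabs (q z) <= 1].
Proof.
move=> oU hf hg Ua fa ga [p [cp pa fp]] [r [cr ra gr]] k0 f1 g0 gK.
pose q z := p z / r z.
have r0 : r a != 0 by rewrite ra.
have fp' w : f w = p w * (w - a) by rewrite -fp fa subr0.
have gr' w : g w = r w * (w - a) by rewrite -gr ga subr0.
have rn0 z : U z -> z != a -> r z != 0.
  by move=> Uz za; apply: contra (g0 _ Uz za) => /eqP E; rewrite gr' E mul0r.
have qE z : z != a -> q z = f z / g z.
  by move=> za; rewrite fp' gr' /q -mulf_div mulfV ?mulr1// subr_eq0.
have cq : {for a, continuous q} := contM cp (contV r0 cr).
have hq z : U z -> z != a -> exists l, cderiv q z l.
  move=> Uz za; have [l1 fl] := hf _ Uz; have [k1 gk] := hg _ Uz.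
  exists (l1 / g z - f z * k1 / g z ^+ 2).
  apply: (@cderiv_near _ (fun w => f w / g w) q z); last exact: cderiv_div (g0 _ Uz za) fl gk.
  apply/nbhsCP; exists (cabs (z - a)); first by rewrite cabs_gt0 subr_eq0.
  move=> w wz; rewrite qE//; apply/eqP => wa; move: wz.
  by rewrite wa cabsC ltxx.
exists q; split=> //.
- by rewrite /q pa ra.
- move=> z Uz; have [->|za] := eqVneq z a; first by rewrite fa ga mulr0.
  by rewrite qE// divfK// g0.
- have mv : mean_value_on U q by exact: (@mean_value_onP _ U q a).
  apply: maximum_principle => // e e0.
  pose rho := Num.max (1 + e)^-1 2^-1.
  have rho1 : 0 < rho < 1.
    rewrite lt_max gt_max invf_lt1 ?ltrDl ?e0 ?addr_gt0// !invr_gt0 ?ltr0n orbT /=.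
    by rewrite invf_lt1 ?ltr1n.
  have [K [cK KU Kg]] := gK _ rho1.
  (* Off [K] the bound [1 / cabs (g z)] is close to 1; the point [a] is added because the quotient
     formula fails where [g] vanishes. *)
  exists (K `|` [set a]); split.
  - by apply: compactU => //; exact: compact_set1.
  - by move=> z [/KU//|->].
  - move=> z Uz nK; have za : z != a by apply/eqP => za; apply: nK; right.
    have gz : rho < cabs (g z) by apply: Kg => // Kz; apply: nK; left.
    have gz0 : 0 < cabs (g z) by apply: lt_trans gz; case/andP: rho1.
    rewrite qE// cabsM cabsV ler_pdivrMr//; apply: (le_trans (f1 _ Uz)).
    have : (1 + e)^-1 <= cabs (g z) by rewrite (le_trans _ (ltW gz))// le_max lexx.
    by rewrite -(@ler_pM2l _ (1 + e)) ?addr_gt0// mulfV// gt_eqF// addr_gt0.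
Qed.

(** Rotating about [z] puts [w] at angle 0 of its circle. There [mean_value_max] gives equality in
    the Cauchy-Schwarz inequality for [f z] and [f w], which forces [f w = f z] because
    [cabs (f w) <= cabs (f z)]. *)
Lemma local_max_const f z (r : R) : 0 < r -> {for z, continuous f} ->
  (forall w, cabs (w - z) <= r -> w != z -> exists l, cderiv f w l) ->
  (forall w, cabs (w - z) <= r -> cabs (f w) <= cabs (f z)) ->
  forall w, cabs (w - z) <= r -> f w = f z.
Proof.
move=> r0 cz df fz w wz.
have [->//|wnz] := eqVneq w z.
have wz0 : w - z != 0 by rewrite subr_eq0.
have s0 : 0 < cabs (w - z) by rewrite cabs_gt0.
pose s := cabs (w - z); pose u := (w - z) / real_cplx s.
have us : u * real_cplx s = w - z by rewrite divfK// rc_eq0 gt_eqF.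
have u1 : cabs u = 1 by rewrite cabsM cabsV cabs_real ger0_norm ?ltW// mulfV// gt_eqF.
pose h x := f (z + u * (x - z)).
have hz : h z = f z by rewrite /h subrr mulr0 addr0.
have dist x : cabs (z + u * (x - z) - z) = cabs (x - z) by rewrite addrC addKr cabsM u1 mul1r.
have dl x : cderiv (fun x => z + u * (x - z)) x u.
  have := cderivD (cderiv_cst z x) (cderivM (cderiv_cst u x) (cderivB (cderiv_id x) (cderiv_cst z x))).
  by rewrite mul0r !add0r subr0 mulr1.
have ch : {for z, continuous h}.
  apply: (cont_comp (cderiv_continuous (dl z))).
  by rewrite subrr mulr0 addr0.
have dh x : cabs (x - z) <= s -> x != z -> exists l, cderiv h x l.
  move=> xz xn; have d1 : cabs (z + u * (x - z) - z) <= r by rewrite dist (le_trans xz).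
  have d2 : z + u * (x - z) != z by rewrite -subr_eq0 -cabs_eq0 dist cabs_eq0 subr_eq0.
  have [l fl] := df _ d1 d2.
  by exists (l * u); exact: cderiv_comp (dl x) fl.
have hM x : cabs (x - z) <= s -> cabs (h x) <= cabs (h z).
  by move=> xz; rewrite hz /h; apply: fz; rewrite dist (le_trans xz).
have chx x : cabs (x - z) <= s -> {for x, continuous h}.
  move=> xz; have [->//|xn] := eqVneq x z.
  by have [l hl] := dh _ xz xn; exact: cderiv_continuous hl.
have cs t : cabs (circle z s t - z) <= s by rewrite cabs_circle ?lexx// ltW.
have E := mean_value_max s0 (fun t => chx _ (cs t)) (circle_mean_value s0 ch dh)
  (fun t => hM _ (cs t)).
have hw : h (z + real_cplx s) = f w.
  by rewrite /h (addrC z (real_cplx s)) addrK us addrC subrK.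
rewrite hz hw in E.
apply/eqP; rewrite -subr_eq0 -cabs_eq0 -sqrf_eq0; apply/eqP.
have : cabs (f w) ^+ 2 <= cabs (f z) ^+ 2.
  by rewrite ler_pXn2r ?nnegrE ?cabs_ge0//; exact: fz.
have : 0 <= cabs (f w - f z) ^+ 2 by exact: sqr_ge0.
move: E; rewrite !cabs2 !ReIm; nra.
Qed.

Definition path_connected_in U := forall x y, U x -> U y -> exists c : R -> C,
  [/\ {within `[0, 1], continuous c}, (forall t, t \in `[0, 1] -> U (c t)), c 0 = x & c 1 = y].

Lemma within_contP (c : R -> C) (a b : R) : {within `[a, b], continuous c} ->
  forall t, a <= t <= b -> forall e : R, 0 < e -> exists2 d : R, 0 < d &
  forall s, a <= s <= b -> `|s - t| < d -> cabs (c s - c t) < e.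
Proof.
move=> /subspace_continuousP cc t tab e e0.
have tI : `[a, b]%classic t by rewrite /= in_itv.
have /cvgCP/(_ _ e0)/within_nbhsP[d d0 H] := cc _ tI.
by exists d => // s sab sd; apply: H => //=; rewrite in_itv.
Qed.

Lemma locally_const_on U (q : C -> C) : path_connected_in U ->
  (forall z, U z -> exists2 r : R, 0 < r & forall w, cabs (w - z) <= r -> q w = q z) ->
  forall x y, U x -> U y -> q x = q y.
Proof.
move=> pU lq x y Ux Uy; have [c [cc Uc <- <-]] := pU _ _ Ux Uy; apply/esym.
apply: (@locally_const_const _ (fun t => q (c t)) 0 1) => // t t01.
have Ut : U (c t) by apply: Uc; rewrite in_itv.
have [r r0 Hr] := lq _ Ut.
have [d d0 Hd] := within_contP cc t01 r0; exists d => // s s01 sd.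
by apply: Hr; apply: ltW; exact: Hd.
Qed.

Lemma conformal_disk_proper U g : open U -> conformal U (@disk R) g ->
  forall r : R, 0 < r < 1 -> exists K, [/\ compact K, K `<=` U &
      forall z, U z -> ~ K z -> r < cabs (g z)].
Proof.
move=> oU cg r /andP[r0 r1].
exists [set z | U z /\ [set w | cabs (w - 0) <= r] (g z)]; split.
- apply: conformal_preimage_compact cg _ _ => //; first exact: compact_closed_disc.
  by move=> z; rewrite /= subr0 => zr; apply/diskE; exact: le_lt_trans r1.
- by move=> z [].
- move=> z Uz nK; rewrite ltNge; apply/negP => H; apply: nK; split => //=.
  by rewrite subr0.
Qed.

(** Schwarz's lemma for two maps of the same domain onto the disk. Both [f / g] and [g / f] are
    bounded by 1, hence [f / g] has modulus 1; each point is then a local maximum of its modulus, so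
    the quotient is locally constant and constant along paths. This uniqueness statement never moves
    to a standard domain. *)
Lemma conformal_ratio U f g a l k : open U -> path_connected_in U ->
  conformal U (@disk R) f -> conformal U (@disk R) g -> U a -> f a = 0 -> g a = 0 ->
  cderiv f a l -> cderiv g a k -> l != 0 -> k != 0 ->
  cabs (l / k) = 1 /\ forall z, U z -> f z = l / k * g z.
Proof.
move=> oU pU cf cg Ua fa ga fl gk l0 k0.
have Pf := conformal_disk_proper oU cf; have Pg := conformal_disk_proper oU cg.
move: (cf) (cg) => /conformalP[hf /set_bijP_C[f1 f2 _]] /conformalP[hg /set_bijP_C[g1 g2 _]].
have f1' z : U z -> cabs (f z) <= 1 by move=> /f1/diskE/ltW.
have g1' z : U z -> cabs (g z) <= 1 by move=> /g1/diskE/ltW.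
have f0 z : U z -> z != a -> f z != 0.
  by move=> Uz; apply: contra => /eqP E; apply/eqP; apply: f2 => //; rewrite E fa.
have g0 z : U z -> z != a -> g z != 0.
  by move=> Uz; apply: contra => /eqP E; apply/eqP; apply: g2 => //; rewrite E ga.
have [q [cq qa hq qE q1]] := ratio_bound oU hf hg Ua fa ga fl gk k0 f1' g0 Pg.
have [p [cp pa hp pE p1]] := ratio_bound oU hg hf Ua ga fa gk fl l0 g1' f0 Pf.
have abs1 z : U z -> cabs (q z) = 1.
  move=> Uz; apply/eqP; rewrite eq_le q1//=.
  have [za|za] := eqVneq z a.
    rewrite za qa; have := p1 _ Ua; rewrite pa !cabsM !cabsV.
    by rewrite ler_pdivrMr ?cabs_gt0// mul1r ler_pdivlMr ?cabs_gt0// mul1r.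
  have fz0 : 0 < cabs (f z) by rewrite cabs_gt0 f0.
  have qp : cabs (q z) * cabs (p z) = 1.
    rewrite -cabsM -(@cabs1 R); congr cabs; apply: (mulIf (f0 _ Uz za)).
    by rewrite mul1r -mulrA -pE// -qE.
  by have := p1 _ Uz; have q0 := cabs_ge0 (q z); nra.
have E : forall z, U z -> q z = q a.
  move=> z Uz; apply: (@locally_const_on U q) => // w Uw.
  have [r r0 Ur] := open_disc oU Uw.
  (* At [a] the quotient is only continuous, so the disc is centred there; around any other point a
     disc that misses [a] is taken. *)
  have [wa|wa] := eqVneq w a.
    exists r; first exact: r0.
    move=> x xw; apply: (@local_max_const q w r r0 _ _ _ x xw).
    - by rewrite wa; exact: cq.
    - by move=> y yw yn; apply: hq; [exact: Ur|rewrite -wa].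
    - by move=> y yw; rewrite !abs1 ?lexx//; exact: Ur.
  have d0 : 0 < cabs (a - w) by rewrite cabs_gt0 subr_eq0 eq_sym.
  have m0 : 0 < Num.min r (cabs (a - w) / 2) by rewrite lt_min r0 divr_gt0.
  have ya y : cabs (y - w) <= Num.min r (cabs (a - w) / 2) -> U y /\ y != a.
    rewrite le_min => /andP[y1 y2]; split; first exact: Ur.
    by apply/eqP => ya; move: y2; rewrite ya; lra.
  exists (Num.min r (cabs (a - w) / 2)); first exact: m0.
  move=> x xw; apply: (@local_max_const q w _ m0 _ _ _ x xw).
  - by have [l1 ql] := hq _ Uw wa; exact: cderiv_continuous ql.
  - by move=> y yw yn; have [Uy yna] := ya _ yw; exact: hq.
  - by move=> y yw; have [Uy _] := ya _ yw; rewrite !abs1 ?lexx.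
split; first by rewrite -qa abs1.
by move=> z Uz; rewrite -qa -(E _ Uz) -qE.
Qed.

End ConformalMaps.

(** * Cayley transforms and conformal maps of the half-plane onto the disk *)

Section Moebius.
Variable R : realType.
Local Notation C := (Cplx R).
Local Notation cRe := (@complex.Re R : C -> R).
Local Notation cIm := (@complex.Im R : C -> R).
Implicit Types (f g h : C -> C) (A B K U : set C) (a c z w l k Z u : C).

Definition cayley c Z z := c * ((z - Z) / (z - cconj Z)).
Definition icayley c Z u := (cconj Z * u - c * Z) / (u - c).

Lemma Im_inj_neq z w : cIm z != cIm w -> z - w != 0.
Proof. by rewrite subr_eq0; apply: contra => /eqP ->. Qed.

Lemma cayley_den Z z : 0 < cIm Z -> 0 <= cIm z -> z - cconj Z != 0.
Proof. by move=> Z0 z0; apply: Im_inj_neq; rewrite cIm_conj gt_eqF//; lra. Qed.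

Lemma conj_diff Z : 0 < cIm Z -> Z - cconj Z != 0.
Proof. by move=> Z0; apply: cayley_den => //; exact: ltW. Qed.

Lemma unit_neq0 c : cabs c = 1 -> c != 0.
Proof. by move=> c1; rewrite -cabs_gt0 c1. Qed.

Lemma cayley_abs c Z z : cabs c = 1 -> 0 < cIm Z -> 0 <= cIm z ->
  cabs (cayley c Z z) ^+ 2 = 1 - 4 * cIm z * cIm Z / cabs (z - cconj Z) ^+ 2.
Proof.
move=> c1 Z0 z0; have n0 := cayley_den Z0 z0.
rewrite /cayley !cabsM c1 mul1r cabsV expr_div_n.
have d0 : cabs (z - cconj Z) ^+ 2 != 0 by rewrite sqrf_eq0 cabs_eq0.
apply: (mulIf d0); rewrite mulfVK// mulrBl mul1r mulfVK//.
rewrite !cabs2 !ReIm; ring.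
Qed.

Lemma cayley_neq c Z z : cabs c = 1 -> 0 < cIm Z -> 0 <= cIm z -> cayley c Z z - c != 0.
Proof.
move=> c1 Z0 z0; have n0 := cayley_den Z0 z0.
have -> : cayley c Z z - c = c * ((cconj Z - Z) / (z - cconj Z)).
  by rewrite /cayley; field.
have d1 : cconj Z - Z != 0 by rewrite -oppr_eq0 opprB conj_diff.
by rewrite mulf_neq0 ?(unit_neq0 c1)// mulf_neq0// invr_eq0.
Qed.

Lemma cayley_disk c Z z : cabs c = 1 -> 0 < cIm Z -> upper z -> disk (cayley c Z z).
Proof.
move=> c1 Z0 z0; have zz : 0 <= cIm z by exact: ltW.
apply/diskE; rewrite -(@ltr_pXn2r _ 2) ?nnegrE ?cabs_ge0// expr1n cayley_abs//.
have d0 : 0 < cabs (z - cconj Z) ^+ 2 by rewrite exprn_gt0// cabs_gt0 cayley_den.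
have : 0 < 4 * cIm z * cIm Z / cabs (z - cconj Z) ^+ 2.
  by apply: divr_gt0 => //; rewrite !mulr_gt0.
lra.
Qed.

Lemma cayley_closed_disk c Z z : cabs c = 1 -> 0 < cIm Z -> closed_upper z ->
  closed_disk (cayley c Z z).
Proof.
move=> c1 Z0 z0; apply/closed_diskE.
rewrite -(@ler_pXn2r _ 2) ?nnegrE ?cabs_ge0// expr1n cayley_abs//.
have d0 : 0 < cabs (z - cconj Z) ^+ 2 by rewrite exprn_gt0// cabs_gt0 cayley_den.
have : 0 <= 4 * cIm z * cIm Z / cabs (z - cconj Z) ^+ 2.
  by apply: divr_ge0; [rewrite !mulr_ge0//; exact: ltW|exact: ltW].
lra.
Qed.

Lemma cayleyK c Z z : cabs c = 1 -> 0 < cIm Z -> 0 <= cIm z -> icayley c Z (cayley c Z z) = z.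
Proof.
move=> c1 Z0 z0; have n0 := cayley_den Z0 z0; have c0 := unit_neq0 c1.
have d0 := conj_diff Z0; have e0 := cayley_neq c1 Z0 z0.
rewrite /icayley; apply: (mulIf e0); rewrite mulfVK//.
by rewrite /cayley; field.
Qed.

Lemma icayley_Im c Z u : cabs c = 1 -> u - c != 0 ->
  cIm (icayley c Z u) = cIm Z * (1 - cabs u ^+ 2) / cabs (u - c) ^+ 2.
Proof.
move=> c1 uc; have d0 : cabs (u - c) ^+ 2 != 0 by rewrite sqrf_eq0 cabs_eq0.
have -> : icayley c Z u = (cconj Z * u - c * Z) * cconj (u - c) / real_cplx (cabs (u - c) ^+ 2).
  have k0 : cconj (u - c) != 0 by rewrite -cabs_eq0 cabs_conj cabs_eq0.
  by rewrite cabs_sqr_conj /icayley; field; rewrite k0.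
have -> (x : C) (r : R) : cIm (x / real_cplx r) = cIm x / r.
  by rewrite -rcV !ReIm mulr0 add0r.
congr (_ / _); have := cabs2 c; rewrite c1 expr1n cabs2 !ReIm => E.
have -> : (1 : R) = cRe c ^+ 2 + cIm c ^+ 2 by [].
ring.
Qed.

Lemma icayley_upper c Z u : cabs c = 1 -> 0 < cIm Z -> disk u -> upper (icayley c Z u).
Proof.
move=> c1 Z0 /diskE u1.
have uc : u - c != 0 by rewrite subr_eq0; apply: contraTneq u1 => ->; rewrite c1 ltxx.
rewrite /upper /= icayley_Im//; apply: divr_gt0; last by rewrite exprn_gt0// cabs_gt0.
by apply: mulr_gt0 => //; rewrite subr_gt0 expr_lt1 ?cabs_ge0.
Qed.

Lemma icayley_closed_upper c Z u : cabs c = 1 -> 0 < cIm Z -> closed_disk u ->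
  closed_upper (icayley c Z u).
Proof.
move=> c1 Z0 /closed_diskE u1.
(* At the pole [u = c] division by zero returns 0, which lies in the closed half-plane as well. *)
have [/eqP|uc] := boolP (u - c == 0).
  by rewrite /icayley => ->; rewrite invr0 mulr0 /closed_upper /=.
rewrite /closed_upper /= icayley_Im//; apply: divr_ge0; last by rewrite exprn_ge0// cabs_ge0.
by apply: mulr_ge0; [exact: ltW|rewrite subr_ge0 expr_le1 ?cabs_ge0].
Qed.

Lemma icayleyK c Z u : cabs c = 1 -> 0 < cIm Z -> u != c -> cayley c Z (icayley c Z u) = u.
Proof.
move=> c1 Z0 uc; have uc0 : u - c != 0 by rewrite subr_eq0.
have c0 := unit_neq0 c1; have d0 := conj_diff Z0.
have E : icayley c Z u - cconj Z = c * (cconj Z - Z) / (u - c).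
  by rewrite /icayley; field.
have e0 : icayley c Z u - cconj Z != 0.
  rewrite E !mulf_neq0 ?invr_eq0//.
  by rewrite -oppr_eq0 opprB.
have F : icayley c Z u - Z = u * (cconj Z - Z) / (u - c).
  by rewrite /icayley; field.
have d1 : cconj Z - Z != 0 by rewrite -oppr_eq0 opprB.
by rewrite /cayley E F; field; rewrite d1 c0 uc0.
Qed.

Lemma cderiv_cayley c Z z : z - cconj Z != 0 ->
  cderiv (cayley c Z) z (c * (Z - cconj Z) / (z - cconj Z) ^+ 2).
Proof.
move=> n0.
have d1 : cderiv (fun w => w - Z) z 1.
  by have := cderivB (cderiv_id z) (cderiv_cst Z z); rewrite subr0.
have d2 : cderiv (fun w => w - cconj Z) z 1.
  by have := cderivB (cderiv_id z) (cderiv_cst (cconj Z) z); rewrite subr0.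
have d3 := @cderiv_div _ (fun w => w - Z) (fun w => w - cconj Z) z 1 1 n0 d1 d2.
have := cderivM (cderiv_cst c z) d3; rewrite /cayley; set l := (X in cderiv _ _ X) => H.
by have -> : c * (Z - cconj Z) / (z - cconj Z) ^+ 2 = l by rewrite /l; field.
Qed.

Lemma cderiv_icayley c Z u : u - c != 0 ->
  cderiv (icayley c Z) u (c * (Z - cconj Z) / (u - c) ^+ 2).
Proof.
move=> n0.
have d1 : cderiv (fun w => cconj Z * w - c * Z) u (cconj Z).
  have := cderivB (cderivM (cderiv_cst (cconj Z) u) (cderiv_id u)) (cderiv_cst (c * Z) u).
  by rewrite subr0 mul0r add0r mulr1.
have d2 : cderiv (fun w => w - c) u 1.
  by have := cderivB (cderiv_id u) (cderiv_cst c u); rewrite subr0.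
have := @cderiv_div _ (fun w => cconj Z * w - c * Z) (fun w => w - c) u (cconj Z) 1 n0 d1 d2.
rewrite /icayley; set l := (X in cderiv _ _ X) => H.
by have -> : c * (Z - cconj Z) / (u - c) ^+ 2 = l by rewrite /l; field.
Qed.

Lemma disk_neq c u : cabs c = 1 -> disk u -> u != c.
Proof. by move=> c1 /diskE u1; apply: contraTneq u1 => ->; rewrite c1 ltxx. Qed.

Lemma conformal_cayley c Z : cabs c = 1 -> 0 < cIm Z -> conformal (@upper R) (@disk R) (cayley c Z).
Proof.
move=> c1 Z0; apply/conformalP; split.
  move=> z z0; exists (c * (Z - cconj Z) / (z - cconj Z) ^+ 2); apply: cderiv_cayley.
  by apply: cayley_den => //; exact: ltW.
apply/set_bijP_C; split.
- by move=> z; exact: cayley_disk.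
- move=> z w z0 w0 E; rewrite -(cayleyK c1 Z0 (ltW z0)) E.
  by rewrite (cayleyK c1 Z0 (ltW w0)).
- move=> u du; exists (icayley c Z u); first exact: icayley_upper.
  by apply: icayleyK => //; exact: disk_neq.
Qed.

Lemma conformal_icayley c Z : cabs c = 1 -> 0 < cIm Z -> conformal (@disk R) (@upper R) (icayley c Z).
Proof.
move=> c1 Z0; apply/conformalP; split.
  move=> z z0; exists (c * (Z - cconj Z) / (z - c) ^+ 2); apply: cderiv_icayley.
  by rewrite subr_eq0; exact: disk_neq.
apply/set_bijP_C; split.
- by move=> z; exact: icayley_upper.
- move=> z w z0 w0 E; rewrite -(icayleyK c1 Z0 (disk_neq c1 z0)) E.
  by rewrite (icayleyK c1 Z0 (disk_neq c1 w0)).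
- move=> u du; exists (cayley c Z u); first exact: cayley_disk.
  by apply: cayleyK => //; exact: ltW.
Qed.

Lemma segment_path U x y : (forall t : R, 0 <= t <= 1 -> U (x + real_cplx t * (y - x))) ->
  exists c : R -> C,
  [/\ {within `[0, 1], continuous c}, (forall t, t \in `[0, 1] -> U (c t)), c 0 = x & c 1 = y].
Proof.
move=> Uxy; exists (fun t => x + real_cplx t * (y - x)); split.
- apply: continuous_subspaceT => t.
  apply: (@cvgCD _ _ (nbhs t)); first exact: (@cvgC_cst _ _ (nbhs t)).
  apply: (@cvgCM _ _ (nbhs t)); last exact: (@cvgC_cst _ _ (nbhs t)).
  by apply: (@cvgC_real _ _ (nbhs t) _ id t); exact: cvg_id.
- by move=> t; rewrite in_itv; exact: Uxy.
- by rewrite rc0 mul0r addr0.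
- by rewrite rc1 mul1r addrC subrK.
Qed.

Lemma upper_path_connected : path_connected_in (@upper R).
Proof.
move=> x y x0 y0; apply: (@segment_path (@upper R)) => t /andP[t0 t1].
by move: x0 y0; rewrite /upper /= !ReIm; nra.
Qed.

Lemma zero_deriv_const U f : (forall x y, U x -> U y ->
   forall t : R, 0 <= t <= 1 -> U (x + real_cplx t * (y - x))) ->
  (forall z, U z -> cderiv f z 0) -> forall x y, U x -> U y -> f x = f y.
Proof.
move=> cU df x y Ux Uy.
have := @tderiv0_const _ [set t | 0 <= t <= 1] (fun t => f (x + real_cplx t * (y - x))) 0 1 ler01.
rewrite rc0 rc1 mul0r mul1r addr0 (addrC x) subrK => H; apply/esym; apply: H => // t t01.
have dt := tderivD (tderiv_cst [set t | 0 <= t <= 1] x t)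
  (tderivM (tderiv_id [set t | 0 <= t <= 1] t) (tderiv_cst [set t | 0 <= t <= 1] (y - x) t)).
have := tderiv_comp (df _ (cU _ _ Ux Uy _ t01)) dt.
by rewrite mul0r.
Qed.

Lemma upperE z : upper z = (0 < cIm z) :> Prop. Proof. by []. Qed.

Lemma upper_Ci (y : R) : 0 < y -> upper (Ci * real_cplx y).
Proof. by rewrite upperE !ReIm; lra. Qed.

Lemma near_inftyP A (P : C -> Prop) :
  (\forall z \near within A (@cplx_infty R), P z) <->
  exists M : R, forall z, A z -> M < cabs z -> P z.
Proof.
split.
- case=> M _ H; exists M => z Az Mz; apply: H => //=.
  by rewrite normC_cabs rc_lt.
- case=> M H; exists M => // z /=; rewrite normC_cabs rc_lt => Mz Az; exact: H.
Qed.

Global Instance cplx_infty_filter : Filter (@cplx_infty R).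
Proof.
apply: filter_from_filter; first by exists 0.
move=> a b _ _; exists (Num.max a b) => // z /=; rewrite !normC_cabs !rc_lt gt_max.
by move=> /andP[].
Qed.

Lemma cayley_infty c Z (e : R) : 0 < e -> exists M : R, forall z, M < cabs z ->
  cabs (cayley c Z z - c) < e.
Proof.
move=> e0; pose k := cabs c * cabs (cconj Z - Z).
exists (cabs Z + k / e + 1) => z zM.
have k0 : 0 <= k / e by rewrite divr_ge0 ?mulr_ge0 ?cabs_ge0// ltW.
have d0 : k / e + 1 < cabs (z - cconj Z).
  by apply: lt_le_trans (lerB_cabs _ _); rewrite cabs_conj; lra.
have d00 : 0 < cabs (z - cconj Z) by lra.
have n0 : z - cconj Z != 0 by rewrite -cabs_gt0.
have -> : cayley c Z z - c = c * (cconj Z - Z) / (z - cconj Z) by rewrite /cayley; field.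
rewrite !cabsM cabsV ltr_pdivrMr// -/k mulrC -ltr_pdivrMr//; lra.
Qed.

(** One point with nonzero derivative is enough: the comparison with a Cayley transform spreads the
    nonvanishing to all of the half-plane. *)
Lemma holo_nonconst_deriv f : conformal (@upper R) (@disk R) f ->
  exists z l, [/\ upper z, cderiv f z l & l != 0].
Proof.
move=> /conformalP[hf /set_bijP_C[_ fi _]]; apply: contrapT => nz.
have df z : upper z -> cderiv f z 0.
  move=> z0; have [l fl] := hf _ z0; have [<-//|l0] := eqVneq l 0.
  by exfalso; apply: nz; exists z, l.
have cU (x y : C) : upper x -> upper y -> forall t : R, 0 <= t <= 1 ->
    upper (x + real_cplx t * (y - x)).
  by move=> x0 y0 t /andP[t0 t1]; move: x0 y0; rewrite /upper /= !ReIm; nra.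
have u1 : upper (Ci : C) by exact: ltr01.
have u2 : upper (Ci + Ci : C) by rewrite upperE !ReIm; lra.
have := fi _ _ u1 u2 (zero_deriv_const cU df u1 u2).
by move=> /(congr1 cIm); rewrite !ReIm; lra.
Qed.

Lemma cayley0 c Z : cayley c Z Z = 0.
Proof. by rewrite /cayley subrr mul0r mulr0. Qed.

Lemma cderiv_cayley0 c Z : cabs c = 1 -> 0 < cIm Z -> exists2 k, cderiv (cayley c Z) Z k & k != 0.
Proof.
move=> c1 Z0; have d0 := conj_diff Z0; exists (c * (Z - cconj Z) / (Z - cconj Z) ^+ 2).
  exact: cderiv_cayley.
by rewrite mulf_neq0 ?invr_eq0 ?expf_neq0// mulf_neq0// unit_neq0.
Qed.

(** [conformal_ratio] asks for a nonzero derivative at the zero [z0], which is not known at first.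
    It is applied once at a point [z1] with nonzero derivative, after moving [f z1] to 0 by the
    automorphism [b] of the disk. So [b] composed with [f] is a multiple of a Cayley transform and
    its derivative vanishes nowhere, in particular not at [z0]; the second application is at
    [z0]. *)
Lemma conformal_upper_disk f z0 : conformal (@upper R) (@disk R) f -> upper z0 -> f z0 = 0 ->
  exists2 c, cabs c = 1 & forall z, upper z -> f z = cayley c z0 z.
Proof.
move=> cf uz0 fz0; have /conformalP[hf /set_bijP_C[f1 _ _]] := cf.
have [z1 [l1 [uz1 fl1 l10]]] := holo_nonconst_deriv cf.
have [c1 Ci0] : cabs (1 : C) = 1 /\ 0 < cIm Ci by rewrite cabs1 ltr01.
pose P := icayley 1 Ci (f z1).
have P0 : 0 < cIm P by exact: (icayley_upper c1 Ci0 (f1 _ uz1)).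
pose b u := cayley 1 P (icayley 1 Ci u).
have cb : conformal (@disk R) (@disk R) b.
  exact: conformal_comp (conformal_icayley c1 Ci0) (conformal_cayley c1 P0).
have [k1 bk1 k10] : exists2 k, cderiv b (f z1) k & k != 0.
  have n0 : f z1 - 1 != 0 by rewrite subr_eq0; exact: disk_neq c1 (f1 _ uz1).
  have [k ck k0] := cderiv_cayley0 c1 P0.
  exists (k * (1 * (Ci - cconj Ci) / (f z1 - 1) ^+ 2)).
    exact: cderiv_comp (cderiv_icayley Ci n0) ck.
  by rewrite !mulf_neq0 ?invr_eq0 ?expf_neq0 ?oner_eq0// conj_diff.
have bf0 : b (f z1) = 0 by rewrite /b cayley0.
have [k2 ck2 k20] := cderiv_cayley0 c1 uz1.
have [_ E] := conformal_ratio (@open_upper R) upper_path_connected (conformal_comp cf cb)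
  (conformal_cayley c1 uz1) uz1 bf0 (cayley0 1 z1) (cderiv_comp fl1 bk1) ck2
  (mulf_neq0 k10 l10) k20.
have [l fl] := hf _ uz0.
have l0 : l != 0.
  apply/eqP => l0; rewrite l0 in fl.
  have /conformalP[hb _] := cb; have [m bm] := hb _ (f1 _ uz0).
  have D1 := cderiv_comp fl bm; rewrite mulr0 in D1.
  have n0 : z0 - cconj z1 != 0 by apply: cayley_den => //; exact: ltW.
  set k := k1 * l1 / k2 in E.
  have k0 : k != 0 by rewrite !mulf_neq0 ?invr_eq0.
  have D2 := cderivM (cderiv_cst k z0) (cderiv_cayley 1 n0).
  rewrite mul0r add0r in D2.
  have D3 : cderiv (fun w => b (f w)) z0 (k * (1 * (z1 - cconj z1) / (z0 - cconj z1) ^+ 2)).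
    apply: cderiv_near D2; have /openCP/(_ _ uz0)[e e0 He] := @open_upper R.
    by apply/nbhsCP; exists e => // w /He uw; rewrite (E _ uw).
  have := cderiv_uniq D1 D3; apply/eqP; rewrite eq_sym.
  by rewrite !mulf_neq0 ?invr_eq0 ?expf_neq0 ?oner_eq0// conj_diff.
have [k3 ck3 k30] := cderiv_cayley0 c1 uz0.
have [lk1 E2] := conformal_ratio (@open_upper R) upper_path_connected cf
  (conformal_cayley c1 uz0) uz0 fz0 (cayley0 1 z0) fl ck3 l0 k30.
exists (l / k3) => // z uz; rewrite (E2 _ uz) /cayley mul1r//.
Qed.

(** Both boundary conditions are read along the imaginary axis. The limit at infinity identifies the
    unimodular constant, and the limit at 0 says [cayley c z0 0 = 1], which is the relation between
    [c] and [z0]. *)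
Lemma conformal_upper_disk_normalized f z0 c : conformal (@upper R) (@disk R) f ->
  cabs c = 1 -> f @ within (@upper R) (@cplx_infty R) --> c ->
  f @ within (@upper R) (nbhs (0 : C)) --> (1 : C) -> upper z0 -> f z0 = 0 ->
  (forall z, upper z -> f z = cayley c z0 z) /\ c * z0 = cconj z0.
Proof.
move=> cf c1 finf f0 uz0 fz0.
have [c' c'1 fE] := conformal_upper_disk cf uz0 fz0.
have cc : c' = c.
  apply/eqP; rewrite -subr_eq0 -cabs_eq0; apply/negPn/negP => n0.
  have e0 : 0 < cabs (c' - c) / 2 by rewrite divr_gt0// lt_neqAle eq_sym n0 cabs_ge0.
  have [M1 H1] := cayley_infty c' z0 e0.
  move/cvgCP: finf => /(_ _ e0)/near_inftyP[M2 H2].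
  pose y := Num.max 0 (Num.max M1 M2) + 1.
  have y0 : 0 < y by rewrite ltr_wpDl// le_max lexx.
  have [y1 y2] : M1 < y /\ M2 < y.
    by split; rewrite ltr_pwDr// !le_max lexx ?orbT.
  have uy := upper_Ci y0.
  have ay : cabs (Ci * real_cplx y) = y by rewrite cabsM cabs_Ci mul1r cabs_real ger0_norm// ltW.
  have := H1 (Ci * real_cplx y); have := H2 (Ci * real_cplx y) uy.
  rewrite ay -fE// => /(_ y2) A /(_ y1) B.
  have := ler_cabsD (c' - f (Ci * real_cplx y)) (f (Ci * real_cplx y) - c).
  rewrite addrA subrK [cabs (c' - _)]cabsC; lra.
rewrite cc in fE; split => //.
have n0 : 0 - cconj z0 != 0 by apply: cayley_den; rewrite ?cIm0.
have cc0 := cderiv_continuous (cderiv_cayley c n0).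
suff : cayley c z0 0 = 1.
  rewrite /cayley !sub0r => E; rewrite sub0r in n0; rewrite -[RHS]mul1r -E.
  by field; rewrite -oppr_eq0.
apply/eqP; rewrite -subr_eq0 -cabs_eq0; apply/negPn/negP => n1.
have e0 : 0 < cabs (cayley c z0 0 - 1) / 2 by rewrite divr_gt0// lt_neqAle eq_sym n1 cabs_ge0.
have /continuousCP/(_ _ e0)[d1 d10 H1] := cc0.
move/cvgCP: f0 => /(_ _ e0); rewrite nearE /within /= => /nbhsCP[d2 d20 H2].
pose y := Num.min d1 d2 / 2.
have y0 : 0 < y by rewrite divr_gt0// lt_min d10.
have [y1 y2] : y < d1 /\ y < d2.
  have [m1 m2] : Num.min d1 d2 <= d1 /\ Num.min d1 d2 <= d2 by split; rewrite ge_min lexx ?orbT.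
  by rewrite /y; split; lra.
have uy := upper_Ci y0.
have ay : cabs (Ci * real_cplx y) = y by rewrite cabsM cabs_Ci mul1r cabs_real ger0_norm// ltW.
have := H1 (Ci * real_cplx y); have := H2 (Ci * real_cplx y).
rewrite subr0 ay => /(_ y2 uy) A /(_ y1) B; rewrite -fE// in B.
have := ler_cabsD (cayley c z0 0 - f (Ci * real_cplx y)) (f (Ci * real_cplx y) - 1).
rewrite addrA subrK [cabs (cayley _ _ _ - f _)]cabsC; lra.
Qed.

End Moebius.

(** * Uniqueness of mapping-out functions *)

Section Uniqueness.
Variable R : realType.
Local Notation C := (Cplx R).
Local Notation cRe := (@complex.Re R : C -> R).
Local Notation cIm := (@complex.Im R : C -> R).
Local Notation tau := (pi *+ 2 : R).
Implicit Types (f g h : C -> C) (A B K U : set C) (a c z w l k Z u : C).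

Lemma ltC_real (x : C) : 0 < x -> exists2 r : R, 0 < r & x = real_cplx r.
Proof.
case: x => a b; rewrite ltcE /= => /andP[/eqP b0 a0]; exists a => //.
by rewrite b0.
Qed.

Lemma cabs_small_eq0 (x : C) : (forall e : R, 0 < e -> cabs x <= e) -> x = 0.
Proof.
move=> H; apply/eqP; rewrite -cabs_eq0; apply/negPn/negP => n0.
have x0 : 0 < cabs x by rewrite lt_neqAle eq_sym n0 cabs_ge0.
by have := H _ (div2_gt0 x0); lra.
Qed.

Lemma disk_mapout_unique U g1 g2 : open U -> path_connected_in U -> U 0 ->
  conformal U (@disk R) g1 -> conformal U (@disk R) g2 -> g1 0 = 0 -> g2 0 = 0 ->
  0 < derive1 g1 0 -> 0 < derive1 g2 0 -> forall z, U z -> g1 z = g2 z.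
Proof.
move=> oU pU U0 c1 c2 g10 g20 d1 d2.
have /conformalP[h1 _] := c1; have /conformalP[h2 _] := c2.
have [l1 gl1] := h1 _ U0; have [l2 gl2] := h2 _ U0.
rewrite (cderiv_derive1 gl1) in d1; rewrite (cderiv_derive1 gl2) in d2.
have [r1 r10 E1] := ltC_real d1; have [r2 r20 E2] := ltC_real d2.
have n1 : l1 != 0 by rewrite E1 rc_eq0 gt_eqF.
have n2 : l2 != 0 by rewrite E2 rc_eq0 gt_eqF.
have [c E z Uz] := conformal_ratio oU pU c1 c2 U0 g10 g20 gl1 gl2 n1 n2.
rewrite E// -[RHS]mul1r; congr (_ * _).
move: c; rewrite E1 E2 -rcV -rcM cabs_real ger0_norm ?divr_ge0 ?ltW// => ->.
exact: rc1.
Qed.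

(** A Cauchy estimate: the Caratheodory quotient of [g w - w] at [z1] has the mean value property
    and is at most [4^-1] on the unit circle around [z1]. With the factor 2 of [cint_bound] this
    gives [cabs (l - 1) <= 2^-1]. *)
Lemma near_id_deriv g z1 l : (forall w, cabs (w - z1) <= 1 -> exists k, cderiv g w k) ->
  (forall w, cabs (w - z1) <= 1 -> cabs (g w - w) <= 8^-1) -> cderiv g z1 l -> l != 0.
Proof.
move=> hg gw gl; pose h w := g w - w.
have [p [cp pz hp]] : cderiv h z1 (l - 1) by exact: cderivB gl (cderiv_id z1).
have hp' w : cabs (w - z1) <= 1 -> w != z1 -> exists k, cderiv p w k.
  move=> w1 wz; have [k gk] := hg _ w1; have wz0 : w - z1 != 0 by rewrite subr_eq0.
  have D1 : cderiv (fun x => h x - h z1) w (k - 1 - 0).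
    exact: cderivB (cderivB gk (cderiv_id w)) (cderiv_cst (h z1) w).
  have D2 : cderiv (fun x => x - z1) w (1 - 0).
    exact: cderivB (cderiv_id w) (cderiv_cst z1 w).
  have D3 := @cderiv_div _ (fun x => h x - h z1) (fun x => x - z1) w _ _ wz0 D1 D2.
  eexists; apply: cderiv_near D3; apply/nbhsCP; exists (cabs (w - z1)).
    by rewrite cabs_gt0.
  move=> x xw; rewrite hp mulfK// subr_eq0; apply/eqP => xz; move: xw.
  by rewrite xz cabsC ltxx.
have mv := @circle_mean_value _ p z1 1 ltr01 cp hp'.
have t0 := @tau_gt0 R.
have cc : ccont_on 0 tau (fun t => p (circle z1 1 t)).
  move=> t _; apply: cvg_on_circle.
  have b1 : cabs (circle z1 1 t - z1) <= 1 by rewrite cabs_circle ?lexx ?ler01.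
  have b2 : circle z1 1 t != z1.
    by rewrite -subr_eq0 -cabs_eq0 cabs_circle ?oner_eq0 ?ler01.
  have [l2 D] := hp' _ b1 b2.
  exact: cderiv_continuous D.
have : cabs (circle_mean p z1 1) <= 2 * 4^-1 * (tau - 0).
  apply: cint_bound; [exact: ltW|exact: cc|] => t _.
  have d1 : cabs (circle z1 1 t - z1) = 1 by rewrite cabs_circle ?ler01.
  have z11 : cabs (z1 - z1) <= 1 by rewrite subrr cabs0 ler01.
  have := hp (circle z1 1 t) => /(congr1 cabs); rewrite cabsM d1 mulr1 => <-.
  apply: (le_trans (ler_cabsB _ _)).
  have := gw _ z11; have := gw (circle z1 1 t); rewrite d1 lexx => /(_ isT).
  by rewrite /h; lra.
rewrite mv cabsM cabs_real (ger0_norm (ltW t0)) subr0 ler_pM2r// pz => H.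
by apply/eqP => l0; move: H; rewrite l0 sub0r cabsN cabs1; lra.
Qed.

Lemma half_expansion_near_id K g (a : R) : half_expansion K g a ->
  forall e : R, 0 < e -> exists M : R, forall z, (@upper R `\` K) z -> M < cabs z ->
  cabs (g z - z) < e.
Proof.
move=> ex e e0; move/cvgCP: ex => /(_ _ ltr01)/near_inftyP[M H].
have a0 := normr_ge0 a.
have b0 : 0 <= (1 + `|a|) / e by rewrite divr_ge0 ?addr_ge0// ltW.
exists (Num.max M ((1 + `|a|) / e)) => z Uz; rewrite gt_max => /andP[zM ze].
have z0 : 0 < cabs z by exact: le_lt_trans ze.
have zn0 : z != 0 by rewrite -cabs_gt0.
have := H _ Uz zM; rewrite subr0 => {}H.
have E : z * (g z - z) = z * (g z - (z + real_cplx a / z)) + real_cplx a by field.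
have : cabs (z * (g z - z)) < 1 + `|a|.
  by rewrite E; apply: (le_lt_trans (ler_cabsD _ _)); rewrite cabs_real ltrD2r.
rewrite cabsM; move: ze; rewrite ltr_pdivrMr// => h1 h2.
by rewrite -(ltr_pM2l z0); apply: (lt_trans h2).
Qed.

(** Composed with the Cayley transforms that send [g1 z1] and [g2 z1] to 0 and infinity to 1, the
    two maps differ by a unimodular factor, which is 1 because both compositions tend to 1 at
    infinity. Solving for [g1] gives [g1 = lam * g2 + mu], and closeness of both maps to the
    identity at infinity leaves only [lam = 1] and [mu = 0]. *)
Lemma half_mapout_unique K g1 g2 : compact K -> path_connected_in (@upper R `\` K) ->
  is_half_mapout K g1 -> is_half_mapout K g2 -> forall z, (@upper R `\` K) z -> g1 z = g2 z.
Proof.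
move=> cK pU [c1 [a1 ex1]] [c2 [a2 ex2]]; set U := @upper R `\` K in pU c1 c2 *.
have oU : open U by exact: openD_compact (@open_upper R) cK.
have [B BP] := compactC_bounded cK.
have near1 := half_expansion_near_id ex1; have near2 := half_expansion_near_id ex2.
have far (P1 P2 : R) : exists y : R, [/\ 0 < y, P1 < y, P2 < y & B < y].
  exists (Num.max (Num.max 0 P1) (Num.max P2 B) + 1).
  by split; rewrite ltr_pwDr// !le_max lexx ?orbT.
have farU (y : R) : 0 < y -> B < y -> U (Ci * real_cplx y).
  move=> y0 By; split; first exact: upper_Ci.
  move=> /BP; rewrite cabsM cabs_Ci mul1r cabs_real ger0_norm ?(ltW y0)//; lra.
have absy (y : R) : 0 < y -> cabs (Ci * real_cplx y) = y.
  by move=> y0; rewrite cabsM cabs_Ci mul1r cabs_real ger0_norm// ltW.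
have e8 : 0 < 8^-1 :> R by rewrite invr_gt0.
have [M1 H1] := near1 _ e8; have [M2 H2] := near2 _ e8.
have [y [y0 y1 y2 yB]] := far M1 M2.
(* So far up that the closed unit disc around [z1] avoids [K] and both maps are within [8^-1] of the
   identity on it, as [near_id_deriv] requires. *)
pose z1 := Ci * real_cplx (y + 1) : C.
have y10 : 0 < y + 1 by lra.
have az1 : cabs z1 = y + 1 by exact: absy.
have disc w : cabs (w - z1) <= 1 -> U w /\ y <= cabs w.
  move=> wz; have yw : y <= cabs w.
    by have := lerB_cabs z1 (z1 - w); rewrite az1 subKr [cabs (z1 - w)]cabsC; lra.
  split=> //; split; last by move=> /BP; lra.
  have := le_trans (ler_Im_cabs _) wz; rewrite upperE /z1 !ReIm ler_norml => /andP[]; lra.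
have Uz1 : U z1 by apply: farU => //; lra.
move: (c1) (c2) => /conformalP[h1 /set_bijP_C[i1 _ _]] /conformalP[h2 /set_bijP_C[i2 _ _]].
have [l1 gl1] := h1 _ Uz1; have [l2 gl2] := h2 _ Uz1.
have l10 : l1 != 0.
  apply: near_id_deriv gl1 => w /disc[Uw yw]; first exact: h1.
  by apply: ltW; apply: H1 => //; exact: lt_le_trans yw.
have l20 : l2 != 0.
  apply: near_id_deriv gl2 => w /disc[Uw yw]; first exact: h2.
  by apply: ltW; apply: H2 => //; exact: lt_le_trans yw.
have one1 : cabs (1 : C) = 1 by exact: cabs1.
have [p10 p20] := (i1 _ Uz1, i2 _ Uz1).
have [k1 ck1 k10] := cderiv_cayley0 one1 p10; have [k2 ck2 k20] := cderiv_cayley0 one1 p20.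
have [ca1 E] := conformal_ratio oU pU (conformal_comp c1 (conformal_cayley one1 p10))
  (conformal_comp c2 (conformal_cayley one1 p20)) Uz1 (cayley0 1 (g1 z1)) (cayley0 1 (g2 z1))
  (cderiv_comp gl1 ck1) (cderiv_comp gl2 ck2) (mulf_neq0 k10 l10) (mulf_neq0 k20 l20).
set c := k1 * l1 / (k2 * l2) in ca1 E.
have c11 : c = 1.
  apply/eqP; rewrite -subr_eq0; apply/eqP; apply: cabs_small_eq0 => e e0.
  have [N1 I1] := cayley_infty 1 (g1 z1) (div2_gt0 e0).
  have [N2 I2] := cayley_infty 1 (g2 z1) (div2_gt0 e0).
  have [x1 [x10 x1a x1b _]] := far (N1 + 1) (N2 + 1).
  have [x2 [x20 x2a x2b x2B]] := far M1 (Num.max M2 x1).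
  have [x2c x2d] : M2 < x2 /\ x1 < x2 by move: x2b; rewrite gt_max => /andP.
  have Ux := farU _ x20 x2B; set x := Ci * real_cplx x2 in Ux.
  have ax : cabs x = x2 by exact: absy.
  have := H1 x Ux; have := H2 x Ux; rewrite ax => /(_ x2c) A2 /(_ x2a) A1.
  have b1 : N1 < cabs (g1 x).
    by have := lerB_cabs x (x - g1 x); rewrite ax subKr [cabs (x - _)]cabsC; lra.
  have b2 : N2 < cabs (g2 x).
    by have := lerB_cabs x (x - g2 x); rewrite ax subKr [cabs (x - _)]cabsC; lra.
  have D1 := I1 _ b1; have D2 := I2 _ b2; rewrite (E _ Ux) in D1.
  set q := cayley _ _ _ in D1 D2.
  have -> : c - 1 = (c * q - 1) - c * (q - 1) by ring.
  by apply: (le_trans (ler_cabsB _ _)); rewrite cabsM ca1 mul1r; lra.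
rewrite c11 in E.
pose p1 := g1 z1; pose p2 := g2 z1.
have d1 : p1 - cconj p1 != 0 by exact: conj_diff.
have d2 : p2 - cconj p2 != 0 by exact: conj_diff.
pose lam := (p1 - cconj p1) / (p2 - cconj p2); pose mu := cconj p1 - lam * cconj p2.
have aff z : U z -> g1 z = lam * g2 z + mu.
  move=> Uz; have := E _ Uz; rewrite mul1r /cayley !mul1r -/p1 -/p2.
  have n1 : g1 z - cconj p1 != 0 by apply: cayley_den => //; exact: ltW (i1 _ Uz).
  have n2 : g2 z - cconj p2 != 0 by apply: cayley_den => //; exact: ltW (i2 _ Uz).
  move=> /eqP; rewrite eqr_div// => /eqP H.
  have {}H : (g1 z - cconj p1) * (p2 - cconj p2) = (p1 - cconj p1) * (g2 z - cconj p2).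
    apply/eqP; rewrite -subr_eq0; apply/eqP.
    have -> : 0 = (g1 z - p1) * (g2 z - cconj p2) - (g2 z - p2) * (g1 z - cconj p1).
      by rewrite H subrr.
    ring.
  apply: (mulIf d2); rewrite /mu /lam.
  have -> : g1 z * (p2 - cconj p2) = (g1 z - cconj p1) * (p2 - cconj p2) + cconj p1 * (p2 - cconj p2) by ring.
  by rewrite H; field.
have close (e : R) : 0 < e -> exists M : R, forall y, M < y -> 
    cabs ((lam - 1) * g2 (Ci * real_cplx y) + mu) <= e /\ cabs (g2 (Ci * real_cplx y) - Ci * real_cplx y) <= e.
  move=> e0; have [N1 I1] := near1 _ (div2_gt0 e0); have [N2 I2] := near2 _ (div2_gt0 e0).
  have [x [x0 xa xb xB]] := far N1 N2; exists x => t xt.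
  have t0 : 0 < t by lra.
  have Ut : U (Ci * real_cplx t) by apply: farU => //; lra.
  have at_ := absy _ t0; set T := Ci * real_cplx t in Ut at_ *.
  have := I1 _ Ut; have := I2 _ Ut; rewrite at_ => /(_ (lt_trans xb xt)) A2 /(_ (lt_trans xa xt)) A1.
  split; last by apply: ltW; lra.
  have -> : (lam - 1) * g2 T + mu = (g1 T - T) - (g2 T - T) by rewrite aff//; ring.
  by apply: (le_trans (ler_cabsB _ _)); lra.
have lam1 : lam = 1.
  apply/eqP; rewrite -subr_eq0; apply/eqP; apply: cabs_small_eq0 => e e0.
  have [M HM] := close 1 ltr01.
  have ee : 0 < 2 / e by rewrite divr_gt0.
  (* The images of the two points under [g2] are at least [2 / e] apart, since [g2] moves each by at
     most 1, while [lam - 1] times their difference has modulus at most 2. *)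
  pose t1 := M + 1; pose t2 := t1 + (2 / e + 2).
  have [m1 m2] : M < t1 /\ M < t2 by rewrite /t2 /t1; split; lra.
  have [A1 B1] := HM _ m1; have [A2 B2] := HM _ m2.
  set T1 := Ci * real_cplx t1 in A1 B1; set T2 := Ci * real_cplx t2 in A2 B2.
  have T12 : cabs (T2 - T1) = 2 / e + 2.
    rewrite /T1 /T2 -mulrBr -rcB absy; last by rewrite /t2; lra.
    by rewrite /t2; ring.
  have G : 2 / e <= cabs (g2 T2 - g2 T1).
    have := lerB_cabsD (T2 - T1) ((g2 T2 - T2) - (g2 T1 - T1)); rewrite T12.
    have -> : T2 - T1 + (g2 T2 - T2 - (g2 T1 - T1)) = g2 T2 - g2 T1 by ring.
    have := ler_cabsB (g2 T2 - T2) (g2 T1 - T1); lra.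
  have : cabs ((lam - 1) * (g2 T2 - g2 T1)) <= 2.
    have -> : (lam - 1) * (g2 T2 - g2 T1) = ((lam - 1) * g2 T2 + mu) - ((lam - 1) * g2 T1 + mu) by ring.
    by apply: (le_trans (ler_cabsB _ _)); lra.
  rewrite cabsM => H.
  have {H} : cabs (lam - 1) * (2 / e) <= 2.
    by apply: le_trans H; apply: ler_wpM2l G; exact: cabs_ge0.
  by rewrite mulrA ler_pdivrMr//; lra.
have mu0 : mu = 0.
  apply: cabs_small_eq0 => e e0; have [M HM] := close _ e0.
  have [A _] := HM (M + 1) (ltr_pwDr ltr01 (lexx M)).
  by move: A; rewrite lam1 subrr mul0r add0r.
by move=> z Uz; rewrite aff// lam1 mu0 mul1r addr0.
Qed.

End Uniqueness.

(** * The radial Loewner flow at a boundary point *)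

Section FlowTools.
Variable R : realType.
Local Notation C := (Cplx R).
Local Notation cRe := (@complex.Re R : C -> R).
Local Notation cIm := (@complex.Im R : C -> R).
Implicit Types (D : set R) (f g : R -> C) (u v : R -> R) (s t m k a b : R) (l z w x : C).

Lemma rderiv_cabs2 D f t l : tderiv D f t l ->
  rderiv D (fun s => cabs (f s) ^+ 2) t (2 * cRe (cconj (f t) * l)).
Proof.
move=> fl; have := rderiv_Re (tderivM (tderiv_conj fl) fl).
rewrite (_ : (fun s => cRe (cconj (f s) * f s)) = (fun s => cabs (f s) ^+ 2)); last first.
  by apply/funext => s; rewrite cabs2_Re.
by apply: rderiv_eqd; rewrite !ReIm; ring.
Qed.

Lemma rderiv_sum D n (u : 'I_n -> R -> R) (m : 'I_n -> R) t : (forall i, rderiv D (u i) t (m i)) ->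
  rderiv D (fun s => \sum_(i < n) u i s) t (\sum_(i < n) m i).
Proof.
elim: n u m => [|n IH] u m um.
  rewrite big_ord0 (_ : (fun _ => _) = fun=> 0); first exact: rderiv_cst.
  by apply/funext => s; rewrite big_ord0.
rewrite big_ord_recr (_ : (fun _ => _) =
   fun s => (\sum_(i < n) u (widen_ord (leqnSn n) i) s) + u ord_max s).
  by apply: rderivD => //; apply: IH.
by apply/funext => s; rewrite big_ord_recr.
Qed.

(** Multiplied by [expR (-2 * m)] the squared modulus of [f] decreases, multiplied by [expR (2 * m)]
    it increases. Squares are used because the modulus itself need not be differentiable at zeros of
    [f]. *)
Lemma gronwall D f (k : R -> C) (m m' : R -> R) a b : a <= b -> (forall s, a <= s <= b -> D s) ->
  (forall s, a <= s <= b -> tderiv D f s (f s * k s)) ->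
  (forall s, a <= s <= b -> rderiv D m s (m' s)) ->
  (forall s, a <= s <= b -> cabs (k s) <= m' s) ->
  cabs (f b) <= cabs (f a) * expR (m b - m a) /\ cabs (f a) <= cabs (f b) * expR (m b - m a).
Proof.
move=> ab Dab df dm km.
have dy s : a <= s <= b -> rderiv D (fun s => cabs (f s) ^+ 2) s (2 * cabs (f s) ^+ 2 * cRe (k s)).
  move=> sab; apply: rderiv_eqd (rderiv_cabs2 (df _ sab)).
  by rewrite cabs2 !ReIm; ring.
have de (c : R) s : a <= s <= b -> rderiv D (fun s => expR (c * m s)) s (expR (c * m s) * (c * m' s)).
  by move=> sab; apply: rderiv_comp (rderivZ c (dm _ sab)); exact: is_derive_expR.
have Rek s : a <= s <= b -> cRe (k s) <= m' s /\ - m' s <= cRe (k s).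
  move=> /km; have := ler_Re_cabs (k s); rewrite ler_norml => /andP[]; lra.
have y0 s : 0 <= 2 * cabs (f s) ^+ 2 by rewrite mulr_ge0// sqr_ge0.
have sq (x y z : R) : 0 <= x -> 0 <= y -> x ^+ 2 <= y ^+ 2 * expR (2 * z) -> x <= y * expR z.
  move=> x0 y00 H; rewrite -(@ler_pXn2r _ 2) ?nnegrE ?mulr_ge0 ?expR_ge0//.
  by rewrite exprMn -expRM_natl.
split; apply: sq; rewrite ?cabs_ge0//.
- have : cabs (f b) ^+ 2 * expR (-2 * m b) <= cabs (f a) ^+ 2 * expR (-2 * m a).
    apply: (@rderiv_ge _ D (fun s => cabs (f s) ^+ 2 * expR (-2 * m s)) _ a b ab Dab).
      by move=> s sab; exact: rderivM (dy _ sab) (de _ _ sab).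
    move=> s sab; have [k1 k2] := Rek _ sab.
    have -> : 2 * cabs (f s) ^+ 2 * cRe (k s) * expR (-2 * m s) +
      cabs (f s) ^+ 2 * (expR (-2 * m s) * (-2 * m' s)) =
      - (2 * cabs (f s) ^+ 2 * expR (-2 * m s) * (m' s - cRe (k s))) by ring.
    by rewrite oppr_le0 !mulr_ge0 ?expR_ge0 ?cabs_ge0// subr_ge0.
  rewrite -ler_pdivlMr ?expR_gt0// -mulrA -expRN -expRD => /le_trans; apply.
  by rewrite le_eqVlt (_ : -2 * m a + - (-2 * m b) = 2 * (m b - m a)) ?eqxx//; ring.
- have : cabs (f a) ^+ 2 * expR (2 * m a) <= cabs (f b) ^+ 2 * expR (2 * m b).
    apply: (@rderiv_le _ D (fun s => cabs (f s) ^+ 2 * expR (2 * m s)) _ a b ab Dab).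
      by move=> s sab; exact: rderivM (dy _ sab) (de _ _ sab).
    move=> s sab; have [k1 k2] := Rek _ sab.
    have -> : 2 * cabs (f s) ^+ 2 * cRe (k s) * expR (2 * m s) +
      cabs (f s) ^+ 2 * (expR (2 * m s) * (2 * m' s)) =
      2 * cabs (f s) ^+ 2 * expR (2 * m s) * (m' s + cRe (k s)) by ring.
    by rewrite !mulr_ge0 ?expR_ge0 ?cabs_ge0//; lra.
  rewrite -ler_pdivlMr ?expR_gt0// -mulrA -expRN -expRD => /le_trans; apply.
  by rewrite le_eqVlt (_ : 2 * m b + - (2 * m a) = 2 * (m b - m a)) ?eqxx//; ring.
Qed.

Definition radial_field (W z : C) : C := z * ((W + z) / (W - z)).

(** Half the growth rate of [cabs z ^+ 2] along the radial flow. It is nonnegative in the disk, and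
    dividing by [1 - cabs z ^+ 2] leaves the inverse square distance to the driving point that the
    clock of a flow line measures. *)
Lemma radial_field_Re W z : cabs W = 1 -> W - z != 0 ->
  cRe (cconj z * radial_field W z) = cabs z ^+ 2 * (1 - cabs z ^+ 2) / cabs (W - z) ^+ 2.
Proof.
move=> W1 n0.
have d0 : cabs (W - z) ^+ 2 != 0 by rewrite sqrf_eq0 cabs_eq0.
have -> : cconj z * radial_field W z =
    real_cplx (cabs z ^+ 2) * ((W + z) * cconj (W - z)) * real_cplx (cabs (W - z) ^+ 2)^-1.
  have k0 : cconj (W - z) != 0 by rewrite -cabs_eq0 cabs_conj cabs_eq0.
  by rewrite rcV !cabs_sqr_conj /radial_field; field; rewrite n0 k0.
have := cabs2 W; rewrite W1 expr1n => E; rewrite ![in RHS]E !cabs2 in d0 *.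
rewrite !ReIm; set q := (_ + _)^-1; ring.
Qed.

(** The difference of two solutions therefore solves a linear equation, to which [gronwall]
    applies. *)
Lemma radial_field_diff W z w : W - z != 0 -> W - w != 0 ->
  radial_field W z - radial_field W w =
  (z - w) * (2 * W ^+ 2 / ((W - z) * (W - w)) - 1).
Proof. by move=> z0 w0; rewrite /radial_field; field; rewrite z0 w0. Qed.

Lemma id_holo U : holo U (fun z => z).
Proof. by move=> z _; exists 1; exact: cderiv_id. Qed.

Lemma schwarz h : holo (@disk R) h -> (forall z, disk z -> disk (h z)) -> h 0 = 0 ->
  forall z, disk z -> cabs (h z) <= cabs z.
Proof.
move=> hh hd h0 z dz; have d0 : disk (0 : C) by apply/diskE; rewrite cabs0.
have [l hl] := hh _ d0.
have ci : conformal (@disk R) (@disk R) (fun z => z).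
  apply/conformalP; split; first exact: id_holo.
  by apply/set_bijP_C; split=> // w dw; exists w.
have h1 w : disk w -> cabs (h w) <= 1 by move=> /hd/diskE/ltW.
have [q [_ _ _ qE q1]] := ratio_bound (@open_disk R) hh (@id_holo (@disk R)) d0 h0 (erefl _) hl
  (cderiv_id 0) (oner_neq0 _) h1 (fun z _ zn => zn) (conformal_disk_proper (@open_disk R) ci).
by rewrite qE// cabsM; apply: ler_piMl; [exact: cabs_ge0|exact: q1].
Qed.

Lemma disk_pseudo_dist (w u : C) : cabs (1 - cconj w * u) ^+ 2 - cabs (u - w) ^+ 2 =
  (1 - cabs w ^+ 2) * (1 - cabs u ^+ 2).
Proof. by rewrite !cabs2 !ReIm; ring. Qed.

(** The Schwarz-Pick inequality on the disc of radius [r] around [c]: rescale to the unit disk, send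
    [h c] to 0 by the automorphism [H], apply [schwarz], and translate back with [disk_pseudo_dist].
    The constants are crude, but the right-hand side is linear in the distance to the boundary of
    the disc. *)
Lemma schwarz_pick_disc h c (r : R) : 0 < r ->
  (forall z, cabs (z - c) < r -> exists l, cderiv h z l) ->
  (forall z, cabs (z - c) < r -> cabs (h z) < 1) ->
  forall z, cabs (z - c) < r ->
  (1 - cabs (h c)) / 2 * (1 - (cabs (z - c) / r) ^+ 2) <= 1 - cabs (h z) ^+ 2.
Proof.
move=> r0 hh h1 z zr; pose w := h c.
have w1 : cabs w < 1 by apply: h1; rewrite subrr cabs0.
have rn : real_cplx r != 0 :> C by rewrite rc_eq0 gt_eqF.
have den (u : C) : cabs u < 1 -> 1 - cabs w <= cabs (1 - cconj w * u).
  move=> u1; apply: le_trans (lerB_cabs _ _); rewrite cabs1 cabsM cabs_conj.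
  by rewrite lerD2l lerN2 ler_piMr ?cabs_ge0// ltW.
have den0 (u : C) : cabs u < 1 -> 1 - cconj w * u != 0.
  by move=> u1; rewrite -cabs_gt0; apply: lt_le_trans (den _ u1); rewrite subr_gt0.
pose H x := (h (c + real_cplx r * x) - w) / (1 - cconj w * h (c + real_cplx r * x)).
have dd x : disk x -> cabs (c + real_cplx r * x - c) < r.
  move=> /diskE x1; rewrite addrC addKr cabsM cabs_real ger0_norm ?ltW//.
  by rewrite -[ltRHS]mulr1 ltr_pM2l.
have hH : holo (@disk R) H.
  move=> x dx; have [l hl] := hh _ (dd _ dx).
  have D1 : cderiv (fun x => c + real_cplx r * x) x (0 + (0 * x + real_cplx r * 1)).
    exact: cderivD (cderiv_cst c x) (cderivM (cderiv_cst _ x) (cderiv_id x)).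
  have D2 := @cderiv_comp _ (fun x => c + real_cplx r * x) h x _ _ D1 hl.
  have D3 := cderivB D2 (cderiv_cst w x).
  have D4 := cderivB (cderiv_cst 1 x) (cderivM (cderiv_cst (cconj w) x) D2).
  eexists; apply: (@cderiv_div _ (fun x => h (c + real_cplx r * x) - w)
    (fun x => 1 - cconj w * h (c + real_cplx r * x)) x _ _ _ D3 D4).
  by apply: den0; apply: h1; exact: dd.
have HE x : disk x -> cabs (H x) < 1.
  move=> dx; have u1 := h1 _ (dd _ dx); set u := h _ in u1; have n0 := den0 _ u1.
  rewrite cabsM cabsV ltr_pdivrMr ?cabs_gt0// mul1r.
  rewrite -(@ltr_pXn2r _ 2) ?nnegrE ?cabs_ge0// -subr_gt0 disk_pseudo_dist.
  by rewrite mulr_gt0// subr_gt0 expr_lt1 ?cabs_ge0.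
have H0 : H 0 = 0 by rewrite /H mulr0 addr0 subrr mul0r.
pose x := (z - c) / real_cplx r.
have ax : cabs x = cabs (z - c) / r by rewrite cabsM cabsV cabs_real ger0_norm// ltW.
have dx : disk x by apply/diskE; rewrite ax ltr_pdivrMr// mul1r.
have xz : c + real_cplx r * x = z by rewrite /x mulrC divfK// addrC subrK.
have := schwarz hH (fun x dx => (diskE _).2 (HE x dx)) H0 dx.
have u1 := h1 _ zr; have n0 := den0 _ u1; have dn := den _ u1.
rewrite /H xz ax cabsM cabsV ler_pdivrMr ?cabs_gt0// => S.
set t := cabs (z - c) / r in S *.
have t0 : 0 <= t by rewrite divr_ge0 ?cabs_ge0// ltW.
have t1 : t < 1 by rewrite ltr_pdivrMr// mul1r.
have := disk_pseudo_dist w (h z).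
have d0 := cabs_ge0 (1 - cconj w * h z); have e0 := cabs_ge0 (h z - w).
have w0 := cabs_ge0 w.
set d := cabs (1 - _) in S dn d0 *; set e := cabs (h z - w) in S e0 *.
rewrite -/w; set a := cabs w in w0 w1 dn *; set b := 1 - cabs (h z) ^+ 2 => E.
have : e ^+ 2 <= t ^+ 2 * d ^+ 2 by rewrite -exprMn !expr2; apply: ler_pM.
have : (1 - a) ^+ 2 <= d ^+ 2 by rewrite !expr2; apply: ler_pM => //; rewrite subr_ge0 ltW.
move=> P1 P2.
have tt : 0 <= 1 - t ^+ 2 by nra.
have : (1 - t ^+ 2) * (1 - a) ^+ 2 <= (1 - a ^+ 2) * b.
  rewrite -E; apply: (@le_trans _ _ ((1 - t ^+ 2) * d ^+ 2)).
    by apply: ler_wpM2l.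
  lra.
have -> : (1 - a ^+ 2) * b = (1 - a) * ((1 + a) * b) by ring.
have -> : (1 - t ^+ 2) * (1 - a) ^+ 2 = (1 - a) * ((1 - t ^+ 2) * (1 - a)) by ring.
have a1 : 0 < 1 - a by lra.
rewrite ler_pM2l// => P3.
have P4 : 0 <= (1 - t ^+ 2) * (1 - a) by rewrite mulr_ge0// ltW.
have b0 : 0 <= b.
  have : 0 <= (1 + a) * b by exact: le_trans P3.
  by rewrite pmulr_rge0//; lra.
have : (1 + a) * b <= 2 * b by apply: ler_wpM2r => //; lra.
lra.
Qed.

(* Discs internally tangent to the unit circle give a linear lower bound on the
   distance to the boundary, as in Hopf's lemma. *)
Lemma hopf_boundary h x (r : R) : cabs x = 1 -> 0 < r <= 2^-1 ->
  (forall z, cabs z < 1 -> cabs (z - x) < r -> exists l, cderiv h z l) ->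
  (forall z, cabs z < 1 -> cabs (z - x) < r -> cabs (h z) < 1) ->
  exists2 c : R, 0 < c & forall z, cabs z < 1 -> cabs (z - x) < r / 4 ->
    c * (1 - cabs z ^+ 2) <= 1 - cabs (h z) ^+ 2.
Proof.
move=> x1 /andP[r0 r2] hh h1; pose p := r / 8.
have p0 : 0 < p by rewrite divr_gt0.
pose K := [set z | [set w : C | cabs (w - x) <= r / 2] z /\ cabs z <= 1 - p].
have cK : compact K.
  by apply: compact_sublevel; [exact: compact_closed_disc|move=> z _; exact: continuous_cabs].
have KU z : K z -> cabs z < 1 /\ cabs (z - x) < r by move=> [/= k1 k2]; split; rewrite /p in k2; lra.
have K0 : K !=set0.
  exists (real_cplx (1 - p) * x); split => /=; rewrite ?cabsM ?cabs_real.
    have -> : real_cplx (1 - p) * x - x = - (real_cplx p * x).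
      by rewrite rcB rc1; ring.
    by rewrite cabsN cabsM cabs_real x1 mulr1 ger0_norm ?ltW//; rewrite /p; lra.
  by rewrite x1 mulr1 ger0_norm// /p; lra.
have cu : {within K, continuous (fun z => cabs (h z))}.
  apply: continuous_in_subspaceT => z; rewrite inE => /KU[k1 k2].
  have [l hl] := hh _ k1 k2; have ch := cderiv_continuous hl.
  exact: (@cvgC_abs _ _ (nbhs z) _ h (h z) ch).
have [q] := compact_EVT_max K0 cK cu; rewrite inE => Kq qmax.
pose e := 1 - cabs (h q).
have e0 : 0 < e by rewrite subr_gt0; have [k1 k2] := KU _ Kq; exact: h1.
have e1 : e <= 1 by rewrite /e; have := cabs_ge0 (h q); lra.
have eK z : K z -> e <= 1 - cabs (h z).
  by move=> Kz; rewrite /e lerD2l lerN2; apply: qmax; rewrite inE.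
(* Points in [K] allow the constant [e], points nearer to the circle the constant [e / (4 * p)]; the
   denominator [4 * p + 1] serves both. *)
exists (e / (4 * p + 1)); first by rewrite divr_gt0// addr_gt0// mulr_gt0.
move=> z z1 zx.
have zn : 2^-1 < cabs z.
  by have := lerB_cabs x (x - z); rewrite subKr x1 [cabs (x - z)]cabsC; lra.
have z00 : 0 <= 1 - cabs z ^+ 2 by rewrite subr_ge0 expr_le1 ?cabs_ge0 ?ltW.
have p4 : 1 < 4 * p + 1 by rewrite ltrDr mulr_gt0.
have p40 : 0 < 4 * p + 1 by lra.
have [zp|zp] := leP (cabs z) (1 - p).
  have Kz : K z by split => //=; lra.
  have h0 := cabs_ge0 (h z).
  have A : e <= 1 - cabs (h z) ^+ 2 by have := eK _ Kz; have := h1 _ z1; nra.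
  apply: le_trans A; rewrite mulrAC ler_pdivrMr// -[leRHS]mulr1 -mulrA ler_pM2l//.
  have : 1 - cabs z ^+ 2 <= 1 by have := sqr_ge0 (cabs z); lra.
  lra.
have az0 : 0 < cabs z by lra.
(* The centre, on the ray of [z], of the disc of radius [p] that is internally tangent to the unit
   circle. It belongs to [K], so [1 - cabs (h m) >= e]. *)
pose m := real_cplx ((1 - p) / cabs z) * z.
have zm : cabs (z - m) = cabs z - (1 - p).
  have -> : z - m = real_cplx (1 - (1 - p) / cabs z) * z by rewrite /m rcB rc1; ring.
  rewrite cabsM cabs_real ger0_norm; first by field; rewrite gt_eqF.
  by rewrite subr_ge0 ler_pdivrMr// mul1r ltW.
have p18 : p <= 16^-1 by rewrite /p; lra.
have am : cabs m = 1 - p.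
  rewrite /m cabsM cabs_real ger0_norm; first by rewrite divfK// gt_eqF.
  by rewrite divr_ge0 ?cabs_ge0//; lra.
have mx : cabs (m - x) < r / 4 + p.
  have := ler_cabsD (m - z) (z - x); rewrite addrA subrK [cabs (m - z)]cabsC; lra.
have Km : K m by split => /=; rewrite ?am// /p in mx *; lra.
have disc w : cabs (w - m) < p -> cabs w < 1 /\ cabs (w - x) < r.
  move=> wm; have := ler_cabsD (w - m) m; have := ler_cabsD (w - m) (m - x).
  rewrite addrA !subrK; split; first by lra.
  by rewrite /p in wm mx *; lra.
have zmp : cabs (z - m) < p by lra.
have := @schwarz_pick_disc h m p p0 (fun w wm => hh w (disc w wm).1 (disc w wm).2)
  (fun w wm => h1 w (disc w wm).1 (disc w wm).2) z zmp.
apply: le_trans; have em := eK _ Km.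
pose y := 1 - cabs z; have y0 : 0 < y by rewrite subr_gt0.
have yp : y < p by rewrite /y; lra.
have -> : cabs (z - m) / p = 1 - y / p by rewrite zm /y; field; rewrite gt_eqF.
have yq : y / p < 1 by rewrite ltr_pdivrMr// mul1r.
have yq0 : 0 < y / p by rewrite divr_gt0.
have A : y / p <= 1 - (1 - y / p) ^+ 2 by nra.
apply: (@le_trans _ _ (e / 2 * (y / p))); last first.
  apply: ler_pM => //; [lra|exact: ltW|by rewrite ler_pM2r ?invr_gt0].
have -> : e / 2 * (y / p) = e / (4 * p) * (2 * y) by field; rewrite gt_eqF.
apply: ler_pM => //; [by rewrite divr_ge0// ltW| |].
  by rewrite ler_pM2l// lef_pV2 ?posrE ?mulr_gt0// lerDl.
rewrite /y; have := cabs_ge0 z; nra.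
Qed.

End FlowTools.

(** * Curves near the unit circle *)

Section BoundaryFlow.
Variable R : realType.
Local Notation C := (Cplx R).
Local Notation cRe := (@complex.Re R : C -> R).
Local Notation cIm := (@complex.Im R : C -> R).
Implicit Types (s t a b e : R) (z w : C).

Lemma tderiv_expi (D : set R) t : tderiv D (@expi R) t (Ci * expi t).
Proof.
have d1 : tderiv D (fun s => Ci * real_cplx s) t (0 * real_cplx t + Ci * 1).
  exact: tderivM (tderiv_cst D Ci t) (tderiv_id D t).
have E s : cexp (Ci * real_cplx s) = expi s.
  rewrite /cexp; have -> : cRe (Ci * real_cplx s) = 0 by rewrite !ReIm; ring.
  have -> : cIm (Ci * real_cplx s) = s by rewrite !ReIm; ring.
  by rewrite expR0 mul1r.
have := tderiv_comp (cderiv_cexp (Ci * real_cplx t)) d1.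
rewrite E mul0r add0r mulr1 mulrC; congr (tderiv D _ t _).
by apply/funext => s; rewrite E.
Qed.

Lemma expi_lipschitz a b : cabs (expi b - expi a) <= `|b - a|.
Proof.
wlog ab : a b / a <= b => [H|].
  have [ab|/ltW ba] := leP a b; first exact: H.
  by rewrite cabsC distrC; exact: H.
rewrite ger0_norm ?subr_ge0//.
apply: (@tderiv_bound _ [set: R] (@expi R) (fun s => Ci * expi s) id (fun=> 1)) => // s _.
- exact: tderiv_expi.
- exact: rderiv_id.
- by rewrite cabsM cabs_Ci cabs_expi mulr1.
Qed.

Lemma expi_chord a b s : 0 < s -> s <= b - a -> b - a <= pi / 2 -> sin s <= cabs (expi b - expi a).
Proof.
move=> s0 sb bp.
have -> : expi b - expi a = expi a * (expi (b - a) - 1).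
  by rewrite mulrBr mulr1 -expiD (addrC a) subrK.
rewrite cabsM cabs_expi mul1r; apply: le_trans (ler_Im_cabs _).
rewrite !ReIm subr0; apply: le_trans (ler_norm _).
have p0 := @pi_gt0 R.
have [<-//|ne] := eqVneq s (b - a).
by rewrite ltW// ltr_sin ?in_itv /= ?lt_neqAle ?ne ?sb//; apply/andP; split; lra.
Qed.

(** With equal signs at the two ends, the end value of smaller modulus would lie between [k 0] and
    the value at the other end, and so would be attained on the other half of the interval, against
    the last two hypotheses. *)
Lemma sign_change (k : R -> R) (d m : R) : 0 < d -> {within `[- d, d], continuous k} ->
  `|k 0| <= m -> m < `|k d| -> m < `|k (- d)| ->
  (forall a, - d <= a <= 0 -> k a <> k d) -> (forall a, 0 <= a <= d -> k a <> k (- d)) ->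
  k (- d) * k d <= 0.
Proof.
move=> d0 ck k0 kd kn H1 H2.
have cl : {within `[- d, 0], continuous k}.
  by apply: continuous_subspaceW ck; apply: subset_itvl; rewrite bnd_simp ltW.
have cr : {within `[0, d], continuous k}.
  by apply: continuous_subspaceW ck; apply: subset_itvr; rewrite bnd_simp oppr_le0 ltW.
have n0 : - d <= 0 by lra.
have d00 := ltW d0.
rewrite leNgt; apply/negP => P.
have IL v : Num.min (k (- d)) (k 0) <= v <= Num.max (k (- d)) (k 0) -> v <> k d.
  by move=> /(IVT n0 cl)[c]; rewrite in_itv => cI <-; exact: H1.
have IR v : Num.min (k 0) (k d) <= v <= Num.max (k 0) (k d) -> v <> k (- d).
  by move=> /(IVT d00 cr)[c]; rewrite in_itv => cI <-; exact: H2.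
have [kd0|kd0] := ltP 0 (k d).
  have kn0 : 0 < k (- d) by rewrite -(pmulr_lgt0 _ kd0).
  rewrite (gtr0_norm kd0) in kd; rewrite (gtr0_norm kn0) in kn.
  move: k0; rewrite ler_norml => /andP[_ k0].
  have [h|/ltW h] := leP (k d) (k (- d)).
    by apply: (IL (k d)) => //; rewrite ge_min le_max h; apply/andP; split=> //; apply/orP; right; lra.
  by apply: (IR (k (- d))) => //; rewrite ge_min le_max h orbT; apply/andP; split=> //; apply/orP; left; lra.
have kd1 : k d < 0 by rewrite lt_neqAle kd0 andbT; apply: contraTneq P => ->; rewrite mulr0 ltxx.
have kn0 : k (- d) < 0 by rewrite -(nmulr_lgt0 _ kd1).
rewrite (ltr0_norm kd1) in kd; rewrite (ltr0_norm kn0) in kn.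
move: k0; rewrite ler_norml => /andP[k0 _].
have [h|/ltW h] := leP (k (- d)) (k d).
  by apply: (IL (k d)) => //; rewrite ge_min le_max h; apply/andP; split=> //; apply/orP; right; lra.
by apply: (IR (k (- d))) => //; rewrite ge_min le_max h orbT; apply/andP; split=> //; apply/orP; left; lra.
Qed.

Lemma grid_sign_change (u : nat -> R) n : (0 < n)%N -> u 0%N * u n <= 0 ->
  exists2 j, (j < n)%N & u j * u j.+1 <= 0.
Proof.
elim: n => // n IH _ H; have [n0|n0] := posnP n.
  by exists 0%N; rewrite // n0 in H *.
have [h|h] := leP (u 0%N * u n) 0.
  by have [j jn uj] := IH n0 h; exists j => //; exact: ltnW.
exists n => //; rewrite leNgt; apply/negP => h2.
have := mulr_gt0 h h2; have un : 0 <= u n ^+ 2 by exact: sqr_ge0.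
have -> : u 0%N * u n * (u n * u n.+1) = (u 0%N * u n.+1) * u n ^+ 2 by ring.
by apply/negP; rewrite -leNgt; rewrite mulr_le0_ge0.
Qed.

Lemma opposite_sign_le (p q : R) : p * q <= 0 -> `|p| <= `|p - q|.
Proof.
move=> pq; have [p0|p0] := leP 0 p.
  have [q0|q0] := leP q 0; first by rewrite !ger0_norm; lra.
  have -> : p = 0 by nra.
  by rewrite normr0.
have [q0|q0] := leP 0 q; first by rewrite !ler0_norm; lra.
by nra.
Qed.

Lemma grid_step (M eta : R) (N : nat) : (0 < N)%N -> 0 < eta -> M * eta <= 8^-1 ->
  M * `|2 * eta / N%:R| <= 1 / (4 * N%:R).
Proof.
move=> NN eta0 Meta; have N0 : 0 < N%:R :> R by rewrite ltr0n.
have q0 : 0 < 2 * eta / N%:R by rewrite divr_gt0// mulr_gt0.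
rewrite gtr0_norm//.
have -> : M * (2 * eta / N%:R) = (2 * (M * eta)) / N%:R by ring.
have -> : 1 / (4 * N%:R) = 4^-1 / N%:R :> R by field; rewrite gt_eqF.
by rewrite ler_pM2r ?invr_gt0//; lra.
Qed.

(* A curve close to [1] that stays in the unit disc and is bi-Lipschitz at scale
   [eta] crosses the ray through [1], so that a fine grid of its points comes
   close to [1]. *)
Lemma grid_near_one (u : R -> C) (M eta kap e : R) (N : nat) : (0 < N)%N -> 1 <= M ->
  0 < eta -> M * eta <= 8^-1 -> 0 < kap -> kap <= 16^-1 -> 0 < e -> e <= N%:R^-1 -> e <= kap ->
  (forall a b, - eta <= a <= eta -> - eta <= b <= eta -> cabs (u a - u b) <= M * `|a - b|) ->
  (forall a b, - eta <= a <= eta -> - eta <= b <= eta -> eta <= b - a ->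
     8 * kap <= cabs (u b - u a)) ->
  (forall a, - eta <= a <= eta -> 1 - e <= cabs (u a) <= 1) ->
  cabs (u 0 - 1) <= kap ->
  exists2 j : nat, (j <= N)%N & cabs (u (- eta + 2 * eta / N%:R * j%:R) - 1) <= 4 / N%:R.
Proof.
move=> NN M1 eta0 Meta kap0 kap16 e0 eN ek lipu low uabs u0.
have M0 : 0 < M by lra.
have N0 : 0 < N%:R :> R by rewrite ltr0n.
have N1 : 1 <= N%:R :> R by rewrite ler1n.
have e8 : e <= 16^-1 by lra.
pose aj (j : nat) : R := - eta + 2 * eta / N%:R * j%:R.
have ajI (j : nat) : (j <= N)%N -> - eta <= aj j <= eta.
  move=> jN; have jN' : j%:R <= N%:R :> R by rewrite ler_nat.
  have j0 : 0 <= j%:R :> R by [].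
  have q0 : 0 <= 2 * eta / N%:R by rewrite divr_ge0// ?mulr_ge0// ltW.
  rewrite /aj lerDl mulr_ge0//=.
  have : 2 * eta / N%:R * j%:R <= 2 * eta / N%:R * N%:R by rewrite ler_wpM2l.
  by rewrite divfK ?gt_eqF//; lra.
have udist a : - eta <= a <= eta -> cabs (u a - 1) <= 1 / 4.
  move=> aI; have z0 : - eta <= (0:R) <= eta by apply/andP; split; lra.
  have := lipu a 0 aI z0; rewrite subr0 => h1.
  have h2 : `|a| <= eta by rewrite ler_norml.
  have h3 : M * `|a| <= M * eta by rewrite ler_pM2l.
  have := ler_cabsD (u a - u 0) (u 0 - 1); rewrite addrA subrK; have := u0; lra.
(* Close to the unit circle [1 - cRe] is second order in the distance to 1, up to [e]; hence the
   imaginary part alone controls this distance. *)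
have uRe a : - eta <= a <= eta -> 1 - cRe (u a) <= e + cabs (u a - 1) / 8 /\ 1 - cRe (u a) >= 0.
  move=> aI; have /andP[b1 b2] := uabs a aI; have b3 := udist a aI.
  have E : 2 * (1 - cRe (u a)) = 1 - cabs (u a) ^+ 2 + cabs (u a - 1) ^+ 2.
    by rewrite !cabs2 !ReIm; ring.
  have := cabs_ge0 (u a); have := cabs_ge0 (u a - 1).
  set p := cabs (u a - 1) in b3 E *; set q := cabs (u a) in b1 b2 E *.
  have := ler_Re_cabs (u a); rewrite -/q ler_norml => /andP[_ rq].
  move=> p0 q0; clear - b1 b2 b3 E rq p0 q0; split; last by lra.
  have A1 : p ^+ 2 <= p * (1 / 4) by rewrite expr2 ler_wpM2l.
  have A2 : 1 - q ^+ 2 <= 2 * e by nra.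
  lra.
have uIm a : - eta <= a <= eta -> cabs (u a - 1) <= 2 * (`|cIm (u a)| + e).
  move=> aI; have [c1 c2] := uRe a aI.
  have := cabs_le_ReIm (u a - 1); rewrite !ReIm oppr0 addr0.
  rewrite -(normrN (cRe (u a) - 1)) opprB ger0_norm//.
  have := cabs_ge0 (u a - 1); have := normr_ge0 (cIm (u a)); lra.
(* Near 1 and within [e] of the circle, the imaginary part determines a point up to [2 * e]. As
   [e <= kap], this contradicts [low] for parameters at least [eta] apart, which is how the
   exclusion hypotheses of [sign_change] are met. *)
have inj a b : - eta <= a <= eta -> - eta <= b <= eta -> cIm (u a) = cIm (u b) ->
    cabs (u a - u b) <= 2 * e.
  move=> aI bI E; have [c1 c2] := uRe a aI; have [d1 d2] := uRe b bI.
  have /andP[a1 a2] := uabs a aI; have /andP[b1 b2] := uabs b bI.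
  have a3 := udist a aI; have b3 := udist b bI.
  apply: (le_trans (cabs_le_ReIm _)); rewrite !ReIm E subrr normr0 addr0.
  have Ea := cabs2 (u a); have Eb := cabs2 (u b); rewrite E in Ea.
  clear - a1 a2 b1 b2 a3 b3 Ea Eb c1 c2 d1 d2 e0 e8 E.
  have q1 : 1 - 2 * e <= cabs (u a) ^+ 2 by nra.
  have q2 : 1 - 2 * e <= cabs (u b) ^+ 2 by nra.
  have q3 : cabs (u a) ^+ 2 <= 1 by rewrite expr_le1 ?cabs_ge0.
  have q4 : cabs (u b) ^+ 2 <= 1 by rewrite expr_le1 ?cabs_ge0.
  have ra : 1 / 2 <= cRe (u a) by lra.
  have rb : 1 / 2 <= cRe (u b) by lra.
  rewrite ler_norml; apply/andP; split; nra.
have z0 : - eta <= (0:R) <= eta by apply/andP; split; lra.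
have zp : - eta <= eta <= eta by rewrite lexx andbT; lra.
have zm : - eta <= - eta <= eta by rewrite lexx /=; lra.
(* Such a point is at distance at least [8 * kap] from [u 0], hence at least [7 * kap] from 1. *)
have big a : - eta <= a <= eta -> eta <= `|a| -> kap < `|cIm (u a)|.
  move=> aI ha; have l8 : 8 * kap <= cabs (u a - u 0).
    have [a0|/ltW a0] := leP 0 a.
      by apply: low => //; rewrite ger0_norm// in ha; lra.
    by rewrite cabsC; apply: low => //; rewrite ler0_norm// in ha; lra.
  have := uIm a aI; have := ler_cabsD (u a - 1) (1 - u 0).
  by rewrite addrA subrK [cabs (1 - u 0)]cabsC; lra.
have cont : {within `[- eta, eta], continuous (fun a => cIm (u a))}.
  apply/subspace_continuousP => a /=; rewrite in_itv /= => aI.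
  apply/cvgrPdist_lt => d d0; apply/within_nbhsP; exists (d / M); first by rewrite divr_gt0.
  move=> b ba; rewrite /= in_itv /= => bI.
  rewrite ltr_pdivlMr// mulrC distrC in ba.
  by apply: le_lt_trans ba; apply: le_trans (lipu _ _ aI bI); rewrite -cImN -cImD ler_Im_cabs.
have sc : cIm (u (- eta)) * cIm (u eta) <= 0.
  apply: (@sign_change (fun a => cIm (u a)) eta kap) => //.
  - have := ler_Im_cabs (u 0 - 1); rewrite !ReIm oppr0 addr0; lra.
  - by apply: big => //; rewrite ger0_norm// ltW.
  - by apply: big => //; rewrite normrN ger0_norm// ltW.
  - move=> a /andP[a1 a2] E; have aI : - eta <= a <= eta by apply/andP; split; lra.
    have := inj _ _ aI zp E; have := low a eta aI zp; rewrite cabsC; lra.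
  - move=> a /andP[a1 a2] E; have aI : - eta <= a <= eta by apply/andP; split; lra.
    have := inj _ _ aI zm E; have := low (- eta) a zm aI; lra.
have aj0 : aj 0%N = - eta by rewrite /aj mulr0 addr0.
have ajN : aj N = eta by rewrite /aj divfK ?gt_eqF//; ring.
have [j jN uj] := @grid_sign_change (fun j => cIm (u (aj j))) N NN
  (eq_ind_r (fun q => cIm (u q) * _ <= 0) (eq_ind_r (fun q => _ * cIm (u q) <= 0) sc ajN) aj0).
exists j; first exact: ltnW.
have I1 := ajI j (ltnW jN); have I2 := ajI j.+1 jN.
have st : M * `|aj j - aj j.+1| <= 1 / (4 * N%:R).
  have -> : aj j - aj j.+1 = - (2 * eta / N%:R) by rewrite /aj (_ : j.+1%:R = j%:R + 1) ?natr1//; ring.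
  by rewrite normrN; exact: grid_step.
have d1 := le_trans (lipu _ _ I1 I2) st.
have d2 : `|cIm (u (aj j)) - cIm (u (aj j.+1))| <= 1 / (4 * N%:R).
  by apply: le_trans d1; rewrite -cImN -cImD ler_Im_cabs.
have d3 : `|cIm (u (aj j))| <= `|cIm (u (aj j)) - cIm (u (aj j.+1))|.
  exact: opposite_sign_le.
have d4 : 1 / (4 * N%:R) <= N%:R^-1 :> R.
  by rewrite div1r lef_pV2 ?posrE ?mulr_gt0//; lra.
have := uIm _ I1.
have -> : 4 / N%:R = 2 * (N%:R^-1 + N%:R^-1) :> R by field; rewrite gt_eqF.
rewrite -/(aj j); lra.
Qed.

End BoundaryFlow.

(* [lra] compares atoms up to conversion, which is slow on complex numbers. *)
Ltac lrac :=
  repeat match goal with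
  | H : (forall _, _) |- _ => clear H
  | |- context [@cabs ?R ?z] => let p := fresh "p" in set p := @cabs R z in *; clearbody p
  | H : context [@cabs ?R ?z] |- _ => let p := fresh "p" in set p := @cabs R z in *; clearbody p
  end; lra.

(** * The clock of a flow line and the distance to the driving point *)

Section LoewnerFlow.
Variable R : realType.
Local Notation C := (Cplx R).
Local Notation cRe := (@complex.Re R : C -> R).
Local Notation cIm := (@complex.Im R : C -> R).
Implicit Types (s t a b e : R) (z w : C).

Section Flow.
Variables (T : R) (W : R -> C) (g : R -> C -> C) (x : C) (r c : R).
Local Notation I := [set t : R | 0 <= t <= T].
Hypothesis T0 : 0 <= T.
Hypothesis W1 : forall t, 0 <= t <= T -> cabs (W t) = 1.
Hypothesis Wc : forall t, 0 <= t <= T -> W @ within I (nbhs t) --> W t.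
Hypothesis x1 : cabs x = 1.
Hypothesis r2 : 0 < r <= 2^-1.
Definition near_bd z := cabs z < 1 /\ cabs (z - x) < r.
Hypothesis g0 : forall z, near_bd z -> g 0 z = z.
Hypothesis g1 : forall z t, near_bd z -> 0 <= t <= T -> cabs (g t z) < 1.
Hypothesis dg : forall z t, near_bd z -> 0 <= t <= T ->
  tderiv I (fun s => g s z) t (radial_field (W t) (g t z)).
Hypothesis c0 : 0 < c.
Hypothesis hopf : forall z, near_bd z -> c * (1 - cabs z ^+ 2) <= 1 - cabs (g T z) ^+ 2.

Let I0 : 0 <= (0 : R) <= T. Proof. by rewrite lexx. Qed.
Let IT : 0 <= T <= T. Proof. by rewrite lexx T0. Qed.
Let Isub s t e : 0 <= s -> t <= T -> s <= e <= t -> 0 <= e <= T.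
Proof. by move=> s0 tT /andP[se et]; rewrite (le_trans s0 se) (le_trans et tT). Qed.

Let Wg z t : near_bd z -> 0 <= t <= T -> W t - g t z != 0.
Proof.
move=> Uz tI; rewrite subr_eq0; apply/eqP => E; have := g1 Uz tI.
by rewrite -E W1// ltxx.
Qed.

Lemma bd_half z : near_bd z -> 2^-1 <= cabs z.
Proof.
move=> [_ zx]; have := lerB_cabs x (x - z); rewrite subKr x1 [cabs (x - z)]cabsC.
by case/andP: r2; lra.
Qed.

Lemma flow_abs_mono z s t : near_bd z -> 0 <= s -> s <= t -> t <= T ->
  cabs (g s z) ^+ 2 <= cabs (g t z) ^+ 2.
Proof.
move=> Uz s0 st tT.
apply: (@rderiv_le _ I (fun s => cabs (g s z) ^+ 2) _ s t st) => [e|e|e] est.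
- exact: (Isub s0 tT est).
- exact: rderiv_cabs2 (dg Uz (Isub s0 tT est)).
- have eI := Isub s0 tT est; rewrite radial_field_Re ?W1 ?Wg//.
  rewrite mulr_ge0// divr_ge0 ?sqr_ge0// mulr_ge0 ?sqr_ge0// subr_ge0.
  by rewrite expr_le1 ?cabs_ge0// ltW// g1.
Qed.

Lemma flow_abs z t : near_bd z -> 0 <= t <= T -> cabs z <= cabs (g t z).
Proof.
move=> Uz /andP[t0 tT]; have := flow_abs_mono Uz (lexx 0) t0 tT; rewrite g0//.
by rewrite ler_pXn2r ?nnegrE ?cabs_ge0.
Qed.

(** A potential for the inverse square distance to the driving point: its derivative is
    [clock_rate], and the factor 2 makes this at least [1 / cabs (W t - g t z) ^+ 2] as soon as
    [cabs (g t z) >= 2^-1]. The Hopf type hypothesis bounds its total increase by [2 * ln] of the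
    constant, in absolute value, uniformly in [z]. *)
Definition clock z t : R := - 2 * ln (1 - cabs (g t z) ^+ 2).
Definition clock_rate z t : R := 4 * cabs (g t z) ^+ 2 / cabs (W t - g t z) ^+ 2.

Let g2 z t : near_bd z -> 0 <= t <= T -> 0 < 1 - cabs (g t z) ^+ 2.
Proof. by move=> Uz tI; rewrite subr_gt0 expr_lt1 ?cabs_ge0// g1. Qed.

Lemma rderiv_clock z t : near_bd z -> 0 <= t <= T -> rderiv I (clock z) t (clock_rate z t).
Proof.
move=> Uz tI; have p := g2 Uz tI.
have d1 := rderivB (rderiv_cst I 1 t) (rderiv_cabs2 (dg Uz tI)).
have d2 := @rderiv_comp _ I (fun s => 1 - cabs (g s z) ^+ 2) (@ln R) t _ _ (is_derive1_ln p) d1.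
apply: rderiv_eqd (rderivZ (- 2) d2); rewrite radial_field_Re ?W1 ?Wg// /clock_rate.
have d0 : cabs (W t - g t z) != 0 by rewrite cabs_eq0 Wg.
by field; rewrite ?d0 ?gt_eqF.
Qed.

Lemma clock_rate_ge z t : near_bd z -> 0 <= t <= T -> (cabs (W t - g t z) ^+ 2)^-1 <= clock_rate z t.
Proof.
move=> Uz tI; rewrite -[leLHS]mul1r; apply: ler_wpM2r; first by rewrite invr_ge0 sqr_ge0.
have := flow_abs Uz tI; have := bd_half Uz; set A := cabs z; set B := cabs _; nra.
Qed.

Lemma clock_rate_ge0 z t : 0 <= clock_rate z t.
Proof. by rewrite /clock_rate; apply: divr_ge0; [apply: mulr_ge0 => //; exact: sqr_ge0|exact: sqr_ge0]. Qed.

Definition total_clock : R := 2 * `|ln c|.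
Local Notation L := total_clock.

Lemma clock_mono z s t : near_bd z -> 0 <= s -> s <= t -> t <= T -> clock z s <= clock z t.
Proof.
move=> Uz s0 st tT; apply: (@rderiv_le _ I _ (clock_rate z) s t st) => [e|e|e] est.
- exact: (Isub s0 tT est).
- exact: rderiv_clock Uz (Isub s0 tT est).
- exact: clock_rate_ge0.
Qed.

Lemma clock_bound z s t : near_bd z -> 0 <= s -> s <= t -> t <= T -> clock z t - clock z s <= L.
Proof.
move=> Uz s0 st tT.
have h1 := clock_mono Uz (lexx 0) s0 (le_trans st tT).
have h2 := clock_mono Uz (le_trans s0 st) tT (lexx T).
suff : clock z T - clock z 0 <= L by lra.
have p0 := g2 Uz I0; rewrite g0// in p0; have pT := g2 Uz IT.
rewrite /clock g0//.
have : ln (c * (1 - cabs z ^+ 2)) <= ln (1 - cabs (g T z) ^+ 2).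
  by rewrite ler_ln ?posrE ?mulr_gt0// hopf.
rewrite lnM ?posrE// /total_clock; have := ler_norm (- ln c); rewrite normrN; lra.
Qed.

Let L0 : 0 <= L. Proof. by rewrite /total_clock mulr_ge0. Qed.

Definition lip : R := expR (T + 2 * L).
Local Notation M := lip.

Lemma lip_ge1 : 1 <= M.
Proof. by rewrite /lip -expR0 ler_expR addr_ge0// mulr_ge0. Qed.

(** The coefficient in the linear equation of [g s z - g s w] is at most 1 plus twice the product of
    the two inverse distances to the driving point, hence at most 1 plus both clock rates. Its
    integral is therefore bounded uniformly in both points, although the field is singular. *)
Lemma flow_bilipschitz z w t : near_bd z -> near_bd w -> 0 <= t <= T ->
  cabs (g t z - g t w) <= cabs (z - w) * M /\ cabs (z - w) <= cabs (g t z - g t w) * M.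
Proof.
move=> Uz Uw tI; have /andP[t0 tT] := tI.
pose m s := s + clock z s + clock w s.
have [] := @gronwall _ I (fun s => g s z - g s w)
  (fun s => 2 * W s ^+ 2 / ((W s - g s z) * (W s - g s w)) - 1) m
  (fun s => 1 + clock_rate z s + clock_rate w s) 0 t t0.
- by move=> s st; exact: (Isub (lexx 0) tT st).
- move=> s st; have sI := Isub (lexx 0) tT st.
  by rewrite -radial_field_diff ?Wg//; exact: tderivB (dg Uz sI) (dg Uw sI).
- move=> s st; have sI := Isub (lexx 0) tT st.
  exact: rderivD (rderivD (rderiv_id I s) (rderiv_clock Uz sI)) (rderiv_clock Uw sI).
- move=> s st; have sI := Isub (lexx 0) tT st.
  apply: (le_trans (ler_cabsB _ _)); 
  rewrite cabs1 (cabsM (2 * W s ^+ 2)) (cabsM 2) cabsX W1// expr1n mulr1 cabs_nat cabsV.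
  rewrite (cabsM (W s - g s z)).
  have := clock_rate_ge Uz sI; have := clock_rate_ge Uw sI.
  rewrite -!exprVn invfM; set p := (cabs (W s - g s z))^-1; set q := (cabs (W s - g s w))^-1.
  by have := sqr_ge0 (p - q); rewrite sqrrB; lra.
rewrite !g0// => A B.
have E : expR (m t - m 0) <= M.
  rewrite ler_expR /m; have := clock_bound Uz (lexx 0) t0 tT; have := clock_bound Uw (lexx 0) t0 tT; lra.
by split; [apply: (le_trans A)|apply: (le_trans B)]; apply: ler_wpM2l => //; exact: cabs_ge0.
Qed.

(** The speed is at most [2 / cabs (W - g)], which is at most [1 / k + k / cabs (W - g) ^+ 2] for
    every [k]; the second term integrates to at most [k * L] by the clock. *)
Lemma flow_equicontinuous z s t (k : R) : near_bd z -> 0 < k -> 0 <= s -> s <= t -> t <= T ->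
  cabs (g t z - g s z) <= (t - s) / k + k * L.
Proof.
move=> Uz k0 s0 st tT.
apply: (@le_trans _ _ ((t / k + k * clock z t) - (s / k + k * clock z s))); last first.
  have := clock_bound Uz s0 st tT => H.
  have : k * (clock z t - clock z s) <= k * L by rewrite ler_pM2l.
  lra.
apply: (@tderiv_bound _ I (fun s => g s z) (fun s => radial_field (W s) (g s z))
   (fun s => s / k + k * clock z s) (fun s => k^-1 * 1 + k * clock_rate z s) s t st) => e est.
- exact: (Isub s0 tT est).
- exact: dg Uz (Isub s0 tT est).
- apply: rderivD; last exact: rderivZ (rderiv_clock Uz (Isub s0 tT est)).
  have := rderivZ k^-1 (rderiv_id I e); congr (rderiv I _ e _).
  by apply/funext => y; rewrite mulrC.
- have eI := Isub s0 tT est.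
  rewrite /radial_field !cabsM cabsV.
  have G1 := ltW (g1 Uz eI).
  have G2 : cabs (W e + g e z) <= 2 by apply: (le_trans (ler_cabsD _ _)); rewrite W1//; lra.
  apply: (@le_trans _ _ (2 * (cabs (W e - g e z))^-1)).
    rewrite mulrA; apply: ler_wpM2r; first by rewrite invr_ge0 cabs_ge0.
    by rewrite -[leRHS]mul1r; apply: ler_pM => //; exact: cabs_ge0.
  apply: (@le_trans _ _ (k^-1 * 1 + k * (cabs (W e - g e z) ^+ 2)^-1)); last first.
    by rewrite lerD2l; apply: ler_wpM2l (clock_rate_ge Uz eI); exact: ltW.
  rewrite -exprVn; set p := (cabs (W e - g e z))^-1.
  have := sqr_ge0 (k * p - 1).
  have -> : k^-1 * 1 + k * p ^+ 2 = (1 + (k * p) ^+ 2) / k by field; rewrite gt_eqF.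
  by rewrite ler_pdivlMr// sqrrB expr1n; lra.
Qed.

End Flow.

(* If the driving point came close to the flow of a point near [x], it would,
   during some time interval, be within O(1/N) of the flow of one of N + 1
   points equally spaced on a circle; the clocks of these points would then
   run faster in total than the linear bound allows. *)
Lemma flow_avoids_driving (T : R) (W : R -> C) (g : R -> C -> C) (x : C) (r c : R) :
  let I := [set t : R | 0 <= t <= T] in 0 <= T ->
  (forall t, 0 <= t <= T -> cabs (W t) = 1) ->
  (forall t, 0 <= t <= T -> W @ within I (nbhs t) --> W t) ->
  cabs x = 1 -> 0 < r <= 2^-1 ->
  (forall z, near_bd x r z -> g 0 z = z) ->
  (forall z t, near_bd x r z -> 0 <= t <= T -> cabs (g t z) < 1) ->
  (forall z t, near_bd x r z -> 0 <= t <= T ->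
     tderiv I (fun s => g s z) t (radial_field (W t) (g t z))) ->
  0 < c -> (forall z, near_bd x r z -> c * (1 - cabs z ^+ 2) <= 1 - cabs (g T z) ^+ 2) ->
  W 0 - x != 0 -> exists d r' : R, [/\ 0 < d, 0 < r', r' <= r &
  forall z t, cabs z < 1 -> cabs (z - x) < r' -> 0 <= t <= T -> d <= cabs (W t - g t z)].
Proof.
move=> I T0 W1 Wc x1 r2 g0 g1 dg c0 hopf W0x.
pose L := total_clock c; pose M := lip T c.
have bd_half := bd_half x1 r2.
have flow_abs_mono := flow_abs_mono W1 g1 dg.
have flow_abs := flow_abs W1 g0 g1 dg.
have rderiv_clock := rderiv_clock W1 g1 dg.
have clock_rate_ge := clock_rate_ge W1 x1 r2 g0 g1 dg.
have clock_bound := clock_bound T0 W1 g0 g1 dg c0 hopf.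
have flow_bilipschitz := flow_bilipschitz T0 W1 x1 r2 g0 g1 dg c0 hopf.
have flow_equicontinuous := flow_equicontinuous T0 W1 x1 r2 g0 g1 dg c0 hopf.
have M1 : 1 <= M := lip_ge1 c T0.
have L0 : 0 <= L by rewrite /L /total_clock mulr_ge0.
rewrite -/L in clock_bound flow_equicontinuous; rewrite -/M in flow_bilipschitz.
clearbody L M.
have Isub s t e : 0 <= s -> t <= T -> s <= e <= t -> 0 <= e <= T.
  by move=> s0 tT /andP[se et]; rewrite (le_trans s0 se) (le_trans et tT).
have Wg z t : near_bd x r z -> 0 <= t <= T -> W t - g t z != 0.
  move=> Uz tI; rewrite subr_eq0; apply/eqP => E; have := g1 _ _ Uz tI.
  by rewrite -E W1// ltxx.
have [r0 r12] : 0 < r /\ r <= 2^-1 by apply/andP.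
(* The counting argument needs a time interval of positive length, so [T = 0] is settled from the
   initial condition. *)
move: T0; rewrite le_eqVlt => /predU1P[T00|Tpos].
  have d0 : 0 < cabs (W 0 - x) by rewrite cabs_gt0.
  have m0 : 0 < Num.min r (cabs (W 0 - x) / 2) by rewrite lt_min r0 divr_gt0.
  exists (cabs (W 0 - x) / 2), (Num.min r (cabs (W 0 - x) / 2)); split=> //.
  - by rewrite divr_gt0.
  - by rewrite ge_min lexx.
  move=> z t z1; rewrite lt_min => /andP[zx1 zx2]; rewrite -T00 => t0.
  have -> : t = 0 by apply/eqP; rewrite eq_le andbC.
  rewrite g0; last by split.
  have := lerB_cabs (W 0 - x) (z - x); rewrite (_ : W 0 - x - (z - x) = W 0 - z); last by ring.
  lrac.
have M0 : 0 < M by apply: lt_le_trans M1.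
have p2 : 1 <= pi / 2 :> R := pihalf_ge1 R.
(* Half the angular width of the grid: [r / 4] keeps the grid near [x], and [M * eta <= 8^-1] keeps
   its image under the flow within [8^-1] of the image of its middle point. *)
pose eta := Num.min (r / 4) (8 * M)^-1.
have eta0 : 0 < eta by rewrite lt_min divr_gt0//= invr_gt0 mulr_gt0.
have [eta1 eta2] : eta <= r / 4 /\ eta <= (8 * M)^-1 by split; rewrite ge_min lexx ?orbT.
have Meta : M * eta <= 8^-1.
  apply: (@le_trans _ _ (M * (8 * M)^-1)); first by rewrite ler_pM2l.
  by rewrite invfM mulrCA mulfV ?mulr1// gt_eqF.
have eta18 : eta <= 8^-1 by lrac.
clearbody eta.
pose sg := sin eta.
have sg0 : 0 < sg by rewrite sin_gt0_pihalf// eta0/=; lrac.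
have sg1 : sg <= 1 by exact: sin_le1.
(* Two points of the grid circle at angle at least [eta] stay at distance [8 * kap]: their chord is
   at least [sg / 2], and the flow shrinks distances at most by the factor [M]. *)
pose kap := sg / (16 * M).
have kap0 : 0 < kap by rewrite divr_gt0// mulr_gt0.
have kap16 : kap <= 16^-1.
  rewrite ler_pdivrMr ?mulr_gt0//; lrac.
have sgM : sg / M = 16 * kap by rewrite /kap; field; rewrite gt_eqF.
(* The assumed distance [del] to the driving point and the displacement [2 * del / c * M], caused by
   replacing [zs] with a point closer to the circle, add up to [kap / 2]. *)
pose del := kap / (2 * (1 + 2 * M / c)).
have B0 : 0 < 2 * (1 + 2 * M / c) by rewrite mulr_gt0// addr_gt0// divr_gt0// mulr_gt0.
have del0 : 0 < del by rewrite divr_gt0.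
have delE : del * (1 + 2 * M / c) = kap / 2.
  by rewrite /del; field; rewrite !gt_eqF// ?addr_gt0 ?mulr_gt0//; lrac.
clearbody del kap.
exists del, (r / 4); split=> //; [by rewrite divr_gt0|by lrac|].
move=> zs ta zs1 zsx taI; rewrite leNgt; apply/negP => close.
have Uzs : near_bd x r zs by split=> //; lrac.
have zsh := bd_half _ Uzs; have azs : 0 < cabs zs by lrac.
pose es := 1 - cabs zs; have es0 : 0 < es by rewrite subr_gt0.
have esx : es <= cabs (zs - x).
  by have := lerB_cabs x (x - zs); rewrite subKr x1 [cabs (x - zs)]cabsC /es; lrac.
have es1 : es < 1 by rewrite /es; lrac.
have zsA : cabs zs = 1 - es by rewrite /es subKr.
(* Being near the driving point means being near the circle. Since the modulus only increases and
   the final distance to the circle is at least linear in the initial one, [zs] itself must start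
   near the circle. *)
have escd : es * c <= 2 * del.
  have [ta0 taT] := andP taI.
  have h1 := hopf _ Uzs; have h2 := flow_abs_mono _ _ _ Uzs ta0 taT (lexx T).
  have h3 : 1 - del <= cabs (g ta zs).
    by have := lerB_cabs (W ta) (W ta - g ta zs); rewrite subKr W1//; lrac.
  have h4 : 1 - 2 * del <= cabs (g ta zs) ^+ 2.
    have [h|h] := leP 0 (1 - del); last by apply: le_trans (sqr_ge0 _); lrac.
    by have := cabs_ge0 (g ta zs); nra.
  have h5 : es <= 1 - cabs zs ^+ 2 by rewrite /es; nra.
  have : c * es <= c * (1 - cabs zs ^+ 2) by rewrite ler_pM2l.
  lrac.
have esd : es <= 2 * del / c by rewrite ler_pdivlMr.
have [ze [ze1 zsE]] : exists ze : C, cabs ze = 1 /\ zs = real_cplx (1 - es) * ze.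
  exists (real_cplx (cabs zs)^-1 * zs); split.
    by rewrite cabsM cabs_real ger0_norm ?invr_ge0 ?cabs_ge0// mulVf// gt_eqF.
  by rewrite /es subKr mulrA -rcM mulfV ?rc1 ?mul1r// gt_eqF.
clearbody es.
pose P (e a : R) : C := real_cplx (1 - e) * (ze * expi a).
have Pabs e a : 0 < e -> e <= es -> cabs (P e a) = 1 - e.
  move=> e0 ee; rewrite /P !cabsM cabs_real cabs_expi ze1 !mulr1 ger0_norm//.
  by lrac.
have PzsE e a : P e a - zs = real_cplx (es - e) * (ze * expi a) + real_cplx (1 - es) * (ze * (expi a - 1)).
  by rewrite /P zsE !rcB; ring.
have Pzs e a : 0 < e -> e <= es -> - eta <= a <= eta -> cabs (P e a - zs) <= es + eta.
  move=> e0 ee /andP[a1 a2]; rewrite PzsE; apply: (le_trans (ler_cabsD _ _)).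
  rewrite !cabsM !cabs_real ze1 cabs_expi !mulr1 mul1r !ger0_norm; [|by lrac|by lrac].
  have := expi_lipschitz 0 a; rewrite expi0 subr0 => h.
  have ha : `|a| <= eta by rewrite ler_norml a1.
  have : (1 - es) * cabs (expi a - 1) <= cabs (expi a - 1).
    by rewrite ler_piMl ?cabs_ge0//; lrac.
  lrac.
have PU e a : 0 < e -> e <= es -> - eta <= a <= eta -> near_bd x r (P e a).
  move=> e0 ee aI; split; first by rewrite Pabs//; lrac.
  have := ler_cabsD (P e a - zs) (zs - x); rewrite addrA subrK.
  have := Pzs e a e0 ee aI; lrac.
have PP e a b : 0 < e -> e <= es -> cabs (P e a - P e b) = (1 - e) * cabs (expi a - expi b).
  move=> e0 ee; rewrite /P -mulrBr -mulrBr !cabsM ze1 mul1r cabs_real ger0_norm//.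
  by lrac.
clearbody P.
(* The length [h] must not depend on [e]: the number [N] is chosen after [h], and [e] after [N]. The
   equicontinuity bound is uniform in the starting point and makes this possible. *)
have [h h0 hP] : exists2 h : R, 0 < h & forall s, 0 <= s <= T -> `|s - ta| < h ->
    forall e, 0 < e -> e <= es -> cabs (g s (P e 0) - W s) <= kap.
  have kap4 : 0 < kap / 4 by rewrite divr_gt0.
  have /cvgCP/(_ _ kap4)/within_nbhsP[h1 h10 H1] := Wc _ taI.
  pose k := kap / (8 * (L + 1)).
  have L1 : 0 < L + 1 by clear - L0; lra.
  have k0 : 0 < k by rewrite divr_gt0// mulr_gt0.
  have kL : k * L <= kap / 8.
    have -> : k * L = kap / 8 * (L / (L + 1)) by rewrite /k; field; rewrite gt_eqF.
    apply: ler_piMr; first by rewrite divr_ge0// ltW.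
    by rewrite ler_pdivrMr//; clear; lra.
  exists (Num.min h1 (k * (kap / 8))); first by rewrite lt_min h10 mulr_gt0// divr_gt0.
  move=> s sI; rewrite lt_min => /andP[sh1 sh2] e e0 ee.
  have UP : near_bd x r (P e 0) by apply: PU => //; clear - eta0; apply/andP; split; lra.
  have d1 := H1 _ sh1 sI.
  have d2 : cabs (g s (P e 0) - g ta (P e 0)) <= kap / 4.
    have [s0 sT] := andP sI; have [ta0 taT] := andP taI.
    have sk : `|s - ta| / k <= kap / 8 by rewrite ler_pdivrMr// mulrC ltW.
    have [st|/ltW st] := leP ta s.
      have := flow_equicontinuous _ _ _ _ UP k0 ta0 st sT.
      by rewrite ger0_norm ?subr_ge0// in sk; clear - sk kL; lra.
    have := flow_equicontinuous _ _ _ _ UP k0 s0 st taT; rewrite cabsC.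
    by rewrite distrC ger0_norm ?subr_ge0// in sk; clear - sk kL; lra.
  have d3 : cabs (g ta (P e 0) - g ta zs) <= 2 * del / c * M.
    have [H _] := flow_bilipschitz _ _ _ UP Uzs taI; apply: (le_trans H).
    apply: ler_wpM2r; first exact: ltW.
    apply: le_trans esd; rewrite PzsE expi0 subrr !mulr0 addr0 mulr1 cabsM ze1 mulr1 cabs_real.
    by clear - e0 ee; rewrite ger0_norm; lra.
  have -> : g s (P e 0) - W s = (g s (P e 0) - g ta (P e 0)) + (g ta (P e 0) - g ta zs)
     + (g ta zs - W ta) + (W ta - W s) by ring.
  do 3 (apply: (le_trans (ler_cabsD _ _)); rewrite -lerBrDr).
  rewrite [cabs (W ta - W s)]cabsC [cabs (g ta zs - _)]cabsC.
  have : del + 2 * del / c * M = kap / 2 by rewrite -delE; ring.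
  clear - d1 d2 d3 close; lra.
have [s1 [s2 [s12 s10 s2T sJ]]] : exists s1 s2 : R, [/\ s1 < s2, 0 <= s1, s2 <= T &
    forall s, s1 <= s <= s2 -> `|s - ta| < h].
  have [ta0 taT] := andP taI.
  exists (Num.max 0 (ta - h / 2)), (Num.min T (ta + h / 2)); split.
  - by clear - Tpos ta0 taT h0; rewrite lt_min !gt_max Tpos /=; apply/andP; split; [|apply/andP; split]; lra.
  - by rewrite le_max lexx.
  - by rewrite ge_min lexx.
  - by move=> s; rewrite le_min ge_max => /andP[/andP[_ a1] /andP[_ a2]]; rewrite ltr_norml; clear - a1 a2 h0; lra.
(* The contradiction will be [(s2 - s1) * N ^ 2 / 16 <= (N + 1) * L], where [N + 1 <= 2 * N]; whence
   32. *)
pose N := (Num.bound (32 * (L + 1) / (s2 - s1))).+1.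
have N0 : 0 < N%:R :> R by rewrite ltr0n.
have N1 : 1 <= N%:R :> R by rewrite ler1n.
have NL : 32 * L < (s2 - s1) * N%:R.
  have : 32 * (L + 1) / (s2 - s1) < N%:R.
    apply: (lt_le_trans (archi_boundP _)); last by rewrite ler_nat.
    have L1 : 0 <= L + 1 by clear - L0; lra.
    by apply: divr_ge0; [exact: mulr_ge0|clear - s12; lra].
  by rewrite ltr_pdivrMr ?subr_gt0// mulrC; clear; lra.
have NN : (0 < N)%N by [].
clearbody N.
pose e := Num.min es (Num.min N%:R^-1 kap).
have e0 : 0 < e by rewrite !lt_min es0 invr_gt0 N0.
have ees : e <= es by rewrite ge_min lexx.
have [eN ek] : e <= N%:R^-1 /\ e <= kap by split; rewrite !ge_min lexx ?orbT.
clearbody e.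
pose aj (j : nat) : R := - eta + 2 * eta / N%:R * j%:R.
have ajI (j : nat) : (j <= N)%N -> - eta <= aj j <= eta.
  move=> jN; have jN' : j%:R <= N%:R :> R by rewrite ler_nat.
  have j0 : 0 <= j%:R :> R by [].
  have q0 : 0 <= 2 * eta / N%:R by rewrite divr_ge0// ?mulr_ge0// ltW.
  rewrite /aj lerDl mulr_ge0//=.
  have : 2 * eta / N%:R * j%:R <= 2 * eta / N%:R * N%:R by rewrite ler_wpM2l.
  by rewrite divfK ?gt_eqF//; clear; lra.
have Uj (j : nat) : (j <= N)%N -> near_bd x r (P e (aj j)) by move=> /ajI; exact: PU.
have key s : s1 <= s <= s2 -> exists2 j : nat, (j <= N)%N & cabs (W s - g s (P e (aj j))) <= 4 / N%:R.
  move=> sJ'; have sI : 0 <= s <= T.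
    by case/andP: sJ' => a1 a2; rewrite (le_trans s10 a1) (le_trans a2 s2T).
  have near0 := hP s sI (sJ s sJ') e e0 ees.
  (* A rotation that brings the driving point to 1 and preserves distances. *)
  pose u a := g s (P e a) * cconj (W s).
  have uW a : cabs (u a - 1) = cabs (g s (P e a) - W s).
    have -> : u a - 1 = (g s (P e a) - W s) * cconj (W s).
      by rewrite /u mulrBl -(cabs_sqr_conj (W s)) W1// expr1n.
    by rewrite cabsM cabs_conj W1// mulr1.
  have uu a b : cabs (u a - u b) = cabs (g s (P e a) - g s (P e b)).
    by rewrite /u -mulrBl cabsM cabs_conj W1// mulr1.
  have lipu a b : - eta <= a <= eta -> - eta <= b <= eta -> cabs (u a - u b) <= M * `|a - b|.
    move=> aI bI; rewrite uu; have [H _] := flow_bilipschitz _ _ _ (PU e a e0 ees aI) (PU e b e0 ees bI) sI.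
    apply: (le_trans H); rewrite mulrC; apply: ler_wpM2l; first exact: ltW.
    rewrite PP//; have := expi_lipschitz b a.
    have : (1 - e) * cabs (expi a - expi b) <= cabs (expi a - expi b).
      by rewrite ler_piMl ?cabs_ge0//; lrac.
    lrac.
  have low a b : - eta <= a <= eta -> - eta <= b <= eta -> eta <= b - a -> 8 * kap <= cabs (u b - u a).
    move=> aI bI ab; rewrite uu.
    have [_ H] := flow_bilipschitz _ _ _ (PU e b e0 ees bI) (PU e a e0 ees aI) sI.
    rewrite PP// in H.
    have ch : sg <= cabs (expi b - expi a).
      by apply: (expi_chord eta0 ab); case/andP: aI => ? ?; case/andP: bI => ? ?; lrac.
    have : sg / 2 <= (1 - e) * cabs (expi b - expi a).
      rewrite mulrC; apply: ler_pM => //; [exact: ltW|clear - ek kap16; lra].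
    move=> H2; have := le_trans H2 H; rewrite -ler_pdivrMr// mulrAC sgM; lrac.
  have uabs a : - eta <= a <= eta -> 1 - e <= cabs (u a) <= 1.
    move=> aI; have Ua := PU e a e0 ees aI.
    rewrite /u cabsM cabs_conj W1// mulr1 (ltW (g1 _ _ Ua sI)) andbT.
    by have := flow_abs _ _ Ua sI; rewrite Pabs.
  have [|||||||||||||j jN H] := @grid_near_one _ u M eta kap e N; try done.
    by rewrite uW.
  by exists j => //; rewrite cabsC -uW.
have zj (i : 'I_N.+1) : near_bd x r (P e (aj i)) by apply: Uj; rewrite -ltnS.
(* At each time of the interval some grid point is within [4 / N] of the driving point, so the sum
   grows at rate at least [N ^ 2 / 16]; yet each of the [N + 1] clocks can advance by at most
   [L]. *)
pose Phi s := \sum_(i < N.+1) clock g (P e (aj i)) s.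
have dPhi s : 0 <= s <= T -> rderiv I Phi s (\sum_(i < N.+1) clock_rate W g (P e (aj i)) s).
  by move=> sI; apply: rderiv_sum => i; exact: rderiv_clock.
have up : Phi s2 - Phi s1 <= N.+1%:R * L.
  rewrite /Phi -sumrB; apply: (@le_trans _ _ (\sum_(i < N.+1) L)).
    by apply: ler_sum => i _; apply: clock_bound => //; exact: ltW.
  by rewrite sumr_const card_ord mulr_natl.
have dn : s1 * (N%:R ^+ 2 / 16) - Phi s1 >= s2 * (N%:R ^+ 2 / 16) - Phi s2.
  apply: (@rderiv_ge _ I (fun s => s * (N%:R ^+ 2 / 16) - Phi s)
    (fun s => (1 * (N%:R ^+ 2 / 16) + s * 0) - \sum_(i < N.+1) clock_rate W g (P e (aj i)) s) s1 s2 (ltW s12)).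
  - by move=> s; exact: (Isub _ _ _ s10 s2T).
  - move=> s sJ'; have sI := Isub _ _ _ s10 s2T sJ'.
    exact: rderivB (rderivM (rderiv_id I s) (rderiv_cst I _ s)) (dPhi s sI).
  - move=> s sJ'; have sI := Isub _ _ _ s10 s2T sJ'.
    rewrite mulr0 addr0 mul1r subr_le0.
    have [j jN H] := key s sJ'.
    have jN' : (j < N.+1)%N by rewrite ltnS.
    rewrite (bigD1 (Ordinal jN')) //= ler_wpDr//.
      by apply: sumr_ge0 => i _; exact: clock_rate_ge0.
    apply: le_trans (clock_rate_ge _ _ (Uj j jN) sI).
    have w0 : 0 < cabs (W s - g s (P e (aj j))) by rewrite cabs_gt0; exact: Wg _ _ (Uj j jN) sI.
    have -> : N%:R ^+ 2 / 16 = ((4 / N%:R) ^+ 2)^-1 :> R by field; rewrite gt_eqF.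
    by rewrite lef_pV2 ?posrE ?exprn_gt0 ?divr_gt0// ler_pXn2r ?nnegrE ?divr_ge0// ltW.
have F : (s2 - s1) * (N%:R ^+ 2 / 16) <= N.+1%:R * L by clear - up dn; lra.
have E : N.+1%:R = N%:R + 1 :> R by rewrite natr1.
have F1 : (N%:R + 1) * L <= 2 * N%:R * L by apply: ler_wpM2r => //; clear - N1; lra.
have F2 : ((s2 - s1) * N%:R / 16) * N%:R <= (2 * L) * N%:R by rewrite E in F; clear - F F1; lra.
by rewrite ler_pM2r// in F2; clear - F2 NL; lra.
Qed.

End LoewnerFlow.

(** * The flow of the boundary point *)

Section BoundaryExtension.
Variable R : realType.
Local Notation C := (Cplx R).
Local Notation cRe := (@complex.Re R : C -> R).
Local Notation cIm := (@complex.Im R : C -> R).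
Implicit Types (s t a b e : R) (z w : C).

Lemma radial_fieldE W z : W - z != 0 -> radial_field W z = 2 * W ^+ 2 / (W - z) - z - 2 * W.
Proof. by move=> H; rewrite /radial_field; field. Qed.

Lemma radial_field_lipschitz (W W' z z' : C) (d : R) : 0 < d -> cabs W = 1 -> cabs W' = 1 ->
  cabs z <= 1 -> cabs z' <= 1 -> d <= cabs (W - z) -> d <= cabs (W' - z') ->
  cabs (radial_field W z - radial_field W' z') <= (2 + 6 / d ^+ 2) * (cabs (W - W') + cabs (z - z')).
Proof.
move=> d0 W1 W1' z1 z1' dW dW'.
have n1 : W - z != 0 by rewrite -cabs_gt0; exact: lt_le_trans dW.
have n2 : W' - z' != 0 by rewrite -cabs_gt0; exact: lt_le_trans dW'.
rewrite !radial_fieldE//.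
have -> : 2 * W ^+ 2 / (W - z) - z - 2 * W - (2 * W' ^+ 2 / (W' - z') - z' - 2 * W') =
  2 * (W * W' * (W - W') - W ^+ 2 * (z' - z) - (W + W') * z * (W - W')) / ((W - z) * (W' - z'))
  - (z - z') - 2 * (W - W') by field; rewrite ?n1 ?n2.
rewrite (cabsC z z'); set p := cabs (W - W'); set q := cabs (z' - z).
have p0 : 0 <= p := cabs_ge0 _; have q0 : 0 <= q := cabs_ge0 _.
apply: (le_trans (ler_cabsB _ _)); rewrite cabsM cabs_nat -/p.
apply: (@le_trans _ _ (6 / d ^+ 2 * (p + q) + q + 2 * p)); last by clear -p0 q0; lra.
rewrite lerD2r; apply: (le_trans (ler_cabsB _ _)); rewrite (cabsC z z') -/q lerD2r.
rewrite cabsM cabsV cabsM cabs_nat (cabsM (W - z)).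
have N6 : cabs (W * W' * (W - W') - W ^+ 2 * (z' - z) - (W + W') * z * (W - W')) <= 3 * (p + q).
  have a0 := ler_cabsB (W * W' * (W - W') - W ^+ 2 * (z' - z)) ((W + W') * z * (W - W')).
  have a1 := ler_cabsB (W * W' * (W - W')) (W ^+ 2 * (z' - z)).
  have a2 : cabs ((W + W') * z * (W - W')) <= 2 * p.
    rewrite cabsM -/p; apply: ler_wpM2r => //; rewrite cabsM -[leRHS]mulr1.
    apply: ler_pM; rewrite ?cabs_ge0//.
    by apply: (le_trans (ler_cabsD _ _)); rewrite W1 W1'; lra.
  rewrite [cabs (W * W' * _)]cabsM [cabs (W * W')]cabsM [cabs (W ^+ 2 * _)]cabsM cabsX W1 W1' !mul1r expr1n mul1r -/p -/q in a1.
  by move: a0 a1 a2; set u := cabs _; set v := cabs _; set k := cabs _; clear - p0 q0; lra.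
have D2 : d ^+ 2 <= cabs (W - z) * cabs (W' - z') by rewrite expr2; apply: ler_pM => //; exact: ltW.
have d2 : 0 < d ^+ 2 by rewrite exprn_gt0.
have -> : 6 / d ^+ 2 * (p + q) = 2 * (3 * (p + q)) / d ^+ 2 by field; rewrite gt_eqF.
apply: ler_pM.
- by apply: mulr_ge0 => //; exact: cabs_ge0.
- by rewrite invr_ge0; apply: mulr_ge0; exact: cabs_ge0.
- by rewrite ler_pM2l.
- by rewrite lef_pV2// posrE; exact: lt_le_trans D2.
Qed.

Lemma tderivI (D : set R) (f : R -> C) t (l : C) :
  (forall e, 0 < e -> exists2 h, 0 < h & forall s, D s -> `|s - t| < h ->
     cabs (f s - f t - real_cplx (s - t) * l) <= e * `|s - t|) -> tderiv D f t l.
Proof.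
move=> H; exists (fun s => if s == t then l else real_cplx (s - t)^-1 * (f s - f t)).
split; rewrite ?eqxx//.
- apply/cvgCP => e e0; have [h h0 hP] := H _ (div2_gt0 e0).
  apply/within_nbhsP; exists h => // s sh Ds; case: ifPn => [_|st].
    by rewrite subrr cabs0.
  have n0 : 0 < `|s - t| by rewrite normr_gt0 subr_eq0.
  have -> : real_cplx (s - t)^-1 * (f s - f t) - l =
      real_cplx (s - t)^-1 * (f s - f t - real_cplx (s - t) * l).
    have E : real_cplx (s - t)^-1 * real_cplx (s - t) = 1 :> C by rewrite -rcM mulVf ?rc1// subr_eq0.
    by rewrite [RHS]mulrBr (mulrA _ _ l) E mul1r.
  rewrite cabsM cabs_real normfV mulrC ltr_pdivrMr//.
  by apply: (le_lt_trans (hP s Ds sh)); rewrite ltr_pM2r//; lra.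
- move=> s _; case: eqVneq => [->|st]; first by rewrite !subrr rc0 mul0r.
  by rewrite mulrA -rcM mulfV ?rc1 ?mul1r// subr_eq0.
Qed.

Lemma near_disk_proper (x : C) : cabs x = 1 -> ProperFilter (within (@disk R) (nbhs x)).
Proof.
move=> x1; apply: Build_ProperFilter_ex => P /nbhsCP[e e0 eP].
pose h := Num.min (e / 2) 2^-1.
have h0 : 0 < h by rewrite lt_min div2_gt0//= invr_gt0.
have [h1 h2] : h <= e / 2 /\ h <= 2^-1 by rewrite /h !ge_min !lexx orbT.
exists (real_cplx (1 - h) * x); apply: eP.
  have -> : real_cplx (1 - h) * x - x = - (real_cplx h * x) by rewrite rcB rc1; ring.
  by rewrite cabsN cabsM x1 cabs_real mulr1 gtr0_norm//; lra.
by rewrite diskE cabsM x1 cabs_real mulr1 ger0_norm; lra.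
Qed.

(** Compactness of the closed disc provides a cluster point of [G] at [x]; the Lipschitz bound makes
    it the limit, with a linear rate. *)
Lemma boundary_value (G : C -> C) (x : C) (r M : R) : cabs x = 1 -> 0 < r -> 0 <= M ->
  (forall z, near_bd x r z -> cabs (G z) < 1) ->
  (forall z w, near_bd x r z -> near_bd x r w -> cabs (G z - G w) <= cabs (z - w) * M) ->
  exists X, forall z, near_bd x r z -> cabs (G z - X) <= M * cabs (z - x).
Proof.
move=> x1 r0 M0 G1 GL.
pose F : set_system C := G @ within (@disk R) (nbhs x).
have PF : ProperFilter F by apply: fmap_proper_filter; exact: near_disk_proper.
have FK : F [set w | cabs (w - 0) <= 1].
  apply/nbhsCP; exists r => // z zr /diskE z1 /=; rewrite subr0.
  by apply: ltW; exact: G1.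
have [X [_ cX]] := @compact_closed_disc R 0 1 F PF FK.
exists X => z Uz; apply/ler_addgt0Pr => e e0.
have F1 : F [set v | cabs (v - G z) <= M * cabs (z - x) + e / 2].
  apply/nbhsCP; exists (Num.min r (e / (2 * (M + 1)))).
    by rewrite lt_min r0 divr_gt0// mulr_gt0//; lra.
  move=> w; rewrite lt_min => /andP[wr we] /diskE w1 /=.
  have Uw : near_bd x r w by [].
  have := GL _ _ Uw Uz; move=> /le_trans; apply.
  have t1 : cabs (w - z) <= cabs (w - x) + cabs (z - x).
    by rewrite (cabsC z x) -{1}(subrK x w) -addrA ler_cabsD.
  have M2 : 0 < 2 * (M + 1) by lra.
  rewrite ltr_pdivlMr// in we.
  have := cabs_ge0 (w - x); have : M * cabs (w - z) <= M * (cabs (w - x) + cabs (z - x)) by apply: ler_wpM2l.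
  by move: we; set p := cabs (w - x); set q := cabs (z - x); set v := cabs (w - z); clear; lra.
have F2 : nbhs X [set v | cabs (v - X) < e / 2] by apply/nbhsCP; exists (e / 2); first exact: div2_gt0.
have [v [/= v1 v2]] := cX _ _ F1 F2.
have := ler_cabsD (G z - v) (v - X); rewrite addrA subrK (cabsC (G z) v).
by move: v1 v2; set p := cabs (v - G z); set q := cabs (v - X); clear; lra.
Qed.

(* Inequalities pass to the limit along the radius ending at [x]. *)
Lemma radial_le (x : C) (r : R) (p B : R) : cabs x = 1 -> 0 < r ->
  (forall z, near_bd x r z -> p <= B * cabs (z - x)) -> p <= 0.
Proof.
move=> x1 r0 H; apply/ler_addgt0Pr => e e0; rewrite add0r.
pose h := Num.min (Num.min (r / 2) 2^-1) (e / (`|B| + 1)).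
have B0 : 0 < `|B| + 1 by rewrite ltr_wpDl.
have h0 : 0 < h by rewrite !lt_min div2_gt0//= invr_gt0 ltr0n divr_gt0.
have [h1 h2 h3] : [/\ h <= r / 2, h <= 2^-1 & h <= e / (`|B| + 1)].
  by rewrite /h !ge_min !lexx !orbT.
have E : cabs (real_cplx (1 - h) * x - x) = h.
  have -> : real_cplx (1 - h) * x - x = - (real_cplx h * x) by rewrite rcB rc1; ring.
  by rewrite cabsN cabsM x1 cabs_real mulr1 gtr0_norm.
have Uz : near_bd x r (real_cplx (1 - h) * x).
  split; last by rewrite E; lra.
  by rewrite cabsM x1 cabs_real mulr1 ger0_norm; lra.
have := H _ Uz; rewrite E => /le_trans; apply.
apply: (@le_trans _ _ ((`|B| + 1) * h)); last by rewrite mulrC -ler_pdivlMr.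
by rewrite ler_pM2r//; have := ler_norm B; lra.
Qed.

(** For each time [X t] is the boundary value of [g t] at [x], and the Lipschitz rate [M] and the
    distance [d] to the driving point are uniform in time. The differential equation is not
    exchanged with the limit pointwise: an increment estimate between two times, with explicit
    errors in [cabs (z - x)], is proved for interior [z] and passes to the limit. *)
Lemma boundary_flow (T : R) (W : R -> C) (g : R -> C -> C) (x : C) (r : R) :
  let I := [set t : R | 0 <= t <= T] in 0 <= T ->
  (forall t, 0 <= t <= T -> cabs (W t) = 1) ->
  (forall t, 0 <= t <= T -> W @ within I (nbhs t) --> W t) ->
  cabs x = 1 -> 0 < r <= 2^-1 ->
  (forall z, near_bd x r z -> g 0 z = z) ->
  (forall z t, near_bd x r z -> 0 <= t <= T -> cabs (g t z) < 1) ->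
  (forall z t, near_bd x r z -> 0 <= t <= T ->
     tderiv I (fun s => g s z) t (radial_field (W t) (g t z))) ->
  (forall z, near_bd x r z -> exists l, cderiv (g T) z l) ->
  W 0 - x != 0 -> exists (X : R -> C) (d M r' : R), [/\ 0 < d, 0 < r' & X 0 = x] /\
  forall t, 0 <= t <= T -> [/\ cabs (X t) = 1, d <= cabs (W t - X t),
    tderiv I X t (radial_field (W t) (X t)) &
    forall z, near_bd x r' z -> cabs (g t z - X t) <= M * cabs (z - x)].
Proof.
move=> I T0 W1 Wc x1 r2 g0 g1 dg hol W0x.
have IT : 0 <= T <= T by rewrite lexx T0.
have [c c0 hopf] := @hopf_boundary R (g T) x r x1 r2
  (fun z h1 h2 => hol z (conj h1 h2)) (fun z h1 h2 => g1 z T (conj h1 h2) IT).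
have r42 : 0 < r / 4 <= 2^-1 by case/andP: r2 => ? ?; apply/andP; split; lra.
have sub4 z : near_bd x (r / 4) z -> near_bd x r z.
  by move=> [h1 h2]; split=> //; case/andP: r2 => ? ?; lra.
have g0' z (h : near_bd x (r / 4) z) := g0 z (sub4 z h).
have g1' z t (h : near_bd x (r / 4) z) := g1 z t (sub4 z h).
have dg' z t (h : near_bd x (r / 4) z) := dg z t (sub4 z h).
have hopf' z (h : near_bd x (r / 4) z) := hopf z (proj1 h) (proj2 h).
have [d [r' [d0 r'0 r'r dP]]] := @flow_avoids_driving R T W g x (r / 4) c T0 W1 Wc x1 r42 g0' g1' dg' c0 hopf' W0x.
have sub' z : near_bd x r' z -> near_bd x (r / 4) z by move=> [h1 h2]; split=> //; lra.
have bl z w t (Uz : near_bd x r' z) (Uw : near_bd x r' w) tI :=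
  proj1 (@flow_bilipschitz R T W g x (r / 4) c T0 W1 x1 r42 g0' g1' dg' c0 hopf' z w t (sub' z Uz) (sub' w Uw) tI).
have ga z t (Uz : near_bd x r' z) := @flow_abs R T W g x (r / 4) W1 g0' g1' dg' z t (sub' z Uz).
have M1 : 1 <= lip T c := lip_ge1 c T0.
move: M1 bl; set M := lip T c => M1 bl; clearbody M.
have [X XP] : exists X : R -> C, forall t, 0 <= t <= T ->
    forall z, near_bd x r' z -> cabs (g t z - X t) <= M * cabs (z - x).
  suff /choice[X XP] : forall t, exists X, 0 <= t <= T ->
    forall z, near_bd x r' z -> cabs (g t z - X) <= M * cabs (z - x) by exists X.
  move=> t; have [tI|tI] := boolP (0 <= t <= T); last by exists 0.
  have [|z Uz|z w Uz Uw|X XP] := @boundary_value (g t) x r' M x1 r'0.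
  - by lra.
  - exact: g1' (sub' z Uz) tI.
  - exact: bl.
  - by exists X.
have d1 z t : near_bd x r' z -> 0 <= t <= T -> d <= cabs (W t - g t z).
  by move=> [h1 h2]; exact: dP.
have Xd t : 0 <= t <= T -> d <= cabs (W t - X t).
  move=> tI; rewrite -subr_le0; apply: (@radial_le x r' _ M x1 r'0) => z Uz.
  have := XP t tI z Uz; have := d1 z t Uz tI; have := ler_cabsD (W t - X t) (X t - g t z).
  rewrite addrA subrK (cabsC (X t)); set p := cabs _; set q := cabs _; set u := cabs _; set v := cabs _.
  by clear; lra.
(* At most 1 since the flow stays in the disk, at least 1 since it increases the modulus and
   [cabs z] tends to 1. *)
have X1 t : 0 <= t <= T -> cabs (X t) = 1.
  move=> tI; apply/le_anti/andP; split; rewrite -subr_le0.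
    apply: (@radial_le x r' _ M x1 r'0) => z Uz.
    have := XP t tI z Uz; have := g1' z t (sub' z Uz) tI; have := ler_cabsD (X t - g t z) (g t z).
    rewrite subrK (cabsC (X t)); set p := cabs _; set q := cabs _; set u := cabs _.
    by clear; lra.
  apply: (@radial_le x r' _ (M + 1) x1 r'0) => z Uz.
  have := XP t tI z Uz; have := ga z t Uz tI; have := lerB_cabs (g t z) (g t z - X t).
  have := ler_cabsD (x - z) z.
  rewrite subrK x1 subKr (cabsC x); set p := cabs _; set q := cabs _; set u := cabs _; set v := cabs _.
  by clear; lra.
have X0 : X 0 = x.
  apply/subr0_eq/cabs_small_eq0 => e e0; apply: le_trans (ltW e0).
  apply: (@radial_le x r' _ (M + 1) x1 r'0) => z Uz.
  have I0 : 0 <= (0 : R) <= T by rewrite lexx.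
  have := XP 0 I0 z Uz; rewrite g0'; last exact: sub'.
  have := ler_cabsD (X 0 - z) (z - x).
  rewrite addrA subrK (cabsC (X 0)); set p := cabs _; set q := cabs _; set u := cabs _.
  by clear; lra.
exists X, d, M, r'; split; first by [].
move=> t tI; split; [exact: X1|exact: Xd| |exact: XP].
pose K := 2 + 6 / d ^+ 2.
have K0 : 0 < K by rewrite /K addr_gt0// divr_gt0// exprn_gt0.
pose F := radial_field (W t) (X t).
have FB z s : near_bd x r' z -> 0 <= s <= T -> cabs (radial_field (W s) (g s z)) <= 2 / d.
  move=> Uz sI; have G1 := ltW (g1' z s (sub' z Uz) sI).
  have G2 : cabs (W s + g s z) <= 2 by apply: (le_trans (ler_cabsD _ _)); rewrite W1//; lra.
  rewrite /radial_field !cabsM cabsV -[leRHS]mul1r.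
  apply: ler_pM; rewrite ?mulr_ge0 ?invr_ge0 ?cabs_ge0//.
  apply: ler_pM; rewrite ?mulr_ge0 ?invr_ge0 ?cabs_ge0//.
  by rewrite lef_pV2 ?posrE//; [exact: d1|apply: lt_le_trans (d1 z s Uz sI)].
(* for [z] near [x] the error is O(|z - x|) plus the modulus of continuity of
   the field at [X t] *)
have step s1 s2 z (h e : R) : s1 <= s2 -> 0 <= s1 -> s2 <= T -> near_bd x r' z -> 0 <= h ->
    (forall s, s1 <= s <= s2 -> `|s - t| <= h /\ cabs (W s - W t) <= e) ->
    cabs (g s2 z - g s1 z - real_cplx (s2 - s1) * F) <=
      K * (e + 2 / d * h + M * cabs (z - x)) * (s2 - s1).
  move=> s12 s10 s2T Uz h0 sP.
  have sI s : s1 <= s <= s2 -> 0 <= s <= T.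
    by move=> /andP[a1 a2]; rewrite (le_trans s10 a1) (le_trans a2 s2T).
  set B := K * _.
  have -> : g s2 z - g s1 z - real_cplx (s2 - s1) * F =
    (g s2 z - F * real_cplx s2) - (g s1 z - F * real_cplx s1) by rewrite rcB; ring.
  rewrite mulrBr.
  apply: (@tderiv_bound _ I (fun s => g s z - F * real_cplx s)
    (fun s => radial_field (W s) (g s z) - (0 * real_cplx s + F * 1)) (fun s => B * s)
    (fun=> B * 1) s1 s2 s12) => s ss.
  - exact: sI.
  - exact: tderivB (dg' z s (sub' z Uz) (sI s ss)) (tderivM (tderiv_cst I F s) (tderiv_id I s)).
  - exact: rderivZ (rderiv_id I s).
  have [sh se] := sP s ss; have sI' := sI s ss.
  rewrite mul0r add0r !mulr1.
  apply: (le_trans (radial_field_lipschitz d0 (W1 s sI') (W1 t tI) (ltW (g1' z s (sub' z Uz) sI')) _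
    (d1 z s Uz sI') (Xd t tI))); first by rewrite X1.
  rewrite ler_pM2l// -addrA lerD//.
  have gs : cabs (g s z - g t z) <= 2 / d * h.
    apply: (@le_trans _ _ (2 / d * `|s - t|)); last by rewrite ler_pM2l// divr_gt0.
    have gl a b : a <= b -> 0 <= a -> b <= T -> cabs (g b z - g a z) <= 2 / d * b - 2 / d * a.
      move=> ab a0 bT; apply: (@tderiv_bound _ I (fun s => g s z)
        (fun s => radial_field (W s) (g s z)) (fun s => 2 / d * s) (fun=> 2 / d * 1) a b ab) => y yI;
      have yI' : 0 <= y <= T by case/andP: yI => y1 y2; rewrite (le_trans a0 y1) (le_trans y2 bT).
      - exact: yI'.
      - exact: dg' (sub' z Uz) yI'.
      - exact: rderivZ (rderiv_id I y).
      - by rewrite mulr1; exact: FB.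
    case/andP: sI' => a1 a2; case/andP: (tI) => b1 b2.
    have [ts|/ltW ts] := leP t s.
      by rewrite ger0_norm ?subr_ge0// mulrBr; exact: gl.
    by rewrite cabsC distrC ger0_norm ?subr_ge0// mulrBr; exact: gl.
  have := ler_cabsD (g s z - g t z) (g t z - X t); rewrite addrA subrK.
  have := XP t tI z Uz; move: gs; set p := cabs _; set q := cabs _; set u := cabs _; set v := cabs _.
  by clear; lra.
apply: tderivI => e e0.
have e1 : 0 < e / (2 * K) by rewrite divr_gt0// mulr_gt0.
have /cvgCP/(_ _ e1)/within_nbhsP[h1 h10 H1] := Wc t tI.
pose h := Num.min h1 (e / (2 * K) * (d / 2)).
have h0 : 0 < h by rewrite lt_min h10 !mulr_gt0// ?invr_gt0 ?mulr_gt0.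
exists h => // s Is sh.
have sh1 : `|s - t| < h1 by apply: lt_le_trans sh _; rewrite ge_min lexx.
have sh2 : 2 / d * `|s - t| <= e / (2 * K).
  have : `|s - t| <= e / (2 * K) * (d / 2) by apply: le_trans (ltW sh) _; rewrite ge_min lexx orbT.
  rewrite -ler_pdivrMr ?divr_gt0// => /(le_trans _); apply.
  by rewrite invf_div mulrC.
(* The two times are fixed from here on and [z] tends to [x]; all errors linear in [cabs (z - x)]
   disappear. *)
rewrite -subr_le0; apply: (@radial_le x r' _ (2 * M + K * M * `|s - t|) x1 r'0) => z Uz.
have sI : 0 <= s <= T := Is.
have close u : `|u - t| <= `|s - t| -> 0 <= u <= T -> `|u - t| <= `|s - t| /\ cabs (W u - W t) <= e / (2 * K).
  by move=> us uI; split=> //; apply/ltW/H1 => //; exact: le_lt_trans sh1.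
have main : cabs (g s z - g t z - real_cplx (s - t) * F) <=
    K * (e / (2 * K) + 2 / d * `|s - t| + M * cabs (z - x)) * `|s - t|.
  case/andP: (sI) => a1 a2; case/andP: (tI) => b1 b2.
  have [ts|/ltW ts] := leP t s.
    have E : `|s - t| = s - t by rewrite ger0_norm ?subr_ge0.
    rewrite {2}E; apply: step => // u /andP[u1 u2]; apply: close.
      by rewrite E ger0_norm ?lerB// subr_ge0.
    by rewrite (le_trans b1 u1) (le_trans u2 a2).
  have E : `|s - t| = t - s by rewrite distrC ger0_norm ?subr_ge0.
  rewrite -cabsN (_ : - _ = g t z - g s z - real_cplx (t - s) * F); last by rewrite !rcB; ring.
  rewrite {2}E; apply: step => // u /andP[u1 u2]; apply: close.
    by rewrite E distrC ger0_norm ?lerB// subr_ge0.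
  by rewrite (le_trans a1 u1) (le_trans u2 b2).
have Ke : K * (e / (2 * K) + 2 / d * `|s - t| + M * cabs (z - x)) <= e + K * M * cabs (z - x).
  have -> : K * (e / (2 * K) + 2 / d * `|s - t| + M * cabs (z - x)) =
    K * (e / (2 * K) + 2 / d * `|s - t|) + K * M * cabs (z - x) by ring.
  rewrite lerD2r; apply: (@le_trans _ _ (K * (e / (2 * K) + e / (2 * K)))).
    by rewrite ler_pM2l// lerD2l.
  have -> : K * (e / (2 * K) + e / (2 * K)) = e by field; rewrite gt_eqF.
    exact: lexx.
have main2 := le_trans main (ler_wpM2r (normr_ge0 (s - t)) Ke).
have b1 := XP s sI z Uz; have b2 := XP t tI z Uz.
have -> : X s - X t = (g s z - g t z) + ((g t z - X t) - (g s z - X s)) by ring.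
rewrite -/F addrAC; have := ler_cabsD (g s z - g t z - real_cplx (s - t) * F) ((g t z - X t) - (g s z - X s)).
have := ler_cabsB (g t z - X t) (g s z - X s).
move: main2 b1 b2; set p := cabs _; set q := cabs _; set u := cabs _; set v := cabs _; set k := cabs _; set k' := cabs _.
by clear; lra.
Qed.

End BoundaryExtension.

(** * Reparametrization of time *)

Section TimeChange.
Variable R : realType.
Implicit Types (u v f q : R -> R) (s t a b e T m : R).
Local Notation mu := (@lebesgue_measure R).

(** Precomposition extrapolates a function on [[0, T]] by constants, and so turns continuity within
    the interval into continuity on the line, as integration and measurability demand. *)
Definition clamp T t := Num.max 0 (Num.min T t).

Lemma clampE T t : 0 <= t <= T -> clamp T t = t.
Proof. by move=> /andP[t0 tT]; rewrite /clamp (min_r tT) (max_r t0). Qed.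

Lemma clamp_itv T t : 0 <= T -> 0 <= clamp T t <= T.
Proof. by move=> T0; rewrite /clamp le_max lexx /= ge_max T0 ge_min lexx. Qed.

Lemma clamp_lip T s t : 0 <= T -> `|clamp T s - clamp T t| <= `|s - t|.
Proof.
move=> T0; wlog st : s t / t <= s => [H|].
  have [/H//|/ltW/H] := leP t s; by rewrite distrC (distrC s).
rewrite [leRHS]ger0_norm ?subr_ge0// ler_norml /clamp.
by case: (leP T s) => ?; case: (leP T t) => ?; case: (leP 0 T) => ?; case: (leP 0 s) => ?;
  case: (leP 0 t) => ?; apply/andP; split; lra.
Qed.

Lemma clamp_continuous T f : 0 <= T ->
  (forall t, 0 <= t <= T -> f @ within [set t | 0 <= t <= T] (nbhs t) --> f t) ->
  continuous (fun t => f (clamp T t)).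
Proof.
move=> T0 fc t; apply/cvgrPdist_lt => e e0.
have := fc _ (clamp_itv t T0); move/cvgrPdist_lt => /(_ _ e0)/within_nbhsP[d d0 dP].
apply/nbhs_ballP; exists d => //= s; rewrite /ball /= distrC => st.
by apply: dP; [exact: le_lt_trans (clamp_lip _ _ T0) st|exact: clamp_itv].
Qed.

Lemma antiderivative T f : 0 <= T ->
  (forall t, 0 <= t <= T -> f @ within [set t | 0 <= t <= T] (nbhs t) --> f t) ->
  exists F : R -> R, F 0 = 0 /\
    forall t, 0 <= t <= T -> rderiv [set t | 0 <= t <= T] F t (f t).
Proof.
move=> T0 fc; pose h t := f (clamp T t).
have hc : continuous h by exact: clamp_continuous.
(* Starting at [-1] makes 0 an interior point, so that the derivative exists there too. *)
pose G t := (\int[mu]_(x in `[(-1 : R), t]) h x)%R.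
have dG t : 0 <= t -> is_derive t 1 G (h t).
  move=> t0.
  have tt : t < t + 1 by rewrite ltrDl.
  have ih : mu.-integrable `[(-1 : R), t + 1] (EFin \o h).
    by apply: (@cont_on_integrable R) => x _; exact: hc.
  have t1 : -1 < t by lra.
  have [dG GE] := continuous_FTC1_closed tt ih t1 (hc t).
  by apply: DeriveDef; [exact: dG|rewrite -derive1E].
exists (fun t => G t - G 0); split; first by rewrite subrr.
move=> t tI; have /andP[t0 _] := tI.
have := rderivB (is_derive_rderiv [set t | 0 <= t <= T] (dG t t0)) (rderiv_cst [set t | 0 <= t <= T] (G 0) t).
by apply: rderiv_eqd; rewrite subr0 /h clampE.
Qed.

(** The lower bound on [u'] makes [u] expanding by [m], so the inverse is Lipschitz, and the
    Caratheodory quotient [q] of [u] is at least [m] everywhere; the reciprocal of [q] along [r] is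
    then a Caratheodory quotient of [r]. *)
Lemma inverse_time T u u' m : 0 <= T -> 0 < m -> u 0 = 0 ->
  (forall t, 0 <= t <= T -> rderiv [set t | 0 <= t <= T] u t (u' t)) ->
  (forall t, 0 <= t <= T -> m <= u' t) ->
  exists r : R -> R, [/\ 0 <= u T, reparametrization (u T) T r,
    forall t, 0 <= t <= T -> 0 <= u t <= u T /\ r (u t) = t,
    forall s, 0 <= s <= u T -> 0 <= r s <= T /\ u (r s) = s &
    forall s, 0 <= s <= u T -> rderiv [set s | 0 <= s <= u T] r s (u' (r s))^-1].
Proof.
move=> T0 m0 u0 du mu'.
have grow a b : 0 <= a -> a <= b -> b <= T -> m * (b - a) <= u b - u a.
  move=> a0 ab bT.
  have sub s : a <= s <= b -> 0 <= s <= T.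
    by move=> /andP[h1 h2]; rewrite (le_trans a0 h1) (le_trans h2 bT).
  have : u a - m * a <= u b - m * b.
    apply: (@rderiv_le _ [set t | 0 <= t <= T] (fun s => u s - m * s)
      (fun s => u' s - m * 1) a b ab) => s sI.
    - exact: sub.
    - exact: rderivB (du s (sub s sI)) (rderivZ m (rderiv_id _ s)).
    - by rewrite mulr1 subr_ge0 mu'// sub.
  lra.
have mono a b : 0 <= a -> a <= b -> b <= T -> u a <= u b.
  move=> a0 ab bT; have := grow a b a0 ab bT.
  have : 0 <= m * (b - a) by rewrite mulr_ge0// ?(ltW m0)// subr_ge0.
  lra.
have uT0 : 0 <= u T by rewrite -u0 mono.
have inj a b : 0 <= a <= T -> 0 <= b <= T -> `|a - b| <= m^-1 * `|u a - u b|.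
  wlog ab : a b / b <= a => [H|] aI bI.
    have [/H|/ltW/H] := leP b a; first exact.
    by rewrite distrC (distrC (u a)); exact.
  case/andP: aI => a0 aT; case/andP: bI => b0 bT.
  have := grow b a b0 ab aT; have := mono b a b0 ab aT => h1 h2.
  by rewrite !ger0_norm ?subr_ge0// mulrC ler_pdivlMr// mulrC.
have uc : {within `[0, T], continuous u}.
  by apply: (@rderiv_within_cont _ [set t | 0 <= t <= T] u u') => // t; exact: du.
have /choice[r rP] : forall s, exists t, 0 <= s <= u T -> 0 <= t <= T /\ u t = s.
  move=> s; have [sI|sI] := boolP (0 <= s <= u T); last by exists 0.
  have [|t tI ts] := @IVT R u 0 T s T0 uc.
    by rewrite u0 (min_l uT0) (max_r uT0).
  by exists t; move: tI; rewrite in_itv.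
have uI t : 0 <= t <= T -> 0 <= u t <= u T.
  by move=> /andP[t0 tT]; rewrite -{1}u0 !mono.
have ru t : 0 <= t <= T -> r (u t) = t.
  move=> tI; have [rI ur] := rP _ (uI t tI).
  apply/eqP; rewrite -subr_eq0 -normr_le0; apply: le_trans (inj _ _ rI tI) _.
  by rewrite ur subrr normr0 mulr0.
have rlip s1 s2 : 0 <= s1 <= u T -> 0 <= s2 <= u T -> `|r s1 - r s2| <= m^-1 * `|s1 - s2|.
  move=> h1 h2; have [rI ur] := rP _ h1; have [rI' ur'] := rP _ h2.
  by have := inj _ _ rI rI'; rewrite ur ur'.
have rc s : 0 <= s <= u T -> r @ within [set s | 0 <= s <= u T] (nbhs s) --> r s.
  move=> sI; apply/cvgrPdist_lt => e e0; apply/within_nbhsP; exists (m * e); first exact: mulr_gt0.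
  move=> s' ss' sI'; rewrite distrC; apply: le_lt_trans (rlip _ _ sI' sI) _.
  by rewrite mulrC ltr_pdivrMr// mulrC.
exists r; split=> //.
- split.
  + by rewrite -u0 ru// lexx.
  + by rewrite ru// lexx T0.
  + apply/subspace_continuousP => s /=; rewrite in_itv /= => sI.
    apply/cvgrPdist_lt => e e0; have /cvgrPdist_lt/(_ _ e0)/within_nbhsP[d d0 dP] := rc s sI.
    apply/within_nbhsP; exists d => // s' ss'; rewrite /= in_itv; exact: dP.
  + move=> s1 s2; rewrite !in_itv /= => h1 h2 s12.
    have [r1I ur1] := rP _ h1; have [r2I ur2] := rP _ h2.
    rewrite ltNge; apply/negP => r21.
    case/andP: r1I => _ ?; case/andP: r2I => ? _.
    have := mono (r s2) (r s1); rewrite ur1 ur2 => /(_ _ r21) H.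
    have /le_lt_trans/(_ s12) : s2 <= s1 by apply: H.
    by rewrite ltxx.
- by move=> t tI; split; [exact: uI|exact: ru].
move=> s sI; have [rI ur] := rP _ sI.
have /rderivP[q [qc qE qP]] := du _ rI.
have qm t : 0 <= t <= T -> m <= q t.
  move=> tI; have [->|ne] := eqVneq t (r s); first by rewrite qE mu'.
  have := qP t tI; have := inj t (r s) tI rI => h1 h2.
  have [lt|gt] := ltP t (r s).
    have := grow t (r s); case/andP: tI => t0 _; case/andP: (rI) => _ rT.
    move=> /(_ t0 (ltW lt) rT); rewrite -opprB -(opprB (u t)) h2 mulrN lerN2 mulrC.
    by rewrite ler_nM2r ?subr_lt0.
  have gt' : r s < t by rewrite lt_neqAle eq_sym ne.
  have := grow (r s) t; case/andP: tI => _ tT; case/andP: (rI) => r0 _.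
  move=> /(_ r0 gt tT); rewrite h2 [leRHS]mulrC ler_pM2r// subr_gt0//.
apply/rderivP; exists (fun s' => (q (r (clamp (u T) s')))^-1); split.
- apply: cvgV.
    by rewrite -qE gt_eqF// (lt_le_trans m0)// qm.
  apply/cvgrPdist_lt => e e0; have /cvgrPdist_lt/(_ _ e0)/within_nbhsP[d d0 dP] := qc.
  have /cvgrPdist_lt/(_ _ d0)/within_nbhsP[d' d'0 dP'] := rc s sI.
  apply/within_nbhsP; exists d' => // s' ss' sI'; rewrite clampE//.
  by apply: dP; [rewrite distrC; exact: dP'|exact: (rP _ sI').1].
- by rewrite clampE// qE.
- move=> s' sI'; rewrite clampE//; have [rI' ur'] := rP _ sI'.
  have := qP _ rI'; rewrite ur' ur => ->; by rewrite mulfK// gt_eqF// (lt_le_trans m0)// qm.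
Qed.

End TimeChange.

(** * Absolute continuity and change of variables *)

Section AbsoluteContinuity.
Variable R : realType.
Implicit Types (f g : R -> R) (a b x y e : R).
Local Notation TV := total_variation.

(** Families indexed by any finite type are wanted for the cells of several partitions at once,
    which are indexed by a dependent sum. *)
Lemma abs_continuous_fin a b f : abs_continuous a b f -> forall e, 0 < e ->
  exists2 d, 0 < d & forall (J : finType) (x y : J -> R),
    (forall i, a <= x i /\ x i <= y i /\ y i <= b) ->
    trivIset [set: J] (fun i => `]x i, y i[%classic) ->
    \sum_i (y i - x i) < d -> \sum_i `|f (y i) - f (x i)| < e.
Proof.
move=> fac e /fac[d d0 H]; exists d => // J x y xy tr s.
have E (F : J -> R) : \sum_i F i = \sum_(i < #|J|) F (enum_val i).
  by have := big_enum_val (A := predT) (op := +%R) (idx := 0) F.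
rewrite (E (fun i => `|f (y i) - f (x i)|)); apply: (H _ (fun i => x (enum_val i)) (fun i => y (enum_val i))) => [i|i j _ _ ij|].
- exact: xy.
- by apply: enum_val_inj; exact: (tr _ _ I I ij).
- by move: s; rewrite (E (fun i => y i - x i)).
Qed.

Lemma abs_continuous_pair a b f : abs_continuous a b f -> forall e, 0 < e ->
  exists2 d, 0 < d & forall x y, a <= x -> x <= y -> y <= b -> y - x < d -> `|f y - f x| < e.
Proof.
move=> fac e /fac[d d0 H]; exists d => // x y ax xy yb yx.
have := H 1%N (fun=> x) (fun=> y); rewrite !big_ord1; apply=> //.
by move=> i j _ _ _; rewrite !ord1.
Qed.

Lemma abs_continuous_cont a b f : abs_continuous a b f -> {within `[a, b], continuous f}.
Proof.
move=> fac; apply/subspace_continuousP => t /=; rewrite in_itv /= => /andP[at_ tb].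
apply/cvgrPdist_lt => e e0; have [d d0 H] := abs_continuous_pair fac e0.
apply/within_nbhsP; exists d => // s st; rewrite /= in_itv /= => /andP[as_ sb].
have [h|/ltW h] := leP s t.
  by apply: H => //; rewrite -(opprB s) -(ger0_norm (_ : 0 <= - (s - t))) ?normrN// oppr_ge0 subr_le0.
by rewrite distrC; apply: H => //; rewrite -(ger0_norm (_ : 0 <= s - t)) ?subr_ge0.
Qed.

Lemma abs_continuous_lip a b f g (L : R) : 0 < L -> abs_continuous a b f ->
  (forall x y, a <= x -> x <= y -> y <= b ->
     `|g y - g x| <= L * ((y - x) + `|f y - f x|)) -> abs_continuous a b g.
Proof.
move=> L0 fac fg e e0; have e2 : 0 < e / (2 * L) by rewrite divr_gt0// mulr_gt0.
have [d d0 H] := fac _ e2; exists (Num.min d (e / (2 * L))); first by rewrite lt_min d0.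
move=> n x y xy tr; rewrite lt_min => /andP[s1 s2].
apply: (@le_lt_trans _ _ (\sum_(i < n) L * ((y i - x i) + `|f (y i) - f (x i)|))).
  by apply: ler_sum => i _; have [? [? ?]] := xy i; exact: fg.
rewrite -mulr_sumr big_split /= -ltr_pdivlMl//.
have := H n x y xy tr s1.
have -> : L^-1 * e = e / (2 * L) + e / (2 * L) by field; rewrite gt_eqF.
lra.
Qed.

(** The time change lengthens intervals by at most the factor [L], and the monotone inverse [r']
    pulls a common point of two image intervals back to a common point of the original ones, so
    disjointness is preserved. *)
Lemma abs_continuous_time (S T : R) f (r r' : R -> R) (L : R) : 0 < L -> abs_continuous 0 S f ->
  (forall t, 0 <= t <= T -> 0 <= r t <= S) ->
  (forall s t, 0 <= s -> s <= t -> t <= T -> r s <= r t /\ r t - r s <= L * (t - s)) ->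
  (forall s t, 0 <= s -> s <= t -> t <= S -> r' s <= r' t) ->
  (forall s, 0 <= s <= S -> 0 <= r' s <= T /\ r (r' s) = s) ->
  (forall t, 0 <= t <= T -> r' (r t) = t) ->
  abs_continuous 0 T (fun t => f (r t)).
Proof.
move=> L0 fac rI rlip r'm r'I r'K e /fac[d d0 H]; exists (d / L); first exact: divr_gt0.
move=> n x y xy tr s; apply: (H _ (fun i => r (x i)) (fun i => r (y i))).
- move=> i; have [x0 [xyi yT]] := xy i.
  have /andP[? ?] : 0 <= r (x i) <= S by apply: rI; rewrite x0 (le_trans xyi).
  have /andP[? ?] : 0 <= r (y i) <= S by apply: rI; rewrite yT (le_trans x0).
  by split=> //; split=> //; have [] := rlip _ _ x0 xyi yT.
- move=> i j _ _ [u [/=]]; rewrite !in_itv /= => /andP[u1 u2] /andP[u3 u4].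
  apply: (tr i j I I); exists (r' u) => /=; rewrite !in_itv /=.
  have aux k : r (x k) < u -> u < r (y k) -> x k < r' u < y k.
    move=> h1 h2; have [x0 [xyi yT]] := xy k.
    have xI : 0 <= x k <= T by rewrite x0 (le_trans xyi).
    have yI : 0 <= y k <= T by rewrite yT (le_trans x0).
    have /andP[rx0 _] := rI _ xI; have /andP[_ ryS] := rI _ yI.
    have uS : 0 <= u <= S by rewrite (le_trans rx0 (ltW h1)) (le_trans (ltW h2) ryS).
    have [_ ru] := r'I _ uS.
    have a1 : x k <= r' u by rewrite -(r'K _ xI); apply: r'm => //; [exact: ltW|case/andP: uS].
    have a2 : r' u <= y k by rewrite -(r'K _ yI); apply: r'm => //; [case/andP: uS|exact: ltW].
    rewrite !lt_neqAle a1 a2 !andbT; apply/andP; split; apply/eqP => E.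
      by move: h1; rewrite E ru ltxx.
    by move: h2; rewrite -E ru ltxx.
  by split; exact: aux.
- apply: (@le_lt_trans _ _ (\sum_(i < n) L * (y i - x i))).
    by apply: ler_sum => i _; have [? [? ?]] := xy i; have [] := rlip (x i) (y i).
  by rewrite -mulr_sumr mulrC -ltr_pdivlMr.
Qed.

Lemma itv_partition_cells (x y : R) (l : seq R) : itv_partition x y l ->
  [/\ forall k, (k < size l)%N -> [/\ x <= nth y (x :: l) k, nth y (x :: l) k < nth y (x :: l) k.+1
      & nth y (x :: l) k.+1 <= y],
   \sum_(k < size l) (nth y (x :: l) k.+1 - nth y (x :: l) k) = y - x &
   trivIset [set: 'I_(size l)] (fun k : 'I_(size l) => `]nth y (x :: l) k, nth y (x :: l) k.+1[%classic)].
Proof.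
move=> [pl /eqP ly].
have lt_n i j : (i < j)%N -> (j <= size l)%N -> nth y (x :: l) i < nth y (x :: l) j.
  move=> ij jl; have := sorted_ltn_nth lt_trans y (s := x :: l) pl.
  by apply; rewrite ?inE ?ltnS// (leq_trans _ jl)// ltnW.
have nl : nth y (x :: l) (size l) = y by rewrite -[RHS]ly (last_nth y).
have le_n i j : (i <= j)%N -> (j <= size l)%N -> nth y (x :: l) i <= nth y (x :: l) j.
  by rewrite leq_eqVlt => /predU1P[->//|ij jl]; rewrite ltW// lt_n.
split.
- move=> k kl; split; [exact: (le_n 0%N k (leq0n k) (ltnW kl))| |by rewrite -[leRHS]nl; exact: le_n].
  exact: lt_n.
- by rewrite -(big_mkord xpredT (fun k => nth y (x :: l) k.+1 - nth y (x :: l) k)) telescope_sumr// nl.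
- move=> i j _ _ [u [/=]]; rewrite !in_itv /= => /andP[u1 u2] /andP[u3 u4].
  apply/val_inj => /=; have [ij|ij|//] := ltngtP i j.
    have := le_n i.+1 j ij (ltnW (ltn_ord j)); move/(lt_le_trans u2)/lt_trans => /(_ _ u3).
    by rewrite ltxx.
  have := le_n j.+1 i ij (ltnW (ltn_ord i)); move/(lt_le_trans u4)/lt_trans => /(_ _ u1).
  by rewrite ltxx.
Qed.

Lemma variation_cells (x y : R) f (l : seq R) :
  variation x y f l = \sum_(k < size l) `|f (nth y (x :: l) k.+1) - f (nth y (x :: l) k)|.
Proof. by rewrite /variation big_mkord. Qed.

(** Take the [d] that belongs to [e = 1]: on intervals shorter than [d] the variation is at most 1,
    and finitely many steps of length [d / 2] exhaust [[a, b]]. *)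
Lemma abs_continuous_BV a b f : a <= b -> abs_continuous a b f -> bounded_variation a b f.
Proof.
move=> ab fac; have [d d0 H] := abs_continuous_fin fac ltr01.
have small x y : a <= x -> x <= y -> y <= b -> y - x < d -> TV x y f \is a fin_num.
  move=> ax xy yb yx; apply/bounded_variationP => //; exists 1 => _ [l pl <-].
  have [c1 c2 c3] := itv_partition_cells pl.
  rewrite variation_cells ltW//; apply: (H _ (fun k : 'I_(size l) => nth y (x :: l) k)
     (fun k : 'I_(size l) => nth y (x :: l) k.+1)) => //.
    by move=> i; have [h1 h2 h3] := c1 i (ltn_ord i); split; [lra|split; lra].
  by rewrite c2.
suff steps n : forall y, a <= y -> y <= b -> y - a <= n%:R * (d / 2) -> TV a y f \is a fin_num.
  apply/bounded_variationP => //.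
  apply: (steps (Num.bound ((b - a) / (d / 2)))) => //.
  rewrite -ler_pdivrMr ?divr_gt0//; apply/ltW/archi_boundP.
  by rewrite divr_ge0 ?subr_ge0// ltW// divr_gt0.
elim: n => [|n IH] y ay yb.
  rewrite mul0r subr_le0 => ya; have -> : y = a by apply/le_anti; rewrite ya.
  by rewrite total_variationxx.
rewrite -natr1 mulrDl mul1r => H1.
have [h|h] := leP (y - a) (n%:R * (d / 2)); first exact: IH.
pose m := Num.max a (y - d / 2).
have am : a <= m by rewrite le_max lexx.
have my : m <= y by rewrite ge_max ay /=; lra.
have mb := le_trans my yb.
rewrite (total_variationD _ am my) fin_numD; apply/andP; split.
  apply: IH => //; rewrite /m; case: (leP a (y - d / 2)) => ?; first lra.
  by rewrite subrr mulr_ge0// ltW// divr_gt0.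
have m2 : y - d / 2 <= m by rewrite le_max lexx orbT.
by apply: small => //; lra.
Qed.

Definition tv a f t := fine (TV a t f).

Lemma tvB a b f x y : bounded_variation a b f -> a <= x -> x <= y -> y <= b ->
  ((tv a f y - tv a f x)%:E = TV x y f)%E.
Proof.
move=> bv ax xy yb; have ay := le_trans ax xy.
have fx : TV a x f \is a fin_num.
  by apply/bounded_variationP => //; apply: bounded_variationl bv => //; exact: le_trans yb.
have fy : TV a y f \is a fin_num by apply/bounded_variationP => //; exact: bounded_variationl bv.
have E := total_variationD f ax xy.
have fxy : TV x y f \is a fin_num by move: fy; rewrite E fin_numD => /andP[].
rewrite /tv E fineD// -{2}(fineK fxy); congr (_%:E); ring.
Qed.

(** On each given interval a partition almost realizes the variation. The cells of all these
    partitions form one disjoint family of the same total length, to which absolute continuity of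
    [f] applies. *)
Lemma tv_abs_continuous a b f : a <= b -> abs_continuous a b f -> abs_continuous a b (tv a f).
Proof.
move=> ab fac; have bv := abs_continuous_BV ab fac.
move=> e e0; have [d d0 H] := abs_continuous_fin fac (div2_gt0 e0).
exists d => // n x y xy tr sd.
(* The [n] errors add up to at most [e / 2]; the successor avoids a division by zero when the family
   is empty. *)
pose eta := e / (2 * n.+1%:R).
have eta0 : 0 < eta by rewrite divr_gt0// mulr_gt0.
have /choice[l lP] : forall i, exists l, itv_partition (x i) (y i) l /\
    tv a f (y i) - tv a f (x i) <= variation (x i) (y i) f l + eta.
  move=> i; have [ax [xyi yb]] := xy i.
  have E := tvB bv ax xyi yb.
  have fin : ereal_sup [set z%:E | z in variations (x i) (y i) f] \is a fin_num by rewrite -/(TV _ _ _) -E.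
  have [_ [_ [l pl <-] <-]] := ub_ereal_sup_adherent eta0 fin.
  rewrite -/(TV _ _ _) -E -EFinB lte_fin => h; exists l; split=> //; lra.
pose K := {i : 'I_n & 'I_(size (l i))}.
pose X (p : K) := nth (y (tag p)) (x (tag p) :: l (tag p)) (tagged p).
pose Y (p : K) := nth (y (tag p)) (x (tag p) :: l (tag p)) (tagged p).+1.
have cells i := itv_partition_cells (lP i).1.
have sumE (F : forall i, 'I_(size (l i)) -> R) :
    \sum_i \sum_(k < size (l i)) F i k = \sum_(p : K) F (tag p) (tagged p).
  by rewrite sig_big_dep; apply: eq_bigl.
have XY (p : K) : [/\ x (tag p) <= X p, X p < Y p & Y p <= y (tag p)].
  by have [c _ _] := cells (tag p); exact: c.
have := H K X Y; rewrite /X /Y.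
rewrite -(sumE (fun i k => `|f (nth (y i) (x i :: l i) k.+1) - f (nth (y i) (x i :: l i) k)|)).
rewrite -(sumE (fun i k => nth (y i) (x i :: l i) k.+1 - nth (y i) (x i :: l i) k)) => Hs.
have {}Hs : \sum_i \sum_(k < size (l i)) `|f (nth (y i) (x i :: l i) k.+1) - f (nth (y i) (x i :: l i) k)| < e / 2.
  apply: Hs.
  - move=> p; have [h1 h2 h3] := XY p; have [ax [_ yb]] := xy (tag p).
    by split; [exact: le_trans h1|split; [exact: ltW|exact: le_trans yb]].
  - move=> [i k] [j m] _ _ [u [/=]]; rewrite !in_itv /= => hu1 hu2.
    have [h1 h2 h3] := XY (existT _ i k); have [h4 h5 h6] := XY (existT _ j m).
    rewrite /X /Y /= in h1 h2 h3 h4 h5 h6.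
    have ij : i = j.
      apply: (tr i j I I); exists u => /=; rewrite !in_itv /=.
      case/andP: hu1 => a1 a2; case/andP: hu2 => a3 a4.
      by split; apply/andP; split; lra.
    case: _ / ij m hu2 {h4 h5 h6} => m hu2; congr existT.
    have [_ _ c3] := cells i; apply: (c3 k m I I); exists u => /=; rewrite !in_itv /=.
    by [].
  - by rewrite (eq_bigr (fun i => y i - x i))// => i _; have [_ -> _] := cells i.
apply: (@le_lt_trans _ _ (\sum_(i < n) (variation (x i) (y i) f (l i) + eta))).
  apply: ler_sum => i _; have [ax [xyi yb]] := xy i; have [_ h] := lP i.
  rewrite ger0_norm//; have := total_variation_ge0 f xyi.
  by rewrite -(tvB bv ax xyi yb) lee_fin.
rewrite big_split /= sumr_const card_ord -mulr_natr.
under eq_bigr do rewrite variation_cells.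
have : eta * n%:R <= e / 2.
  rewrite /eta invfM mulrA -mulrA; apply: ler_piMr; first by rewrite ltW// divr_gt0.
  by rewrite mulrC ler_pdivrMr// mul1r ler_nat.
lra.
Qed.

End AbsoluteContinuity.

(** * Derivatives of absolutely continuous functions *)

Section MonotoneDerivative.
Variable R : realType.
Local Notation mu := (@lebesgue_measure R).
Implicit Types (a b x y e T : R).

Lemma ls_ocitv (F : cumulative R R) a b : a <= b ->
  lebesgue_stieltjes_measure F `]a, b]%classic = (F b - F a)%:E.
Proof.
move=> ab; rewrite /lebesgue_stieltjes_measure /measure_extension measurable_mu_extE/=.
  by rewrite wlength_itv_bnd.
exact: is_ocitv.
Qed.

Lemma lebesgue_ocitv a b : a <= b -> mu `]a, b]%classic = (b - a)%:E.
Proof. by move=> ab; rewrite /lebesgue_measure ls_ocitv. Qed.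

Lemma clamp_mono T a b : a <= b -> clamp T a <= clamp T b.
Proof.
move=> ab; rewrite /clamp; case: (leP T a) => ?; case: (leP T b) => ?; case: (leP 0 T) => ?;
  case: (leP 0 a) => ?; case: (leP 0 b) => ?; lra.
Qed.

(** Covers in the definition of outer measure may overlap, while absolute continuity speaks of
    disjoint intervals; the ring generated by half-open intervals supplies a disjoint
    decomposition. *)
Lemma ocitv_union_decomp n (B : nat -> set (ocitv_type R)) : (forall k, ocitv (B k)) ->
  exists (m : nat) (p : nat -> R * R), [/\ forall j, (j < m)%N -> (p j).1 <= (p j).2,
    trivIset [set: 'I_m] (fun j : 'I_m => `](p j).1, (p j).2]%classic) &
    \big[setU/set0]_(k < n) B k = \big[setU/set0]_(j < m) `](p j).1, (p j).2]%classic].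
Proof.
move=> oB.
have mU : measurable (\big[setU/set0]_(k < n) B k : set (SetRing.type (ocitv_type R))).
  by apply: bigsetU_measurable => k _; apply: SetRing.measurable_subring; exact: oB.
have [D [/finite_seqP[s sE] _ tD mD UE]] := SetRing.ring_finite_set mU.
pose r := undup s.
have rD j : (j < size r)%N -> D (nth set0 r j).
  by move=> jr; rewrite sE /= -mem_undup mem_nth.
have /choice[p pP] : forall j : nat, exists p : R * R, (j < size r)%N ->
    p.1 <= p.2 /\ nth set0 r j = `]p.1, p.2]%classic.
  move=> j; have [jr|jr] := boolP (j < size r)%N; last by exists (0, 0).
  have := mD _ (mem_set (rD j jr)) => /ocitvP[->|[q q12 ->]].
    by exists (0, 0); split=> //=; rewrite set_itvoc0.
  by exists q; split=> //; exact: ltW.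
exists (size r), p; split.
- by move=> j jr; have [] := pP j jr.
- move=> i j _ _; rewrite -(pP i (ltn_ord i)).2 -(pP j (ltn_ord j)).2 => ne.
  have := tD _ _ (rD i (ltn_ord i)) (rD j (ltn_ord j)) ne.
  by move/eqP; rewrite nth_uniq ?undup_uniq// => /eqP/val_inj.
- rewrite UE -(bigcup_mkord _ (fun j => `](p j).1, (p j).2]%classic)); apply/seteqP; split => u /=.
    move=> [X DX Xu].
    have Xr : X \in r by rewrite mem_undup; move: DX; rewrite sE.
    have jr : (index X r < size r)%N by rewrite index_mem.
    exists (index X r); first exact: jr.
    by rewrite -(pP _ jr).2 nth_index.
  by move=> [j jm]; rewrite -(pP j jm).2 => h; exists (nth set0 r j) => //; exact: rD.
Qed.

(** A Lebesgue null set has a cover of total length below [d]. Each finite part of the cover becomes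
    a disjoint family of intervals and so has Stieltjes measure at most [e]; continuity from below
    gives the same bound for the whole cover. *)
Lemma abs_continuous_null T (F : R -> R) (Fc : cumulative R R) : 0 <= T ->
  abs_continuous 0 T F -> (forall t, Fc t = F (clamp T t)) ->
  forall A, measurable A -> mu A = 0%E -> lebesgue_stieltjes_measure Fc A = 0%E.
Proof.
move=> T0 Fac FcE A mA A0.
apply/le_anti; rewrite measure_ge0 andbT; apply/lee_addgt0Pr => e e0; rewrite add0e.
have [d d0 H] := Fac e e0.
have : (mu A < d%:E)%E by rewrite A0 lte_fin.
move=> /ereal_inf_lt[_ [B [mB AB] <-] Bd].
have oB k : ocitv (B k) := mB k.
have mB' k : measurable (B k : set (measurableTypeR R)) by apply: sub_gen_smallest; exact: oB.
pose U n : set (measurableTypeR R) := \big[setU/set0]_(k < n) B k.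
have mUn n : measurable (U n) by apply: bigsetU_measurable => k _; exact: mB'.
have Ue n : (lebesgue_stieltjes_measure Fc (U n) <= e%:E)%E.
  have [m [p [p12 tp UE]]] := @ocitv_union_decomp n B oB.
  have mp (j : 'I_m) : measurable (`](p j).1, (p j).2]%classic : set (measurableTypeR R)).
    by apply: sub_gen_smallest; exact: is_ocitv.
  have Ud : (mu (U n) < d%:E)%E.
    apply: le_lt_trans Bd; apply: (@le_trans _ _ (\sum_(0 <= k <oo) mu (B k))%E).
      apply: measure_sigma_subadditive => //.
      exact: bigsetU_bigcup.
    apply: lee_nneseries => k _ //; rewrite /lebesgue_measure /lebesgue_stieltjes_measure.
    by rewrite /measure_extension measurable_mu_extE//; exact: oB.
  rewrite /U UE measure_bigsetU_ord // in Ud *.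
  have sd : \sum_(j < m) (clamp T (p j).2 - clamp T (p j).1) < d.
    rewrite -lte_fin; apply: le_lt_trans Ud; rewrite -sumEFin; apply: lee_sum => j _.
    have pj := p12 j (ltn_ord j); have E := lebesgue_ocitv pj.
    suff : ((clamp T (p j).2 - clamp T (p j).1)%:E <= ((p j).2 - (p j).1)%:E)%E by rewrite -E.
    rewrite lee_fin.
    have := clamp_lip (p j).2 (p j).1 T0; rewrite [X in _ <= X -> _]ger0_norm ?subr_ge0 ?p12//.
    by apply: le_trans; exact: ler_norm.
  have := H m (fun j => clamp T (p j).1) (fun j => clamp T (p j).2) _ _ sd.
  have cm := @clamp_mono T.
  move=> Hs; rewrite -[X in (X <= _)%E](_ : (\sum_(j < m) (F (clamp T (p j).2) - F (clamp T (p j).1)))%:E = _); last first.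
    rewrite (measure_bigsetU_ord (lebesgue_stieltjes_measure Fc))// -sumEFin.
    by apply: eq_bigr => j _; rewrite -!FcE; apply/esym/ls_ocitv/p12/ltn_ord.
  rewrite lee_fin; apply: le_trans (ltW (Hs _ _)).
  + by apply: ler_sum => j _; exact: ler_norm.
  + move=> j; have /andP[c0 _] := clamp_itv (p j).1 T0; have /andP[_ cT] := clamp_itv (p j).2 T0.
    by split=> //; split=> //; apply: cm; exact: p12.
  + move=> i j _ _ [u [/=]]; rewrite !in_itv /= => /andP[u1 u2] /andP[u3 u4].
    have uc : clamp T u = u.
      apply: clampE; have /andP[c0 _] := clamp_itv (p i).1 T0; have /andP[_ cT] := clamp_itv (p i).2 T0.
      by rewrite (le_trans c0 (ltW u1)) (le_trans (ltW u2)).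
    have aux k : clamp T (p k).1 < u -> u < clamp T (p k).2 -> (p k).1 < u <= (p k).2.
      move=> h1 h2; apply/andP; split.
        by rewrite ltNge; apply/negP => /cm; rewrite uc leNgt h1.
      by apply/ltW; rewrite ltNge; apply/negP => /cm; rewrite uc leNgt h2.
    by apply: (tp i j I I); exists u => /=; rewrite !in_itv /= !aux.
have mUU : measurable (\bigcup_k U k.+1) by apply: bigcupT_measurable => k; exact: mUn.
apply: (@le_trans _ _ (lebesgue_stieltjes_measure Fc (\bigcup_k U k.+1))).
  by apply: le_measure; rewrite ?inE// /U bigcup_bigsetU_bigcup.
have cv : (fun k => lebesgue_stieltjes_measure Fc (U k.+1)) @ \oo -->
    lebesgue_stieltjes_measure Fc (\bigcup_k U k.+1).
  apply: (@nondecreasing_cvg_mu _ _ _ (lebesgue_stieltjes_measure Fc) (fun k => U k.+1)) => //.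
  by move=> i j ij; apply/subsetPset; apply: subset_bigsetU; rewrite ltnS.
rewrite -(cvg_lim _ cv)//; apply: lime_le; first by apply/cvg_ex; eexists; exact: cv.
by apply: nearW => k; exact: Ue.
Qed.

Lemma derivable_is_derive (P : R -> R) x (m : R) : derivable P x 1 -> derive1 P x = m ->
  is_derive x (1 : R) P m.
Proof. by move=> dP <-; apply: DeriveDef => //; rewrite derive1E. Qed.

(** The Stieltjes measure of the extrapolated [F] is dominated by Lebesgue measure. Its
    Radon-Nikodym density [h] has [F - F 0] as its indefinite integral, and the fundamental theorem
    of calculus identifies [h] with the derivative almost everywhere. *)
Lemma monotone_ac_derive T (F : R -> R) : 0 < T ->
  (forall s t, 0 <= s -> s <= t -> t <= T -> F s <= F t) -> abs_continuous 0 T F ->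
  exists h : R -> R, measurable_fun [set: R] h /\
    {ae mu, forall x, 0 < x < T -> is_derive x (1 : R) F (h x)}.
Proof.
move=> T0 Fm Fac; pose G t := F (clamp T t); have T0' := ltW T0.
have Gnd : {homo G : x y / x <= y}.
  move=> a b ab; have /andP[a0 aT] := clamp_itv a T0'; have /andP[b0 bT] := clamp_itv b T0'.
  by apply: Fm => //; exact: clamp_mono.
have Gc : continuous G.
  apply: clamp_continuous => // t tI.
  have := abs_continuous_cont Fac; move=> /subspace_continuousP/(_ t).
  rewrite /= in_itv /= => /(_ tI) c; apply: cvg_trans c; apply: cvg_app.
  by move=> A /within_nbhsP[e e0 eA]; apply/within_nbhsP; exists e => // s se sI; apply: eA => //=; rewrite in_itv.
pose Fc : cumulative R R := HB.pack G (isCumulative.Build R _ R G Gnd (right_continuousW Gc)).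
(* Restriction makes the measure finite. Beginning at [-1] adds no mass, because the extrapolated
   function is constant up to 0. *)
pose D : set (measurableTypeR R) := `](-1), T]%classic.
have mD : measurable D by apply: sub_gen_smallest; exact: is_ocitv.
have T1 : -1 <= T by lra.
have DF : (lebesgue_stieltjes_measure Fc D < +oo)%E by rewrite ls_ocitv// ltry.
pose nu : {finite_measure set (measurableTypeR R) -> \bar R} := mfrestr mD DF.
have numu : nu `<< mu.
  apply/null_content_dominatesP => A mA A0.
  apply/le_anti; rewrite measure_ge0 andbT.
  rewrite -(@abs_continuous_null T F Fc T0' Fac (fun t => erefl) A mA A0).
  by apply: le_measure; rewrite ?inE//; exact: measurableI.
have [f [f0 ffin fint fE]] := radon_nikodym_sigma_finite numu.
pose h : R -> R := fine \o f.
have hE : EFin \o h = f by apply/funext => t; rewrite /= fineK.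
have mh : measurable_fun [set: R] h.
  by apply/measurable_EFinP; rewrite hE; exact: measurable_int fint.
exists h; split => //.
have hint : mu.-integrable [set: R] (EFin \o h) by rewrite hE.
have hinty y : mu.-integrable [set` Interval (BRight (-1)) (BRight y)] (EFin \o h).
  by apply: (integrableS _ _ _ hint) => //; exact: measurable_itv.
have hloc : locally_integrable [set: R] h by apply: open_integrable_locally hint; exact: openT.
have ftc := FTC1 hinty hloc.
move: ftc; apply: filterS; first exact: (ae_filter_ringOfSetsType mu).
move=> x H /andP[x0 xT].
have x1 : (BRight (-1) < BRight x)%O by rewrite bnd_simp; lra.
have [dP dE] := H x1.
pose P y := \int[mu]_(t in `](-1), y]) h t.
have PE y : 0 <= y <= T -> P y + F 0 = F y.
  move=> yI; have /andP[y0 yT] := yI.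
  have my : measurable (`](-1), y]%classic : set (measurableTypeR R)) by apply: sub_gen_smallest; exact: is_ocitv.
  rewrite /P /Rintegral.
  under eq_integral do rewrite -[(h _)%:E]/((EFin \o h) _) hE.
  rewrite -fE// /nu /= /mfrestr /mrestr setIidl; last first.
    by move=> u /=; rewrite /D /= !in_itv /= => /andP[u1 uy]; rewrite u1; exact: le_trans yT.
  rewrite ls_ocitv/=; last lra.
  rewrite /G clampE// /clamp (min_r (_ : -1 <= T))// (max_l (_ : -1 <= 0)) ?lerN10//; ring.
have dP' : is_derive x (1 : R) P (h x) by exact: derivable_is_derive dP dE.
pose E := [set t : R | 0 <= t <= T].
have := rderivD (is_derive_rderiv E dP') (rderiv_cst E (F 0) x); rewrite addr0 => d1.
have xE : E x by rewrite /E /= !ltW.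
have : rderiv E F x (h x) by apply: tderiv_eq xE _ d1 => s sE; congr real_cplx; exact: PE.
apply: (@rderiv_interior _ E F x (h x) (Num.min x (T - x))).
  by rewrite lt_min x0 subr_gt0.
move=> s; rewrite lt_min !ltr_norml /E /= => /andP[/andP[? ?] /andP[? ?]].
by apply/andP; split; lra.
Qed.

Lemma abs_continuousB a b (f g : R -> R) : abs_continuous a b f -> abs_continuous a b g ->
  abs_continuous a b (fun t => f t - g t).
Proof.
move=> fac gac e e0; have [d d0 H] := fac _ (div2_gt0 e0); have [d' d'0 H'] := gac _ (div2_gt0 e0).
exists (Num.min d d'); first by rewrite lt_min d0.
move=> n x y xy tr; rewrite lt_min => /andP[s1 s2].
apply: (@le_lt_trans _ _ (\sum_(i < n) (`|f (y i) - f (x i)| + `|g (y i) - g (x i)|))).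
  apply: ler_sum => i _; rewrite (_ : _ - _ = (f (y i) - f (x i)) - (g (y i) - g (x i))); last by ring.
  exact: ler_normB.
rewrite big_split /=; have := H n x y xy tr s1; have := H' n x y xy tr s2; lra.
Qed.

(** Jordan decomposition: the total variation and its difference with [W] are both nondecreasing and
    absolutely continuous. What matters later is that [h] is measurable on the whole line, which is
    not known of [derive1 W]. *)
Lemma abs_continuous_derive T (W : R -> R) : 0 < T -> abs_continuous 0 T W ->
  exists h : R -> R, measurable_fun [set: R] h /\
    {ae mu, forall x, 0 < x < T -> is_derive x (1 : R) W (h x)}.
Proof.
move=> T0 Wac; have T0' := ltW T0; have bv := abs_continuous_BV T0' Wac.
have Vac := tv_abs_continuous T0' Wac; set V := tv 0 W in Vac.
have VB s t : 0 <= s -> s <= t -> t <= T -> `|W t - W s| <= V t - V s.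
  by move=> s0 st tT; rewrite -lee_fin (tvB bv)//; exact: total_variation_ge.
have [|h1 [mh1 H1]] := monotone_ac_derive T0 _ Vac.
  by move=> s t s0 st tT; have := VB s t s0 st tT; have := normr_ge0 (W t - W s); lra.
have [|h2 [mh2 H2]] := monotone_ac_derive T0 _ (abs_continuousB Vac Wac).
  by move=> s t s0 st tT; have := VB s t s0 st tT; have := ler_norm (W t - W s); lra.
exists (fun t => h1 t - h2 t); split; first exact: measurable_realfun.measurable_funB.
move: H1 H2; apply: filterS2; first exact: (ae_filter_ringOfSetsType mu).
move=> x H1 H2 xI; have := is_deriveB (H1 xI) (H2 xI).
by congr (is_derive _ _ _ _); apply/funext => t /=; rewrite fctE subKr.
Qed.

End MonotoneDerivative.

(** * Integrals of nonnegative functions off null sets *)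

Section NullSets.
Variable R : realType.
Local Notation mu := (@lebesgue_measure R).
Import HBNNSimple.

(** No measurability of [f] or [g] is assumed, since squares of [derive1] terms will be inserted.
    The integral is a supremum over simple functions below the integrand, and setting such a
    function to zero on [N] does not change its integral but puts it below the other integrand. *)
Lemma ge0_integral_off_null (D N : set R) (f g : R -> \bar R) :
  measurable N -> mu N = 0%E -> (forall x, D x -> 0 <= f x)%E -> (forall x, D x -> 0 <= g x)%E ->
  (forall x, D x -> ~ N x -> f x = g x) ->
  (\int[mu]_(x in D) f x = \int[mu]_(x in D) g x)%E.
Proof.
move=> mN N0.
wlog suff : f g / (forall x, D x -> 0 <= f x)%E -> (forall x, D x -> 0 <= g x)%E ->
  (forall x, D x -> ~ N x -> f x = g x) ->
  (\int[mu]_(x in D) f x <= \int[mu]_(x in D) g x)%E.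
  move=> H f0 g0 fg; apply/le_anti/andP; split; apply: H => // x Dx Nx.
  exact/esym/fg.
move=> f0 g0 fg; rewrite ge0_integralE// [leRHS]ge0_integralE//.
apply: ge_ereal_sup => _ [h hf <-].
have mN' : measurable (~` N) by exact: measurableC.
pose h' := proj_nnsfun h mN'.
have -> : sintegral mu h = sintegral mu h'.
  rewrite -!integralT_nnsfun; apply: ae_eq_integral => //.
  - by apply/measurable_EFinP.
  - by apply/measurable_EFinP.
  exists N; split=> // x /= /not_implyP[_ ne]; apply: contrapT => Nx; apply: ne.
  by rewrite /h' /= mindicE mem_set// mulr1.
apply: ereal_sup_ubound; exists h' => // x.
rewrite /h' /= mindicE; have [/set_mem xN|_] := boolP (x \in ~` N); last first.
  by rewrite mulr0 patchE; case: ifPn => // /set_mem Dx; exact: g0.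
rewrite mulr1; have := hf x; rewrite !patchE; case: ifPn => // /set_mem Dx.
by rewrite fg.
Qed.

End NullSets.

(** * Change of variables under a time change *)

Section ChangeOfVariables.
Variable R : realType.
Local Notation mu := (@lebesgue_measure R).
Implicit Types (a b x y e T S L : R).

(** Lebesgue measure is an infimum over covers by half-open intervals, and the inequality holds for
    each such interval, hence for each cover by subadditivity. *)
Lemma ls_lipschitz (F : cumulative R R) L : 0 < L ->
  (forall a b, a <= b -> F b - F a <= L * (b - a)) ->
  forall A, measurable A -> (lebesgue_stieltjes_measure F A <= L%:E * mu A)%E.
Proof.
move=> L0 FL A mA; rewrite -lee_pdivrMl//.
apply: le_ereal_inf_tmp => _ [B [mB AB] <-].
have oB k : ocitv (B k) := mB k.
have mB' k : measurable (B k : set (measurableTypeR R)) by apply: sub_gen_smallest; exact: oB.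
rewrite lee_pdivrMl//.
apply: (@le_trans _ _ (\sum_(0 <= k <oo) lebesgue_stieltjes_measure F (B k))%E).
  exact: measure_sigma_subadditive.
rewrite -nneseriesZl//.
apply: lee_nneseries => k _ //.
have /ocitvP[->|[p p12 ->]] := oB k; first by rewrite !measure0 mule0.
have E : wlength idfun `]p.1, p.2]%classic = (p.2 - p.1)%:E by apply: wlength_itv_bnd; exact: ltW.
apply: (@le_trans _ _ (L%:E * (p.2 - p.1)%:E)%E); last by rewrite -E.
rewrite ls_ocitv; last exact: ltW.
by have := FL _ _ (ltW p12); rewrite -lee_fin EFinM.
Qed.

Section Inverse.
Variables (T S L : R) (u u' r : R -> R).
Hypotheses (T0 : 0 < T) (S0 : 0 <= S) (L1 : 1 <= L) (u0 : u 0 = 0) (uT : u T = S).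
Hypothesis uI : forall t, 0 <= t <= T -> 0 <= u t <= S /\ r (u t) = t.
Hypothesis rI : forall s, 0 <= s <= S -> 0 <= r s <= T /\ u (r s) = s.
Hypothesis du : forall t, 0 <= t <= T -> rderiv [set t | 0 <= t <= T] u t (u' t).
Hypothesis u'I : forall t, 0 <= t <= T -> 0 <= u' t <= L.
Hypothesis u'c : forall t, 0 <= t <= T -> u' @ within [set t | 0 <= t <= T] (nbhs t) --> u' t.
Hypothesis rc : {within `[0, S], continuous r}.

Let uL (s t : R) : 0 <= s -> s <= t -> t <= T -> 0 <= u t - u s <= L * (t - s).
Proof.
move=> s0 st tT.
have sub x : s <= x <= t -> 0 <= x <= T.
  by move=> /andP[h1 h2]; rewrite (le_trans s0 h1) (le_trans h2 tT).
apply/andP; split.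
  rewrite subr_ge0; apply: (@rderiv_le _ [set t | 0 <= t <= T] u u' s t st) => x xI.
  - exact: sub.
  - exact: du (sub x xI).
  - by have /andP[] := u'I (sub x xI).
have : u t - L * t <= u s - L * s.
  apply: (@rderiv_ge _ [set t | 0 <= t <= T] (fun s => u s - L * s)
    (fun s => u' s - L * 1) s t st) => x xI.
  - exact: sub.
  - exact: rderivB (du (sub x xI)) (rderivZ L (rderiv_id _ x)).
  - by have /andP[_ ?] := u'I (sub x xI); rewrite mulr1 subr_le0.
lra.
Qed.

(** [U] and [V] continue [u] and [r] with slope 1 outside their intervals, so that they are mutually
    inverse increasing bijections of the line; [L >= 1] keeps [U] Lipschitz with the same
    constant. *)
Let U (t : R) : R := u (clamp T t) + (t - clamp T t).
Let V (s : R) : R := r (clamp S s) + (s - clamp S s).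

Let UB a b : a <= b -> 0 <= U b - U a <= L * (b - a).
Proof.
move=> ab; have /andP[c0 _] := clamp_itv a (ltW T0); have /andP[_ cT] := clamp_itv b (ltW T0).
have cm := clamp_mono T ab; have /andP[h1 h2] := uL c0 cm cT.
have h3 : clamp T b - clamp T a <= b - a.
  by have := clamp_lip b a (ltW T0); rewrite !ger0_norm ?subr_ge0.
have -> : U b - U a = (u (clamp T b) - u (clamp T a)) + ((b - a) - (clamp T b - clamp T a)) by rewrite /U; ring.
have : 1 * ((b - a) - (clamp T b - clamp T a)) <= L * ((b - a) - (clamp T b - clamp T a)).
  by apply: ler_wpM2r => //; lra.
by move=> h4; apply/andP; split; lra.
Qed.

Let UE (t : R) : 0 <= t <= T -> U t = u t.
Proof. by move=> tI; rewrite /U clampE// subrr addr0. Qed.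

Let VE (s : R) : 0 <= s <= S -> V s = r s.
Proof. by move=> tI; rewrite /V clampE// subrr addr0. Qed.

Let clampN (X t : R) : 0 <= X -> t <= 0 -> clamp X t = 0.
Proof. by move=> X0 t0; rewrite /clamp (min_r (le_trans t0 X0)) (max_l t0). Qed.

Let clampP (X t : R) : 0 <= X -> X <= t -> clamp X t = X.
Proof. by move=> X0 t0; rewrite /clamp (min_l t0) (max_r X0). Qed.

Let r0 : r 0 = 0.
Proof. by have I0 : 0 <= (0 : R) <= T by [rewrite lexx ltW]; have [_] := uI I0; rewrite u0. Qed.

Let rS : r S = T.
Proof. by have I0 : 0 <= T <= T by [rewrite lexx ltW]; have [_] := uI I0; rewrite uT. Qed.

Let UV (s : R) : U (V s) = s.
Proof.
have [s0|s0] := leP s 0.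
  by rewrite /V (clampN S0 s0) r0 /U add0r subr0 (clampN (ltW T0) s0) u0 add0r subr0.
have [sS|sS] := leP s S.
  have sI : 0 <= s <= S by rewrite (ltW s0).
  by have [h1 h2] := rI sI; rewrite VE// UE.
have sS' := ltW sS; rewrite /V (clampP S0 sS') rS /U.
have h : T <= T + (s - S) by rewrite lerDl subr_ge0.
by rewrite (clampP (ltW T0) h) uT; ring.
Qed.

Let VU (t : R) : V (U t) = t.
Proof.
have [t0|t0] := leP t 0.
  by rewrite /U (clampN (ltW T0) t0) u0 /V add0r subr0 (clampN S0 t0) r0 add0r subr0.
have [tT|tT] := leP t T.
  have tI : 0 <= t <= T by rewrite (ltW t0).
  by have [h1 h2] := uI tI; rewrite UE// VE.
have tT' := ltW tT; rewrite /U (clampP (ltW T0) tT') uT /V.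
have h : S <= S + (t - T) by rewrite lerDl subr_ge0.
by rewrite (clampP S0 h) rS; ring.
Qed.

Let Und : {homo U : x y / x <= y}.
Proof. by move=> a b /UB/andP[+ _]; rewrite subr_ge0. Qed.

Let Ult a b : (U a < U b) = (a < b).
Proof.
apply/idP/idP => [h|h]; first by rewrite ltNge; apply/negP => /Und; rewrite leNgt h.
by rewrite lt_neqAle Und ?ltW// andbT; apply/eqP => E; move: h; rewrite -(VU a) E VU ltxx.
Qed.

Let Uc : continuous U.
Proof.
move=> t; apply/cvgrPdist_lt => e e0; apply/nbhs_ballP; exists (e / L) => /=.
  by rewrite divr_gt0// (lt_le_trans ltr01).
move=> s; rewrite /ball /= ltr_pdivlMr ?(lt_le_trans ltr01)// => st.
apply: le_lt_trans st.
have [h|/ltW h] := leP s t.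
  by have /andP[h1 h2] := UB h; rewrite !ger0_norm ?subr_ge0 1?mulrC//; lra.
have /andP[h1 h2] := UB h; rewrite (distrC (U t)) (distrC t) !ger0_norm ?subr_ge0 1?mulrC//; lra.
Qed.

Let Vc : continuous V.
Proof.
have rc' : continuous (fun s => r (clamp S s)).
  apply: clamp_continuous => // t tI.
  move/subspace_continuousP : rc => /(_ t); rewrite /= in_itv /= => /(_ tI) c.
  apply: cvg_trans c; apply: cvg_app.
  by move=> A /within_nbhsP[e e0 eA]; apply/within_nbhsP; exists e => // s se sI; apply: eA => //=; rewrite in_itv.
move=> s; apply: cvgD; first exact: rc'.
apply: cvgB; first exact: cvg_id.
apply/cvgrPdist_lt => e e0; apply/nbhs_ballP; exists e => //= s'; rewrite /ball /=.
exact: le_lt_trans (clamp_lip _ _ S0).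
Qed.

Let mV : measurable_fun [set: measurableTypeR R] (V : measurableTypeR R -> measurableTypeR R).
Proof. exact: continuous_measurable_fun. Qed.

Let Fc : cumulative R R := HB.pack U (isCumulative.Build R _ R U Und (right_continuousW Uc)).
Let D : set (measurableTypeR R) := `]0, T[%classic.

(** Both measures agree on half-open intervals, because the preimage of such an interval under [V]
    is its image under [U]. *)
Let push A : measurable A -> lebesgue_stieltjes_measure Fc A = pushforward mu (V : R -> measurableTypeR R) A.
Proof.
move=> mA; apply: lebesgue_stieltjes_measure_unique => // X /ocitvP[->|[p p12 ->]].
  by rewrite !measure0.
rewrite ls_ocitv ?ltW// -[RHS]/(mu (V @^-1` `]p.1, p.2]%classic)).
have -> : V @^-1` `]p.1, p.2] = `]U p.1, U p.2]%classic.
  apply/seteqP; split => s /=; rewrite !in_itv /=.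
    by rewrite -{3 4}(UV s) Ult => /andP[-> h]; rewrite Und.
  by move=> /andP[h1 h2]; rewrite -Ult UV h1 -(VU p.2) leNgt -Ult !UV -leNgt.
by rewrite lebesgue_ocitv// Und// ltW.
Qed.

(** The Stieltjes measure of [U] is described in two ways: as the measure of density [u'], where the
    fundamental theorem identifies the Radon-Nikodym density almost everywhere, and as the image of
    Lebesgue measure under [V]. *)
Lemma change_of_variables (k : R -> R) : measurable_fun [set: R] k -> (forall x, 0 <= k x) ->
  (\int[mu]_(s in `[0%R, S]) (k (r s))%:E = \int[mu]_(t in `[0%R, T]) (k t * u' t)%:E)%E.
Proof.
move=> mk k0; have T0' := ltW T0.
have Lp : 0 < L by apply: lt_le_trans L1.
have mD : measurable D by exact: measurable_itv.
have lsL A : measurable A -> (lebesgue_stieltjes_measure Fc A <= L%:E * mu A)%E.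
  by apply: ls_lipschitz => // a b /UB/andP[].
have DF : (lebesgue_stieltjes_measure Fc D < +oo)%E.
  apply: le_lt_trans (lsL D mD) _.
  by rewrite lebesgue_measure_itv /= lte_fin T0 -EFinD -EFinM ltry.
pose nu : {finite_measure set (measurableTypeR R) -> \bar R} := mfrestr mD DF.
have numu : nu `<< mu.
  apply/null_content_dominatesP => A mA A0.
  apply/le_anti; rewrite measure_ge0 andbT.
  apply: (@le_trans _ _ (lebesgue_stieltjes_measure Fc A)).
    by apply: le_measure; rewrite ?inE//; exact: measurableI.
  by apply: le_trans (lsL A mA) _; rewrite A0 mule0.
pose f := Radon_Nikodym_SigmaFinite.f nu mu.
have f0 : forall x, (0 <= f x)%E := Radon_Nikodym_SigmaFinite.f_ge0 numu.
have ffin : forall x, f x \is a fin_num := Radon_Nikodym_SigmaFinite.f_fin_num numu.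
have fint : mu.-integrable [set: measurableTypeR R] f := Radon_Nikodym_SigmaFinite.f_integrable numu.
have fE : forall A, measurable A -> nu A = (\int[mu]_(x in A) f x)%E := Radon_Nikodym_SigmaFinite.f_integral numu.
pose h : R -> R := fine \o f.
have hE : EFin \o h = f by apply/funext => t; rewrite /= fineK.
have hint : mu.-integrable [set: R] (EFin \o h) by rewrite hE.
have hinty y : mu.-integrable [set` Interval (BRight 0) (BRight y)] (EFin \o h).
  by apply: (integrableS _ _ _ hint) => //; exact: measurable_itv.
have hloc : locally_integrable [set: R] h by apply: open_integrable_locally hint; exact: openT.
have ftc := FTC1 hinty hloc.
have hu' : {ae mu, forall x, D x -> f x = (u' x)%:E}.
  move: ftc; apply: filterS; first exact: (ae_filter_ringOfSetsType mu).
  move=> x H; rewrite /D /= in_itv /= => /andP[x0 xT].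
  have x1 : (BRight 0 < BRight x)%O by rewrite bnd_simp.
  have [dP dE] := H x1.
  have dP' := derivable_is_derive dP dE.
  pose E := [set t : R | 0 < t < T].
  have xE : E x by rewrite /E /= x0.
  have PE y : E y -> \int[mu]_(t in [set` Interval (BRight 0) (BRight y)]) h t = u y.
    move=> /andP[y0 yT]; rewrite /Rintegral.
    have -> : (\int[mu]_(x0 in `]0%R, y]) (h x0)%:E = nu `]0%R, y]%classic)%E.
      by rewrite fE; [rewrite -hE|exact: measurable_itv].
    rewrite /nu /= /mfrestr /mrestr setIidl; last first.
      by move=> z /=; rewrite /D /= !in_itv /= => /andP[-> zy]; exact: le_lt_trans yT.
    rewrite ls_ocitv ?ltW//=.
    by rewrite !UE ?u0 ?subr0// ?lexx ?T0'// (ltW y0) ltW.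
  have d1 := is_derive_rderiv E dP'.
  have d2 : rderiv E u x (h x) by apply: tderiv_eq xE _ d1 => s sE; congr real_cplx; exact: PE.
  have xI : 0 <= x <= T by rewrite !ltW.
  have d3 : rderiv E u x (u' x).
    by apply: tderiv_sub (du xI) => s /andP[? ?]; apply/andP; split; exact: ltW.
  have nE : forall s, `|s - x| < Num.min x (T - x) -> E s.
    move=> s; rewrite lt_min !ltr_norml /E /= => /andP[/andP[? ?] /andP[? ?]].
    by apply/andP; split; lra.
  have n0 : 0 < Num.min x (T - x) by rewrite lt_min x0 subr_gt0.
  have i2 := rderiv_interior n0 nE d2; have i3 := rderiv_interior n0 nE d3.
  have : h x = u' x by rewrite -(@derive_val _ _ _ _ _ _ _ i2) (@derive_val _ _ _ _ _ _ _ i3).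
  by move=> <-; rewrite -[RHS]/((EFin \o h) x) hE.
have mkE (A : set R) : measurable_fun A (EFin \o k).
  by apply/measurable_EFinP; exact: measurable_funTS.
have mr : measurable_fun D (fun t => (k t * u' t)%:E).
  apply/measurable_EFinP; apply: measurable_funM; first exact: measurable_funTS.
  have mc : measurable_fun [set: R] (fun t => u' (clamp T t)).
    by apply: continuous_measurable_fun; exact: clamp_continuous.
  apply: (eq_measurable_fun (fun t => u' (clamp T t))); last exact: measurable_funTS.
  by move=> t /set_mem; rewrite /D /= in_itv /= => /andP[? ?]; rewrite clampE// !ltW.
have U0 : U 0 = 0 by rewrite UE ?lexx.
have UT : U T = S by rewrite UE ?lexx ?andbT.
have preD : V @^-1` D = `]0, S[%classic.
  have e1 s : (0 < V s) = (0 < s) by rewrite -Ult UV U0.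
  have e2 s : (V s < T) = (s < S) by rewrite -Ult UV UT.
  by apply/seteqP; split => s; rewrite /D /= !in_itv /= e1 e2.
have E1 : (\int[mu]_(t in D) (k t * u' t)%:E = \int[mu]_(t in D) ((EFin \o k) t * f t))%E.
  apply: ae_eq_integral => //.
  - by apply: emeasurable_funM; [exact: mkE|apply: measurable_funTS; exact: measurable_int fint].
  - move: hu'; apply: filterS; first exact: (ae_filter_ringOfSetsType mu).
    by move=> x H Dx; rewrite (H Dx) EFinM.
have E2 : (\int[mu]_(t in D) ((EFin \o k) t * f t) = \int[nu]_(t in D) (EFin \o k) t)%E.
  apply: Radon_Nikodym_SigmaFinite.change_of_variables;
    [exact: numu|by move=> x; rewrite /= lee_fin k0|exact: mD|exact: mkE].
have E3 : (\int[nu]_(t in D) (EFin \o k) t =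
    \int[pushforward mu (V : R -> measurableTypeR R)]_(t in D) (EFin \o k) t)%E.
  apply: eq_measure_integral => A mA AD.
  transitivity (lebesgue_stieltjes_measure Fc A); last exact: push.
  by rewrite /nu /= /mfrestr /mrestr setIidl.
have E4 : (\int[pushforward mu (V : R -> measurableTypeR R)]_(t in D) (EFin \o k) t =
    \int[mu]_(s in `]0%R, S[) (k (V s))%:E)%E.
  have k0' : {in D, forall y, (0 <= (EFin \o k) y)%E} by move=> x _; rewrite /= lee_fin k0.
  have := ge0_integral_pushforward mV mu mD (mkE D) k0'.
  by rewrite preD.
have mkV (A : set R) : measurable_fun A (fun s => (k (V s))%:E).
  by apply/measurable_EFinP; apply: measurable_funTS; exact: measurableT_comp.
have -> : (\int[mu]_(s in `[0%R, S]) (k (r s))%:E = \int[mu]_(s in `[0%R, S]) (k (V s))%:E)%E.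
  by apply: eq_integral => s /set_mem; rewrite /= in_itv /= => sI; rewrite VE.
have oc (X : R) (q : R -> R) : measurable_fun `]0, X[ (fun t => (q t)%:E) ->
    (\int[mu]_(t in `[0%R, X]) (q t)%:E = \int[mu]_(t in `]0%R, X[) (q t)%:E)%E.
  move=> mq; have mq' : measurable_fun `]0, X[ q by exact/measurable_EFinP.
  rewrite -integral_itv_obnd_cbnd; last by apply/measurable_EFinP; exact: measurable_fun_itv_oc mq'.
  by rewrite -integral_itv_bndo_bndc; [reflexivity|exact: mq].
rewrite (oc S (fun s => k (V s)) (mkV _)) (oc T (fun t => k t * u' t) mr).
exact: (esym (etrans E1 (etrans E2 (etrans E3 E4)))).
Qed.

End Inverse.

(** Only [w] is assumed absolutely continuous, and only at its points of differentiability is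
    anything known of [derive1 W]. Each side is compared, off a null set of its own time axis, with
    one measurable function transported by [change_of_variables]. *)
Lemma energy_transfer T S L (u u' r w W A B : R -> R) : 0 <= T -> 0 <= S -> 1 <= L ->
  u 0 = 0 -> u T = S ->
  (forall t, 0 <= t <= T -> 0 <= u t <= S /\ r (u t) = t) ->
  (forall s, 0 <= s <= S -> 0 <= r s <= T /\ u (r s) = s) ->
  (forall t, 0 <= t <= T -> rderiv [set t | 0 <= t <= T] u t (u' t)) ->
  (forall t, 0 <= t <= T -> 0 < u' t <= L) ->
  (forall t, 0 <= t <= T -> u' @ within [set t | 0 <= t <= T] (nbhs t) --> u' t) ->
  {within `[0, S], continuous r} -> abs_continuous 0 T w ->
  (forall t, 0 <= t <= T -> A @ within [set t | 0 <= t <= T] (nbhs t) --> A t) ->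
  (forall t l, 0 < t < T -> is_derive t (1 : R) w l ->
     (derive1 W (u t) - B (u t)) ^+ 2 * u' t = (l - A t) ^+ 2) ->
  (\int[mu]_(t in `[0%R, T]) ((derive1 w t - A t) ^+ 2)%:E =
   \int[mu]_(s in `[0%R, S]) ((derive1 W s - B s) ^+ 2)%:E)%E.
Proof.
move=> T0 S0 L1 u0 uT uI rI du u'I u'c rc wac Ac rel.
move: T0; rewrite le_eqVlt => /predU1P[T0|T0].
  have S0' : S = 0 by rewrite -uT -T0 u0.
  by rewrite -T0 S0' !set_itv1 !(@integral_Sset1 R _ _ 0).
have [h [mh [N [mN N0 hN]]]] := abs_continuous_derive T0 wac.
have T0' := ltW T0.
have u'I' t : 0 <= t <= T -> 0 <= u' t <= L by move=> /u'I/andP[/ltW -> ->].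
have cv := @change_of_variables T S L u u' r T0 S0 L1 u0 uT uI rI du u'I' u'c rc.
have hd t : 0 < t < T -> ~ N t -> is_derive t (1 : R) w (h t).
  by move=> tI Nt; apply: contrapT => H; apply: Nt; apply: hN => /=; apply: contra_not H; exact.
(* The measurable stand-in for the half-plane integrand, written in radial time: [k] times [u'] is
   the radial integrand, and [k] along [r] is the chordal one, almost everywhere. *)
pose k t := (h t - A (clamp T t)) ^+ 2 / u' (clamp T t).
have k0 t : 0 <= k t.
  rewrite /k; apply: divr_ge0; first exact: sqr_ge0.
  by have /andP[/ltW] := u'I _ (clamp_itv t T0').
have mk : measurable_fun [set: R] k.
  have mA : measurable_fun [set: R] (fun t => A (clamp T t)).
    by apply: continuous_measurable_fun; exact: clamp_continuous.
  have mu' : measurable_fun [set: R] (fun t => (u' (clamp T t))^-1).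
    apply: continuous_measurable_fun => t; apply: cvgV.
      by rewrite gt_eqF//; have /andP[] := u'I _ (clamp_itv t T0').
    exact: (clamp_continuous T0' u'c).
  apply: measurable_funM mu'; apply: measurable_funX.
  exact: measurable_realfun.measurable_funB.
pose N' : set R := N `|` ([set 0] `|` [set T]).
have m1 (a : R) : measurable ([set a] : set (measurableTypeR R)) by exact: measurable_set1.
have mN' : measurable (N' : set (measurableTypeR R)).
  by apply: measurableU; [exact: mN|apply: measurableU; exact: m1].
have N'0 : mu N' = 0%E.
  apply: null_set_setU; [exact: mN|by apply: measurableU; exact: m1|exact: N0|].
  by apply: null_set_setU; [exact: m1|exact: m1| |]; exact: lebesgue_measure_set1.
have inside t : 0 <= t <= T -> ~ N' t -> 0 < t < T /\ ~ N t.
  move=> /andP[t0 tT] H; split; last by move=> Nt; apply: H; left.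
  rewrite !lt_neqAle t0 tT !andbT; apply/andP; split; apply/eqP => E; apply: H; right.
    by left; rewrite -E.
  by right.
have kE t : 0 <= t <= T -> k t = (h t - A t) ^+ 2 / u' t by move=> tI; rewrite /k clampE.
have u'n t : 0 <= t <= T -> u' t != 0 by move=> /u'I/andP[? _]; rewrite gt_eqF.
transitivity (\int[mu]_(t in `[0%R, T]) (k t * u' t)%:E)%E.
  apply: (@ge0_integral_off_null R _ N') => // t /=; rewrite in_itv /= => tI.
  - by rewrite lee_fin sqr_ge0.
  - by rewrite lee_fin mulr_ge0//; have /andP[] := u'I' t tI.
  move=> Nt; have [tI' Nt'] := inside t tI Nt; have i := hd t tI' Nt'.
  by rewrite derive1E (@derive_val _ _ _ _ _ _ _ i) kE// divfK// u'n.
rewrite -cv//.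
have rcC : continuous (fun s => r (clamp S s)).
  apply: clamp_continuous => // t tI.
  move/subspace_continuousP : rc => /(_ t); rewrite /= in_itv /= => /(_ tI) c.
  apply: cvg_trans c; apply: cvg_app.
  by move=> E /within_nbhsP[e e0 eA]; apply/within_nbhsP; exists e => // s se sI; apply: eA => //=; rewrite in_itv.
pose N2 : set R := `[0, S]%classic `&` (fun s => r (clamp S s)) @^-1` N'.
have mN2 : measurable (N2 : set (measurableTypeR R)).
  have mrc : measurable_fun [set: R] (fun s => r (clamp S s)) by exact: continuous_measurable_fun.
  apply: measurableI; first exact: measurable_itv.
  by rewrite -[X in measurable X]setTI; apply: mrc; [exact: measurableT|exact: mN'].
(* The exceptional set on the other time axis is null by the change of variables applied to the
   indicator function of [N']. *)
have N20 : mu N2 = 0%E.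
  have -> : N2 = N2 `&` `[0, S]%classic by apply/esym/setIidPl => s [].
  rewrite -(integral_indic mu (measurable_itv _) mN2).
  transitivity (\int[mu]_(s in `[0%R, S]) (\1_N' (r s))%:E)%E.
    apply: eq_integral => s /set_mem sI; congr (_%:E).
    have sI' : 0 <= s <= S by move: sI; rewrite /= in_itv.
    rewrite !indicE; congr (_%:R); congr nat_of_bool; apply/idP/idP => /set_mem H; apply/mem_set.
      by case: H => _; rewrite /preimage /= clampE.
    by split=> //; rewrite /preimage /= clampE.
  rewrite cv; [|exact: measurable_indic|by move=> x; rewrite indicE].
  rewrite (@ge0_integral_off_null R _ N' _ (fun=> 0%E)) //.
  - by rewrite integral0.
  - by move=> t /=; rewrite in_itv /= => tI; rewrite lee_fin mulr_ge0//; have /andP[] := u'I' t tI.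
  - by move=> t _ Nt; rewrite indicE memNset// mul0r.
apply: (@ge0_integral_off_null R _ N2) => // s /=; rewrite in_itv /= => sI.
- by rewrite lee_fin k0.
- by rewrite lee_fin sqr_ge0.
- move=> Ns; have [rsI urs] := rI s sI.
  have Nr : ~ N' (r s) by move=> H; apply: Ns; split; rewrite /preimage /= ?in_itv ?clampE.
  have [tI' Nt'] := inside _ rsI Nr; have i := hd _ tI' Nt'.
  have := rel _ _ tI' i; rewrite urs kE// => <-.
  by rewrite mulfK// u'n.
Qed.

End ChangeOfVariables.

(** * The energies in the coordinates of the time change *)

Section EnergyCoordinates.
Variable R : realType.
Local Notation C := (Cplx R).
Local Notation cRe := (@complex.Re R : C -> R).
Local Notation cIm := (@complex.Im R : C -> R).
Local Notation mu := (@lebesgue_measure R).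
Implicit Types (a b x y e T S L : R).

Lemma within_bounded T (f : R -> R) : 0 <= T ->
  (forall t, 0 <= t <= T -> f @ within [set t | 0 <= t <= T] (nbhs t) --> f t) ->
  exists2 M : R, 1 <= M & forall t, 0 <= t <= T -> `|f t| <= M.
Proof.
move=> T0 fc; have h : continuous (fun t => f (clamp T t)) by exact: clamp_continuous.
have hn : {within `[0, T], continuous (fun t => `|f (clamp T t)|)}.
  by apply: continuous_subspaceT => t; apply: continuous_comp; [exact: h|exact: norm_continuous].
have [c cI cM] := EVT_max T0 hn.
exists (1 + `|f (clamp T c)|); first by rewrite lerDl.
move=> t tI; have := cM t; rewrite in_itv /= clampE// => /(_ tI); lra.
Qed.

Lemma within_pos T (f : R -> R) : 0 <= T ->
  (forall t, 0 <= t <= T -> f @ within [set t | 0 <= t <= T] (nbhs t) --> f t) ->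
  (forall t, 0 <= t <= T -> 0 < f t) ->
  exists2 m : R, 0 < m & forall t, 0 <= t <= T -> m <= f t.
Proof.
move=> T0 fc f0; have h : continuous (fun t => f (clamp T t)) by exact: clamp_continuous.
have [c cI cM] := EVT_min T0 (continuous_subspaceT h).
have cI' : 0 <= c <= T by move: cI; rewrite in_itv.
exists (f c); first exact: f0.
by move=> t tI; have := cM t; rewrite in_itv /= !clampE// => /(_ tI).
Qed.

Lemma cvg_pow (U : Type) (G : set_system U) {FG : Filter G} (f : U -> R) (l : R) n :
  f @ G --> l -> (fun t => f t ^+ n) @ G --> l ^+ n.
Proof.
move=> fl; elim: n => [|n IH].
  have -> : (fun t => f t ^+ 0) = (fun=> 1) by apply/funext => t; rewrite expr0.
  by rewrite expr0; exact: cvg_cst.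
have -> : (fun t => f t ^+ n.+1) = (fun t => f t * f t ^+ n) by apply/funext => t; rewrite exprS.
by rewrite exprS; exact: cvgM.
Qed.

Lemma rderiv_lip T (f f' : R -> R) : 0 <= T ->
  (forall t, 0 <= t <= T -> rderiv [set t | 0 <= t <= T] f t (f' t)) ->
  (forall t, 0 <= t <= T -> f' @ within [set t | 0 <= t <= T] (nbhs t) --> f' t) ->
  exists2 L : R, 1 <= L & forall s t, 0 <= s -> s <= t -> t <= T -> `|f t - f s| <= L * (t - s).
Proof.
move=> T0 df fc; have [L L1 LP] := within_bounded T0 fc; exists L => // s t s0 st tT.
have := @tderiv_bound _ [set t | 0 <= t <= T] (fun s => real_cplx (f s)) (fun s => real_cplx (f' s))
  (fun s => L * s) (fun=> L * 1) s t st.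
rewrite -rcB cabs_real -mulrBr; apply=> x xI.
- by case/andP: xI => h1 h2; rewrite /= (le_trans s0 h1) (le_trans h2 tT).
- by apply: df; case/andP: xI => h1 h2; rewrite (le_trans s0 h1) (le_trans h2 tT).
- exact: rderivZ (rderiv_id _ x).
- by rewrite mulr1 cabs_real LP//; case/andP: xI => h1 h2; rewrite (le_trans s0 h1) (le_trans h2 tT).
Qed.

Lemma cotB a b : sin a != 0 -> sin b != 0 -> cot a - cot b = sin (b - a) / (sin a * sin b).
Proof. by move=> sa sb; rewrite /cot sinB; field; rewrite sa sb. Qed.

Lemma sin_lip x : `|sin x| <= `|x|.
Proof.
have := expi_lipschitz 0 x; rewrite subr0 expi0; apply: le_trans.
by apply: le_trans (ler_Im_cabs _); rewrite !ReIm oppr0 addr0.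
Qed.

Lemma cot_lip m a b : 0 < m -> m <= sin a -> m <= sin b -> `|cot a - cot b| <= `|a - b| / m ^+ 2.
Proof.
move=> m0 ma mb; have sa : 0 < sin a by lra.
have sb : 0 < sin b by lra.
rewrite cotB ?gt_eqF// normrM normfV; apply: ler_pM;
  [exact: normr_ge0|by rewrite invr_ge0|by rewrite distrC; exact: sin_lip|].
rewrite gtr0_norm ?mulr_gt0// lef_pV2 ?posrE ?exprn_gt0 ?mulr_gt0// expr2.
by apply: ler_pM => //; exact: ltW.
Qed.

Lemma atan_lip a b : `|atan a - atan b| <= `|a - b|.
Proof.
wlog ab : a b / b <= a => [H|].
  by have [/H//|/ltW/H] := leP b a; rewrite distrC (distrC a).
have d x : rderiv [set: R] (@atan R) x (1 + x ^+ 2)^-1.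
  by apply: is_derive_rderiv; exact: is_derive1_atan.
have p x : 0 < 1 + x ^+ 2 :> R by rewrite ltr_pwDl// sqr_ge0.
have h1 : atan b <= atan a.
  by apply: (@rderiv_le _ [set: R] _ _ b a ab (fun _ _ => I) (fun x _ => d x)) => x _; rewrite invr_ge0 ltW.
have h2 : atan a - a <= atan b - b.
  apply: (@rderiv_ge _ [set: R] (fun x => atan x - x) (fun x => (1 + x ^+ 2)^-1 - 1) b a ab) => // x _.
    exact: rderivB (d x) (rderiv_id _ x).
  by rewrite subr_le0 invf_le1// lerDl sqr_ge0.
by rewrite !ger0_norm ?subr_ge0//; lra.
Qed.

Lemma atan_cot x : 0 < x < pi -> atan (cot x) = pi / 2 - x.
Proof.
move=> /andP[x0 xp]; have E : cot x = tan (pi / 2 - x).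
  by rewrite /cot /tan sinB cosB sin_pihalf cos_pihalf; congr (_ / _); ring.
by rewrite E tanK// in_itv /=; apply/andP; split; lra.
Qed.

Lemma rderiv_cot (D : set R) (a : R -> R) t l : sin (a t) != 0 -> rderiv D a t l ->
  rderiv D (fun s => cot (a s)) t (- l / sin (a t) ^+ 2).
Proof.
move=> s0 da.
have ds : is_derive (a t) 1 (@sin R) (cos (a t)) by exact: is_derive_sin.
have dc : is_derive (a t) 1 (@cos R) (- sin (a t)) by exact: is_derive_cos.
have d1 := tderiv_div (f := fun s => real_cplx (cos (a s))) (g := fun s => real_cplx (sin (a s)))
   (t := t) (D := D).
have n0 : real_cplx (sin (a t)) != 0 by rewrite rc_eq0.
have := d1 _ _ n0 (rderiv_comp dc da) (rderiv_comp ds da) => d2.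
have E1 : (fun s => real_cplx (cos (a s)) / real_cplx (sin (a s))) = (fun s => real_cplx (cot (a s))).
  by apply/funext => s; rewrite /cot rcM rcV.
rewrite E1 in d2; rewrite /rderiv; apply: tderiv_eqd d2.
rewrite -!rcM -rcB -rcX -rcV -rcM; congr real_cplx; congr (_ / _).
have := cos2Dsin2 (a t) => E.
rewrite (_ : - sin (a t) * l * sin (a t) - _ = - l * (cos (a t) ^+ 2 + sin (a t) ^+ 2)); last by ring.
by rewrite E mulr1.
Qed.

Section Coordinates.
Variables (rho T S : R) (u r v w x y W : R -> R) (Z : R -> C).
Let al t : R := (v t - w t) / 2.
Let J : set R := [set t | 0 <= t <= T].
Let sg t : R := y t ^+ 2 / (4 * sin (al t) ^+ 4).
Hypotheses (T0 : 0 <= T) (S0 : 0 <= S) (u0 : u 0 = 0) (uT : u T = S).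
Hypothesis uI : forall t, 0 <= t <= T -> 0 <= u t <= S /\ r (u t) = t.
Hypothesis rI : forall s, 0 <= s <= S -> 0 <= r s <= T /\ u (r s) = s.
Hypothesis wc : forall t, 0 <= t <= T -> w @ within J (nbhs t) --> w t.
Hypothesis alI : forall t, 0 <= t <= T -> 0 < al t < pi.
Hypothesis y0 : forall t, 0 <= t <= T -> 0 < y t.
Hypothesis dv : forall t, 0 <= t <= T -> rderiv J v t (cot (al t)).
Hypothesis dx : forall t, 0 <= t <= T -> rderiv J x t (- y t * cos (al t) / (2 * sin (al t) ^+ 3)).
Hypothesis dy : forall t, 0 <= t <= T -> rderiv J y t (- y t / (2 * sin (al t) ^+ 2)).
Hypothesis du : forall t, 0 <= t <= T -> rderiv J u t (sg t).
Hypothesis dr : forall s, 0 <= s <= S -> rderiv [set s | 0 <= s <= S] r s (sg (r s))^-1.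
Hypothesis WE : forall t, 0 <= t <= T -> W (u t) = x t + y t * cot (al t).
Hypothesis ZE : forall t, 0 <= t <= T -> Z (u t) = Complex (x t) (y t).

Let sin0 t : 0 <= t <= T -> 0 < sin (al t).
Proof. by move=> /alI; exact: sin_gt0_pi. Qed.

Let alc t : 0 <= t <= T -> al @ within J (nbhs t) --> al t.
Proof. by move=> tI; apply: cvgMl; apply: cvgB; [exact: rderiv_cont (dv tI)|exact: wc]. Qed.

Let sinc t : 0 <= t <= T -> (fun t => sin (al t)) @ within J (nbhs t) --> sin (al t).
Proof. by move=> tI; apply: continuous_cvg; [exact: continuous_sin|exact: alc]. Qed.

Let cosc t : 0 <= t <= T -> (fun t => cos (al t)) @ within J (nbhs t) --> cos (al t).
Proof. by move=> tI; apply: continuous_cvg; [exact: continuous_cos|exact: alc]. Qed.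

Let yc t : 0 <= t <= T -> y @ within J (nbhs t) --> y t.
Proof. by move=> tI; exact: rderiv_cont (dy tI). Qed.

Let cotc t : 0 <= t <= T -> (fun t => cot (al t)) @ within J (nbhs t) --> cot (al t).
Proof.
by move=> tI; apply: cvgM; [exact: cosc|apply: cvgV; [rewrite gt_eqF// sin0|exact: sinc]].
Qed.

Let sinXc n t : 0 <= t <= T -> (fun t => sin (al t) ^+ n) @ within J (nbhs t) --> sin (al t) ^+ n.
Proof. by move=> tI; apply: cvg_pow; exact: sinc. Qed.

Let divc (f g : R -> R) k t : k != 0 -> 0 <= t <= T -> g t != 0 -> f @ within J (nbhs t) --> f t ->
  g @ within J (nbhs t) --> g t -> (fun t => f t / (k * g t)) @ within J (nbhs t) --> f t / (k * g t).
Proof.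
by move=> k0 tI g0 fc gc; apply: cvgM => //; apply: cvgV; [rewrite mulf_neq0|apply: cvgMr].
Qed.

Let sgc t : 0 <= t <= T -> sg @ within J (nbhs t) --> sg t.
Proof.
move=> tI; apply: (@divc (fun t => y t ^+ 2) (fun t => sin (al t) ^+ 4)) => //.
- by rewrite expf_neq0// gt_eqF// sin0.
- by apply: cvg_pow; exact: yc.
- exact: sinXc.
Qed.

Let sg0 t : 0 <= t <= T -> 0 < sg t.
Proof. by move=> tI; rewrite /sg divr_gt0 ?mulr_gt0 ?exprn_gt0 ?y0 ?sin0. Qed.

Let Lu : exists2 L : R, 1 <= L & forall s t, 0 <= s -> s <= t -> t <= T ->
  u s <= u t /\ u t - u s <= L * (t - s).
Proof.
have [L L1 LP] := rderiv_lip T0 du sgc; exists L => // s t s0 st tT.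
have := LP s t s0 st tT; have := ler_norm (u t - u s) => h1 h2; split; last by lra.
have sub e : s <= e <= t -> 0 <= e <= T by move=> /andP[? ?]; rewrite (le_trans s0) ?(le_trans _ tT).
apply: (@rderiv_le _ J u sg s t st) => e eI; [exact: sub|exact: du (sub e eI)|exact/ltW/sg0/sub].
Qed.

Let Lr : exists2 L : R, 1 <= L & forall s t, 0 <= s -> s <= t -> t <= S ->
  r s <= r t /\ r t - r s <= L * (t - s).
Proof.
have rc s : 0 <= s <= S -> r @ within [set s | 0 <= s <= S] (nbhs s) --> r s.
  by move=> sI; exact: rderiv_cont (dr sI).
have dc s : 0 <= s <= S -> (fun s => (sg (r s))^-1) @ within [set s | 0 <= s <= S] (nbhs s) --> (sg (r s))^-1.
  move=> sI; have [rsI _] := rI sI; apply: cvgV; first by rewrite gt_eqF// sg0.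
  apply/cvgrPdist_lt => e e0; have /cvgrPdist_lt/(_ _ e0)/within_nbhsP[d d0 dP] := sgc rsI.
  have /cvgrPdist_lt/(_ _ d0)/within_nbhsP[d' d'0 dP'] := rc s sI.
  apply/within_nbhsP; exists d' => // s' ss' sI'.
  by apply: dP; [rewrite distrC; exact: dP'|exact: (rI sI').1].
have [L L1 LP] := rderiv_lip S0 dr dc; exists L => // s t s0 st tT.
have := LP s t s0 st tT; have := ler_norm (r t - r s) => h1 h2; split; last by lra.
have sub e : s <= e <= t -> 0 <= e <= S by move=> /andP[? ?]; rewrite (le_trans s0) ?(le_trans _ tT).
apply: (@rderiv_le _ [set s | 0 <= s <= S] r (fun s => (sg (r s))^-1) s t st) => e eI.
- exact: sub.
- exact: dr (sub e eI).
- by rewrite invr_ge0; exact/ltW/sg0/(rI (sub e eI)).1.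
Qed.

Let F t := x t + y t * cot (al t).

(** Up to Lipschitz terms the increments of [w] and of [x + y * cot (al t)] are comparable: on the
    compact time interval [sin (al t)] and [y] stay away from 0 and [cot] is bi-Lipschitz on the
    values of [al]. This transfers absolute continuity in both directions. *)
Let lipF : exists2 L : R, 0 < L & forall s t, 0 <= s -> s <= t -> t <= T ->
  `|F t - F s| <= L * ((t - s) + `|w t - w s|) /\ `|w t - w s| <= L * ((t - s) + `|F t - F s|).
Proof.
have [m m0 mP] := within_pos T0 sinc sin0.
have [my my0 myP] := within_pos T0 yc y0.
have [Lc Lc1 LcP] := within_bounded T0 cotc.
have [Ly Ly1 LyP] := within_bounded T0 yc.
have [Lv Lv1 LvP] := rderiv_lip T0 dv cotc.
have s2 n t : 0 <= t <= T -> sin (al t) ^+ n != 0 by move=> tI; rewrite expf_neq0// gt_eqF// sin0.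
have two0 : (2 : R) != 0 by rewrite pnatr_eq0.
have [Lx Lx1 LxP] := rderiv_lip T0 dx (fun t tI => @divc (fun t => - y t * cos (al t)) (fun t => sin (al t) ^+ 3) 2 t
   two0 tI (s2 3%N t tI) (cvgM (cvgN (yc tI)) (cosc tI)) (@sinXc 3%N t tI)).
have [L' L'1 L'P] := rderiv_lip T0 dy (fun t tI => @divc (fun t => - y t) (fun t => sin (al t) ^+ 2) 2 t
   two0 tI (s2 2%N t tI) (cvgN (yc tI)) (@sinXc 2%N t tI)).
have al_w s t : 0 <= s -> s <= t -> t <= T -> `|al t - al s| <= Lv * (t - s) + `|w t - w s|.
  move=> s0 st tT; have := LvP s t s0 st tT.
  have -> : al t - al s = 2^-1 * ((v t - v s) - (w t - w s)) by rewrite /al; field.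
  rewrite normrM gtr0_norm//; have := ler_normB (v t - v s) (w t - w s).
  have := normr_ge0 (v t - v s); have := normr_ge0 (w t - w s); lra.
pose A := Lx + L' * Lc; pose B := Ly / m ^+ 2.
have A0 : 0 <= A by rewrite /A addr_ge0// ?mulr_ge0//; lra.
have B0 : 0 < B by rewrite /B divr_gt0 ?exprn_gt0//; lra.
pose L1 := A + B * Lv + B.
pose L2 := Lv + 2 * ((A + 1) / my).
have A1 : 0 < A + 1 by lra.
have L10 : 0 < L1 by rewrite /L1; have : 0 <= B * Lv by [rewrite mulr_ge0//; lra|]; lra.
have q0 : 0 < (A + 1) / my by rewrite divr_gt0.
have L20 : 0 < L2 by rewrite /L2; lra.
exists (L1 + L2); first lra.
move=> s t s0 st tT.
have sI : 0 <= s <= T by rewrite s0 (le_trans st).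
have tI : 0 <= t <= T by rewrite tT (le_trans s0).
have ts : 0 <= t - s by rewrite subr_ge0.
have dw0 := normr_ge0 (w t - w s).
have E : F t - F s = (x t - x s) + (y t - y s) * cot (al t) + y s * (cot (al t) - cot (al s)).
  by rewrite /F; ring.
have h1 := LxP s t s0 st tT; have h2 := L'P s t s0 st tT; have h3 := LcP t tI.
have h4 : `|(y t - y s) * cot (al t)| <= L' * Lc * (t - s).
  by rewrite normrM mulrAC; apply: ler_pM.
split.
  have h5 : `|y s * (cot (al t) - cot (al s))| <= B * (Lv * (t - s) + `|w t - w s|).
    rewrite normrM /B -mulrA; apply: ler_pM => //; first exact: LyP.
    apply: (le_trans (cot_lip m0 (mP t tI) (mP s sI))).
    by rewrite mulrC; apply: ler_wpM2l; [rewrite invr_ge0 sqr_ge0|exact: al_w].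
  have h6 : `|F t - F s| <= A * (t - s) + B * (Lv * (t - s) + `|w t - w s|).
    rewrite E; apply: (le_trans (ler_normD _ _)); have := ler_normD (x t - x s) ((y t - y s) * cot (al t)).
    rewrite /A; lra.
  apply: (le_trans h6); rewrite /L1.
  have : 0 <= B * `|w t - w s| by rewrite mulr_ge0// ltW.
  have : 0 <= (A + B * Lv) * `|w t - w s| by rewrite mulr_ge0// addr_ge0// mulr_ge0//; lra.
  have : 0 <= B * (t - s) by rewrite mulr_ge0// ltW.
  have : 0 <= L2 * ((t - s) + `|w t - w s|) by apply: mulr_ge0; [exact: ltW|exact: addr_ge0].
  lra.
(* The angle is recovered from its cotangent by [atan], which is 1-Lipschitz. *)
have h7 : `|al t - al s| <= `|cot (al t) - cot (al s)|.
  have -> : al t - al s = atan (cot (al s)) - atan (cot (al t)) by rewrite !atan_cot ?alI//; ring.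
  by rewrite [leRHS]distrC atan_lip.
have h8 : y s * `|cot (al t) - cot (al s)| <= `|F t - F s| + A * (t - s).
  have -> : y s * `|cot (al t) - cot (al s)| = `|y s * (cot (al t) - cot (al s))|.
    by rewrite normrM gtr0_norm// y0.
  have -> : y s * (cot (al t) - cot (al s)) = (F t - F s) - ((x t - x s) + (y t - y s) * cot (al t)).
    by rewrite E; ring.
  apply: (le_trans (ler_normB _ _)); have := ler_normD (x t - x s) ((y t - y s) * cot (al t)).
  rewrite /A; lra.
have h9 : `|al t - al s| <= (`|F t - F s| + A * (t - s)) / my.
  rewrite ler_pdivlMr// mulrC; apply: le_trans h8.
  apply: (@le_trans _ _ (my * `|cot (al t) - cot (al s)|)); first by rewrite ler_pM2l.
  by apply: ler_wpM2r => //; exact: myP.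
have h10 : `|w t - w s| <= Lv * (t - s) + 2 * `|al t - al s|.
  have -> : w t - w s = (v t - v s) - 2 * (al t - al s) by rewrite /al; field.
  apply: (le_trans (ler_normB _ _)); rewrite normrM (gtr0_norm (ltr0n _ 2)).
  by have := LvP s t s0 st tT; lra.
have h11 : (`|F t - F s| + A * (t - s)) / my <= (A + 1) / my * ((t - s) + `|F t - F s|).
  rewrite mulrAC ler_pM2r ?invr_gt0//; have := normr_ge0 (F t - F s) => fn.
  have : 0 <= A * `|F t - F s| by rewrite mulr_ge0.
  lra.
have fn := normr_ge0 (F t - F s).
have : 0 <= L1 * ((t - s) + `|F t - F s|) by apply: mulr_ge0; [exact: ltW|exact: addr_ge0].
have : 0 <= Lv * `|F t - F s| by rewrite mulr_ge0//; lra.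
rewrite /L2; lra.
Qed.

Lemma ac_coordinates : abs_continuous 0 T w <-> abs_continuous 0 S W.
Proof.
have [L L0 LP] := lipF; have [Lu' Lu1 LuP] := Lu; have [Lr' Lr1 LrP] := Lr.
have uI' t : 0 <= t <= T -> 0 <= u t <= S by move=> /uI[].
have uK t : 0 <= t <= T -> r (u t) = t by move=> /uI[].
have rI' t : 0 <= t <= S -> 0 <= r t <= T by move=> /rI[].
have rK t : 0 <= t <= S -> u (r t) = t by move=> /rI[].
split=> ac.
  have ac1 : abs_continuous 0 T F.
    by apply: (abs_continuous_lip L0 ac) => s t s0 st tT; have [] := LP s t s0 st tT.
  have Lr0 : 0 < Lr' by lra.
  have := @abs_continuous_time R T S F r u Lr' Lr0 ac1 rI' LrP (fun s t s0 st tT => (LuP s t s0 st tT).1) uI rK.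
  move=> H e /H[d d0 dP]; exists d => // n a b ab tr sd.
  rewrite (eq_bigr (fun i => `|F (r (b i)) - F (r (a i))|)); first exact: dP.
  move=> i _; have [a0 [abi bS]] := ab i.
  have aI : 0 <= a i <= S by rewrite a0 (le_trans abi).
  have bI : 0 <= b i <= S by rewrite bS (le_trans a0).
  by rewrite /F -!WE ?rI'// !rK.
have Lu0 : 0 < Lu' by lra.
have := @abs_continuous_time R S T W u r Lu' Lu0 ac uI' LuP (fun s t s0 st tT => (LrP s t s0 st tT).1) rI uK.
move=> ac1; apply: (abs_continuous_lip L0 ac1) => s t s0 st tT.
have sI : 0 <= s <= T by rewrite s0 (le_trans st).
have tI : 0 <= t <= T by rewrite tT (le_trans s0).
by rewrite !WE//; have [] := LP s t s0 st tT.
Qed.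

(** Where [w] has derivative [l], the motions of [x], of [y] and of [v] each contribute the same
    [- cot al], so [x + y * cot al] has derivative [y / (2 sin al ^ 2)] times [l - 3 * cot al]. As
    the real part of [1 / (W - Z)] is [sin al ^ 2 * cot al / y], division by [ds/dt] turns 3 into
    the 6 of [- 6 - rho]. *)
Lemma energy_coordinates : abs_continuous 0 T w ->
  (\int[mu]_(t in `[0%R, T]) ((derive1 w t - rho / 2 * cot ((w t - v t) / 2)) ^+ 2)%:E =
   \int[mu]_(s in `[0%R, S])
     ((derive1 W s - (- 6 - rho) * cRe (real_cplx (W s) - Z s)^-1) ^+ 2)%:E)%E.
Proof.
move=> wac; have [L L1 LP] := within_bounded T0 sgc.
apply: (@energy_transfer R T S L u sg r w W (fun t => rho / 2 * cot ((w t - v t) / 2))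
  (fun s => (- 6 - rho) * cRe (real_cplx (W s) - Z s)^-1)) => //.
- by move=> t tI; rewrite sg0//= (le_trans (ler_norm _) (LP t tI)).
- exact: (@rderiv_within_cont _ [set s | 0 <= s <= S] r (fun s => (sg (r s))^-1)).
- move=> t tI; have E e : rho / 2 * cot ((w e - v e) / 2) = - (rho / 2) * cot (al e).
    rewrite (_ : (w e - v e) / 2 = - al e); last by rewrite /al; field.
    by rewrite /cot sinN cosN invrN mulrN mulrN mulNr.
  have EF : (fun t => rho / 2 * cot ((w t - v t) / 2)) = (fun t => - (rho / 2) * cot (al t)).
    by apply/funext => e; exact: E.
  by rewrite EF E; apply: cvgM; [exact: cvg_cst|exact: cotc].
move=> t l /andP[t0 tT] dw.
have tI : 0 <= t <= T by rewrite !ltW.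
have st := sin0 tI; have sn : sin (al t) != 0 by rewrite gt_eqF.
have yn : y t != 0 by rewrite gt_eqF// y0.
have [uI1 ru] := uI tI.
have dal : rderiv J al t ((cot (al t) - l) / 2).
  have := rderivZ 2^-1 (rderivB (dv tI) (is_derive_rderiv J dw)).
  rewrite mulrC; congr (rderiv _ _ _ _); apply/funext => e; by rewrite /al mulrC.
pose D := - y t * cos (al t) / (2 * sin (al t) ^+ 3) + (- y t / (2 * sin (al t) ^+ 2) * cot (al t) +
  y t * (- ((cot (al t) - l) / 2) / sin (al t) ^+ 2)).
have dF : rderiv J F t D := rderivD (dx tI) (rderivM (dy tI) (rderiv_cot sn dal)).
have dr1 := dr uI1; rewrite ru in dr1.
have dF' : rderiv J F (r (u t)) D by rewrite ru.
have dW := rderiv_time (fun s (sI : [set s | 0 <= s <= S] s) => (rI sI).1) dr1 dF'.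
have dW' : rderiv [set s | 0 <= s <= S] W (u t) (D * (sg t)^-1).
  apply: tderiv_eq uI1 _ dW => s sI /=; have [h1 h2] := rI sI.
  by congr real_cplx; rewrite /F -WE// h2.
(* A derivative within [[0, S]] is an ordinary derivative only at interior points; the Lipschitz
   bound on [r] shows that interior times correspond to interior times. *)
have [ulo uhi] : 0 < u t /\ u t < S.
  have [Lr' Lr1 LrP] := Lr.
  have Lr0 : 0 < Lr' by lra.
  have r0 : r 0 = 0 by rewrite -{1}u0; apply: (uI _).2; rewrite lexx.
  have rS : r S = T by rewrite -uT; apply: (uI _).2; rewrite lexx andbT.
  case/andP: uI1 => h1 h2.
  have [_] := LrP 0 (u t) (lexx 0) h1 h2; rewrite ru r0 !subr0 => h3.
  have [_] := LrP (u t) S h1 h2 (lexx S); rewrite ru rS => h4.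
  split; rewrite ltNge; apply/negP => h5.
    by have : Lr' * u t <= 0 by [rewrite pmulr_rle0|]; lra.
  by have : Lr' * (S - u t) <= 0 by [rewrite pmulr_rle0// subr_le0|]; lra.
have n0 : 0 < Num.min (u t) (S - u t) by rewrite lt_min ulo subr_gt0.
have iW : is_derive (u t) (1 : R) W (D * (sg t)^-1).
  apply: (rderiv_interior n0) dW' => s; rewrite lt_min !ltr_norml /= => /andP[/andP[? ?] /andP[? ?]].
  by apply/andP; split; lra.
rewrite derive1E (@derive_val _ _ _ _ _ _ _ iW) WE// ZE// /D.
have -> : (w t - v t) / 2 = - al t by rewrite /al; field.
have -> : cot (- al t) = - cot (al t) by rewrite /cot sinN cosN invrN mulrN.
rewrite cReV !ReIm /=.
have c2 := cos2Dsin2 (al t).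
rewrite /sg /cot; set p := cos (al t) in c2 *; set q := sin (al t) in sn c2 *; set Y := y t in yn *; set X := x t.
rewrite (_ : X + Y * (p / q) - X = Y * (p / q)); last by ring.
have -> : (Y * (p / q)) ^+ 2 + (0 - Y) ^+ 2 = Y ^+ 2 / q ^+ 2.
  rewrite (_ : _ + _ = Y ^+ 2 * (p ^+ 2 + q ^+ 2) / q ^+ 2); first by rewrite c2 mulr1.
  by field.
by field; rewrite yn sn.
Qed.

End Coordinates.
End EnergyCoordinates.

(** * Transfer of hulls *)

Section HullTransfer.
Variable R : realType.
Local Notation C := (Cplx R).
Local Notation cRe := (@complex.Re R : C -> R).
Local Notation cIm := (@complex.Im R : C -> R).
Implicit Types (A B K : set C) (f g : C -> C) (z w c Z u : C).

Lemma within_comp_cont (T : topologicalType) (D : set T) (h : T -> C) (f : C -> C) :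
  {within D, continuous h} -> (forall x, D x -> {for h x, continuous f}) ->
  {within D, continuous (fun x => f (h x))}.
Proof.
move=> /subspace_continuousP hc fc; apply/subspace_continuousP => x Dx.
exact: cvg_comp (hc x Dx) (fc x Dx).
Qed.

Lemma simply_connected_homeo A B f g :
  (forall z, A z -> [/\ B (f z), g (f z) = z & {for z, continuous f}]) ->
  (forall w, B w -> [/\ A (g w), f (g w) = w & {for w, continuous g}]) ->
  simply_connected A -> simply_connected B.
Proof.
move=> fP gP [[a Aa] pc sc]; split.
- by exists (f a); have [] := fP a Aa.
- move=> x y Bx By; have [Ax fx _] := gP x Bx; have [Ay fy _] := gP y By.
  have [h [hc hA h0 h1]] := pc _ _ Ax Ay; exists (fun t => f (h t)); split.
  + by apply: within_comp_cont hc _ => t tI; have [] := fP _ (hA t tI).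
  + by move=> t tI; have [] := fP _ (hA t tI).
  + by rewrite h0.
  + by rewrite h1.
- move=> h hc hB h01.
  have gc : {within `[0, 1], continuous (fun t => g (h t))}.
    by apply: within_comp_cont hc _ => t tI; have [] := gP _ (hB t tI).
  have gA t : t \in `[0, 1] -> A (g (h t)) by move=> tI; have [] := gP _ (hB t tI).
  have [H [Hc HA H0 H1]] := sc _ gc gA (congr1 g h01).
  have I0 : (0 : R) \in `[0, 1] by rewrite in_itv /= lexx ler01.
  have fg t : t \in `[0, 1] -> f (g (h t)) = h t by move=> tI; have [] := gP _ (hB t tI).
  exists (fun p => f (H p)); split.
  + apply: within_comp_cont Hc _ => -[s t] [/= sI tI].
    by have [] := fP _ (HA s t sI tI).
  + by move=> s t sI tI; have [] := fP _ (HA s t sI tI).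
  + by move=> t tI; have [-> ->] := H0 t tI; rewrite !fg.
  + by move=> s sI; have [-> ->] := H1 s sI; rewrite !fg.
Qed.

Lemma closure_image A f z : {for z, continuous f} -> closure A z -> closure (f @` A) (f z).
Proof.
move=> fc cA B /fc/cA[w [Aw Bw]]; exists (f w); split=> //; by exists w.
Qed.

Lemma compact_image_for K f : (forall z, K z -> {for z, continuous f}) -> compact K ->
  compact (f @` K).
Proof.
move=> fc; apply: continuous_compact; apply/subspace_continuousP => z Kz.
by apply: cvg_within_filter; exact: fc.
Qed.

Lemma near_upper_proper z : closed_upper z -> ProperFilter (within (@upper R) (nbhs z)).
Proof.
move=> z0; apply: Build_ProperFilter_ex => P /nbhsCP[e e0 eP].
exists (z + Ci * real_cplx (e / 2)); apply: eP.
  by rewrite addrC addKr cabsM cabs_Ci mul1r cabs_real gtr0_norm ?div2_gt0//; lra.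
rewrite upperE !ReIm; have : 0 <= cIm z := z0; have := div2_gt0 e0; lra.
Qed.

Lemma cayley_cont c Z z : 0 < cIm Z -> 0 <= cIm z -> {for z, continuous (cayley c Z)}.
Proof. by move=> Z0 z0; exact: cderiv_continuous (cderiv_cayley c (cayley_den Z0 z0)). Qed.

Lemma icayley_cont c Z u : u != c -> {for u, continuous (icayley c Z)}.
Proof. by move=> uc; apply: cderiv_continuous (cderiv_icayley Z _); rewrite subr_eq0. Qed.

Section Transfer.
Variables (phi : C -> C) (c Z : C).
Hypotheses (c1 : cabs c = 1) (Z0 : 0 < cIm Z).
Hypothesis phiE : forall z, upper z -> phi z = cayley c Z z.

Lemma extension_cayley z : closed_upper z -> extension (@upper R) phi z = cayley c Z z.
Proof.
move=> z0; have PF := near_upper_proper z0; apply: cvg_lim; first exact: hausdorffC.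
apply/cvgCP => e e0; have /continuousCP/(_ _ e0)[d d0 dP] := @cayley_cont c Z z Z0 z0.
by apply/nbhsCP; exists d => // w wz uw; rewrite phiE//; exact: dP.
Qed.

Lemma hull_preimageE K : hull_preimage phi K = [set z | closed_upper z /\ K (cayley c Z z)].
Proof.
by apply/seteqP; split => z [z0 Kz]; split=> //; move: Kz; rewrite extension_cayley.
Qed.

Lemma hull_imageE K : K `<=` @closed_upper R -> hull_image phi K = cayley c Z @` K.
Proof.
move=> KU; apply/seteqP; split => u [z Kz <-]; exists z => //; first rewrite extension_cayley//.
  exact: KU.
by rewrite extension_cayley//; exact: KU.
Qed.

Lemma cayley_neq_c z : closed_upper z -> cayley c Z z != c.
Proof. by move=> z0; rewrite -subr_eq0; exact: cayley_neq. Qed.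

Lemma preimage_image K : K `<=` @closed_disk R -> ~ K c ->
  [set z | closed_upper z /\ K (cayley c Z z)] = icayley c Z @` K.
Proof.
move=> KD Kc; apply/seteqP; split => z.
  by move=> [z0 Kz]; exists (cayley c Z z) => //; rewrite cayleyK.
move=> [u Ku <-]; have uc : u != c by apply/eqP => E; apply: Kc; rewrite -E.
split; first by apply: icayley_closed_upper => //; exact: KD.
by rewrite icayleyK.
Qed.

(** The hypothesis [~ K c] keeps [K] off the pole of [icayley], so the preimage is a continuous
    image of [K] and hence compact. *)
Lemma half_hull_preimage K : disk_hull K -> ~ K c -> half_hull (hull_preimage phi K).
Proof.
move=> [cK KD K0 sc KE] Kc; rewrite hull_preimageE.
have uc u : K u -> u != c by move=> Ku; apply/eqP => E; apply: Kc; rewrite -E.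
have cP : compact [set z | closed_upper z /\ K (cayley c Z z)].
  by rewrite preimage_image//; apply: compact_image_for => // u Ku; apply: icayley_cont; exact: uc.
split=> //.
- by move=> z [].
- apply: (@simply_connected_homeo (@disk R `\` K) _ (icayley c Z) (cayley c Z)) => //.
  + move=> u [ud Ku]; have ucd := disk_neq c1 ud; split.
    * by split; [exact: icayley_upper|rewrite /= icayleyK// => -[]].
    * exact: icayleyK.
    * exact: icayley_cont.
  + move=> z [zu Kz]; have z0 : 0 <= cIm z := ltW zu; split.
    * by split; [exact: cayley_disk|move=> H; apply: Kz].
    * exact: cayleyK.
    * exact: cayley_cont.
- apply/seteqP; split.
    move=> z [z0 Kz]; move: (Kz); rewrite {1}KE => /(closure_image (@icayley_cont c Z _ (cayley_neq_c z0))).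
    rewrite cayleyK//; apply: closure_subset => _ [u [Ku ud] <-].
    split; last exact: icayley_upper.
    split; first by apply: icayley_closed_upper => //; exact: KD.
    by rewrite icayleyK// uc.
  have E := (closure_id _).1 (compactC_closed cP); rewrite [X in _ `<=` X]E.
  by apply: closure_subset => z [].
Qed.

Lemma disk_hull_image K : half_hull K -> ~ K Z -> disk_hull (hull_image phi K).
Proof.
move=> [cK KU sc KE] KZ; rewrite hull_imageE//.
have cP : compact (cayley c Z @` K).
  by apply: compact_image_for => // z Kz; apply: cayley_cont => //; exact: KU.
have Kinv z : closed_upper z -> (cayley c Z @` K) (cayley c Z z) -> K z.
  by move=> z0 [w Kw E]; rewrite -(cayleyK c1 Z0 z0) -E cayleyK//; exact: KU.
split=> //.
- by move=> _ [z Kz <-]; apply: cayley_closed_disk => //; exact: KU.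
- by move=> H; apply: KZ; apply: Kinv; [exact: ltW|rewrite cayley0].
- apply: (@simply_connected_homeo (@upper R `\` K) _ (cayley c Z) (icayley c Z)) => //.
  + move=> z [zu Kz]; have z0 : 0 <= cIm z := ltW zu; split.
    * by split; [exact: cayley_disk|move=> H; apply: Kz; exact: Kinv].
    * exact: cayleyK.
    * exact: cayley_cont.
  + move=> u [ud Ku]; have ucd := disk_neq c1 ud; split.
    * split; first exact: icayley_upper.
      by move=> H; apply: Ku; exists (icayley c Z u) => //; rewrite icayleyK.
    * exact: icayleyK.
    * exact: icayley_cont.
- apply/seteqP; split.
    move=> _ [z Kz <-]; have z0 := KU z Kz; move: Kz; rewrite {1}KE.
    move=> /(closure_image (@cayley_cont c Z z Z0 z0)); apply: closure_subset => _ [w [Kw wu] <-].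
    by split; [exists w|exact: cayley_disk].
  have E := (closure_id _).1 (compactC_closed cP); rewrite [X in _ `<=` X]E.
  by apply: closure_subset => z [].
Qed.

End Transfer.

(** If no mapping-out function existed, [disk_mapout K] would be [cst 0], whose derivative is 0. *)
Lemma disk_mapoutP K (l : R) : 0 < l -> derive1 (disk_mapout K) 0 = real_cplx l ->
  is_disk_mapout K (disk_mapout K).
Proof.
move=> l0 dK; apply: xgetPex; apply: contrapT => H.
have E : disk_mapout K = cst 0 by apply: xgetPN => g gP; apply: H; exists g.
have d0 : derive1 (cst 0 : C -> C) 0 = 0 := cderiv_derive1 (cderiv_cst 0 0).
by move/eqP: d0; rewrite -E dK rc_eq0 gt_eqF.
Qed.

(** The default [cst 0] is not close to the identity far up on the imaginary axis, where the
    expansion applies because [K] is bounded. *)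
Lemma half_mapoutP K (a : R) : compact K -> half_expansion K (half_mapout K) a ->
  is_half_mapout K (half_mapout K).
Proof.
move=> cK eK; apply: xgetPex; apply: contrapT => H.
have E : half_mapout K = cst 0 by apply: xgetPN => g gP; apply: H; exists g.
have [M MP] := compactC_bounded cK.
have [M' M'P] := half_expansion_near_id eK ltr01.
pose y := `|M| + `|M'| + 1.
have y0 : 0 < y by rewrite /y ltr_wpDl// addr_ge0.
have ay : cabs (Ci * real_cplx y) = y by rewrite cabsM cabs_Ci mul1r cabs_real gtr0_norm.
have hM := ler_norm M; have hM' := ler_norm M'; have nM := normr_ge0 M; have nM' := normr_ge0 M'.
have U : (@upper R `\` K) (Ci * real_cplx y).
  by split; [exact: upper_Ci|move=> /MP; rewrite ay /y; lra].
have yM : M' < cabs (Ci * real_cplx y) by rewrite ay /y; lra.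
by have := M'P _ U yM; rewrite E /cst sub0r cabsN ay /y; lra.
Qed.

End HullTransfer.

(** * From the disk to the half-plane *)

Section LoewnerTransfer.
Variable R : realType.
Local Notation C := (Cplx R).
Local Notation cRe := (@complex.Re R : C -> R).
Local Notation cIm := (@complex.Im R : C -> R).
Implicit Types (D : set R) (t v w a x y s : R).

(** The radial Loewner field of [expi w] at the boundary point [expi v] is thus [expi v] times
    [Ci * cot ((v - w) / 2)]: the cotangent is the angular speed of the boundary point. *)
Lemma expi_cot v w : sin ((v - w) / 2) != 0 ->
  expi v - expi w != 0 /\
  Ci * real_cplx (cot ((v - w) / 2)) = - (expi v + expi w) / (expi v - expi w).
Proof.
set a := (v - w) / 2 => sa.
have E : expi v = expi w * (expi a * expi a).
  by rewrite -!expiD; congr expi; rewrite /a; field.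
have e1 : expi a * expi a - 1 = expi a * (2 * Ci * real_cplx (sin a)).
  have h : cos a * cos a = 1 - sin a * sin a by rewrite -(cos2Dsin2 a); ring.
  by apply: C_eqP; rewrite !ReIm; [rewrite h|]; ring.
have e2 : expi a * expi a + 1 = expi a * (2 * real_cplx (cos a)).
  have h : sin a * sin a = 1 - cos a * cos a by rewrite -(cos2Dsin2 a); ring.
  by apply: C_eqP; rewrite !ReIm; [rewrite h|]; ring.
have s0 : real_cplx (sin a) != 0 by rewrite rc_eq0.
have w0 := expi_neq0 w; have a0 := expi_neq0 a; have i0 := Ci_neq0 R.
have E1 : expi v - expi w = expi w * (expi a * (2 * Ci * real_cplx (sin a))).
  by rewrite E -e1; ring.
have E2 : expi v + expi w = expi w * (expi a * (2 * real_cplx (cos a))).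
  by rewrite E -e2; ring.
split; first by rewrite E1 !mulf_neq0// pnatr_eq0.
rewrite E1 E2 /cot rcM rcV.
have -> : - (expi w * (expi a * (2 * real_cplx (cos a)))) / (expi w * (expi a * (2 * Ci * real_cplx (sin a)))) =
  - (real_cplx (cos a) / (Ci * real_cplx (sin a))) by field; rewrite ?s0 ?i0 ?w0 ?a0 ?pnatr_eq0.
have -> : real_cplx (cos a) / (Ci * real_cplx (sin a)) =
  - (Ci * (real_cplx (cos a) / real_cplx (sin a))) * (- (Ci * Ci))^-1 by field; rewrite ?s0 ?i0.
by rewrite Ci2 opprK invr1 mulr1 opprK.
Qed.

Lemma expi_sin2 v w : sin ((v - w) / 2) != 0 ->
  real_cplx (sin ((v - w) / 2) ^+ 2)^-1 = - 4 * expi v * expi w / (expi v - expi w) ^+ 2.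
Proof.
set a := (v - w) / 2 => sa.
have E : expi v = expi w * (expi a * expi a).
  by rewrite -!expiD; congr expi; rewrite /a; field.
have e1 : expi a * expi a - 1 = expi a * (2 * Ci * real_cplx (sin a)).
  have h : cos a * cos a = 1 - sin a * sin a by rewrite -(cos2Dsin2 a); ring.
  by apply: C_eqP; rewrite !ReIm; [rewrite h|]; ring.
have s0 : real_cplx (sin a) != 0 by rewrite rc_eq0.
have w0 := expi_neq0 w; have a0 := expi_neq0 a.
have -> : expi v - expi w = expi w * (expi a * (2 * Ci * real_cplx (sin a))).
  by rewrite E -e1; ring.
rewrite E rcV rcX.
have -> : (expi w * (expi a * (2 * Ci * real_cplx (sin a)))) ^+ 2 =
  - 4 * expi w ^+ 2 * expi a ^+ 2 * real_cplx (sin a) ^+ 2 * (- (Ci * Ci)) by ring.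
rewrite Ci2 opprK; field; by rewrite ?s0 ?w0 ?a0.
Qed.

(** The subtrahend [(Zb * o - c t * Z) / (o - c t)] is the image of the driving point under
    [icayley], and the factor after the 2 is [ds/dt]. Once conjugation is eliminated, this is a
    rational identity in five independent quantities. *)
Lemma half_flow D t (c Zf g : R -> C) (o : C) : cabs o = 1 -> cabs (c t) = 1 ->
  let Z := Zf t in let Zb := cconj (Zf t) in
  c t - o != 0 -> o - g t != 0 -> g t - c t != 0 -> Z - Zb != 0 ->
  tderiv D c t (- c t * (c t + o) / (c t - o)) ->
  tderiv D Zf t (2 * (Z - Zb) * c t ^+ 2 * o / (c t - o) ^+ 3) ->
  tderiv D g t (radial_field o (g t)) ->
  tderiv D (fun s => icayley (c s) (Zf s) (g s)) t
   (2 * (- (Z - Zb) ^+ 2 * c t ^+ 2 * o ^+ 2 / (c t - o) ^+ 4) /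
     (icayley (c t) Z (g t) - (Zb * o - c t * Z) / (o - c t))).
Proof.
move=> o1 c1 Z Zb co og gc ZZ dc dZ dg.
have c0 : c t != 0 := unit_neq0 c1; have o0 : o != 0 := unit_neq0 o1.
have dZb := tderiv_conj dZ.
(* Conjugation inverts [c t] and [o], since both have modulus 1, and exchanges [Z] with [Zb]. *)
have EZb : cconj (2 * (Z - Zb) * c t ^+ 2 * o / (c t - o) ^+ 3) = 2 * (Z - Zb) * c t * o ^+ 2 / (c t - o) ^+ 3.
  have cX2 (q : C) : cconj (q ^+ 2) = cconj q ^+ 2 by rewrite expr2 conjM.
  have cX3 (q : C) : cconj (q ^+ 3) = cconj q ^+ 3 by rewrite exprS conjM cX2 -exprS.
  have c2E : cconj (2 : C) = 2 by rewrite -rc_nat conj_real.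
  have P (q1 q2 q3 q4 : C) : cconj (2 * q1 * q2 * q3 / q4) = 2 * cconj q1 * cconj q2 * cconj q3 / cconj q4.
    by rewrite !conjM conjV c2E.
  rewrite P cX2 cX3 !conjD !conjN conjK (conj_unit c1) (conj_unit o1) -/Z -/Zb.
  have h : (c t)^-1 - o^-1 = - (c t - o) / (c t * o) by field; rewrite ?c0 ?o0.
  rewrite h; field; by rewrite ?c0 ?o0 ?co ?oppr_eq0.
rewrite EZb in dZb.
have := tderiv_div gc (tderivB (tderivM dZb dg) (tderivM dc dZ)) (tderivB dg dc).
apply: tderiv_eqd; rewrite /radial_field /icayley -/Z -/Zb.
have oc : o - c t != 0 by rewrite -opprB oppr_eq0.
have cg : c t - g t != 0 by rewrite -opprB oppr_eq0.
have E : (Zb * g t - c t * Z) / (g t - c t) - (Zb * o - c t * Z) / (o - c t) =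
  - (c t * (Z - Zb) * (o - g t)) / ((g t - c t) * (o - c t)) by field; rewrite ?gc ?oc.
rewrite E; field; rewrite ?gc ?oc ?co ?og ?c0 ?ZZ //=.
Qed.

(** The counterpart of [half_flow]: in chordal time the transformed point follows the radial field
    of the image of [W], multiplied by [dt/ds]. *)
Lemma disk_flow D t (c Zf G : R -> C) (W : R) :
  let Z := Zf t in let Zb := cconj (Zf t) in
  real_cplx W - Z != 0 -> real_cplx W - Zb != 0 -> G t - real_cplx W != 0 -> G t - Zb != 0 ->
  Z - Zb != 0 -> c t != 0 ->
  tderiv D c t (c t * ((Z - Zb) * (2 * real_cplx W - Z - Zb) /
    ((real_cplx W - Z) ^+ 2 * (real_cplx W - Zb) ^+ 2))) ->
  tderiv D Zf t (2 / (Z - real_cplx W)) ->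
  tderiv D G t (2 / (G t - real_cplx W)) ->
  tderiv D (fun s => cayley (c s) (Zf s) (G s)) t
   (radial_field (cayley (c t) Z (real_cplx W)) (cayley (c t) Z (G t)) *
     (- (Z - Zb) ^+ 2 / ((real_cplx W - Z) ^+ 2 * (real_cplx W - Zb) ^+ 2))).
Proof.
move=> Z Zb WZ WZb GW GZb ZZ c0 dc dZ dG; set w := real_cplx W in WZ WZb GW dc dZ dG *.
have dZb : tderiv D (fun s => cconj (Zf s)) t (2 / (Zb - w)).
  have := tderiv_conj dZ; rewrite conjM conjV conjD conjN -rc_nat conj_real rc_nat.
  by rewrite /w conj_real.
have ZW : Z - w != 0 by rewrite -opprB oppr_eq0.
have ZbW : Zb - w != 0 by rewrite -opprB oppr_eq0.
have := tderivM dc (tderiv_div GZb (tderivB dG dZ) (tderivB dG dZb)).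
apply: tderiv_eqd; rewrite /radial_field /cayley -/Z -/Zb.
have E : c t * ((w - Z) / (w - Zb)) - c t * ((G t - Z) / (G t - Zb)) =
  - (c t * (Z - Zb) * (G t - w)) / ((w - Zb) * (G t - Zb)) by field; rewrite ?WZb ?GZb.
rewrite E; field; rewrite ?GW ?GZb ?WZ ?WZb ?ZW ?ZbW ?ZZ ?c0 //=.
Qed.

Lemma half_expansionP (K : set C) (g : C -> C) (a : R) : half_expansion K g a <->
  forall e : R, 0 < e -> exists M : R, forall z, (@upper R `\` K) z -> M < cabs z ->
    cabs (z * (g z - (z + real_cplx a / z))) < e.
Proof.
split=> [/cvgCP H e e0|H].
  by have /near_inftyP[M MP] := H e e0; exists M => z Uz /(MP z Uz); rewrite subr0.
apply/cvgCP => e e0; apply/near_inftyP; have [M MP] := H e e0.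
by exists M => z Uz zM; rewrite subr0; exact: MP.
Qed.

Lemma eq_half_expansion (K : set C) (g h : C -> C) (a : R) :
  (forall z, (@upper R `\` K) z -> g z = h z) -> half_expansion K g a -> half_expansion K h a.
Proof.
move=> gh /half_expansionP H; apply/half_expansionP => e /H[M MP].
by exists M => z Uz zM; rewrite -gh//; exact: MP.
Qed.

Lemma continuous_on_itvP T (f : R -> R) :
  (forall t, 0 <= t <= T -> f @ within [set t | 0 <= t <= T] (nbhs t) --> f t) <->
  {within `[0, T], continuous f}.
Proof.
split=> [H|/subspace_continuousP H t tI].
  apply/subspace_continuousP => t /=; rewrite in_itv /= => /H c.
  apply: cvg_trans c; apply: cvg_app.
  by move=> A /within_nbhsP[e e0 eA]; apply/within_nbhsP; exists e => // s se; rewrite /= in_itv; exact: eA.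
have := H t; rewrite /= in_itv /= => /(_ tI) c; apply: cvg_trans c; apply: cvg_app.
by move=> A /within_nbhsP[e e0 eA]; apply/within_nbhsP; exists e => // s se sI; apply: eA => //=; rewrite in_itv.
Qed.

End LoewnerTransfer.

(** * Angles of boundary points and the coordinates [x], [y] *)

Section Phase.
Variable R : realType.
Local Notation C := (Cplx R).
Local Notation cRe := (@complex.Re R : C -> R).
Local Notation cIm := (@complex.Im R : C -> R).
Implicit Types (D : set R) (T t a s : R).

Lemma continuous_on_sub T a b (f : R -> R) : 0 <= a -> b <= T ->
  (forall t, 0 <= t <= T -> f @ within [set t | 0 <= t <= T] (nbhs t) --> f t) ->
  {within `[a, b], continuous f}.
Proof.
move=> a0 bT /continuous_on_itvP; apply: continuous_subspaceW => s /=.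
by rewrite !in_itv/= => /andP[h1 h2]; rewrite (le_trans a0 h1) (le_trans h2 bT).
Qed.

Lemma sin0_expi v w : sin ((v - w) / 2) = 0 -> expi v = expi w :> C.
Proof.
set a := (v - w) / 2 => sa.
have -> : expi v = expi w * (expi a * expi a) :> C.
  by rewrite -!expiD; congr expi; rewrite /a; field.
suff -> : expi a * expi a = 1 :> C by rewrite mulr1.
have h : cos a * cos a = 1 by rewrite -(cos2Dsin2 a) sa expr0n/= addr0 expr2.
by apply: C_eqP; rewrite !ReIm sa ?h; ring.
Qed.

Lemma lift_avoid T (a : R -> R) : 0 <= T ->
  (forall t, 0 <= t <= T -> a @ within [set t | 0 <= t <= T] (nbhs t) --> a t) ->
  0 < a 0 < pi -> (forall t, 0 <= t <= T -> sin (a t) != 0) ->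
  forall t, 0 <= t <= T -> 0 < a t < pi.
Proof.
move=> T0 ac /andP[a0 api] sa t /andP[t0 tT].
have c : {within `[0, t], continuous a} by exact: continuous_on_sub ac.
have hit k : sin k = 0 -> Num.min (a 0) (a t) <= k <= Num.max (a 0) (a t) -> False.
  move=> sk /(IVT t0 c)[q]; rewrite in_itv/= => /andP[q0 qt] E.
  have qI : 0 <= q <= T by rewrite q0 (le_trans qt tT).
  by have := sa q qI; rewrite E sk eqxx.
apply/andP; split; rewrite ltNge; apply/negP => H.
  by apply: (hit 0 (sin0 R)); rewrite ge_min le_max H (ltW a0) !orbT.
by apply: (hit pi (sinpi R)); rewrite ge_min le_max H (ltW api) !orbT.
Qed.

(** If one lift exceeded the other, their difference, which starts at 0, would take a value in []0,
    pi]], where [expi] is not 1. *)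
Lemma lift_unique T (v w : R -> R) : 0 <= T ->
  (forall t, 0 <= t <= T -> v @ within [set t | 0 <= t <= T] (nbhs t) --> v t) ->
  (forall t, 0 <= t <= T -> w @ within [set t | 0 <= t <= T] (nbhs t) --> w t) ->
  v 0 = w 0 -> (forall t, 0 <= t <= T -> expi (v t) = expi (w t) :> C) ->
  forall t, 0 <= t <= T -> v t = w t.
Proof.
move=> T0; wlog: v w / True; last first.
  suff le (v1 w1 : R -> R) : (forall t, 0 <= t <= T -> v1 @ within [set t | 0 <= t <= T] (nbhs t) --> v1 t) ->
    (forall t, 0 <= t <= T -> w1 @ within [set t | 0 <= t <= T] (nbhs t) --> w1 t) ->
    v1 0 = w1 0 -> (forall t, 0 <= t <= T -> expi (v1 t) = expi (w1 t) :> C) ->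
    forall t, 0 <= t <= T -> v1 t <= w1 t.
    move=> _ vc wc vw E t tI; apply/eqP; rewrite eq_le (le v w)//= (le w v)//.
    by move=> s sI; rewrite E.
  move: v1 w1 => {}v {}w vc wc vw E t /andP[t0 tT]; rewrite leNgt; apply/negP => H.
  pose d s := v s - w s.
  have dc : {within `[0, t], continuous d}.
    by apply: (@continuous_on_sub T) => // s sI; apply: cvgB; [exact: vc|exact: wc].
  pose m := Num.min (d t) pi.
  have dt : 0 < d t by rewrite subr_gt0.
  have m0 : 0 < m by rewrite lt_min dt pi_gt0.
  have mpi : m <= pi by rewrite ge_min lexx orbT.
  have md : m <= d t by rewrite ge_min lexx.
  have d0 : d 0 = 0 by rewrite /d vw subrr.
  have := @IVT _ d 0 t m t0 dc; rewrite d0 ge_min le_max (ltW m0) md orbT => /(_ isT)[q].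
  rewrite in_itv/= => /andP[q0 qt] Em.
  have qI : 0 <= q <= T by rewrite q0 (le_trans qt tT).
  have : expi m = 1 :> C by rewrite -Em /d expiD expiN E// divff// expi_neq0.
  move=> /(congr1 cRe); rewrite cRe_expi cRe1 => cm.
  have : cos m < cos 0 by rewrite ltr_cos// in_itv/= ?lexx ?pi_ge0 ?(ltW m0).
  by rewrite cos0 cm ltxx.
by move=> H; exact: H.
Qed.

(** The logarithmic derivative [q] of [X] is purely imaginary, because [X] and the driving point are
    unimodular. Integrating its imaginary part defines [v], and [X s * expi (- v s)] has derivative
    0. This builds the lift together with its differential equation, without lifting a given
    path. *)
Lemma phase T (w : R -> R) (X : R -> C) (v0 : R) : let J := [set t | 0 <= t <= T] in 0 <= T -> 0 < v0 < 2 * pi ->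
  (forall t, 0 <= t <= T -> w @ within J (nbhs t) --> w t) -> w 0 = 0 ->
  X 0 = expi v0 -> (forall t, 0 <= t <= T -> cabs (X t) = 1 /\ expi (w t) - X t != 0) ->
  (forall t, 0 <= t <= T -> tderiv J X t (radial_field (expi (w t)) (X t))) ->
  exists v : R -> R, v 0 = v0 /\ forall t, 0 <= t <= T -> [/\ X t = expi (v t),
    0 < (v t - w t) / 2 < pi & rderiv J v t (cot ((v t - w t) / 2))].
Proof.
move=> J T0 /andP[v0p v0pi] wc w0 X0 X1 dX.
pose q t : C := (expi (w t) + X t) / (expi (w t) - X t).
have Xc t : 0 <= t <= T -> X @ within J (nbhs t) --> X t by move=> /dX; exact: tderiv_cont.
have oc t : 0 <= t <= T -> (fun s => expi (w s) : C) @ within J (nbhs t) --> (expi (w t) : C).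
  by move=> tI; apply: cvgC_expi; exact: wc.
have qc t : 0 <= t <= T -> q @ within J (nbhs t) --> q t.
  move=> tI; have [_ n] := X1 t tI; apply: cvgC_div => //.
    by apply: cvgCD; [exact: oc|exact: Xc].
  by apply: cvgCB; [exact: oc|exact: Xc].
have [F [F0 dF]] := @antiderivative R T (fun t => cIm (q t)) T0 (fun t tI => cvgC_Im (qc t tI)).
have qE t : 0 <= t <= T -> q t = Ci * real_cplx (cIm (q t)).
  move=> tI; have [Xt1 n] := X1 t tI.
  have Xn0 : X t != 0 := unit_neq0 Xt1; have o0 : expi (w t) != 0 :> C := expi_neq0 _.
  have E : cconj (q t) = - q t.
    rewrite /q conjM conjV !conjD conjN !conj_unit// ?cabs_expi//.
    have -> : (expi (w t))^-1 - (X t)^-1 = - (expi (w t) - X t) / (expi (w t) * X t) by field; rewrite ?o0 ?Xn0.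
    by field; rewrite ?n ?o0 ?Xn0 ?oppr_eq0.
  have : cRe (q t) = 0 by have := congr1 cRe E; rewrite cRe_conj cReN => ?; lra.
  by rewrite {2}[q t]C_ReIm => ->; rewrite rc0 add0r.
pose v t := v0 + F t.
have dv t : 0 <= t <= T -> rderiv J v t (cIm (q t)).
  by move=> tI; have := rderivD (rderiv_cst J v0 t) (dF t tI); rewrite add0r.
have XE t : 0 <= t <= T -> X t = expi (v t).
  move=> /andP[t0 tT].
  pose f s := X s * expi (- v s).
  have df s : 0 <= s <= t -> tderiv J f s 0.
    move=> /andP[s0 st]; have sI : 0 <= s <= T by rewrite s0 (le_trans st tT).
    have dN := rderivN (dv s sI).
    have de := tderiv_time (D' := J) (D := setT) (fun _ _ => I) dN (tderiv_expi setT (- v s)).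
    have := tderivM (dX s sI) de; apply: tderiv_eqd.
    by rewrite /radial_field -/(q s) {1}qE// rcN; ring.
  have f0 : f 0 = 1 by rewrite /f /v F0 addr0 X0 expiN mulfV// expi_neq0.
  have H : X t * expi (- (v0 + F t)) = 1.
    rewrite -f0; apply: (@tderiv0_const R J f 0 t t0 _ df).
    by move=> s /andP[s0 st]; rewrite /J/= s0 (le_trans st tT).
  rewrite -/(v t) expiN in H; rewrite -[RHS]mul1r -H -mulrA mulVf ?mulr1//; exact: expi_neq0.
have vc t : 0 <= t <= T -> v @ within J (nbhs t) --> v t by move=> /dv; exact: rderiv_cont.
pose a t := (v t - w t) / 2.
have ac t : 0 <= t <= T -> a @ within J (nbhs t) --> a t.
  by move=> tI; apply: cvgMl; apply: cvgB; [exact: vc|exact: wc].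
have sa t : 0 <= t <= T -> sin (a t) != 0.
  move=> tI; apply/eqP => /sin0_expi E; have [_] := X1 t tI.
  by rewrite XE// E subrr eqxx.
have a0 : 0 < a 0 < pi by rewrite /a w0 /v F0 addr0 subr0; lra.
exists v; split; first by rewrite /v F0 addr0.
move=> t tI; split; [exact: XE|exact: lift_avoid ac a0 sa t tI|].
have [n E] := expi_cot (sa t tI).
apply: rderiv_eqd (dv t tI); apply: rc_inj; apply: (mulfI (Ci_neq0 R)).
rewrite -qE// [RHS]E /q XE//.
have n' : expi (w t) - expi (v t) != 0 :> C by rewrite -opprB oppr_eq0.
by field; rewrite ?n ?n'.
Qed.

Lemma cvg_sin (U : Type) (G : set_system U) {FG : Filter G} (f : U -> R) (l : R) :
  f @ G --> l -> (fun i : U => sin (f i)) @ G --> sin l.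
Proof. by move=> fl; exact: (cvg_comp _ _ fl (@continuous_sin R l)). Qed.

Lemma cvg_cos (U : Type) (G : set_system U) {FG : Filter G} (f : U -> R) (l : R) :
  f @ G --> l -> (fun i : U => cos (f i)) @ G --> cos l.
Proof. by move=> fl; exact: (cvg_comp _ _ fl (@continuous_cos R l)). Qed.

(** The equation of [y] does not involve [x], so [y] is an exponential, after which [x] and the new
    time [u] are plain integrals. The time can be inverted because its rate is continuous and
    positive on a compact interval. *)
Lemma loewner_coordinates T (v w : R -> R) (x0 y0 : R) : let J := [set t | 0 <= t <= T] in
  let al := fun t => (v t - w t) / 2 in let sg := fun (y : R -> R) t => y t ^+ 2 / (4 * sin (al t) ^+ 4) in
  0 <= T -> 0 < y0 ->
  (forall t, 0 <= t <= T -> w @ within J (nbhs t) --> w t) ->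
  (forall t, 0 <= t <= T -> 0 < al t < pi) ->
  (forall t, 0 <= t <= T -> v @ within J (nbhs t) --> v t) ->
  exists x y u r : R -> R, [/\ x 0 = x0, y 0 = y0 & u 0 = 0] /\
  (forall t, 0 <= t <= T -> [/\ 0 < y t,
     rderiv J x t (- y t * cos (al t) / (2 * sin (al t) ^+ 3)),
     rderiv J y t (- y t / (2 * sin (al t) ^+ 2)) &
     rderiv J u t (sg y t)]) /\
  [/\ 0 <= u T, reparametrization (u T) T r,
    forall t, 0 <= t <= T -> 0 <= u t <= u T /\ r (u t) = t,
    forall s, 0 <= s <= u T -> 0 <= r s <= T /\ u (r s) = s &
    forall s, 0 <= s <= u T -> rderiv [set s | 0 <= s <= u T] r s (sg y (r s))^-1].
Proof.
move=> J al sg T0 y00 wc alI vc.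
have sp t : 0 <= t <= T -> 0 < sin (al t) by move=> /alI; exact: sin_gt0_pi.
have ac t : 0 <= t <= T -> al @ within J (nbhs t) --> al t.
  by move=> tI; apply: cvgMl; apply: cvgB; [exact: vc|exact: wc].
have sc t n (k : R) : k != 0 -> 0 <= t <= T ->
    (fun s => (k * sin (al s) ^+ n)^-1) @ within J (nbhs t) --> (k * sin (al t) ^+ n)^-1.
  move=> k0 tI; apply: cvgV; first by rewrite mulf_neq0// expf_neq0// gt_eqF// sp.
  by apply: cvgMr; apply: cvg_pow; apply: cvg_sin; exact: ac.
have two0 : (2 : R) != 0 by rewrite pnatr_eq0.
have four0 : (4 : R) != 0 by rewrite pnatr_eq0.
have [F [F0 dF]] := antiderivative T0 (fun t => sc t 2%N 2 two0).
pose y t := y0 * expR (- F t).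
have yp t : 0 < y t by rewrite mulr_gt0// expR_gt0.
have dy t : 0 <= t <= T -> rderiv J y t (- y t / (2 * sin (al t) ^+ 2)).
  move=> tI; have dN := rderivN (dF t tI).
  have := rderivZ y0 (rderiv_comp (u := fun s => - F s) (is_derive_expR (- F t)) dN).
  by apply: rderiv_eqd; rewrite /y; ring.
have yc t : 0 <= t <= T -> y @ within J (nbhs t) --> y t by move=> /dy; exact: rderiv_cont.
have xc t : 0 <= t <= T -> (fun s => - y s * cos (al s) / (2 * sin (al s) ^+ 3)) @ within J (nbhs t)
    --> - y t * cos (al t) / (2 * sin (al t) ^+ 3).
  move=> tI; apply: cvgM; last exact: sc.
  by apply: cvgM; [apply: cvgN; exact: yc|apply: cvg_cos; exact: ac].
have [Fx [Fx0 dFx]] := antiderivative T0 xc.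
have uc t : 0 <= t <= T -> sg y @ within J (nbhs t) --> sg y t.
  by move=> tI; apply: cvgM; [apply: cvg_pow; exact: yc|exact: sc].
have [u [u0 du]] := antiderivative T0 uc.
have sg0 t : 0 <= t <= T -> 0 < sg y t.
  move=> tI; apply: divr_gt0; first exact: exprn_gt0 (yp t).
  by apply: mulr_gt0; [rewrite ltr0n|exact: exprn_gt0 (sp t tI)].
have [m m0 mle] := within_pos T0 uc sg0.
have [r [h1 h2 h3 h4 h5]] := inverse_time T0 m0 u0 du mle.
exists (fun t => x0 + Fx t), y, u, r; split; first by split; rewrite ?Fx0 ?addr0// /y F0 oppr0 expR0 mulr1.
split=> // t tI; split=> //; [|exact: dy|exact: du].
by have := rderivD (rderiv_cst J x0 t) (dFx t tI); rewrite add0r.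
Qed.

(** A dictionary from the trigonometric form, suited to the energies, to the rational form of
    [half_flow]. In order: the velocity of [c], the velocity of [Z], the rate [ds/dt], and the
    driving point as the image of [o] under [icayley]. *)
Lemma coordinate_identities (v w x y : R) (al := (v - w) / 2) (Z := Complex x y : C)
    (c := expi v : C) (o := expi w : C) : sin al != 0 ->
  [/\ c - o != 0,
      Ci * c * real_cplx (cot al) = - c * (c + o) / (c - o),
      real_cplx (- y * cos al / (2 * sin al ^+ 3)) + Ci * real_cplx (- y / (2 * sin al ^+ 2)) =
        2 * (Z - cconj Z) * c ^+ 2 * o / (c - o) ^+ 3,
      real_cplx (y ^+ 2 / (4 * sin al ^+ 4)) = - (Z - cconj Z) ^+ 2 * c ^+ 2 * o ^+ 2 / (c - o) ^+ 4 &
      real_cplx (x + y * cot al) = (cconj Z * o - c * Z) / (o - c)].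
Proof.
move=> sa; have [n E] := expi_cot sa; have E2 := expi_sin2 sa; rewrite -/al -/c -/o in n E E2.
have n' : o - c != 0 by rewrite -opprB oppr_eq0.
have ZE : Z = real_cplx x + Ci * real_cplx y by apply: C_eqP; rewrite !ReIm /Z /=; ring.
have ZbE : cconj Z = real_cplx x - Ci * real_cplx y by apply: C_eqP; rewrite !ReIm /Z /=; ring.
have s0 : real_cplx (sin al) != 0 by rewrite rc_eq0.
have I2 : Ci ^+ 2 = -1 :> C by rewrite expr2 Ci2.
split=> //.
- by rewrite mulrAC E; ring.
- have -> : real_cplx (- y * cos al / (2 * sin al ^+ 3)) + Ci * real_cplx (- y / (2 * sin al ^+ 2)) =
    - (real_cplx y / 2) * real_cplx (sin al ^+ 2)^-1 * (real_cplx (cot al) + Ci).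
    rewrite /cot !(rcX, rcN, rcV, rcM, rc_nat); field; rewrite ?s0 ?pnatr_eq0//.
  have -> : real_cplx (cot al) = - Ci * (Ci * real_cplx (cot al)) by rewrite mulrA mulNr Ci2 opprK mul1r.
  rewrite E E2 ZbE ZE; field; by rewrite ?n ?pnatr_eq0.
- have -> : real_cplx (y ^+ 2 / (4 * sin al ^+ 4)) = real_cplx y ^+ 2 / 4 * real_cplx (sin al ^+ 2)^-1 ^+ 2.
    rewrite !(rcX, rcN, rcV, rcM, rc_nat); field; rewrite ?s0 ?pnatr_eq0//.
  rewrite E2 ZbE ZE.
  have -> : real_cplx x + Ci * real_cplx y - (real_cplx x - Ci * real_cplx y) = 2 * real_cplx y * Ci by ring.
  rewrite [in RHS]exprMn [in RHS]I2; field; by rewrite ?n ?pnatr_eq0.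
- rewrite rcD rcM.
  have -> : real_cplx (cot al) = - Ci * (Ci * real_cplx (cot al)) by rewrite mulrA mulNr Ci2 opprK mul1r.
  rewrite E ZbE ZE; field; by rewrite ?n ?n'.
Qed.

Lemma tderiv_ReIm D (x y : R -> R) t (x' y' : R) : rderiv D x t x' -> rderiv D y t y' ->
  tderiv D (fun s => Complex (x s) (y s) : C) t (real_cplx x' + Ci * real_cplx y').
Proof.
move=> dx dy; have H := tderivD dx (tderivM (tderiv_cst D Ci t) dy).
have -> : (fun s => Complex (x s) (y s) : C) = (fun s => real_cplx (x s) + Ci * real_cplx (y s)).
  by apply/funext => s; apply: C_eqP; rewrite !ReIm /=; ring.
by apply: tderiv_eqd H; ring.
Qed.

End Phase.

(** * Hydrodynamic normalization from the chordal equation *)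

Section ForwardTools.
Variable R : realType.
Local Notation C := (Cplx R).
Local Notation cRe := (@complex.Re R : C -> R).
Local Notation cIm := (@complex.Im R : C -> R).
Implicit Types (D : set R) (T t a s : R) (K : set C) (z x : C).

Lemma avoid_near K x : compact K -> ~ K x -> exists2 r : R, 0 < r <= 2^-1 &
  forall z, near_bd x r z -> ~ K z.
Proof.
move=> cK nK; have oK : open (~` K) by apply: closed_openC; exact: compactC_closed.
have [e e0 eP] := (openCP _).1 oK x nK.
have h0 : (0 : R) < 2^-1 by rewrite invr_gt0.
exists (Num.min e 2^-1); first by rewrite lt_min e0 h0/= ge_min lexx orbT.
by move=> z [_]; rewrite lt_min => /andP[ze _]; exact: eP.
Qed.

(** The chordal equation is integrated twice. The lower bound on the distance to the driving
    function first shows that [G s z - z] stays bounded; inserted in the equation, this makes the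
    derivative of [z * (G s z - z) - 2 * u s] of order [1 / cabs z]. *)
Lemma half_chart_expansion T (K : R -> set C) (G : R -> C -> C) (u sg Wt : R -> R) (B kap M0 : R) :
  let J := [set t | 0 <= t <= T] in u 0 = 0 -> 0 <= B -> 0 < kap ->
  (forall t, 0 <= t <= T -> rderiv J u t (sg t) /\ 0 <= sg t) ->
  (forall t, 0 <= t <= T -> `|Wt t| <= B) ->
  (forall z, upper z -> M0 < cabs z -> G 0 z = z) ->
  (forall z t, upper z -> M0 < cabs z -> 0 <= t <= T -> kap * cabs z - B <= cabs (G t z - real_cplx (Wt t))) ->
  (forall z t, upper z -> M0 < cabs z -> 0 <= t <= T -> G t z - real_cplx (Wt t) != 0 ->
     tderiv J (fun s => G s z) t (2 * real_cplx (sg t) / (G t z - real_cplx (Wt t)))) ->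
  forall t, 0 <= t <= T -> half_expansion (K t) (G t) (2 * u t).
Proof.
move=> J u0 B0 k0 du WB G0 low dG t /andP[t0 tT].
have sub a b s : 0 <= a -> b <= T -> a <= s <= b -> J s.
  by move=> a0 bT /andP[h1 h2]; rewrite /J/= (le_trans a0 h1) (le_trans h2 bT).
have mono a b : 0 <= a -> a <= b -> b <= T -> u a <= u b.
  move=> a0 ab bT; apply: (@rderiv_le R J u sg a b ab) => s sI; first exact: sub sI.
    exact: (du s (sub a b s a0 bT sI)).1.
  exact: (du s (sub a b s a0 bT sI)).2.
have uI s : 0 <= s -> s <= T -> 0 <= u s <= u T.
  by move=> s0 sT; rewrite -{1}u0 !mono.
set U := u T in uI; have U0 : 0 <= U by have /andP[h1 h2] := uI t t0 tT; exact: le_trans h1 h2.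
pose q := kap / 2; have q0 : 0 < q by rewrite divr_gt0.
(* [A] bounds [G s z - z], and [Q / cabs z] will bound the error in the expansion. Halving [kap] to
   [q] absorbs the constant [B] once [cabs z] exceeds [B / q]. *)
pose A := 2 * U / q.
have A0 : 0 <= A by rewrite divr_ge0 ?mulr_ge0// ltW.
pose Q := 2 * (A + B) * U / q.
have Q0 : 0 <= Q by rewrite divr_ge0 ?mulr_ge0 ?addr_ge0// ltW.
apply/half_expansionP => e e0.
exists (`|M0| + B / q + 1 + Q / e) => z [Uz _]; set p := cabs z => zM.
have Bq : 0 <= B / q by rewrite divr_ge0// ltW.
have Qe : 0 <= Q / e by rewrite divr_ge0// ltW.
have nM := normr_ge0 M0; have lM := ler_norm M0.
have zM0 : M0 < p by lra.
have p1 : 1 < p by lra.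
have pB : B / q < p by lra.
have pQ : Q / e < p by lra.
have p0 : 0 < p by lra.
have qp : 0 < q * p by rewrite mulr_gt0.
have lowq s : J s -> q * p <= cabs (G s z - real_cplx (Wt s)).
  move=> sI; apply: le_trans (low z s Uz zM0 sI); rewrite -/p.
  have : B <= q * p by rewrite mulrC -ler_pdivrMr// ltW.
  have -> : kap = 2 * q by rewrite /q mulrC divfK.
  by rewrite -mulrA; move: (q * p) => a; lra.
have neq s : J s -> G s z - real_cplx (Wt s) != 0.
  by move=> sI; rewrite -cabs_gt0; exact: lt_le_trans (lowq s sI).
have dGz s (sI : J s) := dG z s Uz zM0 sI (neq s sI).
have two2 : cabs (2 : C) = 2 by rewrite cabs_nat.
have inv s : J s -> cabs (2 * real_cplx (sg s) / (G s z - real_cplx (Wt s))) <= 2 / (q * p) * sg s.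
  move=> sI; rewrite !cabsM cabsV two2 cabs_real (ger0_norm (du s sI).2).
  rewrite mulrAC; apply: ler_wpM2r; first exact: (du s sI).2.
  by apply: ler_wpM2l => //; rewrite lef_pV2 ?posrE ?(lt_le_trans qp (lowq s sI))// lowq.
have dif s : 0 <= s -> s <= T -> cabs (G s z - z) <= A.
  move=> s0 sT.
  have := @tderiv_bound R J (fun s => G s z) _ (fun s => 2 / (q * p) * u s) _ 0 s s0
    (fun a => sub 0 s a (lexx _) sT)
    (fun a aI => dGz a (sub 0 s a (lexx _) sT aI))
    (fun a aI => rderivZ (2 / (q * p)) (du a (sub 0 s a (lexx _) sT aI)).1)
    (fun a aI => inv a (sub 0 s a (lexx _) sT aI)).
  rewrite G0// u0 mulr0 subr0 => /le_trans; apply.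
  have /andP[us0 usU] := uI s s0 sT.
  have : 2 / (q * p) <= 2 / q.
    by apply: ler_wpM2l => //; rewrite lef_pV2 ?posrE// ler_peMr// ltW.
  move=> h; apply: le_trans (_ : 2 / q * U <= A); last by rewrite /A mulrAC.
  by apply: ler_pM => //; rewrite divr_ge0// ltW.
pose h s : C := z * (G s z - z) - real_cplx (2 * u s).
pose h' s : C := z * (2 * real_cplx (sg s) / (G s z - real_cplx (Wt s))) - real_cplx (2 * sg s).
have dh s : J s -> tderiv J h s (h' s).
  move=> sI.
  have d1 := tderivM (tderiv_cst J z s) (tderivB (dGz s sI) (tderiv_cst J z s)).
  have d2 := rderivZ 2 (du s sI).1.
  by apply: tderiv_eqd (tderivB d1 d2); rewrite /h'; ring.
have h'b s : J s -> cabs (h' s) <= 2 * (A + B) / (q * p) * sg s.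
  move=> sI; have n := neq s sI; have /andP[s0 sT] := sI.
  have -> : h' s = (2 * real_cplx (sg s) / (G s z - real_cplx (Wt s))) * (z - G s z + real_cplx (Wt s)).
    by rewrite /h' rcM rc_nat; field.
  rewrite cabsM.
  have -> : 2 * (A + B) / (q * p) * sg s = (2 / (q * p) * sg s) * (A + B) by ring.
  apply: ler_pM (inv s sI) _; rewrite ?cabs_ge0//.
  apply: le_trans (ler_cabsD _ _) _; apply: lerD; first by rewrite cabsC; exact: dif.
  by rewrite cabs_real; exact: WB.
have := @tderiv_bound R J h h' (fun s => 2 * (A + B) / (q * p) * u s) _ 0 t t0
    (fun a => sub 0 t a (lexx _) tT)
    (fun a aI => dh a (sub 0 t a (lexx _) tT aI))
    (fun a aI => rderivZ (2 * (A + B) / (q * p)) (du a (sub 0 t a (lexx _) tT aI)).1)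
    (fun a aI => h'b a (sub 0 t a (lexx _) tT aI)).
have z0 : z != 0 by rewrite -cabs_gt0.
have -> : z * (G t z - (z + real_cplx (2 * u t) / z)) = h t - h 0.
  by rewrite /h G0// u0 mulr0 rc0; field.
rewrite u0 mulr0 subr0 => /le_lt_trans; apply.
have /andP[us0 usU] := uI t t0 tT.
apply: (@le_lt_trans _ _ (Q / p)); last by rewrite ltr_pdivrMr// mulrC -ltr_pdivrMr.
have -> : Q / p = 2 * (A + B) / (q * p) * U by rewrite /Q [(q * p)^-1]invfM; move: (A + B) (q^-1) (p^-1) => a b c; ring.
by apply: ler_wpM2l => //; rewrite divr_ge0 ?mulr_ge0 ?addr_ge0// ltW.
Qed.

Lemma icayley_sub_conj (c Z x : C) : x - c != 0 ->
  icayley c Z x - cconj Z = c * (cconj Z - Z) / (x - c).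
Proof. by move=> xc; rewrite /icayley; field. Qed.

Lemma cayley_sub (c Z z : C) : z - cconj Z != 0 ->
  cayley c Z z - c = c * (cconj Z - Z) / (z - cconj Z).
Proof. by move=> n; rewrite /cayley; field. Qed.

Lemma extension_disk_limit K (f : C -> C) x (X : C) (r : R) : cabs x = 1 -> 0 < r ->
  (forall z, near_bd x r z -> ~ K z) ->
  (forall e : R, 0 < e -> exists2 d : R, 0 < d & forall z, near_bd x d z -> cabs (f z - X) < e) ->
  extension (@disk R `\` K) f x = X.
Proof.
move=> x1 r0 H L; rewrite /extension.
have sub A : within (@disk R `\` K) (nbhs x) A -> within (@disk R) (nbhs x) A.
  move=> /nbhsCP[e e0 eA]; apply/nbhsCP; exists (Num.min e r); first by rewrite lt_min e0 r0.
  move=> z; rewrite lt_min => /andP[ze zr] Dz; apply: eA => //; split=> //.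
  by apply: (H z); split=> //; apply/diskE.
have P0 := near_disk_proper x1.
have PF : ProperFilter (within (@disk R `\` K) (nbhs x)).
  apply: Build_ProperFilter_ex => A /sub; exact: filter_ex.
apply: (@cvg_lim C); first exact: hausdorffC.
apply/cvgCP => e e0; apply/nbhsCP; have [d d0 dP] := L e e0.
by exists d => // z zd [/diskE Dz _]; apply: dP.
Qed.

Lemma extension_disk_hull K (f : C -> C) x (X : C) (r M : R) : cabs x = 1 -> 0 < r ->
  (forall z, near_bd x r z -> ~ K z /\ cabs (f z - X) <= M * cabs (z - x)) ->
  extension (@disk R `\` K) f x = X.
Proof.
move=> x1 r0 H; apply: (extension_disk_limit x1 r0) => [z /H[]//|e e0].
have M0 : 0 < `|M| + 1 by rewrite ltr_wpDl.
exists (Num.min r (e / (`|M| + 1))); first by rewrite lt_min r0 divr_gt0.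
move=> z [z1]; rewrite lt_min ltr_pdivlMr// => /andP[zr ze].
have [_ h] := H z (conj z1 zr).
apply: (le_lt_trans h); apply: le_lt_trans ze; rewrite mulrC; apply: ler_wpM2l; first exact: cabs_ge0.
by apply: le_trans (ler_norm M) _; rewrite lerDl.
Qed.

End ForwardTools.

(** * The transformed maps of a family of disk hulls *)

Section Forward.
Variable R : realType.
Local Notation C := (Cplx R).
Local Notation cRe := (@complex.Re R : C -> R).
Local Notation cIm := (@complex.Im R : C -> R).
Implicit Types (D : set R) (t a s : R) (K : set C) (z : C).

Lemma conformal_restrict (A B K K' : set C) (f : C -> C) : (forall z, A z -> (K' z <-> K (f z))) ->
  conformal A B f -> conformal (A `\` K') (B `\` K) f.
Proof.
move=> KK [df /set_bijP_C[h1 h2 h3]]; split; first by move=> z [Az _]; exact: df.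
apply/set_bijP_C; split.
- by move=> z [Az nK]; split; [exact: h1|move=> /(KK z Az)].
- by move=> z1 z2 [A1 _] [A2 _]; exact: h2.
- move=> b [Bb nK]; have [z Az fz] := h3 b Bb; exists z => //; split=> //.
  by move=> /(KK z Az); rewrite fz.
Qed.

Variables (v0 : R) (z0 : C) (phi0 : C -> C).
Hypotheses (hv0 : 0 < v0 < 2 * pi) (Z0 : 0 < cIm z0).
Hypothesis phiE : forall z, upper z -> phi0 z = cayley (expi v0) z0 z.
Hypothesis cz : expi v0 * z0 = cconj z0.

Section Family.
Variables (T : R) (KR : R -> set C) (w : R -> R).
Hypotheses (T0 : 0 <= T) (fam : disk_family T KR w) (nK : ~ KR T (expi v0)).
Let J := [set t : R | 0 <= t <= T].
Let KC t := hull_preimage phi0 (KR t).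
Let c1 : cabs (expi v0 : C) = 1. Proof. exact: cabs_expi. Qed.

Lemma fw_hull t : 0 <= t <= T -> disk_hull (KR t).
Proof. by move=> tI; case: fam => _ H _ _ _; apply: H; rewrite in_itv. Qed.

Lemma fw_mapout t : 0 <= t <= T -> is_disk_mapout (KR t) (disk_mapout (KR t)).
Proof.
move=> tI; case: fam => _ _ H _ _; apply: (disk_mapoutP (expR_gt0 t)).
by apply: H; rewrite in_itv.
Qed.

Lemma fw_sub s t : 0 <= s -> s <= t -> t <= T -> KR s `<=` KR t.
Proof. by case: fam => H _ _ _ _; exact: H. Qed.

Lemma fw_driving t : 0 <= t <= T -> w @ within J (nbhs t) --> w t.
Proof. by move=> tI; case: fam => _ _ _ [/continuous_on_itvP wc _] _; exact: wc. Qed.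

Lemma fw_avoid t : 0 <= t <= T -> ~ KR t (expi v0).
Proof. by move=> /andP[t0 tT] /(fw_sub t0 tT (lexx T)). Qed.

Lemma fw_disk t z : 0 <= t <= T -> disk z -> ~ KR t z -> cabs (disk_mapout (KR t) z) < 1.
Proof.
by move=> tI Dz Kz; have [[_ /set_bijP_C[h _ _]] _ _] := fw_mapout tI; apply/diskE; exact: h.
Qed.

Lemma fw_ode t z : 0 <= t <= T -> disk z -> ~ KR t z ->
  tderiv [set s | 0 <= s <= T /\ ~ KR s z] (fun s => disk_mapout (KR s) z) t
    (radial_field (expi (w t)) (disk_mapout (KR t) z)).
Proof.
move=> tI Dz Kz; case: fam => _ _ _ _ [_ H].
have tI' : t \in `[0, T] by rewrite in_itv.
have := H t z tI' (conj Dz Kz) => /tderivP; apply: tderiv_sub.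
by move=> s [sI ?]; split=> //; rewrite in_itv.
Qed.

(** The linear rate at which [disk_mapout (KR t)] approaches [expi (v t)] is kept because, seen from
    the half-plane, it is a lower bound on the growth of the transformed map at infinity. *)
Lemma fw_phase : exists (v : R -> R) (M r : R), [/\ 0 < r, v 0 = v0 &
  forall t, 0 <= t <= T -> [/\ 0 < (v t - w t) / 2 < pi, rderiv J v t (cot ((v t - w t) / 2)) &
    forall z, near_bd (expi v0) r z ->
      ~ KR t z /\ cabs (disk_mapout (KR t) z - expi (v t)) <= M * cabs (z - expi v0)]].
Proof.
have TI : 0 <= T <= T by rewrite T0 lexx.
have OI : (0 : R) <= 0 <= T by rewrite lexx T0.
have [Kcpt _ _ _ _] := fw_hull TI.
have [r rI rK] := avoid_near Kcpt nK.
have nKt z t : near_bd (expi v0) r z -> 0 <= t <= T -> ~ KR t z.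
  by move=> /rK n /andP[t0 tT] /(fw_sub t0 tT (lexx T)).
have Dz (z : C) : near_bd (expi v0) r z -> disk z by move=> [? _]; apply/diskE.
case: (fam) => _ _ _ [_ w0] [g0 _].
have W0 : expi (w 0) - expi v0 != 0 :> C.
  rewrite subr_eq0; apply/eqP => E.
  suff : sin ((v0 - w 0) / 2) != 0.
    by move=> /expi_cot[]; rewrite E subrr eqxx.
  rewrite w0 subr0 gt_eqF//; apply: sin_gt0_pi; move: hv0 => /andP[h1 h2].
  by apply/andP; split; lra.
have [X [d [M [r' [[d0 r'0 X0] H]]]]] := @boundary_flow R T (fun t => expi (w t))
  (fun t z => disk_mapout (KR t) z) (expi v0) r T0 (fun t _ => cabs_expi (w t))
  (fun t tI => cvgC_expi (fw_driving tI)) c1 rI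
  (fun z nz => g0 z (conj (Dz z nz) (nKt z 0 nz OI)))
  (fun z t nz tI => fw_disk tI (Dz z nz) (nKt z t nz tI))
  (fun z t nz tI => tderiv_sub (fun s sI => conj sI (nKt z s nz sI)) (fw_ode tI (Dz z nz) (nKt z t nz tI)))
  (fun z nz => ((conformalP _ _ _).1 (let: And3 h _ _ := fw_mapout TI in h)).1 z (conj (Dz z nz) (nKt z T nz TI)))
  W0.
have X1 t : 0 <= t <= T -> cabs (X t) = 1 /\ expi (w t) - X t != 0.
  by move=> /H[h1 h2 _ _]; split=> //; rewrite -cabs_gt0; exact: lt_le_trans h2.
have [v [v00 vP]] := phase T0 hv0 fw_driving w0 X0 X1 (fun t tI => let: And4 _ _ h _ := H t tI in h).
exists v, M, (Num.min r r'); split=> //.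
  by rewrite lt_min r'0 andbT; case/andP: rI.
move=> t tI; have [XE aI dv] := vP t tI; split=> // z [zd]; rewrite lt_min => /andP[zr zr'].
split; first exact: nKt.
by have [_ _ _] := H t tI; rewrite -XE; apply.
Qed.

Section Chart.
Variables (v x y u : R -> R) (M r : R).
Let al t := (v t - w t) / 2.
Let sg t := y t ^+ 2 / (4 * sin (al t) ^+ 4).
Let Z t : C := Complex (x t) (y t).
Let Wt t := x t + y t * cot (al t).
Let Gt t z := icayley (expi (v t)) (Z t) (disk_mapout (KR t) (cayley (expi v0) z0 z)).
Hypotheses (r0 : 0 < r) (v00 : v 0 = v0) (ZI : Z 0 = z0) (u0 : u 0 = 0).
Hypothesis vP : forall t, 0 <= t <= T -> [/\ 0 < al t < pi, rderiv J v t (cot (al t)) &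
    forall z, near_bd (expi v0) r z ->
      ~ KR t z /\ cabs (disk_mapout (KR t) z - expi (v t)) <= M * cabs (z - expi v0)].
Hypothesis xyuP : forall t, 0 <= t <= T -> [/\ 0 < y t,
     rderiv J x t (- y t * cos (al t) / (2 * sin (al t) ^+ 3)),
     rderiv J y t (- y t / (2 * sin (al t) ^+ 2)) & rderiv J u t (sg t)].

Lemma fw_preimage t z : upper z -> KC t z <-> KR t (cayley (expi v0) z0 z).
Proof.
move=> Uz; rewrite /KC (hull_preimageE Z0 phiE)/=; split=> [[]//|h]; split=> //.
by rewrite /closed_upper/=; apply: ltW.
Qed.

Lemma fw_sin t : 0 <= t <= T -> 0 < sin (al t).
Proof. by move=> /vP[h _ _]; exact: sin_gt0_pi. Qed.

Lemma fw_point t : 0 <= t <= T -> 0 < cIm (Z t).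
Proof. by move=> /xyuP[]. Qed.

Lemma fw_chart_ode t z : 0 <= t <= T -> upper z -> ~ KC t z ->
  tderiv [set s | 0 <= s <= T /\ ~ KC s z] (fun s => Gt s z) t
    (2 * real_cplx (sg t) / (Gt t z - real_cplx (Wt t))).
Proof.
move=> tI Uz nz.
have DJ : [set s | 0 <= s <= T /\ ~ KC s z] `<=` J by move=> s [].
have sa : sin (al t) != 0 by rewrite gt_eqF// fw_sin.
have [n E1 E2 E3 E4] := coordinate_identities (x t) (y t) sa.
have Du : disk (cayley (expi v0) z0 z) := cayley_disk c1 Z0 Uz.
have nu : ~ KR t (cayley (expi v0) z0 z) by move=> h; apply: nz; apply/fw_preimage.
have g1 := fw_disk tI Du nu.
have [aI dv _] := vP tI; have [y0 dx dy du] := xyuP tI.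
have unit_sub (q q' : C) : cabs q = 1 -> cabs q' < 1 -> q' - q != 0.
  by move=> q1 q'1; apply/eqP => /subr0_eq E; rewrite E q1 ltxx in q'1.
have gc := unit_sub (expi (v t)) _ (cabs_expi _) g1.
have og : expi (w t) - disk_mapout (KR t) (cayley (expi v0) z0 z) != 0.
  by rewrite -opprB oppr_eq0; exact: unit_sub (cabs_expi _) g1.
have ZZ := conj_diff (fw_point tI).
have dc : tderiv J (fun s => expi (v s) : C) t (- expi (v t) * (expi (v t) + expi (w t)) / (expi (v t) - expi (w t))).
  rewrite -E1; have := tderiv_time (D' := J) (D := setT) (fun _ _ => I) dv (tderiv_expi setT (v t)).
  by [].
have dZ := tderiv_eqd E2 (tderiv_ReIm dx dy).
have dg := fw_ode tI Du nu.
have dg' : tderiv [set s | 0 <= s <= T /\ ~ KC s z]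
    (fun s => disk_mapout (KR s) (cayley (expi v0) z0 z)) t
    (radial_field (expi (w t)) (disk_mapout (KR t) (cayley (expi v0) z0 z))).
  by apply: tderiv_sub dg => s [sI ns]; split=> // h; apply: ns; apply/fw_preimage.
have := @half_flow R _ t (fun s => expi (v s)) Z (fun s => disk_mapout (KR s) (cayley (expi v0) z0 z)) _ (cabs_expi (w t)) (cabs_expi (v t)) n og gc ZZ (tderiv_sub DJ dc) (tderiv_sub DJ dZ) dg'.
by apply: tderiv_eqd; rewrite -E3 -E4.
Qed.

Lemma fw_chart_conformal t : 0 <= t <= T -> conformal (@upper R `\` KC t) (@upper R) (Gt t).
Proof.
move=> tI; have [h _ _] := fw_mapout tI.
apply: conformal_comp (conformal_comp (B := @disk R `\` KR t) _ h) (conformal_icayley (cabs_expi (v t)) (fw_point tI)).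
by apply: conformal_restrict (conformal_cayley c1 Z0) => z; exact: fw_preimage.
Qed.

Lemma fw_chart0 z : upper z -> ~ KC 0 z -> Gt 0 z = z.
Proof.
move=> Uz nz; case: (fam) => _ _ _ _ [g0 _].
rewrite /Gt v00 ZI g0; first exact: cayleyK (ltW _).
by split; [exact: cayley_disk|move=> h; apply: nz; apply/fw_preimage].
Qed.

(** The distance of [Gt s z] to [cconj (Z s)] is [2 * y s] divided by the distance of the disk image
    to [expi (v s)]. The latter is at most a constant times [1 / cabs (z - cconj z0)], by the
    Lipschitz estimate at [expi v0], so the former grows linearly in [z], uniformly in time. *)
Lemma fw_chart_expansion t : 0 <= t <= T -> half_expansion (KC t) (Gt t) (2 * u t).
Proof.
have JE : J = [set t | 0 <= t <= T] by [].
have wc := fw_driving.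
have vc s (sI : 0 <= s <= T) : v @ within J (nbhs s) --> v s by have [_ h _] := vP sI; exact: rderiv_cont h.
have xc s (sI : 0 <= s <= T) : x @ within J (nbhs s) --> x s by have [_ h _ _] := xyuP sI; exact: rderiv_cont h.
have yc s (sI : 0 <= s <= T) : y @ within J (nbhs s) --> y s by have [_ _ h _] := xyuP sI; exact: rderiv_cont h.
have ac s (sI : 0 <= s <= T) : al @ within J (nbhs s) --> al s.
  by apply: cvgMl; apply: cvgB; [exact: vc|exact: wc].
have Wc s (sI : 0 <= s <= T) : Wt @ within J (nbhs s) --> Wt s.
  apply: cvgD; first exact: xc.
  apply: cvgM; first exact: yc.
  apply: cvgM; first by apply: cvg_cos; exact: ac.
  by apply: cvgV; [rewrite gt_eqF// fw_sin|apply: cvg_sin; exact: ac].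
have [Bx Bx1 xB] := within_bounded T0 xc; have [By By1 yB] := within_bounded T0 yc.
have [BW BW1 WB] := within_bounded T0 Wc.
have [m m0 ym] := within_pos T0 yc (fun s sI => let: And4 h _ _ _ := xyuP sI in h).
pose M' := `|M| + 1; have M'0 : 0 < M' by rewrite ltr_wpDl.
(* The ratio of the smallest [2 * y s] to the product of the Lipschitz constant with the
   [2 * cIm z0] of the first Cayley transform; [B] collects what it takes to pass from
   [z - cconj z0] to [z] and from [cconj (Z s)] to [Wt s]. *)
pose kap := m / (M' * cIm z0); have k0 : 0 < kap by rewrite divr_gt0// mulr_gt0.
have nz0 := cabs_ge0 z0.
pose B := kap * cabs z0 + Bx + By + BW.
have kz : 0 <= kap * cabs z0 by rewrite mulr_ge0// ltW.
have BWB : BW <= B by rewrite /B; move: kz Bx1 By1 BW1; lra.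
have B0 : 0 <= B by rewrite /B; move: kz Bx1 By1 BW1; lra.
have [M0 far] := @cayley_infty R (expi v0) z0 r r0.
have near z : upper z -> M0 < cabs z -> near_bd (expi v0) r (cayley (expi v0) z0 z).
  by move=> Uz /far h; split=> //; apply/diskE; exact: cayley_disk.
have nKC z s : upper z -> M0 < cabs z -> 0 <= s <= T -> ~ KC s z.
  by move=> Uz zM sI /(fw_preimage _ Uz); have [_ _ h] := vP sI; have [] := h _ (near z Uz zM).
apply: (@half_chart_expansion R T KC Gt u sg Wt B kap M0) => //.
- move=> s sI; have [_ _ _ h] := xyuP sI; split=> //.
  by rewrite /sg divr_ge0 ?sqr_ge0// mulr_ge0// exprn_ge0// ltW// fw_sin.
- by move=> s sI; exact: le_trans (WB s sI) BWB.
- by move=> z Uz zM; apply: fw_chart0 => //; apply: nKC; rewrite ?lexx.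
- move=> z s Uz zM sI; have [ys _ _ _] := xyuP sI.
  have [_ _ vn] := vP sI; have [nz gl] := vn _ (near z Uz zM).
  have Du : disk (cayley (expi v0) z0 z) := cayley_disk c1 Z0 Uz.
  have g1 := fw_disk sI Du nz.
  set p := disk_mapout (KR s) (cayley (expi v0) z0 z) in gl g1.
  have pc : p - expi (v s) != 0.
    by apply/eqP => /subr0_eq E; rewrite E cabs_expi ltxx in g1.
  have zc : z - cconj z0 != 0 by apply: cayley_den => //; exact: ltW.
  have E1 : cabs (Gt s z - cconj (Z s)) = 2 * y s / cabs (p - expi (v s)).
    by rewrite /Gt -/p icayley_sub_conj// !cabsM cabsV cabs_expi mul1r cabs_conj_sub ?fw_point.
  have E2 : cabs (cayley (expi v0) z0 z - expi v0) = 2 * cIm z0 / cabs (z - cconj z0).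
    by rewrite cayley_sub// !cabsM cabsV cabs_expi mul1r cabs_conj_sub.
  have P0 : 0 < cabs (p - expi (v s)) by rewrite cabs_gt0.
  have Q0 : 0 < cabs (z - cconj z0) by rewrite cabs_gt0.
  have L1 : cabs (p - expi (v s)) <= M' * (2 * cIm z0 / cabs (z - cconj z0)).
    rewrite -E2; apply: le_trans gl _; apply: ler_wpM2r; first exact: cabs_ge0.
    by apply: le_trans (ler_norm M) _; rewrite lerDl.
  have L2 : kap * cabs (z - cconj z0) <= cabs (Gt s z - cconj (Z s)).
    rewrite E1 ler_pdivlMr//.
    apply: le_trans (ler_wpM2l _ L1) _; first by rewrite mulr_ge0 ?cabs_ge0// ltW.
    have -> : kap * cabs (z - cconj z0) * (M' * (2 * cIm z0 / cabs (z - cconj z0))) = 2 * m.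
      by rewrite /kap; field; rewrite ?gt_eqF.
    by rewrite ler_pM2l// ym.
  have L3 : kap * cabs z - kap * cabs z0 <= kap * cabs (z - cconj z0).
    rewrite -mulrBr ler_pM2l//; have := lerB_cabs z (cconj z0); by rewrite cabs_conj.
  have L4 : cabs (cconj (Z s) - real_cplx (Wt s)) <= Bx + By + BW.
    apply: le_trans (ler_cabsB _ _) _; apply: lerD.
      by rewrite cabs_conj; apply: le_trans (cabs_le_ReIm _) _; apply: lerD; [exact: xB|exact: yB].
    by rewrite cabs_real; exact: WB.
  have L5 := lerB_cabsD (Gt s z - cconj (Z s)) (cconj (Z s) - real_cplx (Wt s)).
  rewrite subrKA in L5.
  by rewrite /B; move: L2 L3 L4 L5; lra.
- move=> z s Uz zM sI _; have nz := nKC z s Uz zM sI.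
  apply: tderiv_sub (fw_chart_ode sI Uz nz).
  by move=> a aI; split=> //; exact: nKC.
Qed.

End Chart.
End Family.
End Forward.

(** * Disk hulls induce half-plane hulls *)

Section ForwardDirection.
Variable R : realType.
Local Notation C := (Cplx R).
Local Notation cRe := (@complex.Re R : C -> R).
Local Notation cIm := (@complex.Im R : C -> R).
Implicit Types (D : set R) (T S t a s : R) (z : C).

Lemma force_angleE T (v0 : R) (K : R -> set C) (v : R -> R) : 0 <= T ->
  (forall t, 0 <= t <= T -> v @ within [set t | 0 <= t <= T] (nbhs t) --> v t) -> v 0 = v0 ->
  (forall t, 0 <= t <= T -> extension (@disk R `\` K t) (disk_mapout (K t)) (expi v0) = expi (v t)) ->
  forall t, 0 <= t <= T -> force_angle v0 T K t = v t.
Proof.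
move=> T0 vc v00 ve.
have [] := @xgetPex _ (cst 0) [set v : R -> R |
    [/\ {within `[0, T], continuous v}, v 0 = v0
      & forall t, t \in `[0, T] ->
          expi (v t) = extension (@disk R `\` K t) (disk_mapout (K t)) (expi v0)]].
  exists v; split=> //; first exact/continuous_on_itvP.
  by move=> t; rewrite in_itv => /ve.
rewrite -/(force_angle v0 T K) => /continuous_on_itvP c f0 fe.
apply: lift_unique => //; first by rewrite f0.
by move=> t tI; rewrite fe ?in_itv// ve.
Qed.

Lemma energies_agree (rho v0 : R) (z0 : C) T S (KR KC : R -> set C) (u r v w x y W : R -> R) :
  let J := [set t | 0 <= t <= T] in let al := fun t => (v t - w t) / 2 in
  let sg := fun t => y t ^+ 2 / (4 * sin (al t) ^+ 4) in
  0 <= T -> 0 <= S -> u 0 = 0 -> u T = S ->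
  (forall t, 0 <= t <= T -> 0 <= u t <= S /\ r (u t) = t) ->
  (forall s, 0 <= s <= S -> 0 <= r s <= T /\ u (r s) = s) ->
  (forall t, 0 <= t <= T -> w @ within J (nbhs t) --> w t) ->
  (forall t, 0 <= t <= T -> 0 < al t < pi) ->
  (forall t, 0 <= t <= T -> 0 < y t) ->
  (forall t, 0 <= t <= T -> rderiv J v t (cot (al t))) ->
  (forall t, 0 <= t <= T -> rderiv J x t (- y t * cos (al t) / (2 * sin (al t) ^+ 3))) ->
  (forall t, 0 <= t <= T -> rderiv J y t (- y t / (2 * sin (al t) ^+ 2))) ->
  (forall t, 0 <= t <= T -> rderiv J u t (sg t)) ->
  (forall s, 0 <= s <= S -> rderiv [set s | 0 <= s <= S] r s (sg (r s))^-1) ->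
  (forall t, 0 <= t <= T -> W (u t) = x t + y t * cot (al t)) ->
  (forall t, 0 <= t <= T -> half_mapout (KC (u t)) z0 = Complex (x t) (y t)) ->
  v 0 = v0 ->
  (forall t, 0 <= t <= T -> extension (@disk R `\` KR t) (disk_mapout (KR t)) (expi v0) = expi (v t)) ->
  disk_energy rho v0 T KR w = half_energy (- 6 - rho) z0 S KC W.
Proof.
move=> J al sg T0 S0 u0 uT uI rI wc aI y0 dv dx dy du dr WE ZE v00 ve.
rewrite /disk_energy /half_energy.
have AC := ac_coordinates T0 S0 uI rI wc aI y0 dv dx dy du dr WE.
rewrite -(asbool_equiv_eq AC); case: asboolP => // ac.
congr (_ * _)%E.
have <- := @energy_coordinates R rho T S u r v w x y W (fun s => half_mapout (KC s) z0)
  T0 S0 u0 uT uI rI wc aI y0 dv dx dy du dr WE ZE ac.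
apply: eq_integral => t; rewrite inE/= in_itv/= => tI.
rewrite (@force_angleE T v0 KR v)// => s sI; exact: rderiv_cont (dv s sI).
Qed.

Lemma within_time T S (f r : R -> R) s : (forall a, 0 <= a <= S -> 0 <= r a <= T) ->
  f @ within [set t | 0 <= t <= T] (nbhs (r s)) --> f (r s) ->
  r @ within [set s | 0 <= s <= S] (nbhs s) --> r s ->
  (fun a => f (r a)) @ within [set s | 0 <= s <= S] (nbhs s) --> f (r s).
Proof.
move=> rI fc rc A /fc /within_nbhsP[e e0 eA].
have /rc /within_nbhsP[d d0 dP] : nbhs (r s) [set q | `|q - r s| < e].
  by apply/nbhs_ballP; exists e => // q; rewrite /ball/= distrC.
apply/within_nbhsP; exists d => // a ad aI; apply: eA; [exact: dP|exact: rI].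
Qed.

Lemma path_connected_simply (A : set C) : simply_connected A -> path_connected_in A.
Proof.
by case=> _ H _ a b Aa Ab; exact: H.
Qed.

Lemma forward_direction (rho v0 : R) (z0 : C) (phi0 : C -> C) T (KR : R -> set C) (w : R -> R) :
  0 < v0 < 2 * pi -> 0 < cIm z0 -> (forall z, upper z -> phi0 z = cayley (expi v0) z0 z) ->
  expi v0 * z0 = cconj z0 -> 0 <= T -> disk_family T KR w -> ~ KR T (expi v0) ->
  exists (S : R) (tau : R -> R) (W : R -> R),
    let KC := fun s => hull_preimage phi0 (KR (tau s)) in
    [/\ 0 <= S, reparametrization S T tau, half_family S KC W, ~ KC S z0
      & disk_energy rho v0 T KR w = half_energy (- 6 - rho) z0 S KC W].
Proof.
move=> hv0 Z0 phiE cz T0 fam nK.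
have [v [M [r [r0 v00 vP]]]] := fw_phase hv0 T0 fam nK.
pose J := [set t : R | 0 <= t <= T].
have wc := fw_driving fam.
have vc t (tI : 0 <= t <= T) : v @ within J (nbhs t) --> v t.
  by have [_ h _] := vP t tI; exact: rderiv_cont h.
have aI t (tI : 0 <= t <= T) := let: And3 h _ _ := vP t tI in h.
have dv t (tI : 0 <= t <= T) := let: And3 _ h _ := vP t tI in h.
have [x [y [u [tau [[x0 y0 u0] [xyu [S0 rep uI tauI dtau]]]]]]] :=
  @loewner_coordinates R T v w (cRe z0) (cIm z0) T0 Z0 wc aI vc.
set S := u T in S0 rep uI tauI dtau.
pose al t := (v t - w t) / 2.
pose Z t : C := Complex (x t) (y t).
have ZI : Z 0 = z0 by rewrite /Z x0 y0; case: (z0).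
pose Wt t := x t + y t * cot (al t).
pose Gt t z := icayley (expi (v t)) (Z t) (disk_mapout (KR t) (cayley (expi v0) z0 z)).
pose KC s := hull_preimage phi0 (KR (tau s)).
have OT : (0 : R) <= 0 <= T by rewrite lexx T0.
have TT : 0 <= T <= T by rewrite T0 lexx.
have [tau0 tauS _ tauM] := rep.
have hulls s : 0 <= s <= S -> half_hull (KC s).
  move=> /tauI[tI _]; apply: (half_hull_preimage (cabs_expi v0) Z0 phiE); first exact: fw_hull fam _ tI.
  exact: fw_avoid fam nK _ tI.
have sa t (tI : 0 <= t <= T) : sin (al t) != 0 by rewrite gt_eqF//; exact: sin_gt0_pi (aI t tI).
have WtC t (tI : 0 <= t <= T) : Wt @ within J (nbhs t) --> Wt t.
  have ac : al @ within J (nbhs t) --> al t.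
    by apply: cvgMl; apply: cvgB; [exact: vc|exact: wc].
  have [_ dx dy _] := xyu t tI.
  apply: cvgD; first exact: rderiv_cont dx.
  apply: cvgM; first exact: rderiv_cont dy.
  apply: cvgM; first exact: cvg_cos.
  by apply: cvgV; [exact: sa|exact: cvg_sin].
have mapE s z : 0 <= s <= S -> (@upper R `\` KC s) z -> half_mapout (KC s) z = Gt (tau s) z.
  move=> sI; have [tI us] := tauI s sI.
  have cf := fw_chart_conformal Z0 phiE fam xyu tI.
  have ex := fw_chart_expansion Z0 phiE T0 fam r0 v00 ZI u0 vP xyu tI.
  have mG : is_half_mapout (KC s) (Gt (tau s)) by split=> //; exists (2 * u (tau s)).
  have mH : is_half_mapout (KC s) (half_mapout (KC s)) by apply: xgetPex; exists (Gt (tau s)).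
  have [Kc _ sc _] := hulls s sI.
  exact: half_mapout_unique Kc (path_connected_simply sc) mH mG z.
have Z0n s : 0 <= s <= S -> ~ KC s z0.
  move=> /tauI[tI _] /(fw_preimage Z0 phiE KR _ Z0); rewrite cayley0.
  by have [_ _ h _ _] := fw_hull fam tI.
have mapZ s : 0 <= s <= S -> half_mapout (KC s) z0 = Z (tau s).
  move=> sI; have [tI us] := tauI s sI; rewrite mapE//; last by split=> //; exact: Z0n.
  have [_ g0 _] := fw_mapout fam tI.
  rewrite /Gt cayley0 g0 /icayley mulr0 !sub0r; field; exact: expi_neq0.
exists S, tau, (fun s => Wt (tau s)); split=> //.
- split.
  + move=> s t s0 st tS z [Uz Kz]; split=> //; move: Kz.
    have sI : 0 <= s <= S by rewrite s0 (le_trans st tS).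
    have tI : 0 <= t <= S by rewrite tS (le_trans s0 st).
    have [/andP[ts0 _] _] := tauI s sI; have [/andP[_ tt1] _] := tauI t tI.
    apply: (fw_sub fam ts0 _ tt1); move: st; rewrite le_eqVlt => /orP[/eqP->//|st].
    by apply: ltW; apply: tauM; rewrite ?in_itv.
  + by move=> s; rewrite in_itv; exact: hulls.
  + move=> s; rewrite in_itv => sI; have [tI us] := tauI s sI.
    have := fw_chart_expansion Z0 phiE T0 fam r0 v00 ZI u0 vP xyu tI.
    by rewrite us; apply: eq_half_expansion => z Uz; rewrite mapE.
  + split.
      apply/continuous_on_itvP => s sI; apply: (@within_time T S Wt tau s).
      * by move=> a /tauI[].
      * by apply: WtC; have [] := tauI s sI.
      * exact: rderiv_cont (dtau s sI).
    (* At time 0 the driving point is [(cconj z0 - expi v0 * z0) / (1 - expi v0)], which vanishes by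
       [cz], that is because [phi0] sends 0 to 1. *)
    rewrite tau0; apply: rc_inj; have [_ _ _ _] := coordinate_identities (x 0) (y 0) (sa 0 OT).
    rewrite -/(Z 0) ZI => ->; case: fam => _ _ _ [_ w0] _.
    by rewrite w0 expi0 mulr1 v00 cz subrr mul0r.
  + split.
      move=> z [Uz nz]; rewrite mapE ?lexx//.
      by rewrite tau0; apply: (fw_chart0 Z0 phiE fam v00 ZI Uz); move: nz; rewrite /KC tau0.
    move=> s z; rewrite in_itv => sI [Uz nz]; have [tI us] := tauI s sI.
    apply/tderivP.
    have dG := fw_chart_ode Z0 phiE fam vP xyu tI Uz nz.
    pose D' := [set a | a \in `[0, S] /\ ~ KC a z].
    have D'I a : D' a -> 0 <= a <= S by case; rewrite in_itv.
    have dt' : rderiv D' tau s (y (tau s) ^+ 2 / (4 * sin (al (tau s)) ^+ 4))^-1.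
      exact: tderiv_sub D'I (dtau s sI).
    have sub a : D' a -> [set t | 0 <= t <= T /\ ~ hull_preimage phi0 (KR t) z] (tau a).
      by move=> h; split; [exact: (tauI a (D'I a h)).1|case: h].
    have := tderiv_time sub dt' dG => h.
    have D's : D' s by split=> //; rewrite in_itv.
    apply: (tderiv_eq D's _ (tderiv_eqd _ h)).
      by move=> a [aI' na]; rewrite mapE//; rewrite -in_itv.
    rewrite mapE// -/(Gt (tau s) z) -/(al (tau s)) -/(Wt (tau s)).
    have sg0 : real_cplx (y (tau s) ^+ 2 / (4 * sin (al (tau s)) ^+ 4)) != 0.
      have [yp _ _ _] := xyu _ tI.
      by rewrite rc_eq0 mulf_neq0// ?expf_neq0 ?gt_eqF// invr_gt0 mulr_gt0// exprn_gt0// sin_gt0_pi// aI.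
    rewrite rcV; move: (real_cplx (y (tau s) ^+ 2 / _)) sg0 => q q0.
    by rewrite -[2 * q / _]mulrA -[2 * _ / q]mulrA [q / _]mulrC mulfK.
- by apply: Z0n; rewrite S0 lexx.
- apply: (@energies_agree rho v0 z0 T S KR KC u tau v w x y (fun s => Wt (tau s))) => //.
  + by move=> t /xyu[].
  + by move=> t /xyu[].
  + by move=> t /xyu[].
  + by move=> t /xyu[].
  + by move=> t tI; have [_ ->] := uI t tI.
  + by move=> t tI; have [h E] := uI t tI; rewrite mapZ// E.
  + move=> t tI; have [_ _ vn] := vP t tI; exact: extension_disk_hull (cabs_expi v0) r0 vn.
Qed.

End ForwardDirection.

(** * From the half-plane to the disk *)

Section ReverseTools.
Variable R : realType.
Local Notation C := (Cplx R).
Local Notation cRe := (@complex.Re R : C -> R).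
Local Notation cIm := (@complex.Im R : C -> R).
Implicit Types (D : set R) (T S t a s : R) (z : C).

Lemma cot_acot (q : R) : cot (pi / 2 - atan q) = q.
Proof.
rewrite /cot cosB sinB cos_pihalf sin_pihalf !mul0r !mul1r add0r subr0.
by rewrite -[RHS]atanK.
Qed.

Lemma acot_itv (q : R) : 0 < pi / 2 - atan q < pi.
Proof. by have := atan_gtNpi2 q; have := atan_ltpi2 q => h1 h2; apply/andP; split; lra. Qed.

Lemma sin2_cot (a : R) : sin a != 0 -> sin a ^+ 2 = (1 + cot a ^+ 2)^-1.
Proof.
move=> s0; have -> : 1 + cot a ^+ 2 = (sin a ^+ 2)^-1; last by rewrite invrK.
by rewrite /cot expr_div_n -[X in X + _](divff (expf_neq0 2 s0)) -mulrDl addrC cos2Dsin2 mul1r.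
Qed.

(** The change of coordinates read backwards. The angle [al] is the arc cotangent of [(W - x) / y],
    so [sin al ^ 2] is [y ^ 2 / N] and [dt/ds] is [4 * y ^ 2 / N ^ 2]. The angle [v] integrates
    [cot al] against radial time, and [w] is defined as [v - 2 * al]. *)
Lemma half_coordinates S (W x y : R -> R) (v0 : R) : let I := [set s | 0 <= s <= S] in
  let N := fun s => (W s - x s) ^+ 2 + y s ^+ 2 in
  0 <= S -> 0 < v0 < 2 * pi -> W 0 = x 0 + y 0 * cot (v0 / 2) ->
  (forall s, 0 <= s <= S -> W @ within I (nbhs s) --> W s) ->
  (forall s, 0 <= s <= S -> x @ within I (nbhs s) --> x s) ->
  (forall s, 0 <= s <= S -> y @ within I (nbhs s) --> y s) ->
  (forall s, 0 <= s <= S -> 0 < y s) ->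
  exists v w tt sig : R -> R, [/\ v 0 = v0, w 0 = 0 & tt 0 = 0] /\
  (forall s, 0 <= s <= S -> [/\ 0 < (v s - w s) / 2 < pi,
     cot ((v s - w s) / 2) = (W s - x s) / y s, sin ((v s - w s) / 2) ^+ 2 = y s ^+ 2 / N s
     & w @ within I (nbhs s) --> w s]) /\
  (forall s, 0 <= s <= S -> rderiv I v s (4 * y s * (W s - x s) / N s ^+ 2) /\
     rderiv I tt s (4 * y s ^+ 2 / N s ^+ 2)) /\
  [/\ 0 <= tt S, reparametrization (tt S) S sig,
    forall s, 0 <= s <= S -> 0 <= tt s <= tt S /\ sig (tt s) = s,
    forall t, 0 <= t <= tt S -> 0 <= sig t <= S /\ tt (sig t) = t &
    forall t, 0 <= t <= tt S -> rderiv [set t | 0 <= t <= tt S] sig t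
      (4 * y (sig t) ^+ 2 / N (sig t) ^+ 2)^-1].
Proof.
move=> I N S0 /andP[v0p v0pi] W0 Wc xc yc yp.
have Np s : 0 <= s <= S -> 0 < N s.
  by move=> sI; rewrite ltr_wpDl ?sqr_ge0// exprn_gt0// yp.
have dc s : 0 <= s <= S -> (fun s => W s - x s) @ within I (nbhs s) --> W s - x s.
  by move=> sI; apply: cvgB; [exact: Wc|exact: xc].
have Nc s : 0 <= s <= S -> N @ within I (nbhs s) --> N s.
  by move=> sI; apply: cvgD; apply: cvg_pow; [exact: dc|exact: yc].
have Nic s : 0 <= s <= S -> (fun s => (N s ^+ 2)^-1) @ within I (nbhs s) --> (N s ^+ 2)^-1.
  by move=> sI; apply: cvgV; [rewrite expf_neq0// gt_eqF// Np|apply: cvg_pow; exact: Nc].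
have vc s : 0 <= s <= S -> (fun s => 4 * y s * (W s - x s) / N s ^+ 2) @ within I (nbhs s) -->
    4 * y s * (W s - x s) / N s ^+ 2.
  move=> sI; apply: cvgM; last exact: Nic.
  by apply: cvgM; [apply: cvgMr; exact: yc|exact: dc].
have mc s : 0 <= s <= S -> (fun s => 4 * y s ^+ 2 / N s ^+ 2) @ within I (nbhs s) -->
    4 * y s ^+ 2 / N s ^+ 2.
  by move=> sI; apply: cvgM; [apply: cvgMr; apply: cvg_pow; exact: yc|exact: Nic].
have [F [F0 dF]] := antiderivative S0 vc.
have [tt [tt0 dtt]] := antiderivative S0 mc.
have mp s : 0 <= s <= S -> 0 < 4 * y s ^+ 2 / N s ^+ 2.
  move=> sI; apply: divr_gt0; last exact: exprn_gt0 (Np s sI).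
  by apply: mulr_gt0; [rewrite ltr0n|exact: exprn_gt0 (yp s sI)].
have [m m0 mle] := within_pos S0 mc mp.
have [sig [h1 h2 h3 h4 h5]] := inverse_time S0 m0 tt0 dtt mle.
pose al s := pi / 2 - atan ((W s - x s) / y s).
pose v s := v0 + F s; pose w s := v s - 2 * al s.
have alE s : (v s - w s) / 2 = al s by rewrite /w; field.
have OI : (0 : R) <= 0 <= S by rewrite lexx S0.
have y00 := yp 0 OI.
exists v, w, tt, sig; split; [split=> //|split; [|split=> //]].
- by rewrite /v F0 addr0.
- rewrite /w /v /al F0 addr0 W0 [x 0 + _]addrC addrK mulrAC mulfV ?gt_eqF// mul1r atan_cot; first by field.
  by apply/andP; split; lra.
- move=> s sI; rewrite alE cot_acot sin2_cot; last by rewrite gt_eqF// sin_gt0_pi// acot_itv.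
  have ys := yp s sI; split=> //; first exact: acot_itv.
    rewrite cot_acot /N; have : (W s - x s) ^+ 2 + y s ^+ 2 != 0 by rewrite gt_eqF// Np.
    by move=> n; field; rewrite ?n ?gt_eqF// addrC.
  apply: cvgB.
    by apply: cvgD; [exact: cvg_cst|exact: rderiv_cont (dF s sI)].
  apply: cvgMr; apply: cvgB; first exact: cvg_cst.
  have qc : (fun s => (W s - x s) / y s) @ within I (nbhs s) --> (W s - x s) / y s.
    by apply: cvgM; [exact: dc|apply: cvgV; [rewrite gt_eqF|exact: yc]].
  exact: (cvg_comp _ _ qc (@continuous_atan R _)).
- move=> s sI; split; last exact: dtt.
  by have := rderivD (rderiv_cst I v0 s) (dF s sI); rewrite add0r.
Qed.

Lemma cayley_driving (v w x y W : R) (Z := Complex x y : C) : 0 < y ->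
  sin ((v - w) / 2) != 0 -> cot ((v - w) / 2) = (W - x) / y ->
  cayley (expi v) Z (real_cplx W) = expi w.
Proof.
move=> y0 sa E; have [n En] := expi_cot sa.
have yn : real_cplx y != 0 :> C by rewrite rc_eq0 gt_eqF.
have WE : real_cplx W = real_cplx x + real_cplx y * real_cplx (cot ((v - w) / 2)) :> C.
  by rewrite -rcM -rcD E mulrC divfK ?gt_eqF// addrC subrK.
have CE : real_cplx (cot ((v - w) / 2)) = - Ci * (- (expi v + expi w) / (expi v - expi w)) :> C.
  by rewrite -En mulrA mulNr Ci2 opprK mul1r.
have ZE : Z = real_cplx x + Ci * real_cplx y by apply: C_eqP; rewrite !ReIm /Z /=; ring.
have ZbE : cconj Z = real_cplx x - Ci * real_cplx y by apply: C_eqP; rewrite !ReIm /Z /=; ring.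
have e1 : real_cplx W - Z = Ci * real_cplx y * (2 * expi w) / (expi v - expi w).
  by rewrite WE CE ZE; field.
have e2 : real_cplx W - cconj Z = Ci * real_cplx y * (2 * expi v) / (expi v - expi w).
  by rewrite WE CE ZbE; field.
rewrite /cayley e1 e2; field.
by rewrite n yn Ci_neq0 expi_neq0 ?pnatr_eq0.
Qed.

Lemma schwarz_scaled (g : C -> C) (r : R) : 0 < r -> g 0 = 0 ->
  (forall z, cabs z < r -> cabs (g z) < 1) -> (forall z, cabs z < r -> exists l, cderiv g z l) ->
  forall z, cabs z < r -> cabs (g z) <= cabs z / r.
Proof.
move=> r0 g0 g1 dg z zr.
pose h z := g (real_cplx r * z).
have sub (q : C) : disk q -> cabs (real_cplx r * q) < r.
  by move=> /diskE q1; rewrite cabsM cabs_real gtr0_norm// gtr_pMr.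
have rn : real_cplx r != 0 :> C by rewrite rc_eq0 gt_eqF.
have hz : h (z / real_cplx r) = g z by rewrite /h mulrC divfK.
rewrite -hz; have -> : cabs z / r = cabs (z / real_cplx r) by rewrite cabsM cabsV cabs_real gtr0_norm.
apply: schwarz.
- move=> q Dq; have [l dl] := dg _ (sub q Dq); exists (l * real_cplx r).
  apply: (cderiv_comp _ dl).
  by have := cderivM (cderiv_cst (real_cplx r) q) (cderiv_id q); rewrite mul0r add0r mulr1.
- by move=> q Dq; apply/diskE; apply: g1; exact: sub.
- by rewrite /h mulr0.
- by apply/diskE; rewrite cabsM cabsV cabs_real gtr0_norm// ltr_pdivrMr// mul1r.
Qed.

(** The time derivative of [expR (- s) * g s z] is [expR (- s)] times [2 * g ^ 2 / (o - g)]. By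
    Schwarz's lemma on the disc of radius [r] it is quadratic in [z], uniformly in time, so
    integration gives [expR (- t) * g t z = z + O(z ^ 2)]. On the disc of radius [r / 2] the
    denominator is at least [2^-1]. *)
Lemma radial_flow_deriv0 T (o : R -> C) (g : R -> C -> C) (r : R) : let J := [set t | 0 <= t <= T] in
  0 <= T -> 0 < r -> (forall t, 0 <= t <= T -> cabs (o t) = 1) ->
  (forall t, 0 <= t <= T -> g t 0 = 0) ->
  (forall z, cabs z < r -> g 0 z = z) ->
  (forall z t, cabs z < r -> 0 <= t <= T -> cabs (g t z) < 1 /\ exists l, cderiv (g t) z l) ->
  (forall z t, cabs z < r -> 0 <= t <= T -> tderiv J (fun s => g s z) t (radial_field (o t) (g t z))) ->
  forall t, 0 <= t <= T -> cderiv (g t) 0 (real_cplx (expR t)).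
Proof.
move=> J T0 r0 o1 g0 gid gd dg t /andP[t0 tT].
have JI s : 0 <= s <= t -> J s by move=> /andP[s0 st]; rewrite /J/= s0 (le_trans st tT).
have sch z s : cabs z < r -> J s -> cabs (g s z) <= cabs z / r.
  move=> zr sI; apply: schwarz_scaled => //; first exact: g0.
    by move=> q qr; have [] := gd q s qr sI.
  by move=> q qr; have [] := gd q s qr sI.
have est z : cabs z < r / 2 -> cabs (real_cplx (expR (- t)) * g t z - z) <= 4 * t * (cabs z / r) ^+ 2.
  move=> zr2; have zr : cabs z < r by apply: (lt_trans zr2); rewrite ltr_pdivrMr// ltr_pMr// ltr1n.
  pose f s : C := real_cplx (expR (- s)) * g s z.
  pose f' s : C := real_cplx (expR (- s)) * (2 * g s z ^+ 2 / (o s - g s z)).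
  have p2 : cabs z / r <= 2^-1 by rewrite ler_pdivrMr// mulrC ltW.
  have low s : J s -> 2^-1 <= cabs (o s - g s z).
    move=> sI; apply: le_trans (lerB_cabs _ _); rewrite o1//.
    by have := le_trans (sch z s zr sI) p2 => h; rewrite lerBrDr; lra.
  have df s : J s -> tderiv J f s (f' s).
    move=> sI.
    have de := rderiv_comp (u := fun s => - s) (is_derive_expR (- s)) (rderivN (rderiv_id J s)).
    have n : o s - g s z != 0 by rewrite -cabs_gt0; apply: lt_le_trans (low s sI); rewrite invr_gt0.
    apply: tderiv_eqd (tderivM de (dg z s zr sI)).
    by rewrite /f' /radial_field rcM rcN rc1; field.
  have f'b s : J s -> cabs (f' s) <= 4 * (cabs z / r) ^+ 2 * 1.
    move=> sI; have /andP[s0 sT] := sI.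
    rewrite mulr1 /f' !cabsM cabsV cabs_real -expr2 cabs_nat ger0_norm ?expR_ge0//.
    have e1 : expR (- s) <= 1 by rewrite -[X in _ <= X]expR0 ler_expR oppr_le0.
    have i2 : (cabs (o s - g s z))^-1 <= 2.
      by rewrite -[X in _ <= X]invrK lef_pV2 ?posrE ?invr_gt0// ?low//; apply: lt_le_trans (low s sI); rewrite invr_gt0.
    have gb : cabs (g s z) ^+ 2 <= (cabs z / r) ^+ 2.
      have h := sch z s zr sI; have h0 := cabs_ge0 (g s z).
      by rewrite !expr2; apply: ler_pM.
    have -> : 4 * (cabs z / r) ^+ 2 = 1 * (2 * (cabs z / r) ^+ 2 * 2) by ring.
    have P : 0 <= cabs (g s z) ^+ 2 by rewrite exprn_ge0// cabs_ge0.
    apply: ler_pM => //; rewrite ?expR_ge0//.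
      by apply: mulr_ge0; [apply: mulr_ge0|rewrite invr_ge0 cabs_ge0].
    by apply: ler_pM => //; [apply: mulr_ge0|rewrite invr_ge0 cabs_ge0|apply: ler_wpM2l].
  have := @tderiv_bound R J f f' (fun s => 4 * (cabs z / r) ^+ 2 * s) _ 0 t t0 JI
    (fun s sI => df s (JI s sI)) (fun s sI => rderivZ (4 * (cabs z / r) ^+ 2) (rderiv_id J s))
    (fun s sI => f'b s (JI s sI)).
  by rewrite {2}/f oppr0 expR0 gid// rc1 mul1r mulr0 subr0 mulrAC.
have e0 := expR_gt0 t; have en : real_cplx (expR t) != 0 :> C by rewrite rc_eq0 gt_eqF.
apply/cderivP => e ep.
pose A := 4 * t / r ^+ 2 * expR t; have A0 : 0 <= A.
  by rewrite mulr_ge0 ?expR_ge0// divr_ge0 ?sqr_ge0// mulr_ge0.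
exists (Num.min (r / 2) (e / (A + 1))); first by rewrite lt_min !divr_gt0// ltr_wpDl.
move=> z; rewrite !subr0 lt_min => /andP[zr ze]; rewrite (g0 t)//; last by rewrite t0 tT.
rewrite subr0.
have -> : g t z - real_cplx (expR t) * z = real_cplx (expR t) * (real_cplx (expR (- t)) * g t z - z).
  rewrite mulrBr mulrA -rcM -expRD subrr expR0 rc1 mul1r //.
rewrite cabsM cabs_real gtr0_norm//.
apply: le_trans (ler_wpM2l (ltW e0) (est z zr)) _.
have -> : expR t * (4 * t * (cabs z / r) ^+ 2) = A * cabs z * cabs z by rewrite /A expr_div_n; ring.
apply: ler_wpM2r; first exact: cabs_ge0.
move: ze; rewrite ltr_pdivlMr ?ltr_wpDl// mulrC => /ltW; apply: le_trans.
by apply: ler_wpM2r; [exact: cabs_ge0|rewrite lerDl].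
Qed.

End ReverseTools.

(** * The transformed maps of a family of half-plane hulls *)

Section Reverse.
Variable R : realType.
Local Notation C := (Cplx R).
Local Notation cRe := (@complex.Re R : C -> R).
Local Notation cIm := (@complex.Im R : C -> R).
Implicit Types (D : set R) (t a s : R) (z : C).

Variables (v0 : R) (z0 : C) (phi0 : C -> C).
Hypotheses (hv0 : 0 < v0 < 2 * pi) (Z0 : 0 < cIm z0).
Hypothesis phiE : forall z, upper z -> phi0 z = cayley (expi v0) z0 z.
Hypothesis cz : expi v0 * z0 = cconj z0.

Section Family.
Variables (S : R) (KC : R -> set C) (W : R -> R).
Hypotheses (S0 : 0 <= S) (fam : half_family S KC W) (nK : ~ KC S z0).
Let I := [set s : R | 0 <= s <= S].
Let KR s := hull_image phi0 (KC s).
Let c1 : cabs (expi v0 : C) = 1. Proof. exact: cabs_expi. Qed.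

Lemma rv_hull s : 0 <= s <= S -> half_hull (KC s).
Proof. by move=> sI; case: fam => _ H _ _ _; apply: H; rewrite in_itv. Qed.

Lemma rv_expansion s : 0 <= s <= S -> half_expansion (KC s) (half_mapout (KC s)) (2 * s).
Proof. by move=> sI; case: fam => _ _ H _ _; apply: H; rewrite in_itv. Qed.

Lemma rv_conformal s : 0 <= s <= S -> conformal (@upper R `\` KC s) (@upper R) (half_mapout (KC s)).
Proof.
move=> sI; have [Kc _ _ _] := rv_hull sI.
by have [] := half_mapoutP Kc (rv_expansion sI).
Qed.

Lemma rv_sub s t : 0 <= s -> s <= t -> t <= S -> KC s `<=` KC t.
Proof. by case: fam => H _ _ _ _; exact: H. Qed.

Lemma rv_driving s : 0 <= s <= S -> W @ within I (nbhs s) --> W s.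
Proof. by move=> sI; case: fam => _ _ _ [/continuous_on_itvP wc _] _; exact: wc. Qed.

Lemma rv_avoid s : 0 <= s <= S -> ~ KC s z0.
Proof. by move=> /andP[s0 sS] /(rv_sub s0 sS (lexx S)). Qed.

Lemma rv_upper s z : 0 <= s <= S -> upper z -> ~ KC s z -> 0 < cIm (half_mapout (KC s) z).
Proof.
by move=> sI Uz Kz; have [_ /set_bijP_C[h _ _]] := rv_conformal sI; exact: h.
Qed.

Lemma rv_ode s z : 0 <= s <= S -> upper z -> ~ KC s z ->
  tderiv [set a | 0 <= a <= S /\ ~ KC a z] (fun a => half_mapout (KC a) z) s
    (2 / (half_mapout (KC s) z - real_cplx (W s))).
Proof.
move=> sI Uz Kz; case: fam => _ _ _ _ [_ H].
have sI' : s \in `[0, S] by rewrite in_itv.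
have := H s z sI' (conj Uz Kz) => /tderivP; apply: tderiv_sub.
by move=> a [aI ?]; split=> //; rewrite in_itv.
Qed.

Lemma rv_initial z : upper z -> ~ KC 0 z -> half_mapout (KC 0) z = z.
Proof. by move=> Uz nz; case: fam => _ _ _ _ [H _]; exact: H. Qed.

Let Z s := half_mapout (KC s) z0.
Let x s := cRe (Z s).
Let y s := cIm (Z s).
Let N s := (W s - x s) ^+ 2 + y s ^+ 2.

Lemma rv_point s : 0 <= s <= S -> 0 < y s.
Proof. by move=> sI; exact: rv_upper sI Z0 (rv_avoid sI). Qed.

Lemma rv_point_ode s : 0 <= s <= S -> tderiv I Z s (2 / (Z s - real_cplx (W s))).
Proof.
move=> sI; apply: tderiv_sub (rv_ode sI Z0 (rv_avoid sI)) => a aI.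
by split=> //; exact: rv_avoid.
Qed.

Lemma rv_coordinates_ode s : 0 <= s <= S ->
  rderiv I x s (2 * (x s - W s) / N s) /\ rderiv I y s (- 2 * y s / N s).
Proof.
move=> sI; have dZ := rv_point_ode sI.
have NE : cRe (Z s - real_cplx (W s)) ^+ 2 + cIm (Z s - real_cplx (W s)) ^+ 2 = N s.
  by rewrite !ReIm subr0 /N -/(x s) -/(y s); ring.
split; [apply: rderiv_eqd (rderiv_Re dZ)|apply: rderiv_eqd (rderiv_Im dZ)];
by rewrite [2 / _]mulrC !(cReM, cImM) cReV cImV cRe_nat cIm_nat NE !ReIm -/(x s) -/(y s); ring.
Qed.

Lemma rv_image s z : 0 <= s <= S -> disk z -> KR s z <-> KC s (icayley (expi v0) z0 z).
Proof.
move=> sI Dz; have [_ KU _ _] := rv_hull sI; rewrite /KR (hull_imageE Z0 phiE KU); split.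
  by move=> [k Kk <-]; rewrite cayleyK//; exact: KU.
move=> h; exists (icayley (expi v0) z0 z) => //; apply: icayleyK => //; exact: disk_neq.
Qed.

Section Chart.
Variables (v w : R -> R).
Let al s := (v s - w s) / 2.
Let gs s z := cayley (expi (v s)) (Z s) (half_mapout (KC s) (icayley (expi v0) z0 z)).
Hypothesis v00 : v 0 = v0.
Hypothesis vwP : forall s, 0 <= s <= S -> [/\ sin (al s) != 0, cot (al s) = (W s - x s) / y s
   & rderiv I v s (4 * y s * (W s - x s) / N s ^+ 2)].

(** Still in chordal time: the extra factor is [dt/ds], which the reparametrization will cancel. By
    [cayley_driving] the real point [W s] is carried to [expi (w s)]. *)
Lemma rv_chart_ode s z : 0 <= s <= S -> disk z -> ~ KR s z ->
  tderiv [set a | 0 <= a <= S /\ ~ KR a z] (fun a => gs a z) s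
    (radial_field (expi (w s)) (gs s z) * real_cplx (4 * y s ^+ 2 / N s ^+ 2)).
Proof.
move=> sI Dz nz; have [sa co dv] := vwP sI; have ys := rv_point sI.
set zeta := icayley (expi v0) z0 z.
have Uz : upper zeta := icayley_upper c1 Z0 Dz.
have nzeta : ~ KC s zeta by move=> h; apply: nz; exact/(rv_image sI Dz).
have Gp := rv_upper sI Uz nzeta.
have DI : [set a | 0 <= a <= S /\ ~ KR a z] `<=` I by move=> a [].
have ZE : Z s = Complex (x s) (y s) by rewrite /x /y; case: (Z s).
have imneq (q : C) : 0 < cIm q -> real_cplx (W s) - q != 0.
  by move=> q0; apply: Im_inj_neq; rewrite cIm_real lt_eqF.
have WZ := imneq _ (ys : 0 < cIm (Z s)).
have WZb : real_cplx (W s) - cconj (Z s) != 0.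
  by apply: Im_inj_neq; rewrite cIm_real cIm_conj gt_eqF// oppr_lt0.
have GW : half_mapout (KC s) zeta - real_cplx (W s) != 0 by rewrite -opprB oppr_eq0; exact: imneq.
have GZb : half_mapout (KC s) zeta - cconj (Z s) != 0.
  by apply: cayley_den; [exact: ys|exact: ltW].
have ZZ : Z s - cconj (Z s) != 0 := conj_diff ys.
have NE : real_cplx (N s) = (real_cplx (W s) - Z s) * (real_cplx (W s) - cconj (Z s)).
  by rewrite /N; apply: C_eqP; rewrite !ReIm -/(x s) -/(y s); ring.
have dc : tderiv I (fun a => expi (v a) : C) s
    (expi (v s) * ((Z s - cconj (Z s)) * (2 * real_cplx (W s) - Z s - cconj (Z s)) /
      ((real_cplx (W s) - Z s) ^+ 2 * (real_cplx (W s) - cconj (Z s)) ^+ 2))).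
  have := tderiv_time (D' := I) (D := setT) (fun _ _ => Logic.I) dv (tderiv_expi setT (v s)).
  apply: tderiv_eqd.
  rewrite -exprMn -NE rcM rcV rcX.
  have -> : (Z s - cconj (Z s)) * (2 * real_cplx (W s) - Z s - cconj (Z s)) =
    Ci * real_cplx (4 * y s * (W s - x s)).
    by apply: C_eqP; rewrite !ReIm -/(x s) -/(y s); ring.
  by ring.
have dG : tderiv [set a | 0 <= a <= S /\ ~ KR a z] (fun a => half_mapout (KC a) zeta) s
    (2 / (half_mapout (KC s) zeta - real_cplx (W s))).
  by apply: tderiv_sub (rv_ode sI Uz nzeta) => a [aI na]; split=> // h; apply: na; exact/(rv_image aI Dz).
have := @disk_flow R _ s (fun a => expi (v a)) Z (fun a => half_mapout (KC a) zeta) (W s)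
  WZ WZb GW GZb ZZ (expi_neq0 _) (tderiv_sub DI dc) (tderiv_sub DI (rv_point_ode sI)) dG.
apply: tderiv_eqd; rewrite {1}ZE (cayley_driving ys sa co) -/(gs s z); congr (_ * _).
rewrite -exprMn -NE rcM rcV rcX; congr (_ / _).
by apply: C_eqP; rewrite !ReIm -/(x s) -/(y s); ring.
Qed.

Lemma rv_chart_conformal s : 0 <= s <= S -> conformal (@disk R `\` KR s) (@disk R) (gs s).
Proof.
move=> sI; have h := rv_conformal sI.
apply: conformal_comp (conformal_comp (B := @upper R `\` KC s) _ h) (conformal_cayley (cabs_expi (v s)) (rv_point sI)).
by apply: conformal_restrict (conformal_icayley c1 Z0) => z; exact: rv_image.
Qed.

Lemma rv_chart0 z : disk z -> ~ KR 0 z -> gs 0 z = z.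
Proof.
move=> Dz nz; have OI : (0 : R) <= 0 <= S by rewrite lexx S0.
have Uz : upper (icayley (expi v0) z0 z) := icayley_upper c1 Z0 Dz.
rewrite /gs rv_initial//; last by move=> h; apply: nz; exact/(rv_image OI Dz).
rewrite /Z rv_initial//; last exact: rv_avoid.
by rewrite v00 icayleyK//; exact: disk_neq.
Qed.

Lemma rv_center : icayley (expi v0) z0 0 = z0.
Proof. by rewrite /icayley mulr0 !sub0r; field; exact: expi_neq0. Qed.

Lemma rv_chart_center s : gs s 0 = 0.
Proof. by rewrite /gs rv_center cayley0. Qed.

Lemma rv_disk_hull s : 0 <= s <= S -> disk_hull (KR s).
Proof. by move=> sI; apply: (disk_hull_image c1 Z0 phiE); [exact: rv_hull|exact: rv_avoid]. Qed.

Lemma rv_boundary_avoid s : 0 <= s <= S -> ~ KR s (expi v0).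
Proof.
move=> sI; have [_ KU _ _] := rv_hull sI; rewrite /KR (hull_imageE Z0 phiE KU) => -[k Kk E].
by have := cayley_neq_c c1 Z0 (KU k Kk); rewrite E eqxx.
Qed.

(** Points near [expi v0] come from points near infinity, where the half-plane mapping-out function
    is close to the identity; the Cayley transform of time [s] sends these near [expi (v s)]. *)
Lemma rv_boundary s (e : R) : 0 <= s <= S -> 0 < e -> exists2 d : R, 0 < d &
  forall z, near_bd (expi v0) d z -> ~ KR s z /\ cabs (gs s z - expi (v s)) < e.
Proof.
move=> sI e0.
have [Kc _ _ _ _] := rv_disk_hull sI.
have [r /andP[r0 _] rK] := avoid_near Kc (rv_boundary_avoid sI).
have [M1 M1P] := @cayley_infty R (expi (v s)) (Z s) e e0.
have [M2 M2P] := half_expansion_near_id (rv_expansion sI) ltr01.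
pose B := `|M1| + `|M2| + 1 + cabs z0.
have B0 : 0 < B by rewrite /B; have := normr_ge0 M1; have := normr_ge0 M2; have := cabs_ge0 z0 => *; lra.
exists (Num.min r (2 * cIm z0 / B)).
  by rewrite lt_min r0 divr_gt0// mulr_gt0.
move=> z [z1]; rewrite lt_min => /andP[zr zB].
have nz := rK z (conj z1 zr); split=> //.
have Dz : disk z by apply/diskE.
set zeta := icayley (expi v0) z0 z.
have Uz : upper zeta := icayley_upper c1 Z0 Dz.
have nzeta : ~ KC s zeta by move=> h; apply: nz; exact/(rv_image sI Dz).
have zc : z - expi v0 != 0.
  by apply/eqP => /subr0_eq E; rewrite E cabs_expi ltxx in z1.
have P0 : 0 < cabs (z - expi v0) by rewrite cabs_gt0.
have E : cabs (zeta - cconj z0) = 2 * cIm z0 / cabs (z - expi v0).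
  by rewrite /zeta icayley_sub_conj// !cabsM cabsV cabs_expi mul1r cabs_conj_sub.
have far : B < cabs (zeta - cconj z0).
  by rewrite E ltr_pdivlMr// mulrC -ltr_pdivlMr.
have l1 := ler_cabsB zeta (cconj z0); rewrite cabs_conj in l1.
have big : `|M1| + `|M2| + 1 < cabs zeta by move: far l1; rewrite /B; set p := cabs _; set q := cabs _; lra.
have m1 := ler_norm M1; have m2 := ler_norm M2; have n1 := normr_ge0 M1; have n2 := normr_ge0 M2.
have l2 := M2P zeta (conj Uz nzeta); set G := half_mapout (KC s) zeta in l2.
have {}l2 : cabs (G - zeta) < 1 by apply: l2; move: big; set p := cabs _; lra.
have l3 := lerB_cabs zeta (zeta - G); rewrite subKr cabsC in l3.
by apply: M1P; move: big l2 l3; rewrite -/G; set p := cabs G; set q := cabs zeta; set p' := cabs (G - zeta); lra.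
Qed.

End Chart.
End Family.
End Reverse.

(** * Half-plane hulls induce disk hulls *)

Section ReverseDirection.
Variable R : realType.
Local Notation C := (Cplx R).
Local Notation cRe := (@complex.Re R : C -> R).
Local Notation cIm := (@complex.Im R : C -> R).
Implicit Types (T S t a s : R) (z : C).

Lemma real_time_cancel (q : C) (m : R) : m != 0 -> q * real_cplx m * real_cplx m^-1 = q.
Proof. by move=> m0; rewrite -mulrA -rcM mulfV// rc1 mulr1. Qed.

Lemma reverse_direction (rho v0 : R) (z0 : C) (phi0 : C -> C) S (KC : R -> set C) (W : R -> R) :
  0 < v0 < 2 * pi -> 0 < cIm z0 -> (forall z, upper z -> phi0 z = cayley (expi v0) z0 z) ->
  expi v0 * z0 = cconj z0 -> 0 <= S -> half_family S KC W -> ~ KC S z0 ->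
  exists (T : R) (sigma : R -> R) (w : R -> R),
    let KR := fun t => hull_image phi0 (KC (sigma t)) in
    [/\ 0 <= T, reparametrization T S sigma, disk_family T KR w, ~ KR T (expi v0)
      & disk_energy rho v0 T KR w = half_energy (- 6 - rho) z0 S KC W].
Proof.
move=> hv0 Z0 phiE cz S0 fam nK.
pose I := [set s : R | 0 <= s <= S].
pose Z s := half_mapout (KC s) z0; pose x s := cRe (Z s); pose y s := cIm (Z s).
pose N s := (W s - x s) ^+ 2 + y s ^+ 2.
have OI : (0 : R) <= 0 <= S by rewrite lexx S0.
have SI : 0 <= S <= S by rewrite S0 lexx.
have yp s (sI : 0 <= s <= S) : 0 < y s := rv_point Z0 fam nK sI.
have xode s (sI : 0 <= s <= S) := (rv_coordinates_ode Z0 fam nK sI).1.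
have yode s (sI : 0 <= s <= S) := (rv_coordinates_ode Z0 fam nK sI).2.
have Z00 : Z 0 = z0 by rewrite /Z (rv_initial fam)//; exact: (rv_avoid fam nK OI).
have W00 : W 0 = 0 by case: fam => _ _ _ [_ ->].
have W0E : W 0 = x 0 + y 0 * cot (v0 / 2).
  have sv : sin ((v0 - 0) / 2) != 0.
    move: hv0 => /andP[h1 h2]; rewrite gt_eqF//; apply: sin_gt0_pi; rewrite subr0.
    by apply/andP; split; lra.
  have [_ _ _ _] := coordinate_identities (x 0) (y 0) sv.
  have -> : Complex (x 0) (y 0) = z0 by rewrite /x /y Z00; case: (z0).
  rewrite expi0 mulr1 cz subrr mul0r subr0 W00 => h.
  by apply: rc_inj; rewrite rc0 -h.
have [v [w [tt [sig [[v00 w00 tt0] [vwP [dvt [T0 rep ttI sigI dsig]]]]]]]] :=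
  @half_coordinates R S W x y v0 S0 hv0 W0E (rv_driving fam)
    (fun s sI => rderiv_cont (xode s sI)) (fun s sI => rderiv_cont (yode s sI)) yp.
set T := tt S in T0 rep ttI sigI dsig.
pose J := [set t : R | 0 <= t <= T].
have [sig0 sigT _ sigM] := rep.
have sigIn t (tI : 0 <= t <= T) := (sigI t tI).1.
have OT : (0 : R) <= 0 <= T by rewrite lexx T0.
have TT : 0 <= T <= T by rewrite T0 lexx.
have P s : 0 <= s <= S -> [/\ sin ((v s - w s) / 2) != 0, cot ((v s - w s) / 2) = (W s - x s) / y s
   & rderiv I v s (4 * y s * (W s - x s) / N s ^+ 2)].
  move=> sI; have [aI co _ _] := vwP s sI; split=> //; last by have [] := dvt s sI.
  by rewrite gt_eqF// sin_gt0_pi.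
have Np s : 0 <= s <= S -> 0 < N s.
  by move=> sI; rewrite ltr_wpDl ?sqr_ge0// exprn_gt0// yp.
have mn s : 0 <= s <= S -> 4 * y s ^+ 2 / N s ^+ 2 != 0.
  move=> sI; rewrite gt_eqF//; apply: divr_gt0; last exact: exprn_gt0 (Np s sI).
  by apply: mulr_gt0; [rewrite ltr0n|exact: exprn_gt0 (yp s sI)].
pose KR t := hull_image phi0 (KC (sig t)).
pose gt t z := cayley (expi (v (sig t))) (Z (sig t)) (half_mapout (KC (sig t)) (icayley (expi v0) z0 z)).
have hulls t : 0 <= t <= T -> disk_hull (KR t).
  by move=> tI; exact: (rv_disk_hull Z0 phiE fam nK (sigIn t tI)).
have sig_le s t : 0 <= s -> s <= t -> t <= T -> sig s <= sig t.
  move=> s0 st tT; move: st; rewrite le_eqVlt => /orP[/eqP->//|st].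
  have sI : 0 <= s <= T by rewrite s0 (le_trans (ltW st) tT).
  have tI : 0 <= t <= T by rewrite tT (le_trans s0 (ltW st)).
  by apply: ltW; apply: sigM; rewrite ?in_itv.
have KRsub s t : 0 <= s -> s <= t -> t <= T -> KR s `<=` KR t.
  move=> s0 st tT z [k Kk <-]; exists k => //; move: Kk.
  have sI : 0 <= s <= T by rewrite s0 (le_trans st tT).
  have tI : 0 <= t <= T by rewrite tT (le_trans s0 st).
  have /andP[a0 _] := sigIn s sI; have /andP[_ b1] := sigIn t tI.
  exact: (rv_sub fam a0 (sig_le s t s0 st tT) b1).
have gode t z : 0 <= t <= T -> disk z -> ~ KR t z ->
    tderiv [set s | 0 <= s <= T /\ ~ KR s z] (fun s => gt s z) t
      (radial_field (expi (w (sig t))) (gt t z)).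
  move=> tI Dz nz.
  have dG := rv_chart_ode Z0 phiE fam nK P (sigIn t tI) Dz nz.
  pose D' := [set s | 0 <= s <= T /\ ~ KR s z].
  have dr : rderiv D' sig t (4 * y (sig t) ^+ 2 / N (sig t) ^+ 2)^-1.
    by apply: tderiv_sub (dsig t tI) => s [].
  have sub s : D' s -> [set a | 0 <= a <= S /\ ~ hull_image phi0 (KC a) z] (sig s).
    by move=> [sI ns]; split=> //; exact: sigIn.
  have := tderiv_time sub dr dG; apply: tderiv_eqd.
  by rewrite real_time_cancel//; exact: mn (sigIn t tI).
have gconf t : 0 <= t <= T -> conformal (@disk R `\` KR t) (@disk R) (gt t).
  by move=> tI; exact: (rv_chart_conformal Z0 phiE fam nK v (sigIn t tI)).
have g00 t : gt t 0 = 0 by exact: rv_chart_center.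
have gid z : disk z -> ~ KR 0 z -> gt 0 z = z.
  move=> Dz; rewrite /KR /gt sig0 => nz; exact: (rv_chart0 Z0 phiE S0 fam nK v00 Dz nz).
have D0 : disk (0 : C) by apply/diskE; rewrite cabs0.
(* A disc around 0 that no hull of the family meets, taken from the final hull by monotonicity;
   [radial_flow_deriv0] works on it at all times simultaneously. *)
have [r r0 rP] : exists2 r : R, 0 < r & forall z t, cabs z < r -> 0 <= t <= T -> disk z /\ ~ KR t z.
  have [Kc _ n0 _ _] := hulls T TT.
  have [e e0 eP] := (openCP _).1 (openD_compact (@open_disk R) Kc) 0 (conj D0 n0).
  exists e => // z t ze /andP[t0 tT]; have [Dz nz] := eP z (ltac:(by rewrite subr0)).
  by split=> // /(KRsub t T t0 tT (lexx T)).
have gder t : 0 <= t <= T -> cderiv (gt t) 0 (real_cplx (expR t)).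
  apply: (@radial_flow_deriv0 R T (fun t => expi (w (sig t))) gt r T0 r0) => //.
  - by move=> s _; exact: cabs_expi.
  - by move=> z zr; have [Dz nz] := rP z 0 zr OT; exact: gid.
  - move=> z s zr sI; have U := rP z s zr sI.
    have [hd hb] := (conformalP _ _ _).1 (gconf s sI).
    split; last exact: hd U.
    by have [h _ _] := (set_bijP_C _ _ _).1 hb; apply/diskE; exact: h.
  - move=> z s zr sI; have [Dz nz] := rP z s zr sI.
    by apply: tderiv_sub (gode s z sI Dz nz) => a aI; split=> //; exact: (rP z a zr aI).2.
have gmap t : 0 <= t <= T -> is_disk_mapout (KR t) (gt t).
  move=> tI; split; [exact: gconf|exact: g00|].
  by rewrite (cderiv_derive1 (gder t tI)) -rc0 rc_lt expR_gt0.
have mapE t z : 0 <= t <= T -> (@disk R `\` KR t) z -> disk_mapout (KR t) z = gt t z.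
  move=> tI; have [Kc _ n0 sc _] := hulls t tI; have [cg _ pg] := gmap t tI.
  have [cd d0 pd] : is_disk_mapout (KR t) (disk_mapout (KR t)).
    by apply: xgetPex; exists (gt t); exact: gmap.
  exact: (disk_mapout_unique (openD_compact (@open_disk R) Kc) (path_connected_simply sc)
    (conj D0 n0) cd cg d0 (g00 t) pd pg).
have in_itvT t : (t \in `[0, T]) = (0 <= t <= T) by rewrite in_itv.
exists T, sig, (fun t => w (sig t)); split=> //.
- split.
  + exact: KRsub.
  + by move=> t; rewrite in_itvT; exact: hulls.
  + move=> t; rewrite in_itvT => tI; apply: cderiv_derive1.
    apply: cderiv_near (gder t tI); apply/nbhsCP; exists r => // z; rewrite subr0 => zr.
    by rewrite mapE//; exact: rP zr tI.
  + split; last by rewrite sig0.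
    apply/continuous_on_itvP => t tI; apply: (@within_time R S T w sig t) => //.
      by have [_ _ _ h] := vwP _ (sigIn t tI).
    exact: rderiv_cont (dsig t tI).
  + split.
      by move=> z [Dz nz]; rewrite mapE//; exact: gid.
    move=> t z; rewrite in_itvT => tI [Dz nz]; apply/tderivP.
    have Ds : [set s | s \in `[0, T] /\ ~ KR s z] t by split=> //; rewrite in_itvT.
    have sub : [set s | s \in `[0, T] /\ ~ KR s z] `<=` [set s | 0 <= s <= T /\ ~ KR s z].
      by move=> s [+ ns]; rewrite in_itvT.
    rewrite mapE//; apply: (tderiv_eq Ds _ (tderiv_sub sub (gode t z tI Dz nz))).
    by move=> s [+ ns]; rewrite in_itvT => sI; rewrite mapE.
- exact: (rv_boundary_avoid Z0 phiE fam (sigIn T TT)).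
- have sin0 s : 0 <= s <= S -> 0 < sin ((v s - w s) / 2).
    by move=> sI; have [h _ _ _] := vwP s sI; exact: sin_gt0_pi.
  have sin2 s (sI : 0 <= s <= S) : sin ((v s - w s) / 2) ^+ 2 = y s ^+ 2 / N s by have [] := vwP s sI.
  have sin4 s (sI : 0 <= s <= S) : sin ((v s - w s) / 2) ^+ 4 = (y s ^+ 2 / N s) ^+ 2.
    by rewrite -sin2// -exprM.
  have cotE s (sI : 0 <= s <= S) : cot ((v s - w s) / 2) = (W s - x s) / y s by have [] := vwP s sI.
  have sgE s (sI : 0 <= s <= S) : y s ^+ 2 / (4 * sin ((v s - w s) / 2) ^+ 4) = (4 * y s ^+ 2 / N s ^+ 2)^-1.
    have n1 : y s != 0 by rewrite gt_eqF// yp.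
    have n2 : N s != 0 by rewrite gt_eqF// Np.
    by rewrite sin4//; move: n1 n2; move: (y s) (N s) => Y M n1 n2; field; rewrite n1 n2.
  have timeD (f : R -> R) (k : R) t (tI : 0 <= t <= T) : rderiv I f (sig t) k ->
      rderiv J (fun a => f (sig a)) t (k * (4 * y (sig t) ^+ 2 / N (sig t) ^+ 2)^-1).
    by apply: rderiv_time (dsig t tI); exact: sigIn.
  have n1 t (tI : 0 <= t <= T) : y (sig t) != 0 by rewrite gt_eqF// yp// sigIn.
  have n2 t (tI : 0 <= t <= T) : N (sig t) != 0 by rewrite gt_eqF// Np// sigIn.
  apply: (@energies_agree R rho v0 z0 T S KR KC sig tt (fun t => v (sig t)) (fun t => w (sig t))
     (fun t => x (sig t)) (fun t => y (sig t)) W) => //.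
  + move=> t tI; apply: (@within_time R S T w sig t) => //.
      by have [_ _ _ h] := vwP _ (sigIn t tI).
    exact: rderiv_cont (dsig t tI).
  + by move=> t tI; have [] := vwP _ (sigIn t tI).
  + by move=> t tI; exact: yp (sigIn t tI).
  + move=> t tI; apply: rderiv_eqd (timeD v _ t tI (dvt _ (sigIn t tI)).1).
    rewrite -/(N (sig t)) cotE ?sigIn//; move: (n1 t tI) (n2 t tI).
    move: (y (sig t)) (N (sig t)) (W (sig t) - x (sig t)) => Y M q n1' n2'.
    by field; rewrite n1' n2'.
  + move=> t tI; have sI := sigIn t tI; apply: rderiv_eqd (timeD x _ t tI (xode _ sI)).
    have sn : sin ((v (sig t) - w (sig t)) / 2) != 0 by rewrite gt_eqF// sin0.
    have -> : - y (sig t) * cos ((v (sig t) - w (sig t)) / 2) / (2 * sin ((v (sig t) - w (sig t)) / 2) ^+ 3) =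
      - y (sig t) * cot ((v (sig t) - w (sig t)) / 2) / (2 * sin ((v (sig t) - w (sig t)) / 2) ^+ 2).
      by rewrite /cot; field.
    rewrite sin2// cotE// -(opprB (W (sig t)) (x (sig t))); move: (n1 t tI) (n2 t tI).
    rewrite -/(N (sig t)); move: (y (sig t)) (N (sig t)) (W (sig t) - x (sig t)) => Y M q n1' n2'.
    by field; rewrite n1' n2'.
  + move=> t tI; have sI := sigIn t tI; apply: rderiv_eqd (timeD y _ t tI (yode _ sI)).
    rewrite sin2//; move: (n1 t tI) (n2 t tI).
    rewrite -/(N (sig t)) -/(y (sig t)); move: (y (sig t)) (N (sig t)) => Y M n1' n2'.
    by field; rewrite n1' n2'.
  + by move=> t tI; apply: rderiv_eqd (dsig t tI); rewrite sgE// sigIn.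
  + move=> s sI; have [tI E] := ttI s sI; rewrite E sgE// invrK.
    exact: (dvt s sI).2.
  + move=> t tI; rewrite cotE ?sigIn//; have := n1 t tI.
    by move: (y (sig t)) => Y Yn; field.
  + by move=> t tI; rewrite -/(Z (sig t)) /x /y; case: (Z _).
  + by rewrite sig0.
  + move=> t tI; have sI := sigIn t tI.
    have [r1 r10 r1P] := rv_boundary Z0 phiE fam nK v sI (@ltr01 R).
    apply: (extension_disk_limit (cabs_expi v0) r10) => [z /r1P[]//|e e0].
    have [d d0 dP] := rv_boundary Z0 phiE fam nK v sI e0.
    exists d => // z nz; have [nKz h] := dP z nz; rewrite mapE//.
    by split=> //; apply/diskE; case: nz.
Qed.

End ReverseDirection.

Theorem proposition3 (R : realType) (rho v0 : R) (hv0 : 0 < v0 < 2 * pi)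
    (phi0 : Cplx R -> Cplx R)
    (hphi0 : conformal (@upper R) (@disk R) phi0)
    (hphi0_infty : phi0 @ within (@upper R) (@cplx_infty R) --> expi v0)
    (hphi0_0 : phi0 @ within (@upper R) (nbhs (0 : Cplx R)) --> (1 : Cplx R))
    (z0 : Cplx R) (hz0 : upper z0) (hphi0_z0 : phi0 z0 = 0) :
  (forall (T : R) (KR : R -> set (Cplx R)) (w : R -> R),
      0 <= T -> disk_family T KR w -> ~ KR T (expi v0) ->
      exists (S : R) (tau : R -> R) (W : R -> R),
        let KC := fun s => hull_preimage phi0 (KR (tau s)) in
        [/\ 0 <= S, reparametrization S T tau, half_family S KC W,
            ~ KC S z0
          & disk_energy rho v0 T KR w = half_energy (- 6 - rho) z0 S KC W])
  /\
  (forall (S : R) (KC : R -> set (Cplx R)) (W : R -> R),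
      0 <= S -> half_family S KC W -> ~ KC S z0 ->
      exists (T : R) (sigma : R -> R) (w : R -> R),
        let KR := fun t => hull_image phi0 (KC (sigma t)) in
        [/\ 0 <= T, reparametrization T S sigma, disk_family T KR w,
            ~ KR T (expi v0)
          & disk_energy rho v0 T KR w = half_energy (- 6 - rho) z0 S KC W]).
Proof.
have [phiE cz] := conformal_upper_disk_normalized hphi0 (cabs_expi v0) hphi0_infty hphi0_0 hz0 hphi0_z0.
by split=> *; [exact: forward_direction|exact: reverse_direction].
Qed.
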